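(* Assume there exist an order $s>0$ and a constant $M>0$ such that $$M=\sup_{\varepsilon>0}\ \varepsilon\inf_{\{\mathcal T_1\le\mathcal T_\varepsilon:\ \inf_{u_\varepsilon\in V_\varepsilon,\|u_\varepsilon\|_{a,\Omega}=1}(\|u_\varepsilon-Eu_\varepsilon\|_{a,\Omega}^2+{\rm osc}^2(Lu_\varepsilon;\mathcal T_\varepsilon))\le\varepsilon^2\}}(\#\mathcal T_\varepsilon-\#\mathcal T_1)^s<\infty,$$ where $\mathcal T_1\le\mathcal T_\varepsilon$ means that $\mathcal T_\varepsilon$ is a conforming refinement of $\mathcal T_1$ (with finite element space $V_\varepsilon$) and $\#\mathcal T$ is the number of elements of $\mathcal T$. Let $u_k$ and $\mathcal T_k$ be produced by Adaptive Algorithm $C$ (described in the context), and fix $\alpha$ with $\hat\alpha<\alpha<1$. When $H$ is small enough, for $k\in\mathbb N$, $$\|u_k-Eu_k\|_{a,\Omega}^2+{\rm osc}^2(Lu_k;\mathcal T_k)\le C_c\,(\#\mathcal T_k-\#\mathcal T_1)^{-2s},$$ where $$C_c=C_\#^{2s}\,C_{\mathcal M}^{2s}\Big(1+\frac{2\gamma}{C_{\rm low}^2}\Big)\alpha^2\big(1-\alpha^{1/s}\big)^{-2s}\Big(2+\frac5\gamma\Big),\qquad C_{\mathcal M}=\Big(\frac{\tilde\xi_0^2}{16\hat C_D}\Big)^{-\frac1{2s}}M^{\frac1s},$$ and $\tilde\xi_0$ is a fixed number with $\tilde\xi_0^2\in(0,\frac12)$ and $\theta_*\sqrt{1-2\tilde\xi_0^2}\ge\theta_1$.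 (The right-hand side is read as $+\infty$ if $\#\mathcal T_k=\#\mathcal T_1$.)
   Context: PROBLEM. $\Omega\subset\mathbb R^d$ ($d\ge1$) is a bounded polytopic domain with Lipschitz boundary, $V=H_0^1(\Omega)$, $(\cdot,\cdot)$ is the $L^2(\Omega)$ inner product. $A=(a_{ij})_{d\times d}$ is a symmetric positive definite matrix with $a_{ij}\in W^{1,\infty}(\Omega)$, $0\le\varphi\in L^\infty(\Omega)$, $Lu=-\nabla\cdot(A\nabla u)+\varphi u$, $a(u,v)=\int_\Omega(A\nabla u\cdot\nabla v+\varphi uv)\,d\Omega$, $\|w\|_{a,\Omega}=\sqrt{a(w,w)}$, and $c_a,C_a>0$ satisfy $c_a\|w\|_{1,\Omega}\le\|w\|_{a,\Omega}\le C_a\|w\|_{1,\Omega}$ on $V$. Eigenvalue problem: $(\lambda,u)\in\mathbb R\times V$, $\|u\|_{a,\Omega}=1$, $a(u,v)=\lambda(u,v)$ for all $v\in V$; eigenvalues $0<\hat\lambda^1<\hat\lambda^2\le\cdots$, eigenfunctions $\hat u^i$ with $a(\hat u^i,\hat u^j)=\delta_{ij}$. $M(\hat\lambda^1)$ is the eigenspace of $\hat\lambda^1$ and $E:V\to M(\hat\lambda^1)$ is the $a$-orthogonal projection. $K:L^2(\Omega)\to V$ is defined by $a(Kw,v)=(w,v)$ for all $v\in V$ (so $L^{-1}f=Kf$). Only the first eigenpair is considered; it is assumed that $\hat u^1$ is not a piecewise polynomial. FINITE ELEMENTS AND ESTIMATOR. All meshes are conforming, nested and shape regular: $h_T/\rho_T\le\gamma^*$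 for all elements $T$ ($h_T$ diameter, $\rho_T$ diameter of the largest inscribed ball). $V_k\subset V$ is the space of continuous piecewise polynomials of fixed degree $m\ge1$ on $\mathcal T_k$ vanishing on $\partial\Omega$; $R_k:V\to V_k$ is the Galerkin projection, $a(v-R_kv,v_k)=0$ for all $v_k\in V_k$. $\mathcal E_k$ is the set of interior faces. For $f\in L^2(\Omega)$, $v_k\in V_k$: $\mathcal R_T(f,v_k)=f+\nabla\cdot(A\nabla v_k)-\varphi v_k$ in $T$; $\mathcal J_E(v_k)=-A\nabla v_k^+\cdot\nu^+-A\nabla v_k^-\cdot\nu^-$ on $E\in\mathcal E_k$, $E$ being the common side of $T^\pm$ with outward normals $\nu^\pm$; $\eta_k^2(f,v_k;T)=h_T^2\|\mathcal R_T(f,v_k)\|_{0,T}^2+\sum_{E\in\mathcal E_k,E\subset\partial T}h_E\|\mathcal J_E(v_k)\|_{0,E}^2$; $\eta_k(f,v_k;\mathcal T')=(\sum_{T\in\mathcal T'}\eta_k^2(f,v_k;T))^{1/2}$ for $\mathcal T'\subset\mathcal T_k$; $\eta(f;\mathcal T_k):=\eta_k(f,R_kKf;\mathcal T_k)$. Oscillation: ${\rm osc}(g;\mathcal T_k)=(\sum_{T\in\mathcal T_k}\|h_T(g-P_Tg)\|_{0,T}^2)^{1/2}$, $P_T$ the $L^2(T)$-projection onto polynomials of some fixed degree (such that ${\rm osc}(f-Lv_k;\mathcal T_k)={\rm osc}(Lv_k;\mathcal T_k)$ for $f,v_k\in V_k$); $Lv_k$ is understood elementwise. ADAPTIVE ALGORITHM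 C. Modules: ESOLVE$(W)$ returns the first eigenpair $(\mu,w)\in\mathbb R\times W$ with $\|w\|_{a,\Omega}=1$, $a(w,v)=\mu(w,v)$ for all $v\in W$. LSOLVE$(f,W)$ returns $w\in W$ with $a(w,v)=(f,v)$ for all $v\in W$. MARK at level $k$ with parameter $\theta_1$ returns a minimal subset $\mathcal M_k\subset\mathcal T_k$ with $\eta_k(\bar f_k,\bar u_k;\mathcal M_k)\ge\theta_1\eta_k(\bar f_k,\bar u_k;\mathcal T_k)$. REFINE$(\mathcal M_k,\mathcal T_k)$ returns a conforming refinement $\mathcal T_{k+1}$ of $\mathcal T_k$ (by iterative or recursive bisection, with the minimal refinement condition) in which at least all elements of $\mathcal M_k$ are refined, together with $V_{k+1}$. Initialization: given $\theta_1,\theta_2\in(0,1)$ and a coarse mesh $\mathcal T_H$ of mesh size $H$ with finite element space $V_H$, refine $\mathcal T_H$ regularly to get $\mathcal T_1$ and $V_1$ (possibly $\mathcal T_1=\mathcal T_H$). $(\lambda_1,u_1)=$ESOLVE$(V_1)$; set $\bar f_2^{(0)}=\bar f_1=\tilde u_1=u_1$, $\bar u_1=u_1/\lambda_1$, $n_1=1$, $k=2$, $\ell=1$, $j=0$, and the number $\eta_1=\eta_1(\bar f_1,\bar u_1;\mathcal T_1)$. Iterate: (1) MARK on $\mathcal T_{k-1}$ gives $\mathcal M_{k-1}$. (2) $(\mathcal T_k,V_k)=$REFINE$(\mathcal M_{k-1},\mathcal T_{k-1})$. (3) $\bar u_k^{(j)}=$LSOLVE$(\bar f_k^{(j)},V_k)$,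 $u_k^{(j)}=\bar u_k^{(j)}/\|\bar u_k^{(j)}\|_{a,\Omega}$, $\lambda_k^{(j)}=a(u_k^{(j)},u_k^{(j)})/(u_k^{(j)},u_k^{(j)})$. (4) Compute $\eta_k(\bar f_k^{(j)},\bar u_k^{(j)};T)$, $T\in\mathcal T_k$. (5) If $\eta_k(\bar f_k^{(j)},\bar u_k^{(j)};\mathcal T_k)\le\theta_2^{j+1}\eta_\ell$, then $(\tilde\lambda_k^{(j)},\tilde u_k^{(j)})=$ESOLVE$(V_H+{\rm span}\{u_k^{(j)}\})$, set $\bar f_k^{(j+1)}=\tilde u_k^{(j)}$, $j:=j+1$, go to (3); else set $\bar f_k=\bar f_k^{(j)}$, $\bar u_k=\bar u_k^{(j)}$, $u_k=u_k^{(j)}$, $\lambda_k=\lambda_k^{(j)}$. (6) If $j>0$, then $(\tilde\lambda_k,\tilde u_k)=$ESOLVE$(V_H+{\rm span}\{u_k\})$, $\bar f_{k+1}^{(0)}=\tilde u_k$, $\eta_{\ell+1}=\eta_k(\bar f_k^{(j)},\bar u_k^{(j)};\mathcal T_k)$, $n_{\ell+1}=k$, $\ell:=\ell+1$, $j:=0$; else $\bar f_{k+1}^{(0)}=u_k$. (7) $k:=k+1$, go to (1). Standing assumption: $\theta_1\in(0,\theta_* )$, where $\theta_*$ is the constant of Cascon–Kreuzer–Nochetto–Siebert with the property: if $f\in L^2(\Omega)$, $\mathcal T_{k,*}$ is a refinement of $\mathcal T_k$ (Galerkin projection $R_{k,*}$) and $\|(I-R_{k,*})Kf\|_{a,\Omega}^2+{\rm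 osc}^2(f-LR_{k,*}Kf;\mathcal T_{k,*})\le\tilde\xi_0^2(\|(I-R_k)Kf\|_{a,\Omega}^2+{\rm osc}^2(f-LR_kKf;\mathcal T_k))$ with $\tilde\xi_0^2\in(0,\frac12)$, then $\eta_k^2(f,R_kKf;\mathcal T_k\setminus(\mathcal T_{k,*}\cap\mathcal T_k))\ge\theta_*^2(1-2\tilde\xi_0^2)\,\eta_k^2(f,R_kKf;\mathcal T_k)$. KNOWN QUANTITIES AND CONSTANTS. For a finite dimensional $W\subset V$: $\eta_a(W)=\sup_{f\in L^2(\Omega),\|f\|_{0,\Omega}=1}\inf_{v\in W}\|L^{-1}f-v\|_{a,\Omega}$, $\delta_W(\hat\lambda^1)=\sup_{v\in M(\hat\lambda^1),\|v\|_{a,\Omega}=1}\inf_{w\in W}\|v-w\|_{a,\Omega}$; both tend to $0$ for $W=V_H$ as $H\to0$. The following are known constants with the stated properties (mesh-independent, except that $C_\#$ depends on $\mathcal T_1$). - $C_{ea},C_{e0}$: for $W=V_1$ or $W=V_H+{\rm span}\{u\}$ with $u=u_{n_\ell}^{(j)}$ or $u=u_{n_\ell}$ ($\ell\ge2$), and $w$ the function returned by ESOLVE$(W)$, $\|w-Ew\|_{a,\Omega}\le C_{ea}\delta_W(\hat\lambda^1)$ (hence, for the second type of $W$, $\le C_{ea}\min\{\delta_{V_H}(\hat\lambda^1),\|\hat u^1-u\|_{a,\Omega}\}$) and $\|w-Ew\|_{0,\Omega}\le C_{e0}\eta_a(W)\|w-Ew\|_{a,\Omega}$ (with $\eta_a(W)\le\eta_a(V_H)$).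 - $C_{an}$: $\|(I-R_k)v\|_{0,\Omega}\le C_{an}\eta_a(V_k)\|(I-R_k)v\|_{a,\Omega}$ for $v\in V$. - $C_{\rm up},C_{\rm low}$: for $f\in L^2(\Omega)$, $\|(I-R_k)Kf\|_{a,\Omega}\le C_{\rm up}\eta(f;\mathcal T_k)$ and $C_{\rm low}\eta(f;\mathcal T_k)\le\|(I-R_k)Kf\|_{a,\Omega}+{\rm osc}(f-LR_kKf;\mathcal T_k)$. - $C_{oa}$: ${\rm osc}(Lv_k;\mathcal T_k)\le C_{oa}\|v_k\|_{a,\Omega}$ for $v_k\in V_k$. - $\hat C_D$: for every mesh and $f\in L^2(\Omega)$, $\|(I-R_k)Kf\|_{a,\Omega}^2+{\rm osc}^2(f-LR_kKf;\mathcal T_k)\le\hat C_D\inf_{v_k\in V_k}(\|Kf-v_k\|_{a,\Omega}^2+{\rm osc}^2(f-Lv_k;\mathcal T_k))$. - $\gamma>0$, $\hat\alpha\in(0,1)$ (depending on $\gamma^*,A,\varphi,\theta_1$): for all $k$, $\|(I-R_{k+1})K\bar f_k\|_{a,\Omega}^2+\gamma\eta^2(\bar f_k;\mathcal T_{k+1})\le\hat\alpha^2(\|(I-R_k)K\bar f_k\|_{a,\Omega}^2+\gamma\eta^2(\bar f_k;\mathcal T_k))$. - $C_\#$: $\#\mathcal T_{k+1}-\#\mathcal T_1\le C_\#\sum_{i=1}^k\#\mathcal M_i$ for all $k$. ''$H$ small enough'' means: there is $H_0>0$ such that the assertion holds whenever $0<H\le H_0$. *)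

(* Defs.v *)
From HB Require Import structures.
From mathcomp Require Import all_boot all_order all_algebra finmap.
From mathcomp Require Import all_classical all_reals all_analysis.
Set Implicit Arguments.
Unset Strict Implicit.
Unset Printing Implicit Defensive.
Import Order.TTheory GRing.Theory Num.Theory numFieldNormedType.Exports.
Local Open Scope classical_set_scope.
Local Open Scope ring_scope.

Section TupleMeasure.
Context (d : measure_display) (T : measurableType d) (R : realType).
Context (m1 : {sigma_finite_measure set T -> \bar R}).

Section Step.
Context (n : nat) (mu : {sigma_finite_measure set (n.-tuple T) -> \bar R}).

Definition cons_pair (p : T * n.-tuple T) : n.+1.-tuple T :=
  [the n.+1.-tuple T of p.1 :: p.2].

Lemma measurable_cons_pair : measurable_fun setT cons_pair.
Proof. by apply: measurable_cons; [exact: measurable_fst | exact: measurable_snd]. Qed.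

Definition tuple_measureS : set (n.+1.-tuple T) -> \bar R :=
  fun A => (m1 \x mu)%E (cons_pair @^-1` A).

Lemma tuple_measureS0 : tuple_measureS set0 = 0%E.
Proof. by rewrite /tuple_measureS preimage_set0 measure0. Qed.

Lemma tuple_measureS_ge0 A : (0 <= tuple_measureS A)%E.
Proof. exact: measure_ge0. Qed.

Lemma tuple_measureS_sigma_additive : semi_sigma_additive tuple_measureS.
Proof.
have mc A : measurable A -> measurable (cons_pair @^-1` A).
  by move=> mA; rewrite -[X in measurable X]setTI; exact: measurable_cons_pair.
move=> F mF tF mUF; rewrite /tuple_measureS preimage_bigcup.
apply: measure_semi_sigma_additive.
- by move=> k; exact: mc.
- apply/trivIsetP => /= i j _ _ ij; rewrite -preimage_setI.
  by move/trivIsetP : tF => /(_ _ _ _ _ ij) ->//; rewrite preimage_set0.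
- by rewrite -preimage_bigcup; exact: mc.
Qed.

HB.instance Definition _ := isMeasure.Build _ _ _ tuple_measureS
  tuple_measureS0 tuple_measureS_ge0 tuple_measureS_sigma_additive.

Lemma tuple_measureS_sigma_finite : sigma_finite setT tuple_measureS.
Proof.
have /sigma_finiteP[F [FT ndF Foo]] := sigma_finiteT m1.
have /sigma_finiteP[G [GT ndG Goo]] := sigma_finiteT mu.
have mB : measurable_fun setT (fun t : n.+1.-tuple T => [tuple of behead t]).
  exact: measurable_behead.
exists (fun k => (@thead n T) @^-1` F k `&`
                 (fun t : n.+1.-tuple T => [tuple of behead t]) @^-1` G k).
  apply/seteqP; split => // t _.
  have : setT (thead t) by []. rewrite FT => -[i _ Fi].
  have : setT [tuple of behead t] by []. rewrite GT => -[j _ Gj].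
  exists (maxn i j) => //; split.
  - by have /subsetPset := ndF _ _ (leq_maxl i j); exact.
  - by have /subsetPset := ndG _ _ (leq_maxr i j); exact.
move=> k; have [mF Fk] := Foo k; have [mG Gk] := Goo k; split.
  apply: measurableI; rewrite -[X in measurable X]setTI.
  - exact: (@measurable_tnth _ T _ ord0).
  - exact: mB.
rewrite /tuple_measureS (_ : cons_pair @^-1` _ = F k `*` G k).
  by rewrite product_measure1E// lte_mul_pinfty// ge0_fin_numE.
apply/seteqP; split => -[x t] /=; rewrite /cons_pair /= theadE;
  by rewrite (_ : [tuple of _] = t)//; exact: val_inj.
Qed.

HB.instance Definition _ := Measure_isSigmaFinite.Build _ _ _ tuple_measureS
  tuple_measureS_sigma_finite.

End Step.

Fixpoint tuple_measure (n : nat) : {sigma_finite_measure set (n.-tuple T) -> \bar R} :=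
  match n with
  | 0 => [the {sigma_finite_measure set (0.-tuple T) -> \bar R} of \d_[tuple]]
  | k.+1 => [the {sigma_finite_measure set (k.+1.-tuple T) -> \bar R}
              of tuple_measureS (tuple_measure k)]
  end.
End TupleMeasure.

Arguments tuple_measure {d T R} m1 n.

(* R^n is 'rV[R]_n, with the sigma-algebra generated by the coordinates (the
   Borel sets) and the n-dimensional Lebesgue measure; for n = 0 the latter is
   the Dirac mass of the only point. *)
Section LebesgueRow.
Context (R : realType) (n : nat).

Definition row_of_tuple (t : n.-tuple (measurableTypeR R)) : 'rV[R]_n :=
  \row_i tnth t i.

Definition measurable_row (A : set 'rV[R]_n) := measurable (row_of_tuple @^-1` A).

Lemma measurable_row0 : measurable_row set0.
Proof. by rewrite /measurable_row preimage_set0. Qed.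

Lemma measurable_rowC A : measurable_row A -> measurable_row (~` A).
Proof. by rewrite /measurable_row preimage_setC; exact: measurableC. Qed.

Lemma measurable_row_bigcup (F : (set 'rV[R]_n)^nat) :
  (forall i, measurable_row (F i)) -> measurable_row (\bigcup_i F i).
Proof.
by move=> mF; rewrite /measurable_row preimage_bigcup; apply: bigcup_measurable => i _; exact: mF.
Qed.

HB.instance Definition _ := @isMeasurable.Build default_measure_display
  'rV[R]_n measurable_row measurable_row0 measurable_rowC measurable_row_bigcup.

Definition lebesgue_row (A : set 'rV[R]_n) : \bar R :=
  tuple_measure (@lebesgue_measure R) n (row_of_tuple @^-1` A).

Lemma lebesgue_row0 : lebesgue_row set0 = 0%E.
Proof. by rewrite /lebesgue_row preimage_set0 measure0. Qed.

Lemma lebesgue_row_ge0 A : (0 <= lebesgue_row A)%E.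
Proof. exact: measure_ge0. Qed.

Lemma lebesgue_row_sigma_additive : semi_sigma_additive lebesgue_row.
Proof.
move=> F mF tF mUF; rewrite /lebesgue_row preimage_bigcup.
apply: measure_semi_sigma_additive.
- by move=> k; exact: mF.
- apply/trivIsetP => /= i j _ _ ij; rewrite -preimage_setI.
  by move/trivIsetP : tF => /(_ _ _ _ _ ij) ->//; rewrite preimage_set0.
- by rewrite -preimage_bigcup; exact: mUF.
Qed.

HB.instance Definition _ := isMeasure.Build _ _ _ lebesgue_row
  lebesgue_row0 lebesgue_row_ge0 lebesgue_row_sigma_additive.

End LebesgueRow.
Arguments lebesgue_row {R} n _.

Lemma lebesgue_row_box (R : realType) (n : nat) (F : 'I_n -> set (measurableTypeR R)) :
  (forall i, measurable (F i)) ->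
  lebesgue_row n [set x : 'rV[R]_n | forall i, F i (x 0 i)] =
  (\prod_i lebesgue_measure (F i))%E.
Proof.
rewrite /lebesgue_row.
have -> : row_of_tuple (R:=R) (n:=n) @^-1` [set x : 'rV[R]_n | forall i, F i (x 0 i)] = [set t | forall i, F i (tnth t i)].
  by apply/seteqP; split => t /= h i; move: (h i); rewrite /row_of_tuple mxE.
elim: n F => [|n IH] F mF.
  rewrite big_ord0 /= diracE mem_set //= => -[]//.
rewrite big_ord_recl /= /tuple_measureS.
have -> : cons_pair (n:=n) @^-1` [set t | forall i, F i (tnth t i)]
   = F ord0 `*` [set t | forall i, F (lift ord0 i) (tnth t i)].
  apply/seteqP; split => -[x t] /=.
    by move=> h; split; [exact: (h ord0) | move=> i; have := h (lift ord0 i); rewrite tnthS].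
  move=> [h0 h] i; case: (unliftP ord0 i) => [j|] ->; last exact: h0.
  by rewrite tnthS.
set B := [set t : n.-tuple (measurableTypeR R) |
           forall i, F (lift ord0 i) (tnth t i)].
have mB : measurable B.
  have -> : B = \bigcap_(i in [set: 'I_n])
      ((fun t : n.-tuple (measurableTypeR R) => tnth t i) @^-1` F (lift ord0 i)).
    by apply/seteqP; split=> t /= h i; [move=> _; exact: h | exact: (h i I)].
  apply: fin_bigcap_measurable => [|i _]; first exact: finite_finset.
  by rewrite -[X in measurable X]setTI; exact: measurable_tnth.
have IHB := IH (fun i => F (lift ord0 i)) (fun i => mF _).
by rewrite (product_measure1E _ _ (mF ord0) mB) IHB.
Qed.

Section Analysis.
Context (R : realType).

Definition dotv (k : nat) (u v : 'rV[R]_k) : R := \sum_i u 0 i * v 0 i.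
Definition enorm (k : nat) (u : 'rV[R]_k) : R := Num.sqrt (dotv u u).

Context (n : nat).
Local Notation pt := 'rV[R]_n.+1.
Implicit Types (D : set pt) (f g : pt -> R).

Definition diam D : R := sup [set enorm (x - y) | x in D & y in D].

Definition indiam D : R :=
  sup [set 2 * r | r in [set r : R | 0 <= r /\
         exists c : pt, forall x : pt, enorm (x - c) <= r -> D x]].

Definition pd (i : 'I_n.+1) f (x : pt) : R := 'D_(delta_mx 0 i) f x.
Definition gradv f (x : pt) : pt := \row_i pd i f x.

Definition smooth f : Prop := forall s : seq 'I_n.+1,
  continuous (foldr pd f s) /\
  forall i x, derivable (foldr pd f s) x (delta_mx 0 i).

Definition test_fun D f : Prop := smooth f /\
  exists C : set pt, [/\ compact C, C `<=` D & forall x, ~ C x -> f x = 0].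

Definition polyfun (m : nat) f : Prop :=
  exists c : {ffun 'I_n.+1 -> 'I_m.+1} -> R, forall x : pt,
    f x = \sum_(a : {ffun 'I_n.+1 -> 'I_m.+1} | (\sum_i a i <= m)%N)
            c a * \prod_i x 0 i ^+ a i.

Definition ip D f g : R := \int[lebesgue_row n.+1]_(x in D) (f x * g x).
Definition nrm D f : R := Num.sqrt (ip D f f).

Definition L2 D f : Prop := measurable_fun D f /\
  (\int[lebesgue_row n.+1]_(x in D) ((f x) ^+ 2)%:E < +oo)%E.

Definition Linfty D f : Prop := measurable_fun D f /\
  exists C : R, {ae lebesgue_row n.+1, forall x, D x -> `|f x| <= C}.

(* g is the weak partial derivative of f in the direction i. *)
Definition weak_pd D (i : 'I_n.+1) f g : Prop :=
  forall psi, test_fun D psi -> ip D f (pd i psi) = - ip D g psi.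

Definition lipschitz_boundary D : Prop :=
  forall x0 : pt, (closure D `\` D) x0 ->
  exists (U : set pt) (Q : 'M[R]_n.+1) (psi : 'rV[R]_n -> R) (L : R),
    [/\ nbhs x0 U, Q *m Q^T = 1%:M,
        forall s t, `|psi s - psi t| <= L * enorm (s - t) &
        forall y, U y ->
          (D y <-> psi (col' ord0 (y *m Q)) < (y *m Q) 0 ord0)].

End Analysis.

Section Meshes.
Context (R : realType) (n : nat).
Local Notation pt := 'rV[R]_n.+1.

(* A simplex of R^(n+1): the rows of the matrix are its (ordered) vertices; the
   second component is the type that drives the bisection. *)
Definition simplex : choiceType := ('M[R]_(n.+2, n.+1) * 'I_n.+1)%type.
Definition mesh := {fset simplex}.
Implicit Types (T : simplex) (M : mesh).

Definition vertex T (i : 'I_n.+2) : pt := row i T.1.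

Definition nondegenerate T : bool :=
  (\matrix_(i < n.+1) (vertex T (lift ord0 i) - vertex T ord0)) \in unitmx.

(* The face spanned by the vertices whose index is in S. *)
Definition subface T (S : pred 'I_n.+2) : set pt :=
  [set x | exists b : 'rV[R]_n.+2,
     [/\ forall i, 0 <= b 0 i, \sum_i b 0 i = 1,
         forall i, ~~ S i -> b 0 i = 0 & x = b *m T.1]].

Definition hull T : set pt := subface T predT.
Definition facet T (i : 'I_n.+2) : set pt := subface T (predC1 i).

Definition osimplex T : set pt :=
  [set x | exists b : 'rV[R]_n.+2,
     [/\ forall i, 0 < b 0 i, \sum_i b 0 i = 1 & x = b *m T.1]].

(* h_T *)
Definition diamT T : R := diam (hull T).

Definition outer_normal T (i : 'I_n.+2) : pt :=
  xget 0 [set nu : pt | [/\ enorm nu = 1,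
    forall j k, j != i -> k != i -> dotv nu (vertex T j - vertex T k) = 0 &
    forall j, j != i -> dotv nu (vertex T i - vertex T j) < 0]].

Definition ref_simplex : set 'rV[R]_n :=
  [set t | (forall j, 0 < t 0 j) /\ \sum_j t 0 j < 1].

(* Surface integral over the i-th facet of T: pull back to the reference
   simplex of R^n; point evaluation when n = 0. *)
Definition facet_int T (i : 'I_n.+2) (g : pt -> R) : R :=
  let V : 'M[R]_n.+1 := row' i T.1 in
  let B : 'M[R]_(n, n.+1) :=
    \matrix_(j < n) (row (lift ord0 j) V - row ord0 V) in
  Num.sqrt (\det (B *m B^T)) *
  \int[lebesgue_row n]_(t in ref_simplex) g (row ord0 V + t *m B).

Definition polytopic (D : set pt) : Prop := exists M,
  {in M, forall T, nondegenerate T} /\ \bigcup_(T in [set` M]) hull T = closure D.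

Definition conforming (D : set pt) M : Prop :=
  [/\ {in M, forall T, nondegenerate T},
      \bigcup_(T in [set` M]) hull T = closure D,
      {in M &, forall T T', T != T' -> osimplex T `&` osimplex T' = set0} &
      {in M &, forall T T', exists S S' : pred 'I_n.+2,
         hull T `&` hull T' = subface T S /\ hull T `&` hull T' = subface T' S'}].

Definition mesh_size M : R := \big[Num.max/0]_(T <- M) diamT T.

(* Bisection of a tagged simplex (x_0, ..., x_d)_g, d = n+1, at the midpoint z
   of x_0 x_d (Maubach, Traxler), with children
     (x_0, z, x_1, ..., x_g, x_(g+1), ..., x_(d-1))_(g+1 mod d),
     (x_d, z, x_1, ..., x_g, x_(d-1), ..., x_(g+1))_(g+1 mod d). *)
Definition midpoint T : pt := 2^-1 *: (vertex T ord0 + vertex T ord_max).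

Definition child1 T : simplex :=
  (\matrix_(i < n.+2)
     (if i == 0%N :> nat then vertex T ord0
      else if i == 1%N :> nat then midpoint T
      else vertex T (inord i.-1)),
   ordS T.2).

Definition child2 T : simplex :=
  (\matrix_(i < n.+2)
     (if i == 0%N :> nat then vertex T ord_max
      else if i == 1%N :> nat then midpoint T
      else if (i <= T.2.+1)%N then vertex T (inord i.-1)
      else vertex T (inord ((n + T.2).+2 - i))),
   ordS T.2).

Definition bisect M T : mesh := (child1 T |` (child2 T |` (M `\ T)))%fset.

Inductive bisections M : mesh -> Prop :=
| bisections_refl : bisections M M
| bisections_step M' T :
    bisections M M' -> T \in M' -> bisections M (bisect M' T).

Definition refinement (D : set pt) M M' : Prop :=
  bisections M M' /\ conforming D M'.

End Meshes.

(* Data of the problem. The dimension is d = n+1. An element of H^1_0 is a pair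
   (function, weak gradient). *)
Definition sobfun (R : realType) (n : nat) : lmodType R :=
  (('rV[R]_n.+1 -> R^o) * ('rV[R]_n.+1 -> 'rV[R]_n.+1))%type.

Record setting (R : realType) (n : nat) := Setting {
  dom : set 'rV[R]_n.+1;
  coefA : 'rV[R]_n.+1 -> 'M[R]_n.+1;
  dcoefA : 'I_n.+1 -> 'rV[R]_n.+1 -> 'M[R]_n.+1;  (* weak derivatives of A *)
  pot : 'rV[R]_n.+1 -> R;
  deg : nat;           (* polynomial degree of the finite element spaces *)
  gstar : R;           (* shape regularity constant *)
  solK : ('rV[R]_n.+1 -> R) -> sobfun R n;
  eigval : nat -> R;   (* eigval i is the (i+1)-st eigenvalue *)
  eigfun : nat -> sobfun R n;
  projE : sobfun R n -> sobfun R n;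
  galerkin : mesh R n -> sobfun R n -> sobfun R n;
  odeg : nat;          (* polynomial degree of the projections P_T *)
  projP : simplex R n -> ('rV[R]_n.+1 -> R) -> ('rV[R]_n.+1 -> R)
}.

Section Problem.
Context (R : realType) (n : nat) (S : setting R n).
Local Notation pt := 'rV[R]_n.+1.
Local Notation V := (sobfun R n).
Local Notation Om := (dom S).
Local Notation A := (coefA S).
Local Notation K := (solK S).
Local Notation E := (projE S).
Implicit Types (u v w : V) (f g : pt -> R) (T : simplex R n) (M : mesh R n).
Implicit Types (W : set V).

Definition norm1 w : R :=
  Num.sqrt (ip Om w.1 w.1 +
            \sum_i ip Om (fun x => w.2 x 0 i) (fun x => w.2 x 0 i)).

(* H^1_0: closure of the test functions in H^1. *)
Definition H01 : set V := [set u : V |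
  [/\ L2 Om u.1, forall i, L2 Om (fun x => u.2 x 0 i) &
      exists2 psi : nat -> pt -> R, forall k, test_fun Om (psi k) &
        (fun k => norm1 (((psi k : pt -> R^o), gradv (psi k)) - u : V)) @ \oo
          --> (0 : R)]].

Definition aform u v : R :=
  \int[lebesgue_row n.+1]_(x in Om)
    (dotv (u.2 x *m (A x)^T) (v.2 x) + pot S x * u.1 x * v.1 x).
Definition anorm u : R := Num.sqrt (aform u u).

Definition eigpair (lam : R) u : Prop :=
  [/\ H01 u, anorm u = 1 & forall v, H01 v -> aform u v = lam * ip Om u.1 v.1].

Definition eigspace1 : set V := [set v : V | H01 v /\
  forall w, H01 w -> aform v w = eigval S 0 * ip Om v.1 w.1].

Definition shape_regular M : Prop :=
  {in M, forall T, diamT T <= gstar S * indiam (hull T)}.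

Definition is_mesh M : Prop := conforming Om M /\ shape_regular M.

(* The weak gradient of a finite element function is represented by the
   elementwise classical gradient. *)
Definition fespace M : set V := [set v : V |
  [/\ H01 v, {within closure Om, continuous (v.1 : pt -> R)},
      forall x, (closure Om `\` Om) x -> v.1 x = 0 &
      {in M, forall T,
        (exists2 p, polyfun (deg S) p & forall x, hull T x -> v.1 x = p x) /\
        (forall x, osimplex T x -> v.2 x = gradv v.1 x)}]].

Definition span_add W u : set V :=
  [set w : V | exists v (c : R), W v /\ w = v + c *: u].

Definition lsolve f W w : Prop :=
  W w /\ forall v, W v -> aform w v = ip Om f v.1.

Definition disc_eigpair W (mu : R) w : Prop :=
  [/\ W w, anorm w = 1 & forall v, W v -> aform w v = mu * ip Om w.1 v.1].

Definition esolve W (mu : R) w : Prop := disc_eigpair W mu w /\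
  forall mu' w', disc_eigpair W mu' w' -> mu <= mu'.

(* Elementwise div (A grad v) and L v. *)
Definition divA f (x : pt) : R :=
  \sum_i \sum_j (dcoefA S i x i j * pd j f x + A x i j * pd i (pd j f) x).
Definition Lop f (x : pt) : R := - divA f x + pot S x * f x.

Definition resid f g (x : pt) : R := f x + divA g x - pot S x * g x.

(* Trace at x of the gradient of the restriction of g to T. *)
Definition tgrad T g (x : pt) : pt := lim (gradv g @ within (osimplex T) (nbhs x)).

Definition jump T i T' i' g (x : pt) : R :=
  - dotv (tgrad T g x *m (A x)^T) (outer_normal T i)
  - dotv (tgrad T' g x *m (A x)^T) (outer_normal T' i').

(* The interior faces contained in the boundary of T are the facets of T that
   are also a facet of another element T' of M (there is at most one). The
   length h_E is the diameter of E, hence 0 in dimension one. *)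
Definition eta2 M f g T : R :=
  diamT T ^+ 2 * nrm (osimplex T) (resid f g) ^+ 2 +
  \sum_i \sum_(T' <- M | T' != T) \sum_i'
    (if `[< facet T i = facet T' i' >]
     then diam (facet T i) * facet_int T i (fun x => jump T i T' i' g x ^+ 2)
     else 0).

Definition eta M f g M' : R := Num.sqrt (\sum_(T <- M') eta2 M f g T).

Definition eta_sol f M M' : R := eta M f (galerkin S M (K f)).1 M'.

Definition osc g M : R :=
  Num.sqrt (\sum_(T <- M)
    nrm (osimplex T) (fun x => diamT T * (g x - projP S T g x)) ^+ 2).

Definition galerr f M : R := anorm (K f - galerkin S M (K f)).

Definition oscsol f M : R :=
  osc (fun x => f x - Lop (galerkin S M (K f)).1 x) M.

Definition etaA W : R :=
  sup [set inf [set anorm (K f - v) | v in W]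
      | f in [set f : pt -> R | L2 Om f /\ nrm Om f = 1]].

Definition delta W : R :=
  sup [set inf [set anorm (v - w) | w in W]
      | v in [set v : V | eigspace1 v /\ anorm v = 1]].

Definition err2 u M : R := anorm (u - E u) ^+ 2 + osc (Lop u.1) M ^+ 2.

(* The constant M of the approximation class; infima over the empty set are
   +oo. *)
Definition best_err2 M : \bar R :=
  ereal_inf [set (err2 u M)%:E | u in [set u : V | fespace M u /\ anorm u = 1]].

Definition approx_const (s : R) (M1 : mesh R n) : \bar R :=
  ereal_sup [set (e%:E * ereal_inf
      [set (((#|` M|%:R - #|` M1|%:R) `^ s)%:E) | M in
         [set M | refinement Om M1 M /\ (best_err2 M <= (e ^+ 2)%:E)%E]])%E
    | e in [set e : R | 0 < e]].

Record standing : Prop := Standing {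
  dom_open : open Om;
  dom_connected : connected Om;
  dom_nonempty : Om !=set0;
  dom_bounded : bounded_set Om;
  dom_polytopic : polytopic Om;
  dom_lipschitz : lipschitz_boundary Om;
  coefA_sym : forall x, Om x -> (A x)^T = A x;
  coefA_pos : forall x, Om x -> forall xi : pt, xi != 0 ->
    0 < dotv (xi *m (A x)^T) xi;
  (* the coefficients, in W^{1,oo}, are their continuous representatives *)
  coefA_cont : forall i j, {within Om, continuous (fun x => A x i j)};
  coefA_bnd : forall i j, Linfty Om (fun x => A x i j);
  dcoefA_bnd : forall l i j, Linfty Om (fun x => dcoefA S l x i j);
  dcoefA_weak : forall l i j,
    weak_pd Om l (fun x => A x i j) (fun x => dcoefA S l x i j);
  pot_bnd : Linfty Om (pot S);
  pot_ge0 : {ae lebesgue_row n.+1, forall x, Om x -> 0 <= pot S x};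
  deg_ge1 : (1 <= deg S)%N;
  solK_spec : forall f, L2 Om f ->
    H01 (K f) /\ forall v, H01 v -> aform (K f) v = ip Om f v.1;
  eigval_gt0 : 0 < eigval S 0;
  eigval_gap : eigval S 0 < eigval S 1;
  eigval_nd : forall i, eigval S i.+1 <= eigval S i.+2;
  eigfun_spec : forall i, eigpair (eigval S i) (eigfun S i);
  eigfun_orth : forall i j, aform (eigfun S i) (eigfun S j) = (i == j)%:R;
  (* every eigenvalue is listed, with its multiplicity *)
  eigfun_complete : forall v, H01 v ->
    (forall i, aform v (eigfun S i) = 0) -> anorm v = 0;
  projE_spec : forall v, H01 v -> eigspace1 (E v) /\
    forall w, eigspace1 w -> aform (v - E v) w = 0;
  galerkin_spec : forall M, is_mesh M -> forall v, H01 v ->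
    fespace M (galerkin S M v) /\
    forall w, fespace M w -> aform (v - galerkin S M v) w = 0;
  projP_spec : forall T, nondegenerate T -> forall g, L2 (osimplex T) g ->
    polyfun (odeg S) (projP S T g) /\
    forall q, polyfun (odeg S) q ->
      ip (osimplex T) (fun x => g x - projP S T g x) q = 0;
  osc_data : forall M, is_mesh M -> forall v w, fespace M v -> fespace M w ->
    osc (fun x => v.1 x - Lop w.1 x) M = osc (Lop w.1) M;
  eigfun_not_poly : forall M (p : nat), is_mesh M ->
    ~ {in M, forall T, exists2 q, polyfun p q &
         {ae lebesgue_row n.+1, forall x, osimplex T x -> (eigfun S 0).1 x = q x}}
}.

(* Coarse mesh MH and initial mesh M1; M1 carries the vertex orderings and types
   that drive the bisections. *)
Definition admissible (MH M1 : mesh R n) : Prop :=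
  [/\ is_mesh MH, is_mesh M1,
      {in M1, forall T, exists2 T', T' \in MH & hull T `<=` hull T'} &
      forall M, refinement Om M1 M -> shape_regular M].

Definition mark (th : R) M f g (Mk : mesh R n) : Prop :=
  [/\ (Mk `<=` M)%fset, th * eta M f g M <= eta M f g Mk &
      forall M', (M' `<=` M)%fset -> th * eta M f g M <= eta M f g M' ->
        (#|` Mk| <= #|` M'|)%N].

(* M' is a minimal conforming refinement of M that refines the marked elements. *)
Definition refine Mk M M' : Prop :=
  [/\ refinement Om M M', [disjoint Mk & M']%fset &
      forall M'', refinement Om M M'' -> [disjoint Mk & M'']%fset ->
        bisections M'' M' -> M'' = M'].

End Problem.

(* A run of the adaptive algorithm: r_mesh k is T_k; r_jmax k is the value of j
   when the inner loop of level k stops, and r_ell k the value of l when level k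
   starts. The fields in j have r_xj k j = x_k^(j); t stands for the tilde. *)
Record run (R : realType) (n : nat) := Run {
  r_mesh : nat -> mesh R n;
  r_marked : nat -> mesh R n;
  r_jmax : nat -> nat;
  r_fbarj : nat -> nat -> sobfun R n;
  r_ubarj : nat -> nat -> sobfun R n;
  r_uj : nat -> nat -> sobfun R n;
  r_lamj : nat -> nat -> R;
  r_tlamj : nat -> nat -> R;
  r_tuj : nat -> nat -> sobfun R n;
  r_fbar : nat -> sobfun R n;
  r_ubar : nat -> sobfun R n;
  r_u : nat -> sobfun R n;
  r_lam : nat -> R;
  r_tlam : nat -> R;
  r_tu : nat -> sobfun R n;
  r_ell : nat -> nat;
  r_eta : nat -> R;
  r_n : nat -> nat
}.

Section Algorithm.
Context (R : realType) (n : nat) (S : setting R n) (th1 th2 : R).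
Context (MH M1 : mesh R n) (r : run R n).

Definition est_j (k j : nat) : R :=
  eta S (r_mesh r k) (r_fbarj r k j).1 (r_ubarj r k j).1 (r_mesh r k).

Definition run_init : Prop :=
  [/\ r_mesh r 1 = M1,
      esolve S (fespace S M1) (r_lam r 1) (r_u r 1),
      [/\ r_fbar r 1 = r_u r 1, r_fbarj r 2 0 = r_u r 1, r_tu r 1 = r_u r 1 &
          r_ubar r 1 = (r_lam r 1)^-1 *: r_u r 1] &
      [/\ r_n r 1 = 1%N, r_ell r 2 = 1%N &
          r_eta r 1 = eta S M1 (r_fbar r 1).1 (r_ubar r 1).1 M1]].

Definition run_solve (k j : nat) : Prop :=
  [/\ lsolve S (r_fbarj r k j).1 (fespace S (r_mesh r k)) (r_ubarj r k j),
      r_uj r k j = (anorm S (r_ubarj r k j))^-1 *: r_ubarj r k j &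
      r_lamj r k j = aform S (r_uj r k j) (r_uj r k j)
                     / ip (dom S) (r_uj r k j).1 (r_uj r k j).1].

Definition run_test (k j : nat) : Prop :=
  est_j k j <= th2 ^+ j.+1 * r_eta r (r_ell r k).

Definition run_level (k : nat) : Prop :=
  let J := r_jmax r k in
  [/\ mark S th1 (r_mesh r k.-1) (r_fbar r k.-1).1 (r_ubar r k.-1).1
        (r_marked r k.-1) /\
      refine S (r_marked r k.-1) (r_mesh r k.-1) (r_mesh r k),
      forall j, (j <= J)%N -> run_solve k j,
      (forall j, (j < J)%N ->
        [/\ run_test k j,
            esolve S (span_add (fespace S MH) (r_uj r k j))
              (r_tlamj r k j) (r_tuj r k j) &
            r_fbarj r k j.+1 = r_tuj r k j]) /\
      ~ run_test k J,
      [/\ r_fbar r k = r_fbarj r k J, r_ubar r k = r_ubarj r k J,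
          r_u r k = r_uj r k J & r_lam r k = r_lamj r k J] &
      if (0 < J)%N then
        [/\ esolve S (span_add (fespace S MH) (r_u r k)) (r_tlam r k) (r_tu r k),
            r_fbarj r k.+1 0 = r_tu r k,
            r_eta r (r_ell r k).+1 = est_j k J,
            r_n r (r_ell r k).+1 = k &
            r_ell r k.+1 = (r_ell r k).+1]
      else r_fbarj r k.+1 0 = r_u r k /\ r_ell r k.+1 = r_ell r k].

(* The levels 1, ..., N of r are produced by the algorithm. *)
Definition is_run (N : nat) : Prop :=
  run_init /\ forall k, (2 <= k <= N)%N -> run_level k.

End Algorithm.

Section Constants.
Context (R : realType) (n : nat) (S : setting R n).
Local Notation Om := (dom S).
Local Notation V := (sobfun R n).

Definition norm_equiv (ca Ca : R) : Prop := forall w : V, H01 S w ->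
  ca * norm1 S w <= anorm S w <= Ca * norm1 S w.

Definition coarse_limits : Prop := forall e : R, 0 < e ->
  exists2 H1 : R, 0 < H1 & forall MH : mesh R n, is_mesh S MH ->
    mesh_size MH <= H1 ->
    etaA S (fespace S MH) < e /\ delta S (fespace S MH) < e.

Definition esolve_bounds (Cea Ce0 : R) (W : set V) : Prop :=
  forall (mu : R) (w : V), esolve S W mu w ->
    anorm S (w - projE S w) <= Cea * delta S W /\
    nrm Om (w - projE S w).1 <= Ce0 * etaA S W * anorm S (w - projE S w).

(* The levels with 0 < r_jmax are the n_l with l >= 2. *)
Definition esolve_property (th1 th2 Cea Ce0 : R) : Prop :=
  forall MH M1 : mesh R n, admissible S MH M1 ->
    esolve_bounds Cea Ce0 (fespace S M1) /\
    forall (r : run R n) (N k j : nat), is_run S th1 th2 MH M1 r N ->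
      (2 <= k <= N)%N -> (0 < r_jmax r k)%N -> (j <= r_jmax r k)%N ->
      esolve_bounds Cea Ce0 (span_add (fespace S MH) (r_uj r k j)).

Definition duality_property (Can : R) : Prop := forall M : mesh R n, is_mesh S M ->
  forall v : V, H01 S v ->
    nrm Om (v - galerkin S M v).1
      <= Can * etaA S (fespace S M) * anorm S (v - galerkin S M v).

Definition upper_property (Cup : R) : Prop := forall M : mesh R n, is_mesh S M ->
  forall f, L2 Om f -> galerr S f M <= Cup * eta_sol S f M M.

Definition lower_property (Clow : R) : Prop := forall M : mesh R n, is_mesh S M ->
  forall f, L2 Om f -> Clow * eta_sol S f M M <= galerr S f M + oscsol S f M.

Definition osc_property (Coa : R) : Prop := forall M : mesh R n, is_mesh S M ->
  forall v : V, fespace S M v -> osc S (Lop S v.1) M <= Coa * anorm S v.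

Definition quasi_opt_property (CD : R) : Prop :=
  forall M : mesh R n, is_mesh S M -> forall f, L2 Om f ->
    galerr S f M ^+ 2 + oscsol S f M ^+ 2 <=
    CD * inf [set anorm S (solK S f - v) ^+ 2
                  + osc S (fun x => f x - Lop S v.1 x) M ^+ 2
             | v in fespace S M].

Definition marking_property (ths : R) : Prop :=
  forall M M' : mesh R n, is_mesh S M -> is_mesh S M' -> refinement Om M M' ->
  forall f, L2 Om f -> forall xi : R, 0 < xi ^+ 2 < 2^-1 ->
    galerr S f M' ^+ 2 + oscsol S f M' ^+ 2
      <= xi ^+ 2 * (galerr S f M ^+ 2 + oscsol S f M ^+ 2) ->
    ths ^+ 2 * (1 - 2 * xi ^+ 2) * eta_sol S f M M ^+ 2
      <= eta_sol S f M (M `\` (M' `&` M))%fset ^+ 2.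

Definition contraction_property (th1 th2 gam alh : R) : Prop :=
  forall MH M1 : mesh R n, admissible S MH M1 ->
  forall (r : run R n) (N k : nat), is_run S th1 th2 MH M1 r N -> (1 <= k < N)%N ->
    let f := (r_fbar r k).1 in
    galerr S f (r_mesh r k.+1) ^+ 2
      + gam * eta_sol S f (r_mesh r k.+1) (r_mesh r k.+1) ^+ 2
    <= alh ^+ 2 * (galerr S f (r_mesh r k) ^+ 2
      + gam * eta_sol S f (r_mesh r k) (r_mesh r k) ^+ 2).

Definition complexity_property (th1 th2 : R) (MH M1 : mesh R n) (Csharp : R) : Prop :=
  forall (r : run R n) (N k : nat), is_run S th1 th2 MH M1 r N -> (1 <= k < N)%N ->
    #|` r_mesh r k.+1|%:R - #|` M1|%:R
      <= Csharp * (\sum_(1 <= i < k.+1) #|` r_marked r i|)%:R.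

End Constants.

(* Main.v *)
From mathcomp Require Import all_boot all_order all_algebra finmap.
From mathcomp Require Import all_classical all_reals all_analysis.
From mathcomp Require Import measurable_realfun.
From mathcomp Require Import ring lra zify.
Require Import Defs.
Set Implicit Arguments.
Unset Strict Implicit.
Unset Printing Implicit Defensive.
Import Order.TTheory GRing.Theory Num.Theory numFieldNormedType.Exports.
Local Open Scope classical_set_scope.
Local Open Scope ring_scope.

(** Write w for the component of a function that is energy-orthogonal to the first
    eigenfunction; the eigenspace is a line, so the energy norm of w is the eigenfunction
    error. The proof treats every step of the algorithm as a source problem with a load f
    of energy norm one that lies almost in the eigenspace.

    One solve. The remainder of the solution of a source problem is at most the
    discretisation error plus the L2 remainder of the load ([N_ww_sol]), and its L2
    remainder is smaller still, by duality ([l2_ww_sol]). A correction in the coarse space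
    plus the span of the solution yields a load whose L2 remainder is a small multiple eps
    of its energy remainder ([correction_numbers]), where eps measures the coarse space.
    Hence the eigenvalue iteration is a perturbation of a linear adaptive method, provided
    that the L2 remainder of the load stays small against the estimator.

    This is the delicate point, because without corrections the L2 remainder may grow by a
    fixed factor from level to level. Let h be the estimator at the last correction. The
    total error E (energy error and gamma times the estimator, squared) contracts for a
    fixed load by hypothesis, and for changing loads it still contracts by alpha, since
    loads of norm one close to the same line agree, up to sign, to higher order
    ([unit_diff], [total_err_pert], [contraction_step]). So E decreases geometrically while
    no correction occurs, whereas the estimator stays above theta_2 h: the number of levels
    between corrections is bounded, and with it the growth of the remainder.
    [adaptive_recursion] carries out this induction for the real numbers involved, and
    [uniform_control] collects its consequences for runs.

    Complexity. By the definition of the approximation class some mesh T_e with few elements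
    carries a function close to the eigenspace, up to an error e proportional to the current
    total error. The multiple of that function which matches the load approximates the
    solution of the source problem, and near-optimality of the total error shows that the
    overlay of T_e with the current mesh reduces the total error by the factor xi
    ([overlay_reduces]). The marking property then says that the elements refined in the
    overlay satisfy the marking criterion, so the minimal marked set is no larger
    ([marked_count]). The overlay is built along bisections ([overlay_refinement]): two nodes
    of a bisection tree are nested or have disjoint interiors, which yields the count, and
    conformity holds because faces of a simplex are extreme sets. Finally the marked
    elements of all levels are summed; as E decays geometrically, the last level dominates
    ([marked_sum]), and solving the count for E gives the rate.

    Estimator, oscillation and Galerkin projection depend on function values of finite
    element functions, while energy arguments only determine functions up to energy zero.
    The two agree by [fespace_eq]. For the estimator to be quadratic in its arguments, the
    jumps must be square integrable on interior faces, which lie in the open domain because a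
    Lipschitz domain has no slits ([facet_interior]). *)

(** * Semi-inner products *)

Record semi_inner (R : realType) (V : lmodType R) (P : set V) (b : V -> V -> R)
    : Prop := SemiInner {
  si_add : forall u v, P u -> P v -> P (u + v);
  si_scale : forall a u, P u -> P (a *: u);
  si_sym : forall u v, P u -> P v -> b u v = b v u;
  si_addl : forall u v w, P u -> P v -> P w -> b (u + v) w = b u w + b v w;
  si_scalel : forall a u v, P u -> P v -> b (a *: u) v = a * b u v;
  si_ge0 : forall u, P u -> 0 <= b u u
}.

Section SemiInnerTheory.
Context (R : realType) (V : lmodType R) (P : set V) (b : V -> V -> R).
Hypothesis h : semi_inner P b.

Definition snorm (u : V) := Num.sqrt (b u u).

Lemma si_opp u : P u -> P (- u).
Proof. by move=> Pu; rewrite -scaleN1r; apply: (si_scale h). Qed.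

Lemma si_sub u v : P u -> P v -> P (u - v).
Proof. by move=> Pu Pv; apply: (si_add h) => //; exact: si_opp. Qed.

Lemma si_addr u v w : P u -> P v -> P w -> b w (u + v) = b w u + b w v.
Proof.
move=> Pu Pv Pw; rewrite (si_sym h Pw) ?(si_addl h)//; last exact: (si_add h).
by rewrite (si_sym h Pu)// (si_sym h Pv).
Qed.

Lemma si_scaler a u v : P u -> P v -> b u (a *: v) = a * b u v.
Proof.
move=> Pu Pv; rewrite (si_sym h Pu) ?(si_scalel h)//; last exact: (si_scale h).
by rewrite (si_sym h Pu).
Qed.

Lemma si_oppl u v : P u -> P v -> b (- u) v = - b u v.
Proof. by move=> Pu Pv; rewrite -scaleN1r (si_scalel h)// mulN1r. Qed.

Lemma si_oppr u v : P u -> P v -> b u (- v) = - b u v.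
Proof. by move=> Pu Pv; rewrite -scaleN1r si_scaler// mulN1r. Qed.

Lemma si_subl u v w : P u -> P v -> P w -> b (u - v) w = b u w - b v w.
Proof.
by move=> Pu Pv Pw; rewrite (si_addl h)// ?si_oppl//; exact: si_opp.
Qed.

Lemma si_subr u v w : P u -> P v -> P w -> b w (u - v) = b w u - b w v.
Proof.
by move=> Pu Pv Pw; rewrite si_addr// ?si_oppr//; exact: si_opp.
Qed.

Lemma snorm_ge0 u : 0 <= snorm u.
Proof. exact: sqrtr_ge0. Qed.

Lemma snorm_sqr u : P u -> snorm u ^+ 2 = b u u.
Proof. by move=> Pu; rewrite sqr_sqrtr// (si_ge0 h). Qed.

Lemma si_sqrD u v : P u -> P v -> b (u + v) (u + v) = b u u + 2 * b u v + b v v.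
Proof.
move=> Pu Pv; have Puv := si_add h Pu Pv.
rewrite (si_addl h)// !si_addr// (si_sym h Pv Pu); ring.
Qed.

Lemma snormZ a u : P u -> snorm (a *: u) = `|a| * snorm u.
Proof.
move=> Pu; rewrite /snorm (si_scalel h)// ?si_scaler//; last exact: (si_scale h).
by rewrite mulrA -expr2 sqrtrM ?sqr_ge0// sqrtr_sqr.
Qed.

Lemma snormN u : P u -> snorm (- u) = snorm u.
Proof. by move=> Pu; rewrite -scaleN1r snormZ// normrN1 mul1r. Qed.

Lemma snormB u v : P u -> P v -> snorm (u - v) = snorm (v - u).
Proof. by move=> Pu Pv; rewrite -opprB snormN//; exact: si_sub. Qed.

(** The form may vanish on nonzero vectors, so the case of a null vector is
    separate; there a large multiple of it does the job. *)
Lemma si_cs u v : P u -> P v -> `|b u v| <= snorm u * snorm v.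
Proof.
move=> Pu Pv; rewrite -(ler_pXn2r (n := 2))// ?nnegrE ?mulr_ge0 ?snorm_ge0//.
rewrite exprMn !snorm_sqr// real_normK ?num_real//.
have H t s : 0 <= t ^+ 2 * b u u + 2 * (t * s) * b u v + s ^+ 2 * b v v.
  have Pt := si_scale h t Pu; have Ps := si_scale h s Pv.
  have := si_ge0 h (si_add h Pt Ps); rewrite si_sqrD// !(si_scalel h)// !si_scaler//.
  by lra.
have uu := si_ge0 h Pu; have vv := si_ge0 h Pv.
have [v0|v0] := eqVneq (b v v) 0.
  have := H (b u v) (- (b u u + 1)).
  rewrite v0 => H1.
  suff -> : b u v = 0 by rewrite expr0n/= mulr0.
  apply/eqP; rewrite -sqrf_eq0 eq_le sqr_ge0 andbT.
  rewrite leNgt; apply/negP => c0; move: H1; rewrite leNgt => /negP; apply.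
  nra.
have v1 : 0 < b v v by rewrite lt_neqAle eq_sym v0.
have := H (b v v) (- b u v) => H1.
rewrite -subr_ge0 -(pmulr_rge0 _ v1); apply: le_trans H1 _.
lra.
Qed.

Lemma snormD u v : P u -> P v -> snorm (u + v) <= snorm u + snorm v.
Proof.
move=> Pu Pv; rewrite -(ler_pXn2r (n := 2))// ?nnegrE ?addr_ge0 ?snorm_ge0//.
have Puv := si_add h Pu Pv.
rewrite snorm_sqr// si_sqrD// sqrrD !snorm_sqr//.
have := le_trans (ler_norm _) (si_cs Pu Pv); lra.
Qed.

Lemma snorm_subD u v : P u -> P v -> snorm (u - v) <= snorm u + snorm v.
Proof.
by move=> Pu Pv; rewrite -(snormN Pv); apply: snormD => //; exact: si_opp.
Qed.

Lemma snorm_lip u v : P u -> P v -> snorm u <= snorm v + snorm (u - v).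
Proof.
move=> Pu Pv; rewrite -{1}(subrK v u) addrC; apply: snormD => //; exact: si_sub.
Qed.

Lemma si_null u v : P u -> P v -> snorm u = 0 -> b u v = 0.
Proof.
move=> Pu Pv u0; apply/eqP; rewrite -normr_le0.
by apply: le_trans (si_cs Pu Pv) _; rewrite u0 mul0r.
Qed.

(** Young's form of the triangle inequality. Unlike the latter it passes to sums
    of squares term by term. *)
Lemma si_young u v (d : R) : P u -> P v -> 0 < d ->
  b (u + v) (u + v) <= (1 + d) * b u u + (1 + d^-1) * b v v.
Proof.
move=> Pu Pv d0; rewrite si_sqrD//.
have Pd := si_scale h d Pu.
have := si_ge0 h (si_sub Pd Pv); rewrite si_sqrD// ?si_oppr// ?si_oppl//; try exact: si_opp.
rewrite !(si_scalel h)// !si_scaler// => H.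
rewrite -(ler_pM2l d0).
have -> : d * ((1 + d) * b u u + (1 + d^-1) * b v v)
  = d * b u u + d * d * b u u + d * b v v + b v v.
  by field; rewrite gt_eqF.
lra.
Qed.

End SemiInnerTheory.

(** * Finite sums *)

Section Sums.
Context (R : realType) (I : eqType) (s : seq I) (P : pred I).
Implicit Types F G H : I -> R.

Lemma ler_sum_lin (a b : R) F G H :
  (forall i, i \in s -> P i -> F i <= a * G i + b * H i) ->
  \sum_(i <- s | P i) F i <= a * \sum_(i <- s | P i) G i + b * \sum_(i <- s | P i) H i.
Proof.
move=> FGH; rewrite !mulr_sumr -big_split [leLHS]big_seq_cond [leRHS]big_seq_cond /=.
by apply: ler_sum => i /andP[si Pi]; exact: FGH.
Qed.

Lemma eq_sum_scale (a : R) F G : (forall i, i \in s -> P i -> F i = a * G i) ->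
  \sum_(i <- s | P i) F i = a * \sum_(i <- s | P i) G i.
Proof.
move=> FG; rewrite mulr_sumr [LHS]big_seq_cond [RHS]big_seq_cond.
by apply: eq_bigr => i /andP[si Pi]; exact: FG.
Qed.

Lemma eq_sum_seq F G : (forall i, i \in s -> P i -> F i = G i) ->
  \sum_(i <- s | P i) F i = \sum_(i <- s | P i) G i.
Proof.
move=> FG; rewrite [LHS]big_seq_cond [RHS]big_seq_cond.
by apply: eq_bigr => i /andP[si Pi]; exact: FG.
Qed.

Lemma ler_sum_seq F G : (forall i, i \in s -> P i -> F i <= G i) ->
  \sum_(i <- s | P i) F i <= \sum_(i <- s | P i) G i.
Proof.
move=> FG; rewrite [leLHS]big_seq_cond [leRHS]big_seq_cond.
by apply: ler_sum => i /andP[si Pi]; exact: FG.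
Qed.

End Sums.

(** * Square integrable functions *)

Section SquareIntegrable.
Context (d : measure_display) (T : measurableType d) (R : realType).
Context (mu : {measure set T -> \bar R}) (D : set T) (mD : measurable D).
Implicit Types f g h : T -> R.

Definition sqint f := measurable_fun D f /\
  (\int[mu]_(x in D) ((f x) ^+ 2)%:E < +oo)%E.

Definition prodint f g : R := \int[mu]_(x in D) (f x * g x).

Lemma sqint_integrable f : sqint f -> mu.-integrable D (EFin \o (fun x => f x ^+ 2)).
Proof.
move=> [mf foo]; apply/integrableP; split.
  by apply/measurable_EFinP; exact: measurable_funX.
by under eq_integral do rewrite /= ger0_norm ?sqr_ge0//.
Qed.

Lemma sqintP f : measurable_fun D f ->
  mu.-integrable D (EFin \o (fun x => f x ^+ 2)) -> sqint f.
Proof.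
move=> mf /integrableP[_]; split=> //.
by move: b; under eq_integral do rewrite /= ger0_norm ?sqr_ge0//.
Qed.

Lemma sqint_mul f g : sqint f -> sqint g ->
  mu.-integrable D (EFin \o (fun x => f x * g x)).
Proof.
move=> sf sg; have [mf _] := sf; have [mg _] := sg.
apply: (@le_integrable _ _ _ mu D mD _ (EFin \o (fun x => f x ^+ 2 + g x ^+ 2))).
- by apply/measurable_EFinP; exact: measurable_funM.
- move=> x Dx /=; rewrite lee_fin normrM [leRHS]ger0_norm ?addr_ge0 ?sqr_ge0//.
  rewrite -(real_normK (num_real (f x))) -(real_normK (num_real (g x))).
  have := sqr_ge0 (`|f x| - `|g x|); have := mulr_ge0 (normr_ge0 (f x)) (normr_ge0 (g x)).
  nra.
- have := integrableD mD (sqint_integrable sf) (sqint_integrable sg).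
  by apply: eq_integrable => // x _ /=; rewrite EFinD.
Qed.

Lemma sqintD f g : sqint f -> sqint g -> sqint (fun x => f x + g x).
Proof.
move=> sf sg; have [mf _] := sf; have [mg _] := sg.
apply: sqintP; first exact: measurable_funD.
have := integrableD mD (sqint_integrable sf) (integrableD mD (sqint_mul sf sg)
   (integrableD mD (sqint_mul sf sg) (sqint_integrable sg))).
by apply: eq_integrable => // x _ /=; rewrite -!EFinD; congr EFin; ring.
Qed.

Lemma sqintZ a f : sqint f -> sqint (fun x => a * f x).
Proof.
move=> sf; have [mf _] := sf.
apply: sqintP; first by apply: measurable_funM => //; exact: measurable_cst.
have := integrableZl mD (a ^+ 2) (sqint_integrable sf).
by apply: eq_integrable => // x _ /=; rewrite -EFinM exprMn.
Qed.

Lemma sqintN f : sqint f -> sqint (fun x => - f x).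
Proof.
by move=> /(sqintZ (-1)); congr sqint; apply/funext => x; rewrite mulN1r.
Qed.

Lemma sqintB f g : sqint f -> sqint g -> sqint (fun x => f x - g x).
Proof. by move=> sf sg; apply: sqintD => //; exact: sqintN. Qed.

Lemma sqint_eq f g : (forall x, D x -> f x = g x) -> sqint f -> sqint g.
Proof.
move=> fg sf; have [mf _] := sf; apply: sqintP.
  by apply: eq_measurable_fun mf => x /set_mem; exact: fg.
have := sqint_integrable sf; apply: eq_integrable => // x /set_mem Dx /=.
by rewrite fg.
Qed.

Lemma sqint0 : sqint (fun=> 0).
Proof.
apply: sqintP; first exact: measurable_cst.
by have := @integrable0 _ _ _ mu D; apply: eq_integrable => // x _ /=; rewrite expr0n.
Qed.

Lemma sqint_sum (I : Type) (s : seq I) (F : I -> T -> R) :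
  (forall i, sqint (F i)) -> sqint (fun x => \sum_(i <- s) F i x).
Proof.
move=> sF; elim: s => [|i s IH].
  by apply: sqint_eq sqint0 => x _; rewrite big_nil.
by apply: sqint_eq (sqintD (sF i) IH) => x _; rewrite big_cons.
Qed.

Lemma Rintegral_bigsum (I : Type) (s : seq I) (F : I -> T -> R) :
  (forall i, mu.-integrable D (EFin \o F i)) ->
  mu.-integrable D (EFin \o (fun x => \sum_(i <- s) F i x)) /\
  \int[mu]_(x in D) (\sum_(i <- s) F i x) = \sum_(i <- s) \int[mu]_(x in D) F i x.
Proof.
move=> iF; elim: s => [|i s [IH1 IH2]].
  split.
    by have := @integrable0 _ _ _ mu D; apply: eq_integrable => // x _ /=; rewrite big_nil.
  by rewrite big_nil; under eq_Rintegral do rewrite big_nil; rewrite Rintegral_cst// mul0r.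
split.
  have := integrableD mD (iF i) IH1; apply: eq_integrable => // x _ /=.
  by rewrite big_cons EFinD.
by rewrite big_cons -IH2 -RintegralD//; apply: eq_Rintegral => x _; rewrite big_cons.
Qed.

Lemma sqint_bndM f g (C : R) : measurable_fun D f ->
  {ae mu, forall x, D x -> `|f x| <= C} -> sqint g -> sqint (fun x => f x * g x).
Proof.
move=> mf fC sg; have [mg goo] := sg.
have mfg : measurable_fun D (fun x => f x * g x) by exact: measurable_funM.
split=> //.
have : (\int[mu]_(x in D) ((f x * g x) ^+ 2)%:E <=
        \int[mu]_(x in D) ((C * g x) ^+ 2)%:E)%E.
  apply: ae_ge0_le_integral => //.
  - by move=> x _; rewrite lee_fin sqr_ge0.
  - by apply/measurable_EFinP; exact: measurable_funX.
  - by move=> x _; rewrite lee_fin sqr_ge0.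
  - apply/measurable_EFinP; apply: measurable_funX.
    by apply: measurable_funM => //; exact: measurable_cst.
  - apply: filterS fC => x /[apply] fC; rewrite lee_fin !exprMn.
    rewrite ler_wpM2r ?sqr_ge0// -real_normK ?num_real//.
    by rewrite ler_pXn2r// nnegrE// (le_trans _ fC).
by move=> /le_lt_trans; apply; have [] := sqintZ C sg.
Qed.

Lemma sqint_bounded f (C : R) : (mu D < +oo)%E -> measurable_fun D f ->
  (forall x, D x -> `|f x| <= C) -> sqint f.
Proof.
move=> Doo mf fC.
have s1 : sqint (fun=> 1).
  split; first exact: measurable_cst.
  by rewrite integral_cst// expr1n mul1e.
have /sqint_eq : forall x, D x -> f x * 1 = f x by move=> x _; rewrite mulr1.
apply; apply: (sqint_bndM mf _ s1); exact/aeW/fC.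
Qed.

Lemma prodint_semi_inner : semi_inner (V := (T -> R^o : lmodType R)) sqint prodint.
Proof.
split.
- by move=> f g sf sg; have := sqintD sf sg.
- by move=> a f sf; have := sqintZ a sf.
- by move=> f g _ _; apply: eq_Rintegral => x _; rewrite mulrC.
- move=> f g h sf sg sh; rewrite /prodint -RintegralD//; try exact: sqint_mul.
  by apply: eq_Rintegral => x _; rewrite mulrDl.
- move=> a f g sf sg; rewrite /prodint -RintegralZl//; last exact: sqint_mul.
  by apply: eq_Rintegral => x _; rewrite mulrA.
- by move=> f _; apply: Rintegral_ge0 => x _; rewrite -expr2 sqr_ge0.
Qed.

Lemma eq_prodint f g f' g' : (forall x, D x -> f x = f' x) ->
  (forall x, D x -> g x = g' x) -> prodint f g = prodint f' g'.
Proof.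
by move=> ff gg; apply: eq_Rintegral => x /set_mem Dx; rewrite ff// gg.
Qed.

End SquareIntegrable.

Lemma sqint_sub (d : measure_display) (T : measurableType d) (R : realType)
    (mu : {measure set T -> \bar R}) (D D' : set T) (f : T -> R) :
  measurable D -> measurable D' -> D' `<=` D -> sqint mu D f -> sqint mu D' f.
Proof.
move=> mD mD' DD sf; have [mf _] := sf; apply: sqintP => //.
  exact: measurable_funS mf.
by apply: (integrableS mD mD' DD); exact: sqint_integrable.
Qed.

Lemma sum_prodint_le (d : measure_display) (T : measurableType d) (R : realType)
    (mu : {measure set T -> \bar R}) (I : eqType) (s : seq I) (F : I -> set T)
    (D : set T) (f : T -> R) :
  measurable D -> (forall i, i \in s -> measurable (F i)) -> uniq s ->
  (forall i, i \in s -> F i `<=` D) ->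
  (forall i j, i \in s -> j \in s -> i != j -> F i `&` F j = set0) ->
  sqint mu D f ->
  \sum_(i <- s) prodint mu (F i) f f <= prodint mu D f f.
Proof.
elim: s D => [|i s IH] D mD mF us FD dF sf.
  by rewrite big_nil; apply: (si_ge0 (prodint_semi_inner mu mD)).
move: us => /= /andP[iNs us].
have mFi : measurable (F i) by apply: mF; rewrite mem_head.
have mDF : measurable (D `\` F i) by exact: measurableD.
have FiD : F i `<=` D by apply: FD; rewrite mem_head.
have -> : prodint mu D f f = prodint mu (F i) f f + prodint mu (D `\` F i) f f.
  rewrite /prodint -Rintegral_setU//.
  - by rewrite setDUK.
  - by rewrite setDUK//; exact: sqint_mul.
  - by apply/disj_setPS => x [Fx []].
rewrite big_cons lerD2l; apply: IH => //.
- by move=> j js; apply: mF; rewrite in_cons js orbT.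
- move=> j js x Fx; split; first by apply: (FD j) => //; rewrite in_cons js orbT.
  move=> Fix; have : (F i `&` F j) x by [].
  rewrite dF// ?mem_head// ?in_cons ?js ?orbT//.
  by apply: contraNneq iNs => ->.
- by move=> j k js ks; apply: dF; rewrite in_cons ?js ?ks orbT.
- exact: sqint_sub sf.
Qed.

(** * Lebesgue measure of open sets *)

Section RowMeasure.
Context (R : realType) (n : nat).
Local Notation pt := 'rV[R]_n.

Lemma measurable_coord (i : 'I_n) : measurable_fun setT (fun x : pt => x 0 i).
Proof.
move=> _ A mA; rewrite setTI.
rewrite /measurable/= /measurable_row.
have -> : row_of_tuple (R:=R) (n:=n) @^-1` ((fun x : pt => x 0 i) @^-1` A) =
  (fun t : n.-tuple (measurableTypeR R) => tnth t i) @^-1` A.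
  by apply/seteqP; split => t; rewrite /= mxE.
by rewrite -[X in measurable X]setTI; exact: measurable_tnth.
Qed.

Lemma measurable_box (F : 'I_n -> set (measurableTypeR R)) :
  (forall i, measurable (F i)) -> measurable [set x : pt | forall i, F i (x 0 i)].
Proof.
move=> mF.
have -> : [set x : pt | forall i, F i (x 0 i)] =
   \bigcap_(i in [set: 'I_n]) ((fun x : pt => x 0 i) @^-1` F i).
  by apply/seteqP; split=> x /= h i; [move=> _; exact: h | exact: (h i I)].
apply: fin_bigcap_measurable => [|i _]; first exact: finite_finset.
by rewrite -[X in measurable X]setTI; exact: (measurable_coord i measurableT (mF i)).
Qed.

Definition cube (x : pt) (e : R) : set pt :=
  [set y : pt | forall i, `|x 0 i - y 0 i| < e].

Lemma cube_box (x : pt) (e : R) : cube x e =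
  [set y : pt | forall i, (`](x 0 i - e), (x 0 i + e)[%classic : set R) (y 0 i)].
Proof.
by apply/seteqP; split => y h i; have := h i; rewrite /= in_itv/= ltr_distlC.
Qed.

Lemma nbhs_cubeP (x : pt) (A : set pt) :
  nbhs x A <-> exists2 e : R, 0 < e & cube x e `<=` A.
Proof.
split => [/nbhs_ballP[e /= e0 h]|[e e0 h]].
  exists e => // y xy; apply: h; split=> // i j; rewrite (ord1 i); exact: xy.
by apply/nbhs_ballP; exists e => // y [_ xy]; apply: h => i; exact: xy.
Qed.

Lemma measurable_cube x e : measurable (cube x e).
Proof.
rewrite cube_box.
apply: (measurable_box (F := fun i => `](x 0 i - e), (x 0 i + e)[%classic)) => i.
exact: measurable_itv.
Qed.

Lemma lebesgue_cube x (e : R) : 0 < e -> lebesgue_row n (cube x e) = ((2 * e) ^+ n)%:E.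
Proof.
move=> e0; rewrite cube_box.
rewrite (lebesgue_row_box (F := fun i => `](x 0 i - e), (x 0 i + e)[%classic)); last first.
  by move=> i; exact: measurable_itv.
transitivity (\prod_(i < n) (2 * e)%:E)%E.
  apply: eq_bigr => i _; rewrite lebesgue_measure_itv/= lte_fin ifT.
    by rewrite -EFinB; congr EFin; ring.
  by rewrite ltrD2l; lra.
by rewrite prodEFin prodr_const card_ord.
Qed.

Lemma measurable_open (A : set pt) : open A -> measurable A.
Proof.
move=> oA.
pose Q := [set p : 'rV[rat]_n * rat | (0 < ratr p.2 :> R) /\
   cube (map_mx ratr p.1) (ratr p.2) `<=` A].
have -> : A = \bigcup_(p in Q) cube (map_mx ratr p.1) (ratr p.2).
  apply/seteqP; split => [x Ax|x [p [_ +]]]; last exact.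
  have /nbhs_cubeP[e e0 he] : nbhs x A by exact: open_nbhs_nbhs.
  have [q] := @rat_in_itvoo R 0 (e / 2) ltac:(lra).
  rewrite in_itv/= => /andP[q0 qe].
  have /choice[y hy] : forall i : 'I_n, exists z : rat, `|x 0 i - ratr z| < ratr q.
    move=> i; have [z] := @rat_in_itvoo R (x 0 i - ratr q) (x 0 i + ratr q) ltac:(lra).
    by rewrite in_itv/= => zz; exists z; rewrite ltr_distlC.
  exists (\row_i y i, q) => /=; first split => //=.
    move=> z hz; apply: he => i.
    have := hz i; rewrite !mxE => {}hz.
    rewrite -[ltRHS](_ : e / 2 + e / 2 = e); last by lra.
    apply: le_lt_trans (ler_distD (ratr (y i)) _ _) _.
    by apply: ltrD; [apply: lt_trans (hy i) _|apply: lt_trans hz _].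
  by move=> i; rewrite !mxE distrC; exact: hy.
rewrite bigcup_mkcond; apply: countable_bigcupT_measurable => [|p].
  exact: countableP.
by case: ifP => _; [exact: measurable_cube|exact: measurable0].
Qed.

Lemma measurable_fun_open_continuous (A : set pt) (f : pt -> R) :
  open A -> (forall x, A x -> {for x, continuous f}) -> measurable_fun A f.
Proof.
move=> oA cf; apply: (measurability _ (RGenOpens.measurableE R)).
move=> _ [_ [a [b ->] <-]].
apply: measurable_open.
rewrite openE => x [Ax fx].
have nA : nbhs x A by exact: open_nbhs_nbhs.
have nf : nbhs x (f @^-1` `]a, b[%classic).
  apply: (cf x Ax); apply: open_nbhs_nbhs; split => //; exact: interval_open.
by near=> y; split; near: y.
Unshelve. all: by end_near. Qed.

Lemma lebesgue_bounded (A : set pt) (C : R) : measurable A ->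
  (forall x, A x -> forall i, `|x 0 i| <= C) -> (lebesgue_row n A < +oo)%E.
Proof.
move=> mA AC; pose e := `|C| + 1.
have e0 : 0 < e by rewrite ltr_wpDl.
apply: (@le_lt_trans _ _ (lebesgue_row n (cube 0 e))).
  apply: le_measure; rewrite ?inE//; first exact: measurable_cube.
  move=> x Ax i; rewrite mxE sub0r normrN.
  by apply: le_lt_trans (AC x Ax i) _; rewrite /e (le_lt_trans (ler_norm _))// ltrDl.
by rewrite lebesgue_cube// ltry.
Qed.

(** An almost everywhere valid closed condition on a continuous function holds
    everywhere in the interior, since open sets are not negligible. *)
Lemma ae_bound_continuous (A : set pt) (f : pt -> R) (C : R) : open A ->
  (forall x, A x -> {for x, continuous f}) ->
  {ae lebesgue_row n, forall x, A x -> `|f x| <= C} ->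
  forall x, A x -> `|f x| <= C.
Proof.
move=> oA cf [N [mN N0 hN]] x Ax; rewrite leNgt; apply/negP => fC.
have : nbhs x (A `&` [set y | C < `|f y|]).
  apply: filterI; first exact: open_nbhs_nbhs.
  have : {for x, continuous (fun y => `|f y|)}.
    by apply: (@continuous_comp _ _ _ f (fun z : R => `|z|)); [exact: cf|exact: norm_continuous].
  by move=> cn; apply: (cn [set z | C < z]); exact: lt_nbhsr.
move=> /nbhs_cubeP[e e0 he].
have sN : cube x e `<=` N.
  by move=> y /he[Ay fy]; apply: hN => /= /(_ Ay); rewrite leNgt fy.
have := le_measure (lebesgue_row n) (mem_set (measurable_cube x e)) (mem_set mN) sN.
have N1 : (lebesgue_row n N <= 0)%E by rewrite [X in (X <= _)%E]N0.
move=> H; have : (((2 * e) ^+ n)%:E <= 0 :> \bar R)%E.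
  by rewrite -(lebesgue_cube x e0); exact: le_trans H N1.
by rewrite lee_fin leNgt exprn_gt0//; lra.
Qed.

Lemma prodint_eq0_continuous (A : set pt) (f : pt -> R) : open A ->
  (forall x, A x -> {for x, continuous f}) -> sqint (lebesgue_row n) A f ->
  prodint (lebesgue_row n) A f f = 0 -> forall x, A x -> f x = 0.
Proof.
move=> oA cf sf f0 x Ax; apply/eqP; apply: contraTT isT => fx.
have mA := measurable_open oA; have [mf _] := sf.
pose c := `|f x| / 2.
have c0 : 0 < c by rewrite divr_gt0 ?normr_gt0.
have : nbhs x (A `&` [set y | c < `|f y|]).
  apply: filterI; first exact: open_nbhs_nbhs.
  have : {for x, continuous (fun y => `|f y|)}.
    by apply: (@continuous_comp _ _ _ f (fun z : R => `|z|)); [exact: cf|exact: norm_continuous].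
  move=> cn; apply: (cn [set z | c < z]); apply: lt_nbhsr; rewrite /c.
  by have : 0 < `|f x| by [rewrite normr_gt0]; lra.
move=> /nbhs_cubeP[e e0 he].
have mC := measurable_cube x e.
have sC : cube x e `<=` A by move=> y /he[].
have Hle : c * c * fine (lebesgue_row n (cube x e)) <= prodint (lebesgue_row n) A f f.
  rewrite -Rintegral_cst//.
  have Coo : (lebesgue_row n (cube x e) < +oo)%E by rewrite lebesgue_cube// ltry.
  apply: (@le_trans _ _ (prodint (lebesgue_row n) (cube x e) f f)).
    apply: le_Rintegral => //.
    - have sc : sqint (lebesgue_row n) (cube x e) (fun=> c).
        apply: (@sqint_bounded _ _ _ (lebesgue_row n) _ mC _ `|c|) => //.
      by exact: (sqint_mul mC sc sc).
    - by apply: sqint_mul => //; exact: sqint_sub sf.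
    - move=> y /he[_ fy]; rewrite -!expr2 -[leRHS]real_normK ?num_real//.
      rewrite /= in fy; apply: lerXn2r; rewrite ?nnegrE ?normr_ge0//; exact: ltW.
  have := @sum_prodint_le _ _ _ (lebesgue_row n) _ [:: tt] (fun=> cube x e) A f mA.
  rewrite big_seq1; apply => //.
move: Hle; rewrite f0 lebesgue_cube//= leNgt => /negP[].
have e2 : 0 < 2 * e by lra.
by rewrite mulr_gt0 ?exprn_gt0// mulr_gt0.
Qed.

End RowMeasure.

(** * Barycentric coordinates *)

Lemma continuous_for_ext (X Y : topologicalType) (f g : X -> Y) (x : X) :
  f =1 g -> {for x, continuous f} -> {for x, continuous g}.
Proof. by move=> /funext ->. Qed.

Lemma continuous_bigsum (R : realType) (X : topologicalType) (I : Type) (s : seq I)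
    (f : I -> X -> R) x : (forall i, {for x, continuous (f i)}) ->
  {for x, continuous (fun y => \sum_(i <- s) f i y)}.
Proof.
move=> cf; elim: s => [|i s IH].
  by apply: (@continuous_for_ext _ _ (fun=> 0)); [move=> y; rewrite big_nil|exact: cst_continuous].
apply: (@continuous_for_ext _ _ (fun y => f i y + \sum_(i <- s) f i y)); last exact: continuousD.
by move=> y; rewrite big_cons.
Qed.

Lemma continuous_linear_form (R : realType) (n : nat) (w : 'I_n -> R) :
  continuous (fun x : 'rV[R]_n => \sum_j x 0 j * w j).
Proof.
move=> x; apply: continuous_bigsum => j.
apply: (@continuousM _ _ (fun y : 'rV[R]_n => y 0 j)); last exact: cst_continuous.
exact: coord_continuous.
Qed.

Section Barycentric.
Context (R : realType) (n : nat).
Local Notation pt := 'rV[R]_n.+1.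
Implicit Types (T : simplex R n) (x y : pt).

(** Vertices with a column of ones: the square matrix whose inverse gives the
    barycentric coordinates. *)
Definition augm (T : simplex R n) : 'M[R]_(n.+2, 1 + n.+1) := row_mx (const_mx 1) T.1.

Definition bary T x : 'rV[R]_n.+2 := row_mx 1 x *m invmx (augm T : 'M[R]_n.+2).

Definition vtx T (i : 'I_n.+2) : pt := row i T.1.

Lemma mul_augm T (b : 'rV[R]_n.+2) :
  b *m augm T = row_mx (\sum_i b 0 i)%:M (b *m T.1).
Proof.
rewrite mul_mx_row; congr row_mx; apply/matrixP => i j.
rewrite !mxE (ord1 i) (ord1 j) eqxx mulr1n; apply: eq_bigr => k _.
by rewrite mxE mulr1.
Qed.

Lemma row_mxs_lift (b : 'rV[R]_n.+2) T :
  b *m T.1 = \sum_i b 0 i *: vtx T i.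
Proof. exact: mulmx_sum_row. Qed.

Lemma augm_unitP T : reflect
  (forall b : 'rV[R]_n.+2, \sum_i b 0 i = 0 -> b *m T.1 = 0 -> b = 0)
  ((augm T : 'M[R]_n.+2) \in unitmx).
Proof.
apply: (iffP idP) => [U b b0 bT|H].
  have : b *m augm T = 0.
    rewrite mul_augm b0 bT; apply/rowP => j; rewrite -(splitK j).
    by case: (fintype.split j) => k; rewrite ?row_mxEl ?row_mxEr !mxE// mul0rn.
  by move=> /(congr1 (mulmx^~ (invmx (augm T)))); rewrite (mulmxK U) mul0mx.
rewrite -row_free_unit -kermx_eq0; apply/rowV0P => b /sub_kermxP.
rewrite mul_augm => E.
have /eq_row_mx[/matrixP/(_ 0 0) E1 E2] : row_mx (\sum_i b 0 i)%:M (b *m T.1) = row_mx 0 0.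
  by rewrite row_mx0.
by apply: H => //; move: E1; rewrite !mxE eqxx mulr1n.
Qed.

Lemma nondegenerateE T : nondegenerate T = ((augm T : 'M[R]_n.+2) \in unitmx).
Proof.
rewrite /nondegenerate; set D := \matrix_(i < n.+1) _.
have DE (c : 'rV[R]_n.+1) : c *m D =
    \sum_i c 0 i *: vtx T (lift ord0 i) - (\sum_i c 0 i) *: vtx T ord0.
  rewrite mulmx_sum_row scaler_suml -sumrB; apply: eq_bigr => i _.
  by rewrite -scalerBr; congr (_ *: _); apply/rowP => j; rewrite !mxE.
apply/idP/augm_unitP => [U b b0 bT|H].
  pose c : 'rV[R]_n.+1 := \row_i b 0 (lift ord0 i).
  have bc : b 0 ord0 = - \sum_i c 0 i.
    move: b0; rewrite big_ord_recl => /eqP; rewrite addr_eq0 => /eqP ->.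
    by congr (- _); apply: eq_bigr => i _; rewrite mxE.
  have : c *m D = 0.
    rewrite DE -scaleNr -bc -[RHS]bT row_mxs_lift [RHS]big_ord_recl addrC; congr (_ + _).
    by apply: eq_bigr => i _; rewrite mxE.
  move=> /(congr1 (mulmx^~ (invmx D))); rewrite (mulmxK U) mul0mx => c0.
  apply/rowP => i; rewrite mxE; case: (unliftP ord0 i) => [j|] ->.
    by move/rowP: c0 => /(_ j); rewrite !mxE.
  by rewrite bc c0 big1 ?oppr0// => j _; rewrite mxE.
rewrite -row_free_unit -kermx_eq0; apply/rowV0P => c /sub_kermxP.
rewrite DE => E.
pose b : 'rV[R]_n.+2 := \row_i (if unlift ord0 i is Some j then c 0 j else - \sum_j c 0 j).
have bl j : b 0 (lift ord0 j) = c 0 j by rewrite mxE liftK.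
have b0 : b 0 ord0 = - \sum_j c 0 j by rewrite mxE unlift_none.
have : b = 0.
  apply: H.
    rewrite big_ord_recl b0 addrC; apply/eqP; rewrite subr_eq0; apply/eqP.
    by apply: eq_bigr => j _; exact: bl.
  rewrite row_mxs_lift big_ord_recl b0 -[RHS]E addrC scaleNr; congr (_ - _).
  by apply: eq_bigr => j _; rewrite bl.
by move=> /rowP bb; apply/rowP => j; rewrite -bl bb !mxE.
Qed.

Lemma baryK T x : nondegenerate T ->
  \sum_i bary T x 0 i = 1 /\ bary T x *m T.1 = x.
Proof.
rewrite nondegenerateE => U.
have : bary T x *m augm T = row_mx 1 x by rewrite /bary mulmxKV.
rewrite mul_augm => E.
have := congr1 (fun z => lsubmx z) E; have := congr1 (fun z => rsubmx z) E.
rewrite /= !row_mxKl !row_mxKr => E2 /matrixP/(_ 0 0); rewrite !mxE eqxx mulr1n.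
by [].
Qed.

Lemma bary_uniq T (b : 'rV[R]_n.+2) x : nondegenerate T ->
  \sum_i b 0 i = 1 -> x = b *m T.1 -> bary T x = b.
Proof.
rewrite nondegenerateE => U b1 ->.
rewrite /bary; have -> : row_mx 1 (b *m T.1) = b *m augm T.
  by rewrite mul_augm b1; congr row_mx.
by rewrite mulmxK.
Qed.

Lemma bary_vtx T i : nondegenerate T -> bary T (vtx T i) = delta_mx 0 i.
Proof.
move=> U; apply: bary_uniq => //; last by rewrite -rowE.
rewrite (bigD1 i)//= mxE !eqxx big1 ?addr0// => j ji; rewrite mxE (negbTE ji).
by rewrite andbF.
Qed.

Lemma bary_affine T (I : finType) (c : I -> R) (y : I -> pt) : nondegenerate T ->
  \sum_i c i = 1 -> bary T (\sum_i c i *: y i) = \sum_i c i *: bary T (y i).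
Proof.
move=> U c1; apply: bary_uniq => //.
  under eq_bigr do rewrite summxE.
  rewrite exchange_big/= -[RHS]c1; apply: eq_bigr => i _.
  under eq_bigr do rewrite mxE.
  by rewrite -mulr_sumr (baryK (y i) U).1 mulr1.
rewrite mulmx_suml; apply: eq_bigr => i _.
by rewrite -scalemxAl (baryK (y i) U).2.
Qed.

Lemma bary_affine2 T (t : R) x y : nondegenerate T ->
  bary T ((1 - t) *: x + t *: y) = (1 - t) *: bary T x + t *: bary T y.
Proof.
move=> U.
have := @bary_affine T bool (fun b => if b then 1 - t else t) (fun b => if b then x else y) U.
by rewrite !big_bool/= subrK => ->.
Qed.

Lemma bary_affine2E T (t : R) x y i : nondegenerate T ->
  bary T ((1 - t) *: x + t *: y) 0 i = (1 - t) * bary T x 0 i + t * bary T y 0 i.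
Proof. by move=> U; rewrite bary_affine2// [LHS]mxE; congr (_ + _); rewrite [LHS]mxE. Qed.

Lemma hullP T x : nondegenerate T ->
  hull T x <-> forall i, 0 <= bary T x 0 i.
Proof.
move=> U; split => [[b [b0 b1 _ xb]]|H]; first by rewrite (bary_uniq U b1 xb).
by exists (bary T x); have [? ?] := baryK x U; split => // i.
Qed.

Lemma osimplexP T x : nondegenerate T ->
  osimplex T x <-> forall i, 0 < bary T x 0 i.
Proof.
move=> U; split => [[b [b0 b1 xb]]|H]; first by rewrite (bary_uniq U b1 xb).
by exists (bary T x); have [? ?] := baryK x U; split.
Qed.

Lemma subfaceP T (F : pred 'I_n.+2) x : nondegenerate T ->
  subface T F x <-> hull T x /\ forall i, ~~ F i -> bary T x 0 i = 0.
Proof.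
move=> U; split => [[b [b0 b1 bF xb]]|[/(hullP _ U) H HF]].
  by rewrite (bary_uniq U b1 xb); split=> //; exists b; split.
by exists (bary T x); have [? ?] := baryK x U; split.
Qed.

Lemma subface_hull T (F : pred 'I_n.+2) : subface T F `<=` hull T.
Proof. by move=> x [b [b0 b1 bF xb]]; exists b; split. Qed.

Lemma osimplex_hull T : osimplex T `<=` hull T.
Proof. by move=> x [b [b0 b1 xb]]; exists b; split => // i; exact: ltW. Qed.

Lemma vtx_hull T i : hull T (vtx T i).
Proof.
exists (delta_mx 0 i); split => //; last by rewrite -rowE.
  by move=> j; rewrite mxE; case: (_ && _).
rewrite (bigD1 i)//= mxE !eqxx big1 ?addr0// => j ji; rewrite mxE (negbTE ji).
by rewrite andbF.
Qed.

Definition barycenter T : pt := (const_mx (n.+2%:R^-1) : 'rV_n.+2) *m T.1.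

Lemma osimplex_barycenter T : osimplex T (barycenter T).
Proof.
exists (const_mx (n.+2%:R^-1)); split => //.
  by move=> i; rewrite mxE invr_gt0 ltr0n.
under eq_bigr do rewrite mxE.
by rewrite sumr_const card_ord -[LHS]mulr_natl mulfV// pnatr_eq0.
Qed.

Lemma sum_gt0 (I : finType) (F : I -> R) i : (forall j, 0 <= F j) -> 0 < F i ->
  0 < \sum_j F j.
Proof.
move=> F0 Fi; rewrite (bigD1 i)//=; apply: ltr_pwDl => //; exact: sumr_ge0.
Qed.

Lemma bary_mulmx T (b : 'rV[R]_n.+2) (T' : simplex R n) i : nondegenerate T' ->
  \sum_j b 0 j = 1 ->
  bary T' (b *m T.1) 0 i = \sum_j b 0 j * bary T' (vtx T j) 0 i.
Proof.
move=> U b1; rewrite row_mxs_lift (bary_affine _ U)// summxE.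
by apply: eq_bigr => j _; rewrite mxE.
Qed.

(** A coordinate of the bigger simplex cannot vanish at all vertices of a
    nondegenerate one. *)
Lemma hull_sub_osimplex T T' : nondegenerate T -> nondegenerate T' ->
  hull T `<=` hull T' -> osimplex T `<=` osimplex T'.
Proof.
move=> U U' TT x [b [b0 b1 xb]]; apply/(osimplexP _ U') => i.
have H j : 0 <= bary T' (vtx T j) 0 i.
  by move: i; apply/(hullP _ U'); apply: TT; exact: vtx_hull.
rewrite xb bary_mulmx//.
have [j Hj|Hall] := pickP (fun j => 0 < bary T' (vtx T j) 0 i).
  apply: (sum_gt0 (i := j)); last by rewrite mulr_gt0.
  by move=> k; rewrite mulr_ge0// ltW.
exfalso.
have H0 j : bary T' (vtx T j) 0 i = 0.
  by apply/eqP; have := Hall j; rewrite lt_neqAle H andbT eq_sym => /negbFE.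
have : bary T' (vtx T' i) 0 i = 0.
  rewrite -(baryK (vtx T' i) U).2 bary_mulmx ?(baryK _ U).1//.
  by rewrite big1// => j _; rewrite H0 mulr0.
by rewrite bary_vtx// mxE !eqxx => /eqP; rewrite oner_eq0.
Qed.

(** Faces are extreme sets, so they cut smaller simplices in faces. *)
Lemma subface_sub T T' (F : pred 'I_n.+2) : nondegenerate T -> nondegenerate T' ->
  hull T' `<=` hull T -> exists F' : pred 'I_n.+2,
  hull T' `&` subface T F = subface T' F'.
Proof.
move=> U U' TT; pose F' := [pred j | [forall i, ~~ F i ==> (bary T (vtx T' j) 0 i == 0)]].
exists F'; apply/seteqP; split => x.
  move=> [T'x /(subfaceP _ _ U)[Tx xF]]; apply/(subfaceP _ _ U'); split=> // j.
  rewrite /F' /= => /forallPn[i]; rewrite negb_imply => /andP[iF nz].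
  have := xF i iF; rewrite -{1}(baryK x U').2 bary_mulmx ?(baryK _ U').1// => /eqP.
  have h0 k : 0 <= bary T' x 0 k * bary T (vtx T' k) 0 i.
    apply: mulr_ge0; first by move: k; apply/(hullP _ U').
    by move: i {iF nz}; apply/(hullP _ U); apply: TT; exact: vtx_hull.
  rewrite psumr_eq0//= => /allP/(_ j); rewrite mem_index_enum => /(_ isT).
  by rewrite mulf_eq0 (negbTE nz) orbF => /eqP.
move=> /(subfaceP _ _ U')[T'x xF]; split=> //; apply/(subfaceP _ _ U).
split; first exact: TT.
move=> i iF; rewrite -(baryK x U').2 bary_mulmx ?(baryK _ U').1//.
rewrite big1// => j _; have [jF|jF] := boolP (F' j).
  by move: jF => /forallP/(_ i); rewrite iF /= => /eqP ->; rewrite mulr0.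
by rewrite xF// mul0r.
Qed.

Lemma continuous_bary T i : continuous (fun x : pt => bary T x 0 i).
Proof.
pose N := invmx (augm T : 'M[R]_n.+2).
have -> : (fun x : pt => bary T x 0 i) =
    (fun x : pt => N ord0 i + \sum_j x 0 j * N (lift ord0 j) i).
  apply/funext => x; rewrite mxE (big_ord_recl n.+1)/=; congr (_ + _).
    rewrite (_ : ord0 = lshift n.+1 (0 : 'I_1)); last exact: val_inj.
    by rewrite row_mxEl mxE eqxx mul1r.
  apply: eq_bigr => j _; rewrite (_ : lift ord0 j = rshift 1 j); last exact: val_inj.
  by rewrite row_mxEr.
move=> x; apply: (@continuousD _ _ _ (fun=> N ord0 i)); first exact: cst_continuous.
exact: continuous_linear_form.
Qed.

Lemma nbhs_bary_gt0 T x (P : pred 'I_n.+2) : (forall i, P i -> 0 < bary T x 0 i) ->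
  \forall y \near x, forall i, P i -> 0 < bary T y 0 i.
Proof.
move=> H.
have : forall s : seq 'I_n.+2,
    \forall y \near x, forall i, i \in s -> P i -> 0 < bary T y 0 i.
  elim=> [|i s IH]; first by near=> y => j; rewrite in_nil.
  have Hi : \forall y \near x, P i -> 0 < bary T y 0 i.
    have [Pi|Pi] := boolP (P i); last by near=> y.
    have : \forall y \near x, 0 < bary T y 0 i.
      by apply: (@continuous_bary T i x [set u | 0 < u]); exact: lt_nbhsr (H i Pi).
    by apply: filterS.
  apply: filterS2 Hi IH => y h1 h2 j; rewrite inE => /predU1P[->//|]; exact: h2.
move=> /(_ (enum 'I_n.+2)).
by apply: filterS => y hy i; apply: hy; rewrite mem_enum.
Unshelve. all: by end_near. Qed.

Lemma open_osimplex T : nondegenerate T -> open (osimplex T).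
Proof.
move=> U; rewrite openE => x /(osimplexP _ U) H.
have := @nbhs_bary_gt0 T x predT (fun i _ => H i).
by apply: filterS => y hy; apply/(osimplexP _ U) => i; exact: hy.
Qed.

(** Moving a point a little towards the barycenter makes all coordinates positive. *)
Lemma hull_closure T x : nondegenerate T -> hull T x -> closure (osimplex T) x.
Proof.
move=> U /(hullP _ U) Hx.
pose y t := (1 - t) *: x + t *: barycenter T.
have Hy t : 0 < t <= 1 -> osimplex T (y t).
  move=> /andP[t0 t1]; apply/(osimplexP _ U) => i; rewrite bary_affine2E//.
  apply: ltr_wpDl; first by rewrite mulr_ge0// subr_ge0.
  by rewrite mulr_gt0//; move: i; apply/(osimplexP _ U); exact: osimplex_barycenter.
move=> B nB.
have cy : y @ (0 : R)^'+ --> x.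
  rewrite -[X in _ --> X](_ : y 0 = x); last by rewrite /y subr0 scale1r scale0r addr0.
  apply: cvg_at_right_filter; apply: cvgD.
    by apply: cvgZr_tmp; apply: cvgB; [exact: cvg_cst|exact: cvg_id].
  by apply: cvgZr_tmp; exact: cvg_id.
have : \forall t \near (0 : R)^'+, B (y t) by exact: (cy _ nB).
move=> nBy; near (0 : R)^'+ => t; exists (y t); split; last by near: t.
by apply: Hy; apply/andP; split; near: t; [exact: nbhs_right_gt|exact: nbhs_right_le].
Unshelve. all: by end_near. Qed.

End Barycentric.

(** * Bisection *)

Section Bisection.
Context (R : realType) (n : nat).
Local Notation pt := 'rV[R]_n.+1.
Implicit Types (T : simplex R n) (M : mesh R n) (x y : pt).

Definition child (b : bool) T : simplex R n := if b then child2 T else child1 T.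

Definition i1 : 'I_n.+2 := lift ord0 ord0.
Definition dend (b : bool) : 'I_n.+2 := if b then ord_max else ord0.

(** Up to the order of its vertices, a child replaces one end of the bisected edge
    by the midpoint; nothing else about the ordering matters for the geometry. *)
Lemma childP b T : exists p : 'I_n.+2 -> 'I_n.+2,
  [/\ injective p, p ord0 = dend b, p i1 = dend (~~ b),
      vtx (child b T) i1 = 2^-1 *: (vtx T (dend b) + vtx T (dend (~~ b))) &
      forall i, i != i1 -> vtx (child b T) i = vtx T (p i)].
Proof.
case: T => X t; have g : (t < n.+1)%N := ltn_ord t.
set T : simplex R n := (X, t).
have i1E (i : 'I_n.+2) : (i == i1) = (i == 1%N :> nat) by [].
have row1 (i : 'I_n.+2) : vtx (child1 T) i =
   (if i == 0%N :> nat then vertex T ord0 else if i == 1%N :> nat then midpoint T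
    else vertex T (inord i.-1)) by rewrite /vtx rowK.
have row2 (i : 'I_n.+2) : vtx (child2 T) i =
   (if i == 0%N :> nat then vertex T ord_max else if i == 1%N :> nat then midpoint T
    else if (i <= t.+1)%N then vertex T (inord i.-1)
    else vertex T (inord ((n + t).+2 - i))) by rewrite /vtx rowK.
have L (i : 'I_n.+2) := ltn_ord i.
case: b; rewrite /child /dend /=.
- exists (fun i : 'I_n.+2 => if i == 0%N :> nat then ord_max else if i == 1%N :> nat then ord0
    else if (i <= t.+1)%N then inord i.-1 else inord ((n + t).+2 - i)); split=> //.
  + move=> i j; have := L i; have := L j.
    case: (nat_of_ord i =P 0%N) => i0; case: (nat_of_ord j =P 0%N) => j0;
    case: (nat_of_ord i =P 1%N) => i1'; case: (nat_of_ord j =P 1%N) => j1;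
    case: (leqP i t.+1) => ig; case: (leqP j t.+1) => jg Li Lj;
    move=> /(congr1 val) /=; rewrite ?inordK; try lia; move=> H; apply: val_inj => /=; lia.
  + by rewrite row2 /= /midpoint addrC.
  + move=> i; rewrite i1E row2 => /negbTE ->.
    by case: ifP => // _; case: ifP.
- exists (fun i : 'I_n.+2 => if i == 0%N :> nat then ord0 else if i == 1%N :> nat then ord_max
    else inord i.-1); split=> //.
  + move=> i j; have := L i; have := L j.
    case: (nat_of_ord i =P 0%N) => i0; case: (nat_of_ord j =P 0%N) => j0;
    case: (nat_of_ord i =P 1%N) => i1'; case: (nat_of_ord j =P 1%N) => j1 Li Lj;
    move=> /(congr1 val) /=; rewrite ?inordK; try lia; move=> H; apply: val_inj => /=; lia.
  + move=> i; rewrite i1E row1 => /negbTE ->.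
    by case: ifP.
Qed.

Lemma dend_neq b : dend b != dend (~~ b).
Proof. by case: b. Qed.

Lemma sum_split_ends (V : lmodType R) b (p : 'I_n.+2 -> 'I_n.+2) (c : 'I_n.+2 -> R)
    (w : 'I_n.+2 -> V) : injective p -> p ord0 = dend b -> p i1 = dend (~~ b) ->
  \sum_i c i *: w i = c (dend b) *: w (dend b) + c (dend (~~ b)) *: w (dend (~~ b))
     + \sum_(i | (i != ord0) && (i != i1)) c (p i) *: w (p i).
Proof.
move=> ip p0 p1; rewrite (reindex p)/=; last exact/onW_bij/injF_bij.
rewrite (bigD1 ord0)//= (bigD1 i1)//= p0 p1 addrA; congr (_ + _).
Qed.

(** With m the midpoint of v and v', c v + c' v' = (c - c') v + 2 c' m. *)
Lemma child_coord b T (c : 'rV[R]_n.+2) :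
  exists e : 'rV[R]_n.+2, exists p : 'I_n.+2 -> 'I_n.+2,
  [/\ [/\ injective p, p ord0 = dend b & p i1 = dend (~~ b)],
      \sum_i e 0 i = \sum_i c 0 i, e *m (child b T).1 = c *m T.1,
      e 0 ord0 = c 0 (dend b) - c 0 (dend (~~ b)) /\ e 0 i1 = 2 * c 0 (dend (~~ b)) &
      forall i, i != ord0 -> i != i1 -> e 0 i = c 0 (p i)].
Proof.
have [p [ip p0 p1 v1 vi]] := childP b T.
exists (\row_i if i == ord0 then c 0 (dend b) - c 0 (dend (~~ b))
   else if i == i1 then 2 * c 0 (dend (~~ b)) else c 0 (p i)), p.
split=> //.
- have := @sum_split_ends R^o b p (fun i => c 0 i) (fun=> 1) ip p0 p1.
  have sc a : a *: (1 : R^o) = a :> R by exact: mulr1.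
  under eq_bigr do rewrite sc; move=> ->.
  rewrite (bigD1 ord0)//= (bigD1 i1)//= !mxE /= addrA; congr (_ + _).
    by rewrite !sc; ring.
  by apply: eq_bigr => i /andP[i0 i1']; rewrite mxE (negbTE i0) (negbTE i1') sc.
- rewrite !row_mxs_lift (@sum_split_ends _ b p (fun i => c 0 i) _ ip p0 p1).
  rewrite (bigD1 ord0)//= (bigD1 i1)//= !mxE /= addrA; congr (_ + _).
    rewrite v1 vi// p0 scalerA mulrAC mulfV ?mul1r// scalerDr scalerBl addrA subrK//.
  apply: eq_bigr => i /andP[i0 i1']; rewrite mxE (negbTE i0) (negbTE i1').
  by rewrite vi.
- by rewrite !mxE.
- by move=> i i0 i1'; rewrite mxE (negbTE i0) (negbTE i1').
Qed.

Lemma child_coord_inv b T (e : 'rV[R]_n.+2) :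
  exists c : 'rV[R]_n.+2, exists p : 'I_n.+2 -> 'I_n.+2,
  [/\ [/\ injective p, p ord0 = dend b & p i1 = dend (~~ b)],
      \sum_i c 0 i = \sum_i e 0 i, c *m T.1 = e *m (child b T).1,
      e 0 ord0 = c 0 (dend b) - c 0 (dend (~~ b)) /\ e 0 i1 = 2 * c 0 (dend (~~ b)) &
      forall i, i != ord0 -> i != i1 -> e 0 i = c 0 (p i)].
Proof.
have [p [ip p0 p1 v1 vi]] := childP b T.
pose q := invF ip.
pose c : 'rV[R]_n.+2 := \row_i if i == dend b then e 0 ord0 + e 0 i1 / 2
   else if i == dend (~~ b) then e 0 i1 / 2 else e 0 (q i).
have cb : c 0 (dend b) = e 0 ord0 + e 0 i1 / 2 by rewrite mxE eqxx.
have cnb : c 0 (dend (~~ b)) = e 0 i1 / 2.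
  by rewrite mxE eq_sym (negbTE (dend_neq b)) eqxx.
have cp i : i != ord0 -> i != i1 -> c 0 (p i) = e 0 i.
  move=> i0 i1'; rewrite mxE -p0 -p1 !(inj_eq ip) (negbTE i0) (negbTE i1').
  by rewrite /q invF_f.
have [e' [p' [[ip' p0' p1'] s' m' [e0 e1] ei]]] := child_coord b T c.
exists c, p; split=> //.
- have := @sum_split_ends R^o b p (fun i => c 0 i) (fun=> 1) ip p0 p1.
  have sc a : a *: (1 : R^o) = a :> R by exact: mulr1.
  under eq_bigr do rewrite sc; move=> ->.
  rewrite [RHS](bigD1 ord0)//= [in RHS](bigD1 i1)//= !sc cb cnb addrA; congr (_ + _).
    by field.
  by apply: eq_bigr => i /andP[i0 i1']; rewrite sc cp.
- rewrite !row_mxs_lift (@sum_split_ends _ b p (fun i => c 0 i) _ ip p0 p1) cb cnb.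
  rewrite [RHS](bigD1 ord0)//= [in RHS](bigD1 i1)//= addrA; congr (_ + _).
    by rewrite v1 vi// p0 scalerA scalerDl scalerDr addrA.
  by apply: eq_bigr => i /andP[i0 i1']; rewrite cp// vi.
- by rewrite cb cnb; split; field.
- by move=> i i0 i1'; rewrite cp.
Qed.

Lemma child_nondegenerate b T : nondegenerate T -> nondegenerate (child b T).
Proof.
rewrite !nondegenerateE => /augm_unitP U; apply/augm_unitP => e e0 eT.
have [c [p [[ip p0 p1] s m [E0 E1] Ei]]] := child_coord_inv b T e.
have c0 : c = 0 by apply: U; rewrite ?s ?m.
move: E0 E1 Ei; rewrite c0 !mxE subrr mulr0 => E0 E1 Ei.
apply/rowP => i; rewrite mxE; have [->//|i0] := eqVneq i ord0.
by have [->//|i1'] := eqVneq i i1; rewrite Ei// mxE.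
Qed.

Lemma bary_child b T x : nondegenerate T -> exists p : 'I_n.+2 -> 'I_n.+2,
  [/\ [/\ injective p, p ord0 = dend b & p i1 = dend (~~ b)],
   bary (child b T) x 0 ord0 = bary T x 0 (dend b) - bary T x 0 (dend (~~ b)),
   bary (child b T) x 0 i1 = 2 * bary T x 0 (dend (~~ b)) &
   forall i, i != ord0 -> i != i1 -> bary (child b T) x 0 i = bary T x 0 (p i)].
Proof.
move=> U; have [e [p [ip s m [E0 E1] Ei]]] := child_coord b T (bary T x).
have [b1 bx] := baryK x U.
have -> : bary (child b T) x = e.
  by apply: bary_uniq; [exact: child_nondegenerate|rewrite s|rewrite m].
by exists p.
Qed.

Lemma hull_childP b T x : nondegenerate T -> hull (child b T) x <->
  hull T x /\ bary T x 0 (dend (~~ b)) <= bary T x 0 (dend b).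
Proof.
move=> U; have Uc := child_nondegenerate b U.
have [p [[ip p0 p1] E0 E1 Ei]] := bary_child b x U.
split => [/(hullP _ Uc) H|[/(hullP _ U) H le]].
  have H0 := H ord0; have H1 := H i1; rewrite E0 subr_ge0 in H0; split=> //.
  rewrite E1 pmulr_rge0// in H1.
  apply/(hullP _ U) => i; have [j <-] : exists j, p j = i.
    by exists (invF ip i); rewrite f_invF.
  have [->|j0] := eqVneq j ord0; first by rewrite p0 (le_trans H1).
  have [->|j1] := eqVneq j i1; first by rewrite p1.
  by rewrite -Ei.
apply/(hullP _ Uc) => i; have [->|i0] := eqVneq i ord0; first by rewrite E0 subr_ge0.
have [->|i1'] := eqVneq i i1; first by rewrite E1 mulr_ge0.
by rewrite Ei.
Qed.

Lemma osimplex_childP b T x : nondegenerate T -> osimplex (child b T) x <->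
  osimplex T x /\ bary T x 0 (dend (~~ b)) < bary T x 0 (dend b).
Proof.
move=> U; have Uc := child_nondegenerate b U.
have [p [[ip p0 p1] E0 E1 Ei]] := bary_child b x U.
split => [/(osimplexP _ Uc) H|[/(osimplexP _ U) H le]].
  have H0 := H ord0; have H1 := H i1; rewrite E0 subr_gt0 in H0; split=> //.
  rewrite E1 pmulr_rgt0// in H1.
  apply/(osimplexP _ U) => i; have [j <-] : exists j, p j = i.
    by exists (invF ip i); rewrite f_invF.
  have [->|j0] := eqVneq j ord0; first by rewrite p0 (lt_trans H1).
  have [->|j1] := eqVneq j i1; first by rewrite p1.
  by rewrite -Ei.
apply/(osimplexP _ Uc) => i; have [->|i0] := eqVneq i ord0; first by rewrite E0 subr_gt0.
have [->|i1'] := eqVneq i i1; first by rewrite E1 mulr_gt0.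
by rewrite Ei.
Qed.

Lemma hull_children T : nondegenerate T ->
  hull (child false T) `|` hull (child true T) = hull T.
Proof.
move=> U; apply/seteqP; split => x.
  by case=> /(hull_childP _ _ U)[].
move=> Tx; have [le|lt] := leP (bary T x 0 (dend true)) (bary T x 0 (dend false)).
  by left; apply/(hull_childP _ _ U).
by right; apply/(hull_childP _ _ U); rewrite ltW.
Qed.

Lemma osimplex_children T : nondegenerate T ->
  osimplex (child false T) `&` osimplex (child true T) = set0.
Proof.
move=> U; rewrite -subset0 => x [/(osimplex_childP _ _ U)[_ +] /(osimplex_childP _ _ U)[_]].
by move=> /lt_trans /[apply]; rewrite ltxx.
Qed.

Lemma osimplex_child_sub b T : nondegenerate T -> osimplex (child b T) `<=` osimplex T.
Proof. by move=> U x /(osimplex_childP _ _ U)[]. Qed.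

Lemma hull_child_sub b T : nondegenerate T -> hull (child b T) `<=` hull T.
Proof. by move=> U x /(hull_childP _ _ U)[]. Qed.

(** The descendant of T reached along a path of the bisection tree. *)
Fixpoint node T (s : seq bool) : simplex R n :=
  if s is b :: s' then node (child b T) s' else T.

Lemma node_rcons T s b : node T (rcons s b) = child b (node T s).
Proof. by elim: s T => //= c s IH T; rewrite IH. Qed.

Lemma node_nondegenerate T s : nondegenerate T -> nondegenerate (node T s).
Proof. by elim: s T => //= b s IH T U; apply: IH; exact: child_nondegenerate. Qed.

Lemma hull_node_sub T s : nondegenerate T -> hull (node T s) `<=` hull T.
Proof.
elim: s T => [|b s IH] T U /=; first by move=> x.
apply: (subset_trans (IH _ (child_nondegenerate b U))).
exact: hull_child_sub.
Qed.

Lemma osimplex_node_sub T s : nondegenerate T -> osimplex (node T s) `<=` osimplex T.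
Proof.
elim: s T => [|b s IH] T U /=; first by move=> x.
apply: (subset_trans (IH _ (child_nondegenerate b U))).
exact: osimplex_child_sub.
Qed.

Lemma osimplex_disjoint_neq T T' : osimplex T `&` osimplex T' = set0 -> T != T'.
Proof.
move=> TT; apply/eqP => E; move: TT; rewrite -E setIid => E0.
by have := osimplex_barycenter T; rewrite E0.
Qed.

(** Where two paths part, the open simplices lie on different sides of a bisecting
    plane. *)
Lemma node_trichotomy T s s' : nondegenerate T ->
  [\/ exists t, node T s = node (node T s') t,
      exists t, node T s' = node (node T s) t |
      osimplex (node T s) `&` osimplex (node T s') = set0].
Proof.
elim: s s' T => [|b s IH] s' T U; first by constructor 2; exists s'.
case: s' => [|b' s']; first by constructor 1; exists (b :: s).
have Uc c := child_nondegenerate c U.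
have [->|bb] := eqVneq b b'; first exact: IH.
constructor 3; rewrite -subset0 => x [/= /(osimplex_node_sub (Uc _)) H1].
move=> /(osimplex_node_sub (Uc _)) H2.
suff : (osimplex (child false T) `&` osimplex (child true T)) x by rewrite osimplex_children.
by move: bb H1 H2; case: b; case: b' => //= _; split.
Qed.

Lemma node_not_sub T b s : nondegenerate T -> ~ (hull T `<=` hull (node T (b :: s))).
Proof.
move=> U /= H; have Uc c := child_nondegenerate c U.
have := osimplex_barycenter (child (~~ b) T) => H1.
have : osimplex (child b T) `&` osimplex (child (~~ b) T) = set0.
  by case: (b); [rewrite setIC|]; exact: osimplex_children.
rewrite -subset0 => /(_ (barycenter (child (~~ b) T))); apply; split=> //.
apply: (osimplex_node_sub (Uc b) (s := s)).
apply: (hull_sub_osimplex U (node_nondegenerate s (Uc b)) H).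
exact: osimplex_child_sub H1.
Qed.

Lemma bisectE M T T' : (T' \in bisect M T) =
  [|| T' == child false T, T' == child true T | (T' != T) && (T' \in M)].
Proof. by rewrite /bisect !inE. Qed.

End Bisection.

(** * Overlay of two refinements *)

Section Refinements.
Context (R : realType) (n : nat).
Local Notation pt := 'rV[R]_n.+1.
Implicit Types (T : simplex R n) (M : mesh R n) (x y : pt).

(** The part of conformity that a single bisection preserves. *)
Record packed M : Prop := Packed {
  pk_nd : forall T, T \in M -> nondegenerate T;
  pk_dj : forall T T', T \in M -> T' \in M -> T != T' ->
    osimplex T `&` osimplex T' = set0
}.

Definition mhull M : set pt := \bigcup_(T in [set` M]) hull T.

Lemma conforming_packed D M : conforming D M -> packed M.
Proof. by case=> nd _ dj _; split=> [T TM|T T' TM TM']; [exact: nd|exact: dj]. Qed.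

Lemma packed_sub_eq M T T' : packed M -> T \in M -> T' \in M ->
  hull T `<=` hull T' -> T = T'.
Proof.
move=> [nd dj] TM T'M TT; apply/eqP; apply: contraT => /(dj _ _ TM T'M).
rewrite -subset0 => /(_ (barycenter T)); case; split; first exact: osimplex_barycenter.
by apply: (hull_sub_osimplex (nd _ TM) (nd _ T'M) TT); exact: osimplex_barycenter.
Qed.

Lemma child_notin M T b : packed M -> T \in M -> child b T \notin M.
Proof.
move=> pM TM; have U := pk_nd pM TM; apply/negP => cM.
have cT : child b T = T by apply: (packed_sub_eq pM) => //; exact: hull_child_sub.
by apply: (@node_not_sub _ _ T b [::] U); rewrite /= cT.
Qed.

Lemma child_neq T : nondegenerate T -> child false T != child true T.
Proof. by move=> U; apply: osimplex_disjoint_neq; exact: osimplex_children. Qed.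

Lemma packed_bisect M T : packed M -> T \in M -> packed (bisect M T).
Proof.
move=> pM TM; have [nd dj] := pM; have U := nd _ TM.
have sub b T' : T' \in M -> T' != T -> osimplex (child b T) `&` osimplex T' = set0.
  move=> T'M T'T; rewrite -subset0 => x [/(osimplex_child_sub U) xT xT'].
  by have := dj _ _ TM T'M; rewrite eq_sym T'T => /(_ isT); rewrite -subset0; apply.
split=> [T'|T1 T2]; rewrite !bisectE.
  move=> /or3P[/eqP->|/eqP->|/andP[_ /nd]//]; exact: child_nondegenerate.
move=> /or3P[/eqP->|/eqP->|/andP[n1 m1]] /or3P[/eqP->|/eqP->|/andP[n2 m2]];
  rewrite ?eqxx// => ne.
- exact: osimplex_children.
- exact: sub.
- by rewrite setIC osimplex_children.
- exact: sub.
- by rewrite setIC; exact: sub.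
- by rewrite setIC; exact: sub.
- exact: dj.
Qed.

Lemma card_bisect M T : packed M -> T \in M -> #|` bisect M T| = #|` M|.+1.
Proof.
move=> pM TM; have U := pk_nd pM TM.
rewrite /bisect cardfsU1 cardfsU1 (cardfsD1 T M) TM.
have := child_notin false pM TM; have := child_notin true pM TM.
have := child_neq U; rewrite /= !in_fset1U !in_fsetD1 => /negbTE -> /negbTE -> /negbTE ->.
by rewrite !andbF.
Qed.

Lemma mhull_bisect M T : packed M -> T \in M -> mhull (bisect M T) = mhull M.
Proof.
move=> pM TM; have U := pk_nd pM TM; apply/seteqP; split=> x [T' /=].
  rewrite bisectE => /or3P[/eqP->|/eqP->|/andP[_ T'M]] xT'.
  - by exists T => //; exact: hull_child_sub xT'.
  - by exists T => //; exact: hull_child_sub xT'.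
  - by exists T'.
move=> T'M xT'; have [E|ne] := eqVneq T' T; last first.
  by exists T' => //=; rewrite bisectE ne T'M !orbT.
move: xT'; rewrite E -(hull_children U) => -[xT|xT].
  by exists (child false T) => //=; rewrite bisectE eqxx.
by exists (child true T) => //=; rewrite bisectE eqxx orbT.
Qed.

Lemma bisections_trans M M' M'' : bisections M M' -> bisections M' M'' -> bisections M M''.
Proof. by move=> b; elim=> // Q T _ bQ TQ; exact: bisections_step. Qed.

Section FromM.
Variable M1 : mesh R n.
Hypothesis pM1 : packed M1.

Lemma bisections_packed M : bisections M1 M -> packed M.
Proof. by elim=> // M' T _ pM' TM'; exact: packed_bisect. Qed.

Lemma bisections_mhull M : bisections M1 M -> mhull M = mhull M1.
Proof.
by elim=> // M' T b <- TM'; apply: mhull_bisect => //; exact: bisections_packed.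
Qed.

Lemma bisections_node M : bisections M1 M -> forall T, T \in M ->
  exists2 T1, T1 \in M1 & exists s, T = node T1 s.
Proof.
elim=> [T TM|M' T b IH TM' T']; first by exists T => //; exists [::].
rewrite bisectE => /or3P[/eqP->|/eqP->|/andP[_ /IH]//];
  have [T1 T1M [s ->]] := IH _ TM'; exists T1 => //.
- by exists (rcons s false); rewrite node_rcons.
- by exists (rcons s true); rewrite node_rcons.
Qed.

Lemma bisections_hull M : bisections M1 M -> forall T, T \in M ->
  exists2 T1, T1 \in M1 & hull T `<=` hull T1.
Proof.
move=> b T /(bisections_node b)[T1 T1M [s ->]]; exists T1 => //.
by apply: hull_node_sub; exact: (pk_nd pM1).
Qed.

(** Each bisection removes one simplex and creates two. *)
Lemma card_refined M : bisections M1 M ->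
  (#|` M1| <= #|` M|)%N /\ (#|` (M1 `\` (M `&` M1))%fset| + #|` M1| <= #|` M|)%N.
Proof.
elim=> [|M' T b [le1 le2] TM'].
  by rewrite fsetIid fsetDv cardfs0.
have pM' := bisections_packed b.
rewrite card_bisect//; split; first exact: leqW.
apply: leq_trans (_ : (#|` (M1 `\` (M' `&` M1))%fset|.+1 + #|` M1| <= _)%N); last first.
  by rewrite addSn.
rewrite leq_add2r.
apply: leq_trans (_ : (#|` (T |` (M1 `\` (M' `&` M1)))%fset| <= _)%N); last first.
  by rewrite cardfsU1; case: (_ \notin _).
apply: fsubset_leq_card; apply/fsubsetP => T'.
rewrite in_fset1U !in_fsetD !in_fsetI bisectE; have [//|ne] := eqVneq T' T.
by case: (T' \in M1); rewrite ?andbF// !andbT !negb_or => /and3P[].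
Qed.

Lemma nodes_trichotomy T1 T2 s1 s2 : T1 \in M1 -> T2 \in M1 ->
  hull (node T1 s1) `<=` hull (node T2 s2) ->
  (exists t, node T1 s1 = node (node T2 s2) t).
Proof.
move=> m1 m2 H; have U1 := pk_nd pM1 m1; have U2 := pk_nd pM1 m2.
have W1 := node_nondegenerate s1 U1; have W2 := node_nondegenerate s2 U2.
have Ho := hull_sub_osimplex W1 W2 H.
have B := osimplex_barycenter (node T1 s1).
have [E|ne] := eqVneq T1 T2; last first.
  exfalso; have := pk_dj pM1 m1 m2 ne; rewrite -subset0.
  move=> /(_ (barycenter (node T1 s1))); apply; split.
    exact: (osimplex_node_sub U1 B).
  by apply: (osimplex_node_sub U2 (s := s2)); exact: Ho.
subst T2; have [//|[[|b t] E]|dj] := node_trichotomy s1 s2 U1.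
- by exists [::]; rewrite E.
- by exfalso; apply: (@node_not_sub _ _ (node T1 s1) b t W1); rewrite -E.
- exfalso; move: dj; rewrite -subset0 => /(_ (barycenter (node T1 s1))); apply.
  by split=> //; exact: Ho.
Qed.

(** The common refinement, built along the bisections that lead to M'. A simplex
    that M' bisects is bisected if it is present; otherwise it is already refined. *)
Lemma overlay M M' : bisections M1 M -> bisections M1 M' ->
  exists N, [/\ bisections M N,
    forall T, T \in N -> exists2 T', T' \in M' & hull T `<=` hull T',
    forall T, T \in N -> (T \in M) || (T \in M') &
    (#|` N| + #|` M1| <= #|` M| + #|` M'|)%N].
Proof.
move=> bM; have pM := bisections_packed bM.
elim=> {M'} [|M' T bM' [N [bN subN inN cN]] TM'].
  exists M; split=> //; first exact: bisections_refl.
    exact: bisections_hull.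
  by move=> T ->.
have pM' := bisections_packed bM'.
have pN : packed N := bisections_packed (bisections_trans bM bN).
have [TN|TN] := boolP (T \in N).
  exists (bisect N T); split.
  - exact: bisections_step.
  - move=> T'; rewrite bisectE => /or3P[/eqP->|/eqP->|/andP[ne T'N]].
    + by exists (child false T) => //; rewrite bisectE eqxx.
    + by exists (child true T) => //; rewrite bisectE eqxx orbT.
    + have [S SM TS] := subN _ T'N; exists S => //; rewrite bisectE SM andbT.
      have [E|_] := eqVneq S T; last by rewrite !orbT.
      by exfalso; move/eqP: ne; apply; apply: (packed_sub_eq pN) => //; rewrite -E.
  - move=> T'; rewrite !bisectE => /or3P[->|->|/andP[ne /inN/orP[->//|->]]];
      by rewrite ?ne ?orbT.
  - by rewrite !card_bisect// addSn addnS ltnS.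
exists N; split=> //.
- move=> T' T'N; have [S SM TS] := subN _ T'N.
  have [E|ne] := eqVneq S T; last by exists S => //; rewrite bisectE ne SM !orbT.
  subst S; have T'T : T' != T by apply: contraNneq TN => <-.
  have T'M : T' \in M.
    have /orP[//|T'M'] := inN _ T'N.
    by move/eqP: T'T; case; apply: (packed_sub_eq pM').
  have [T1 m1 [s1 E1]] := bisections_node bM T'M.
  have [T2 m2 [s2 E2]] := bisections_node bM' TM'.
  have [[|b t] Et] : exists t, T' = node T t.
  + by rewrite E1 E2; apply: nodes_trichotomy => //; rewrite -E1 -E2.
  + by move: T'T; rewrite Et eqxx.
  exists (child b T); first by rewrite bisectE; case: b {Et}; rewrite /child eqxx ?orbT.
  rewrite Et /=; apply: hull_node_sub; apply: child_nondegenerate; exact: (pk_nd pM' TM').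
- move=> T' T'N; rewrite bisectE; have /orP[->//|->] := inN _ T'N.
  have -> : T' != T by apply: contraNneq TN => <-.
  by rewrite !orbT.
- by rewrite card_bisect// addnS leqW.
Qed.

End FromM.

Lemma refinement_refl D M : conforming D M -> refinement D M M.
Proof. by move=> c; split=> //; exact: bisections_refl. Qed.

Lemma refinement_trans D M M' M'' : refinement D M M' -> refinement D M' M'' ->
  refinement D M M''.
Proof. by move=> [b _] [b' c]; split=> //; exact: bisections_trans b'. Qed.

(** The overlay of conforming refinements is conforming: a simplex of M meets one of
    M' in the trace of a face of its neighbour in M, hence in a face. *)
Lemma overlay_refinement D M1 M M' : conforming D M1 ->
  refinement D M1 M -> refinement D M1 M' ->
  exists N, [/\ refinement D M N,
    forall T, T \in N -> exists2 T', T' \in M' & hull T `<=` hull T' &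
    (#|` N| + #|` M1| <= #|` M| + #|` M'|)%N].
Proof.
move=> c1 [bM cM] [bM' cM']; have p1 := conforming_packed c1.
have pM := conforming_packed cM; have pM' := conforming_packed cM'.
have [N [bN subN inN cN]] := overlay p1 bM bM'.
have pN := bisections_packed pM bN.
exists N; split=> //; split=> //; split.
- by move=> T /(pk_nd pN).
- by rewrite -/(mhull N) (bisections_mhull pM bN); case: cM.
- by move=> T T' TN T'N; exact: (pk_dj pN).
- have nd := pk_nd pN.
  have key (P Q : mesh R n) T T' : packed P -> conforming D P ->
      (forall S, S \in N -> exists2 S', S' \in P & hull S `<=` hull S') ->
      T \in N -> T' \in N -> T \in P ->
      exists F', hull T `&` hull T' = subface T' F'.
    move=> pP [_ _ _ cP] sP TN T'N TP.
    have [S SP T'S] := sP _ T'N.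
    have [F [F' [E1 E2]]] := cP _ _ TP SP.
    have [G EG] := subface_sub F' (pk_nd pP SP) (nd _ T'N) T'S.
    exists G; rewrite -EG -E2; apply/seteqP; split=> x [a b]; first by split=> //; split=> //; exact: T'S.
    by case: b => ? ?; split.
  have subM := bisections_hull pM bN.
  move=> T T' TN T'N.
  have both S S' : S \in N -> S' \in N -> exists F', hull S `&` hull S' = subface S' F'.
    move=> SN S'N; have /orP[SM|SM] := inN _ SN.
      exact: (key M M).
    exact: (key M' M').
  have [F' EF'] := both _ _ TN T'N; have [F EF] := both _ _ T'N TN.
  by exists F, F'; split=> //; rewrite setIC.
Qed.

End Refinements.

(** * Interior faces *)

Section InteriorFaces.
Context (R : realType) (n : nat).
Local Notation pt := 'rV[R]_n.+1.
Implicit Types (T : simplex R n) (M : mesh R n) (x y : pt) (D : set pt).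

Lemma segment_cvg (x v : pt) : (fun t : R => x + t *: v) @ (0 : R)^'+ --> x.
Proof.
rewrite -[X in _ --> X](_ : x + 0 *: v = x); last by rewrite scale0r addr0.
apply: cvg_at_right_filter; apply: cvgD; first exact: cvg_cst.
by apply: cvgZr_tmp; exact: cvg_id.
Qed.

Lemma segment_point (x v : pt) (A : set pt) : nbhs x A -> exists2 t : R, 0 < t & A (x + t *: v).
Proof.
move=> nA; have n1 : \forall t \near (0 : R)^'+, A (x + t *: v) by exact: segment_cvg nA.
by near (0 : R)^'+ => t; exists t; near: t; [exact: nbhs_right_gt|exact: n1].
Unshelve. all: by end_near. Qed.

(** A Lipschitz domain lies on one side of its boundary: it has no slits. *)
Lemma lipschitz_interior_closure D : open D -> lipschitz_boundary D ->
  interior (closure D) `<=` D.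
Proof.
move=> oD lD x ix; apply: contrapT => nDx.
have cx : closure D x by exact: interior_subset.
have [U [Q [psi [L [nU QQ Lpsi DU]]]]] := lD x (conj cx nDx).
have Ux : U x by exact: nbhs_singleton.
pose v : pt := - delta_mx 0 0 *m Q^T.
have vQ : v *m Q = - delta_mx 0 0 by rewrite /v -mulmxA (mulmx1C QQ) mulmx1.
have nxU : \forall z \near x, nbhs z U by exact: nbhs_interior.
have nxD : \forall z \near x, closure D z by [].
have [t t0 [yU yD]] := segment_point v (filterI nxU nxD).
set y := x + t *: v in yU yD.
pose pr (z : pt) := col' ord0 (z *m Q); pose h (z : pt) := (z *m Q) 0 ord0.
have yQ : y *m Q = x *m Q - t *: delta_mx 0 0.
  by rewrite /y mulmxDl -scalemxAl vQ scalerN.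
have pry : pr y = pr x.
  by rewrite /pr yQ; apply/rowP => j; rewrite !mxE /= ?andbF ?mulr0 subr0.
have hy : h y = h x - t by rewrite /h yQ !mxE !eqxx mulr1.
have hx : h x <= psi (pr x) by rewrite leNgt; apply/negP => /DU -/(_ Ux).
have nh : \forall z \near y, h z < h y + t / 2.
  have ch : continuous h.
    have -> : h = (fun z : pt => \sum_j z 0 j * Q j 0 : R) by apply/funext => w; rewrite /h mxE.
    exact: continuous_linear_form.
  by apply: (ch y [set u | u < h y + t / 2]); apply: lt_nbhsl; rewrite ltrDl divr_gt0.
have np : \forall z \near y, L * enorm (pr y - pr z) < t / 2.
  have cp : {for y, continuous (fun z => L * enorm (pr y - pr z))}.
    apply: (@continuousM _ _ (fun=> L)); first exact: cst_continuous.
    rewrite /enorm; apply: (@continuous_comp _ _ _ (fun z => dotv (pr y - pr z) (pr y - pr z)) Num.sqrt).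
      apply: continuous_bigsum => i.
      have ci : {for y, continuous (fun z => (pr y - pr z) 0 i)}.
        apply: (@continuous_for_ext _ _ (fun z => pr y 0 i - pr z 0 i)).
          by move=> z; rewrite [RHS]mxE [X in _ = _ + X]mxE.
        apply: (@continuousB _ _ _ (fun=> pr y 0 i) (fun z => pr z 0 i)); first exact: cst_continuous.
        have cpi : continuous (fun z : pt => (pr z 0 i : R)).
          have -> : (fun z : pt => (pr z 0 i : R)) = (fun z : pt => \sum_j z 0 j * Q j (lift ord0 i) : R).
            by apply/funext => z; rewrite /pr !mxE.
          exact: continuous_linear_form.
        exact: cpi.
      exact: continuousM.
    exact: sqrt_continuous.
  apply: (cp [set u | u < t / 2]); apply: lt_nbhsl.
  by rewrite subrr /enorm /dotv big1 ?sqrtr0 ?mulr0 ?divr_gt0// => i _; rewrite mxE mul0r.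
have [z [Dz [Uz [hz pz]]]] := yD _ (filterI yU (filterI nh np)).
have Dz' := (DU z Uz).1 Dz; rewrite -/(pr z) -/(h z) in Dz'.
have := le_lt_trans (Lpsi (pr y) (pr z)) pz.
rewrite ltr_norml => /andP[_]; rewrite pry => H.
move: hz; rewrite hy /=; lra.
Qed.

Lemma osimplex_sub_dom D M T : open D -> lipschitz_boundary D -> conforming D M ->
  T \in M -> osimplex T `<=` D.
Proof.
move=> oD lD [nd cov _ _] TM x Tx; apply: (lipschitz_interior_closure oD lD).
have : nbhs x (osimplex T) by apply: open_nbhs_nbhs; split=> //; apply: open_osimplex; exact: nd.
apply: filterS => y Ty; rewrite -cov; exists T => //; exact: osimplex_hull.
Qed.

(** An affine function that vanishes on a facet is a multiple of the coordinate of
    the opposite vertex. *)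
Lemma bary_facet T T' i k y : nondegenerate T -> nondegenerate T' ->
  (forall j, j != i -> bary T' (vtx T j) 0 k = 0) ->
  bary T' y 0 k = bary T y 0 i * bary T' (vtx T i) 0 k.
Proof.
move=> U U' H; rewrite -{1}(baryK y U).2 bary_mulmx ?(baryK _ U).1//.
by rewrite (bigD1 i)//= big1 ?addr0// => j ji; rewrite H// mulr0.
Qed.

Lemma facetP T i x : nondegenerate T -> facet T i x <-> hull T x /\ bary T x 0 i = 0.
Proof.
move=> U; split => [/(subfaceP _ _ U)[Tx H]|[Tx H]].
  by split=> //; apply: H; rewrite /= negbK.
by apply/(subfaceP _ _ U); split=> // j; rewrite /= negbK => /eqP ->.
Qed.

Lemma vtx_facet T i j : nondegenerate T -> j != i -> facet T i (vtx T j).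
Proof.
move=> U ji; apply/(facetP _ _ U); split; first exact: vtx_hull.
by rewrite bary_vtx// mxE eq_sym (negbTE ji) andbF.
Qed.

(** Two simplices with a common facet lie on its two sides, so together they cover a
    neighbourhood of its relative interior. *)
Lemma facet_interior D M T T' i i' x : conforming D M -> T \in M -> T' \in M ->
  T' != T -> facet T i = facet T' i' ->
  bary T x 0 i = 0 -> (forall j, j != i -> 0 < bary T x 0 j) ->
  interior (closure D) x.
Proof.
move=> cM TM T'M ne FF xi xj; have [nd cov dj _] := cM.
have U := nd _ TM; have U' := nd _ T'M.
have Fx : facet T i x.
  apply/(facetP _ _ U); split=> //; apply/(hullP _ U) => j.
  by have [->|/xj/ltW] := eqVneq j i; rewrite ?xi.
have F'x : facet T' i' x by rewrite -FF.
have vi' j : j != i -> bary T' (vtx T j) 0 i' = 0.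
  by move=> ji; have := vtx_facet U ji; rewrite FF => /(facetP _ _ U')[].
have x'j k : k != i' -> 0 < bary T' x 0 k.
  move=> ki'; rewrite lt_neqAle; apply/andP; split; last first.
    by move: k {ki'}; apply/(hullP _ U'); case/(facetP _ _ U'): F'x.
  apply/eqP => x0.
  have v0 j : j != i -> bary T' (vtx T j) 0 k = 0.
    move=> ji; move: x0; rewrite -{1}(baryK x U).2 bary_mulmx ?(baryK _ U).1// => /esym/eqP.
    have H l : 0 <= bary T x 0 l * bary T' (vtx T l) 0 k.
      have [->|li] := eqVneq l i; first by rewrite xi mul0r.
      apply: mulr_ge0; first exact/ltW/xj.
      have := vtx_facet U li; rewrite FF => /(facetP _ _ U')[/(hullP _ U')] + _; exact.
    rewrite psumr_eq0// => /allP/(_ j); rewrite mem_index_enum => /(_ isT)/=.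
    by rewrite mulf_eq0 gt_eqF ?xj//= => /eqP.
  have := vtx_facet U' ki'; rewrite -FF => /(facetP _ _ U)[_ b0].
  have := @bary_facet T T' i k (vtx T' k) U U' v0.
  by rewrite b0 mul0r bary_vtx// mxE !eqxx => /eqP; rewrite oner_eq0.
have E y : bary T' y 0 i' = bary T y 0 i * bary T' (vtx T i) 0 i' by exact: bary_facet.
have nT := nbhs_bary_gt0 (T := T) (P := predC1 i) xj.
have nT' := nbhs_bary_gt0 (T := T') (P := predC1 i') x'j.
set c := bary T' (vtx T i) 0 i' in E.
have c0 : c < 0.
  rewrite ltNge; apply/negP => c0.
  have {c0} c0 : 0 < c.
    rewrite lt_neqAle c0 andbT; apply/eqP => cz; have := E (vtx T' i').
    by rewrite bary_vtx// mxE !eqxx -cz mulr0 => /eqP; rewrite oner_eq0.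
  have [t t0 [H H']] := segment_point (vtx T i - x) (filterI nT nT').
  set y := x + t *: (vtx T i - x) in H H'.
  have yi : bary T y 0 i = t.
    rewrite /y scalerBr addrA addrAC -[X in X - _]scale1r -scalerBl bary_affine2E//.
    by rewrite xi mulr0 add0r bary_vtx// mxE !eqxx mulr1.
  have := dj _ _ T'M TM ne; rewrite -subset0 => /(_ y); apply; split.
    apply/(osimplexP _ U') => j; have [->|/H'//] := eqVneq j i'.
    by rewrite E yi mulr_gt0.
  by apply/(osimplexP _ U) => j; have [->|/H//] := eqVneq j i; rewrite yi.
apply: filterS2 nT nT' => y H H'; rewrite -cov.
have [yi|yi] := leP 0 (bary T y 0 i).
  exists T => //; apply/(hullP _ U) => j; have [->//|ji] := eqVneq j i.
  exact/ltW/H.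
exists T' => //; apply/(hullP _ U') => j; have [->|ji] := eqVneq j i'; last exact/ltW/H'.
by rewrite E ltW// nmulr_rgt0.
Qed.

(** The parametrization of a facet over the reference simplex. *)
Definition facet_pt T (i : 'I_n.+2) (t : 'rV[R]_n) : pt :=
  let V : 'M[R]_n.+1 := row' i T.1 in
  row ord0 V + t *m (\matrix_(j < n) (row (lift ord0 j) V - row ord0 V)).

Lemma facet_ptE T i t : facet_pt T i t =
  (1 - \sum_j t 0 j) *: vtx T (lift i ord0) + \sum_j t 0 j *: vtx T (lift i (lift ord0 j)).
Proof.
have vl k : vtx T (lift i k) = row k (row' i T.1) by apply/rowP => l; rewrite !mxE.
rewrite /facet_pt mulmx_sum_row !vl scalerBl scale1r -addrA; congr (_ + _).
rewrite scaler_suml -sumrN -big_split/=; apply: eq_bigr => j _.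
by rewrite rowK scalerBr addrC vl.
Qed.

Lemma bary_facet_pt T i t : nondegenerate T -> ref_simplex t ->
  bary T (facet_pt T i t) 0 i = 0 /\
  forall j, j != i -> 0 < bary T (facet_pt T i t) 0 j.
Proof.
move=> U [t0 t1].
pose c (k : 'I_n.+1) := if unlift ord0 k is Some j then t 0 j else 1 - \sum_j t 0 j.
have c0 : c ord0 = 1 - \sum_j t 0 j by rewrite /c unlift_none.
have cl j : c (lift ord0 j) = t 0 j by rewrite /c liftK.
have cgt k : 0 < c k.
  by case: (unliftP ord0 k) => [j|] ->; rewrite ?c0 ?cl ?subr_gt0.
have -> : facet_pt T i t = \sum_k c k *: vtx T (lift i k).
  rewrite facet_ptE big_ord_recl c0; congr (_ + _).
  by apply: eq_bigr => j _; rewrite cl.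
have c1 : \sum_k c k = 1.
  rewrite big_ord_recl c0 -[RHS](subrK (\sum_j t 0 j)); congr (_ + _).
  by apply: eq_bigr => j _; rewrite cl.
rewrite bary_affine//.
have bE j : (\sum_k c k *: bary T (vtx T (lift i k))) 0 j =
    \sum_k c k * (j == lift i k)%:R.
  rewrite summxE; apply: eq_bigr => k _; rewrite mxE bary_vtx// mxE eqxx/=.
  by [].
split=> [|j ji]; rewrite bE.
  by rewrite big1// => k _; rewrite (negbTE (neq_lift i k)) mulr0.
have [k ->] : exists k, j = lift i k.
  by move: ji; case: (unliftP i j) => [k|] ->; [exists k|rewrite eqxx].
apply: (sum_gt0 (i := k)); last by rewrite eqxx mulr1.
by move=> l; rewrite mulr_ge0// ltW.
Qed.

End InteriorFaces.

(** * Polynomial functions *)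

Section Polynomials.
Context (R : realType) (n : nat).
Local Notation pt := 'rV[R]_n.+1.
Implicit Types (f g : pt -> R) (x : pt).

(** The ring generated by constants and coordinates; forgetting the degree makes it
    visibly stable under differentiation. *)
Inductive polyn : (pt -> R) -> Prop :=
| polyn_cst c : polyn (fun=> c)
| polyn_coord i : polyn (fun x => x 0 i)
| polyn_add f g : polyn f -> polyn g -> polyn (f + g)
| polyn_mul f g : polyn f -> polyn g -> polyn (f * g).

Lemma polyn_sum (I : Type) (s : seq I) (P : pred I) (F : I -> pt -> R) :
  (forall i, polyn (F i)) -> polyn (fun x => \sum_(i <- s | P i) F i x).
Proof.
move=> pF; elim: s => [|i s IH].
  by rewrite (_ : (fun _ => _) = fun=> 0);
    [exact: polyn_cst|apply/funext => x; rewrite big_nil].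
rewrite (_ : (fun _ => _) = (fun x => (if P i then F i x else 0)) + (fun x => \sum_(i <- s | P i) F i x)).
  apply: polyn_add => //; case: (P i) => //; exact: polyn_cst.
by apply/funext => x; rewrite big_cons /= fctE; case: ifP => //; rewrite add0r.
Qed.

Lemma polyn_prod (I : Type) (s : seq I) (F : I -> pt -> R) :
  (forall i, polyn (F i)) -> polyn (fun x => \prod_(i <- s) F i x).
Proof.
move=> pF; elim: s => [|i s IH].
  by rewrite (_ : (fun _ => _) = fun=> 1);
    [exact: polyn_cst|apply/funext => x; rewrite big_nil].
rewrite (_ : (fun _ => _) = F i * (fun x => \prod_(i <- s) F i x)).
  exact: polyn_mul.
by apply/funext => x; rewrite big_cons.
Qed.

Lemma polyn_exp f k : polyn f -> polyn (fun x => f x ^+ k).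
Proof.
move=> pf; elim: k => [|k IH].
  by rewrite (_ : (fun _ => _) = fun=> 1);
    [exact: polyn_cst|apply/funext => x; rewrite expr0].
rewrite (_ : (fun _ => _) = f * (fun x => f x ^+ k)); first exact: polyn_mul.
by apply/funext => x; rewrite exprS.
Qed.

Lemma polyfun_polyn m f : polyfun m f -> polyn f.
Proof.
move=> [c fE]; rewrite (_ : f = fun x => \sum_(a : {ffun 'I_n.+1 -> 'I_m.+1} |
    (\sum_i a i <= m)%N) c a * \prod_i x 0 i ^+ a i); last exact/funext.
apply: polyn_sum => a.
apply: (@polyn_mul (fun=> c a) (fun x => \prod_i x 0 i ^+ a i)); first exact: polyn_cst.
by apply: polyn_prod => i; apply: polyn_exp; exact: polyn_coord.
Qed.

Lemma polyn_continuous f : polyn f -> continuous f.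
Proof.
elim=> [c|i|g h _ cg _ ch|g h _ cg _ ch] x.
- exact: cst_continuous.
- exact: coord_continuous.
- by apply: continuousD; [exact: cg|exact: ch].
- by apply: continuousM; [exact: cg|exact: ch].
Qed.

Lemma polyn_bounded f (B : R) : polyn f ->
  exists C : R, forall x, (forall i, `|x 0 i| <= B) -> `|f x| <= C.
Proof.
elim=> [c|i|g h _ [C1 c1] _ [C2 c2]|g h _ [C1 c1] _ [C2 c2]].
- by exists `|c|.
- by exists B.
- exists (C1 + C2) => x Hx; rewrite fctE; apply: le_trans (ler_normD _ _) _.
  by apply: lerD; [exact: c1|exact: c2].
- exists (C1 * C2) => x Hx; rewrite fctE normrM.
  by apply: ler_pM => //; [exact: c1|exact: c2].
Qed.

Lemma coord_derive (i : 'I_n.+1) x (v : pt) :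
  derivable (fun x : pt => x 0 i) x v /\ 'D_v (fun x : pt => x 0 i) x = v 0 i.
Proof.
have E : \forall h \near (0 : R)^',
    h^-1 *: (((fun x : pt => x 0 i) \o shift x) (h *: v) - x 0 i) = v 0 i.
  near=> h; have h0 : h != 0 by near: h; exact: nbhs_dnbhs_neq.
  by rewrite /= !mxE addrK -[LHS]/(h^-1 * (h * v 0 i)) mulKf.
have c : (fun h : R => h^-1 *: (((fun x : pt => x 0 i) \o shift x) (h *: v) - x 0 i)) @ 0^' --> v 0 i.
  apply: cvg_near_cst; exact: E.
split; first by apply/cvg_ex; exists (v 0 i).
exact: cvg_lim c.
Unshelve. all: by end_near. Qed.

Lemma polyn_derivable f x v : polyn f -> derivable f x v.
Proof.
move=> pf; elim: pf x v => [c|i|g h _ dg _ dh|g h _ dg _ dh] x v.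
- exact: derivable_cst.
- by have [] := coord_derive i x v.
- exact: derivableD.
- exact: derivableM.
Qed.

Lemma polyn_pd i f : polyn f -> polyn (pd i f).
Proof.
elim=> [c|j|g h pg dg ph dh|g h pg dg ph dh].
- rewrite (_ : pd i _ = fun=> 0); first exact: polyn_cst.
  by apply/funext => x; rewrite /pd derive_cst.
- rewrite (_ : pd i _ = fun=> (delta_mx 0 i : pt) 0 j); first exact: polyn_cst.
  by apply/funext => x; rewrite /pd (coord_derive j x _).2.
- rewrite (_ : pd i _ = pd i g + pd i h); first exact: polyn_add.
  by apply/funext => x; rewrite /pd fctE deriveD//; exact: polyn_derivable.
- rewrite (_ : pd i _ = (g * pd i h) + (h * pd i g)).
    by apply: polyn_add; exact: polyn_mul.
  by apply/funext => x; rewrite /pd !fctE deriveM//; exact: polyn_derivable.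
Qed.

Lemma polyfun_add m f g : polyfun m f -> polyfun m g -> polyfun m (fun x => f x + g x).
Proof.
move=> [c fE] [d gE]; exists (fun a => c a + d a) => x; rewrite fE gE -big_split.
by apply: eq_bigr => a _; rewrite mulrDl.
Qed.

Lemma polyfun_scale m a f : polyfun m f -> polyfun m (fun x => a * f x).
Proof.
move=> [c fE]; exists (fun b => a * c b) => x; rewrite fE mulr_sumr.
by apply: eq_bigr => b _; rewrite mulrA.
Qed.

Lemma polyfun0 m : polyfun m (fun _ : pt => 0 : R).
Proof. by exists (fun=> 0) => x; rewrite big1// => a _; rewrite mul0r. Qed.

Lemma pd_local (U : set pt) f g i x : open U -> (forall y, U y -> f y = g y) -> U x ->
  pd i f x = pd i g x.
Proof.
move=> oU fg Ux; apply: near_eq_derive.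
have : nbhs x U by exact: open_nbhs_nbhs.
by apply: filterS => y; exact: fg.
Qed.

Lemma gradv_local (U : set pt) f g x : open U -> (forall y, U y -> f y = g y) -> U x ->
  gradv f x = gradv g x.
Proof. by move=> oU fg Ux; apply/rowP => i; rewrite !mxE; exact: pd_local Ux. Qed.

Lemma cvg_row (X : Type) (F : set_system X) (f : X -> pt) (l : pt) :
  Filter F -> (forall i, (fun t : X => f t 0 i) @ F --> l 0 i) -> f @ F --> l.
Proof.
move=> FF H A /nbhs_cubeP[e e0 eA].
have : \forall t \near F, forall i, `|l 0 i - f t 0 i| < e.
  apply: filter_forall => i; have /cvgrPdist_lt := H i; exact.
by apply: filterS => t Ht; apply: eA => i; exact: Ht.
Qed.

Lemma gradv_polyn_continuous f : polyn f -> continuous (gradv f).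
Proof.
move=> pf x; apply: (@cvg_row _ (nbhs x) (gradv f) (gradv f x)) => i.
rewrite mxE (_ : (fun _ => _) = pd i f); last by apply/funext => y; rewrite mxE.
exact: (polyn_continuous (polyn_pd i pf)).
Qed.

(** The gradient of the polynomial piece is continuous up to the boundary. *)
Lemma tgradE (T : simplex R n) f g x : nondegenerate T -> polyn g ->
  (forall y, osimplex T y -> f y = g y) -> hull T x -> tgrad T f x = gradv g x.
Proof.
move=> U pg fg Tx.
have cl := hull_closure U Tx.
have PF : ProperFilter (within (osimplex T) (nbhs x)) by exact: within_nbhs_proper.
apply: cvg_lim => //.
have E : \forall y \near within (osimplex T) (nbhs x), gradv g y = gradv f y.
  rewrite near_withinE; apply: nearW => y Ty.
  by apply/esym; apply: (gradv_local (open_osimplex U)).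
apply: cvg_trans (near_eq_cvg E) _.
by apply: cvg_within_filter; exact: gradv_polyn_continuous.
Qed.

End Polynomials.

(** * The energy space *)

Section Energy.
Context (R : realType) (n : nat) (S : setting R n) (HS : standing S).
Local Notation pt := 'rV[R]_n.+1.
Local Notation V := (sobfun R n).
Local Notation Om := (dom S).
Local Notation mu := (lebesgue_row n.+1).
Implicit Types (f g : pt -> R) (u v w : V) (T : simplex R n) (M : mesh R n).

Lemma measurable_dom : measurable Om.
Proof. apply: measurable_open; exact: (dom_open HS). Qed.

Lemma dom_bound : exists B : R, forall x, closure Om x -> forall i, `|x 0 i| <= B.
Proof.
have [B [_ /(_ (B + 1))]] := dom_bounded HS; rewrite ltrDl ltr01 => /(_ isT) H.
exists (B + 1 + 1) => x cx i.
have [y [Oy xy]] : Om `&` cube x 1 !=set0.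
  by apply: cx; apply/nbhs_cubeP; exists 1.
have := ler_distD (y 0 i) (x 0 i) 0; rewrite !subr0 => /le_trans; apply.
rewrite addrC; apply: lerD; last exact/ltW/xy.
apply: le_trans (H y Oy); rewrite [leRHS]mx_normrE.
exact: (le_bigmax _ (fun ij : 'I_1 * 'I_n.+1 => `|y ij.1 ij.2|) (0, i)).
Qed.

Lemma dom_finite : (mu Om < +oo)%E.
Proof.
have [B HB] := dom_bound; apply: (lebesgue_bounded (C := B)); first exact: measurable_dom.
by move=> x Ox; apply: HB; exact: subset_closure.
Qed.

Lemma ipE D f g : ip D f g = prodint mu D f g. Proof. by []. Qed.

Definition ip_si := prodint_semi_inner mu measurable_dom.

Lemma coefA_ae : exists C : R, forall i j,
  {ae mu, forall x, Om x -> `|coefA S x i j| <= C}.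
Proof.
have /choice[C HC] : forall ij : 'I_n.+1 * 'I_n.+1, exists C : R,
    {ae mu, forall x, Om x -> `|coefA S x ij.1 ij.2| <= C}.
  by move=> [i j]; have [_] := coefA_bnd HS i j.
exists (\big[Num.max/0]_ij C ij) => i j; have := HC (i, j).
apply: filterS => x H /H /le_trans; apply; exact: (le_bigmax _ C (i, j)).
Qed.

Lemma sqint_coefA i j f : sqint mu Om f -> sqint mu Om (fun x => coefA S x i j * f x).
Proof.
have [C HC] := coefA_ae; have [mA _] := coefA_bnd HS i j.
exact: (sqint_bndM measurable_dom mA (HC i j)).
Qed.

Lemma sqint_pot f : sqint mu Om f -> sqint mu Om (fun x => pot S x * f x).
Proof.
have [mp [C HC]] := pot_bnd HS; exact: (sqint_bndM measurable_dom mp HC).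
Qed.

(** The space in which H^1_0 is the closure of the test functions. *)
Definition L2pair u := sqint mu Om u.1 /\ forall i, sqint mu Om (fun x => u.2 x 0 i).

Definition b1 u v : R := ip Om u.1 v.1 +
  \sum_i ip Om (fun x => u.2 x 0 i) (fun x => v.2 x 0 i).

Lemma L2pairD u v : L2pair u -> L2pair v -> L2pair (u + v).
Proof.
move=> [u1 u2] [v1 v2]; split; first exact: (sqintD measurable_dom u1 v1).
move=> i; apply: (sqint_eq measurable_dom _ (sqintD measurable_dom (u2 i) (v2 i))).
by move=> x _; rewrite [RHS]mxE.
Qed.

Lemma L2pairZ a u : L2pair u -> L2pair (a *: u).
Proof.
move=> [u1 u2]; split; first exact: (sqintZ measurable_dom a u1).
move=> i; apply: (sqint_eq measurable_dom _ (sqintZ measurable_dom a (u2 i))).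
by move=> x _; rewrite [RHS]mxE.
Qed.

Lemma ipD1 f g h : sqint mu Om f -> sqint mu Om g -> sqint mu Om h ->
  ip Om (fun x => f x + g x) h = ip Om f h + ip Om g h.
Proof. exact: (si_addl ip_si). Qed.

Lemma ipZ1 a f h : sqint mu Om f -> sqint mu Om h ->
  ip Om (fun x => a * f x) h = a * ip Om f h.
Proof. exact: (si_scalel ip_si). Qed.

Lemma ipC f g : ip Om f g = ip Om g f.
Proof. by apply: eq_Rintegral => x _; rewrite mulrC. Qed.

Lemma eq_ip D f g f' g' : (forall x, D x -> f x = f' x) -> (forall x, D x -> g x = g' x) ->
  ip D f g = ip D f' g'.
Proof. exact: eq_prodint. Qed.

Lemma b1_si : semi_inner L2pair b1.
Proof.
split.
- exact: L2pairD.
- exact: L2pairZ.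
- by move=> u v _ _; rewrite /b1 ipC; congr (_ + _); apply: eq_bigr => i _; rewrite ipC.
- move=> u v w [u1 u2] [v1 v2] [w1 w2]; rewrite /b1 ipD1// addrACA; congr (_ + _).
  rewrite -big_split; apply: eq_bigr => i _ /=; rewrite -ipD1//.
  by apply: eq_ip => // x _; rewrite [LHS]mxE.
- move=> a u v [u1 u2] [v1 v2]; rewrite /b1 ipZ1// mulrDr; congr (_ + _).
  rewrite mulr_sumr; apply: eq_bigr => i _ /=; rewrite -ipZ1//.
  by apply: eq_ip => // x _; rewrite [LHS]mxE.
- move=> u [u1 u2]; apply: addr_ge0; first exact: (si_ge0 ip_si).
  by apply: sumr_ge0 => i _; exact: (si_ge0 ip_si (u2 i)).
Qed.

Lemma norm1E u : norm1 S u = snorm b1 u. Proof. by []. Qed.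

Lemma smooth_add f g : smooth f -> smooth g -> smooth (fun x => f x + g x) /\
  forall x, gradv (fun x => f x + g x) x = gradv f x + gradv g x.
Proof.
move=> sf sg.
have E s : foldr (@pd R n) (fun x => f x + g x) s = fun x => foldr (@pd R n) f s x + foldr (@pd R n) g s x.
  elim: s => //= i s ->; apply/funext => x; rewrite /pd.
  by rewrite (@deriveD _ _ _ (foldr (@pd R n) f s) (foldr (@pd R n) g s))//;
    [exact: (sf s).2|exact: (sg s).2].
split=> [s|x].
  rewrite E; split=> [x|i x].
    by apply: continuousD; [exact: (sf s).1|exact: (sg s).1].
  by apply: (@derivableD _ _ _ (foldr (@pd R n) f s) (foldr (@pd R n) g s)); [exact: (sf s).2|exact: (sg s).2].
by apply/rowP => i; have := E [:: i] => /(congr1 (fun z => z x)) /= Ei; rewrite !mxE.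
Qed.

Lemma smooth_scale a f : smooth f -> smooth (fun x => a * f x) /\
  forall x, gradv (fun x => a * f x) x = a *: gradv f x.
Proof.
move=> sf.
have E s : foldr (@pd R n) (fun x => a * f x) s = fun x => a * foldr (@pd R n) f s x.
  elim: s => //= i s ->; apply/funext => x; rewrite /pd.
  by rewrite (@deriveZ _ _ _ (foldr (@pd R n) f s) a)//; exact: (sf s).2.
split=> [s|x].
  rewrite E; split=> [x|i x].
    by apply: (@continuousM _ _ (fun=> a)); [exact: cst_continuous|exact: (sf s).1].
  by apply: (@derivableZ _ _ _ (foldr (@pd R n) f s) a); exact: (sf s).2.
by apply/rowP => i; have := E [:: i] => /(congr1 (fun z => z x)) /= Ei; rewrite !mxE.
Qed.

Lemma test_fun_add f g : test_fun Om f -> test_fun Om g -> test_fun Om (fun x => f x + g x).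
Proof.
move=> [sf [C [cC CO Cf]]] [sg [D [cD DO Dg]]]; split; first by have [] := smooth_add sf sg.
exists (C `|` D); split; first exact: compactU.
  by move=> x [/CO|/DO].
move=> x CD; have nC : ~ C x by move=> H; apply: CD; left.
have nD : ~ D x by move=> H; apply: CD; right.
by rewrite Cf// Dg// addr0.
Qed.

Lemma test_fun_scale a f : test_fun Om f -> test_fun Om (fun x => a * f x).
Proof.
move=> [sf [C [cC CO Cf]]]; split; first by have [] := smooth_scale a sf.
by exists C; split=> // x /Cf ->; rewrite mulr0.
Qed.

Lemma sqint_compact_support f (C : set pt) : continuous f -> compact C ->
  (forall x, ~ C x -> f x = 0) -> sqint mu Om f.
Proof.
move=> cf cC fC.
have [B [_ /(_ (B + 1))]] : bounded_set (f @` C).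
  apply: compact_bounded; apply: continuous_compact => //.
  exact: continuous_subspaceT.
rewrite ltrDl ltr01 => /(_ isT) HB.
apply: (sqint_bounded measurable_dom dom_finite (C := `|B + 1|)).
  by apply: measurable_fun_open_continuous; [exact: (dom_open HS)|move=> x _; exact: cf].
move=> x _; have [Cx|/fC ->] := pselect (C x); last by rewrite normr0.
apply: le_trans (ler_norm _); apply: HB; by exists x.
Qed.

Lemma test_fun_L2pair f : test_fun Om f -> L2pair ((f : pt -> R^o), gradv f).
Proof.
move=> [sf [C [cC CO Cf]]]; split; first exact: (sqint_compact_support (sf [::]).1 cC Cf).
move=> i; rewrite (_ : (fun _ => _) = pd i f); last by apply/funext => x; rewrite mxE.
apply: (sqint_compact_support (sf [:: i]).1 cC) => x nCx.
have oC : open (~` C) by apply: closed_openC; apply: compact_closed => //; exact: norm_hausdorff.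
by rewrite /= (@pd_local _ _ (~` C) f (fun=> 0) i x)// /pd derive_cst.
Qed.

Lemma H01_L2pair u : H01 S u -> L2pair u.
Proof. by case. Qed.

Lemma H01D u v : H01 S u -> H01 S v -> H01 S (u + v).
Proof.
move=> Hu Hv; have pu := H01_L2pair Hu; have pv := H01_L2pair Hv.
have [_ _ [p tp cp]] := Hu; have [_ _ [q tq cq]] := Hv.
have [s1 s2] := L2pairD pu pv; split=> //.
exists (fun k x => p k x + q k x) => [k|]; first exact: test_fun_add.
have H k : norm1 S (((fun x => p k x + q k x : R^o), gradv (fun x => p k x + q k x)) - (u + v) : V)
   <= norm1 S (((p k : pt -> R^o), gradv (p k)) - u : V) +
      norm1 S (((q k : pt -> R^o), gradv (q k)) - v : V).
  rewrite !norm1E.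
  have -> : (((fun x => p k x + q k x : R^o), gradv (fun x => p k x + q k x)) - (u + v) : V) =
    (((p k : pt -> R^o), gradv (p k)) - u : V) + (((q k : pt -> R^o), gradv (q k)) - v : V).
    rewrite addrACA -opprD; congr (_ - _); congr (_, _).
    by apply/funext => x; have [_ ->] := smooth_add (tp k).1 (tq k).1.
  by apply: (snormD b1_si); apply: (si_sub b1_si) => //; exact: test_fun_L2pair.
apply: (@squeeze_cvgr _ _ _ _ (fun=> 0) (fun k => norm1 S (((p k : pt -> R^o), gradv (p k)) - u : V) +
      norm1 S (((q k : pt -> R^o), gradv (q k)) - v : V))).
- by apply: nearW => k; rewrite H andbT norm1E snorm_ge0.
- exact: cvg_cst.
- have C := cvgD cp cq; rewrite addr0 in C; exact: C.
Qed.

Lemma H01Z a u : H01 S u -> H01 S (a *: u).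
Proof.
move=> Hu; have pu := H01_L2pair Hu.
have [_ _ [p tp cp]] := Hu.
have [s1 s2] := L2pairZ a pu; split=> //.
exists (fun k x => a * p k x) => [k|]; first exact: test_fun_scale.
have H k : norm1 S (((fun x => a * p k x : R^o), gradv (fun x => a * p k x)) - (a *: u) : V)
   = `|a| * norm1 S (((p k : pt -> R^o), gradv (p k)) - u : V).
  rewrite !norm1E -(snormZ b1_si); last first.
    by apply: (si_sub b1_si) => //; exact: test_fun_L2pair.
  congr snorm; rewrite scalerBr; congr (_ - _); congr (_, _).
  by apply/funext => x; have [_ ->] := smooth_scale a (tp k).1.
have -> : (fun k => norm1 S (((fun x => a * p k x : R^o), gradv (fun x => a * p k x)) - (a *: u) : V))
  = (fun k => `|a| * norm1 S (((p k : pt -> R^o), gradv (p k)) - u : V)) by exact/funext.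
have c1 : (fun _ : nat => `|a|) @ \oo --> `|a| by exact: cvg_cst.
have C := cvgM c1 cp; rewrite mulr0 in C; exact: C.
Qed.

(** The integrand may be split because the coefficients are essentially bounded. *)
Lemma aformE u v : L2pair u -> L2pair v -> aform S u v =
  \sum_i ip Om (fun x => \sum_j coefA S x i j * u.2 x 0 j) (fun x => v.2 x 0 i)
  + ip Om (fun x => pot S x * u.1 x) v.1.
Proof.
move=> [u1 u2] [v1 v2].
have mO := measurable_dom.
have sA i : sqint mu Om (fun x => \sum_j coefA S x i j * u.2 x 0 j).
  by apply: sqint_sum => // j; exact: sqint_coefA.
transitivity (\int[mu]_(x in Om)
   ((\sum_i (\sum_j coefA S x i j * u.2 x 0 j) * v.2 x 0 i) + pot S x * u.1 x * v.1 x)).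
  apply: eq_Rintegral => x _; congr (_ + _); rewrite /dotv; apply: eq_bigr => i _.
  by rewrite mxE; congr (_ * _); apply: eq_bigr => j _; rewrite mxE mulrC.
have iF i : mu.-integrable Om (EFin \o (fun x => (\sum_j coefA S x i j * u.2 x 0 j) * v.2 x 0 i)).
  exact: (sqint_mul mO (sA i) (v2 i)).
have [Is Es] := Rintegral_bigsum mO (index_enum 'I_n.+1) iF.
by rewrite RintegralD//; [rewrite Es|apply: sqint_mul => //; exact: sqint_pot].
Qed.

Lemma aform_addl u v w : L2pair u -> L2pair v -> L2pair w ->
  aform S (u + v) w = aform S u w + aform S v w.
Proof.
move=> pu pv pw; rewrite !aformE//; last exact: L2pairD.
have [u1 u2] := pu; have [v1 v2] := pv; have [w1 w2] := pw.
rewrite addrACA; congr (_ + _); last first.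
  rewrite -(ipD1 (sqint_pot u1) (sqint_pot v1) w1).
  by apply: eq_ip => // x _; rewrite -mulrDr.
rewrite -big_split; apply: eq_bigr => i _ /=.
have sA z : L2pair z -> sqint mu Om (fun x => \sum_j coefA S x i j * z.2 x 0 j).
  by move=> [z1 z2]; apply: sqint_sum; [exact: measurable_dom|move=> j; exact: sqint_coefA].
rewrite -(ipD1 (sA _ pu) (sA _ pv) (w2 i)).
apply: eq_ip => // x _; rewrite -big_split; apply: eq_bigr => j _ /=.
by rewrite -mulrDr; congr (_ * _); rewrite mxE.
Qed.

Lemma aform_scalel a u w : L2pair u -> L2pair w -> aform S (a *: u) w = a * aform S u w.
Proof.
move=> pu pw; rewrite !aformE//; last exact: L2pairZ.
have [u1 u2] := pu; have [w1 w2] := pw.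
rewrite mulrDr; congr (_ + _); last first.
  rewrite -(ipZ1 a (sqint_pot u1) w1).
  by apply: eq_ip => // x _; rewrite mulrCA.
rewrite mulr_sumr; apply: eq_bigr => i _ /=.
have sA z : L2pair z -> sqint mu Om (fun x => \sum_j coefA S x i j * z.2 x 0 j).
  by move=> [z1 z2]; apply: sqint_sum; [exact: measurable_dom|move=> j; exact: sqint_coefA].
rewrite -(ipZ1 a (sA _ pu) (w2 i)).
apply: eq_ip => // x _; rewrite mulr_sumr; apply: eq_bigr => j _ /=.
by rewrite mulrCA; congr (_ * _); rewrite mxE.
Qed.

Lemma dotv_mx (k : nat) (x y : 'rV[R]_k) : dotv x y = (x *m y^T) 0 0.
Proof. by rewrite mxE; apply: eq_bigr => i _; rewrite mxE. Qed.

Lemma aformC u v : aform S u v = aform S v u.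
Proof.
apply: eq_Rintegral => x /set_mem Ox; congr (_ + _); last by rewrite mulrAC.
have sA := coefA_sym HS Ox; rewrite !dotv_mx -{1}sA trmxK.
have -> : u.2 x *m coefA S x *m (v.2 x)^T = (v.2 x *m (coefA S x)^T *m (u.2 x)^T)^T.
  by rewrite !trmx_mul !trmxK mulmxA.
by rewrite mxE.
Qed.

Context (ca Ca : R) (ca_gt0 : 0 < ca) (Hca : norm_equiv S ca Ca).

Lemma nrm_le_norm1 w : H01 S w -> nrm Om w.1 <= norm1 S w.
Proof.
move=> Hw; have [w1 w2] := H01_L2pair Hw.
rewrite /nrm /norm1 ler_sqrt; last exact: (si_ge0 b1_si (H01_L2pair Hw)).
by rewrite lerDl sumr_ge0// => i _; exact: (si_ge0 ip_si (w2 i)).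
Qed.

(** Positivity on all of H^1_0 is read off the norm equivalence: where it failed the
    square root would vanish, and with it the H^1 norm and the form itself. *)
Lemma aform_ge0 u : H01 S u -> 0 <= aform S u u.
Proof.
move=> Hu; have pu := H01_L2pair Hu; have [u1 u2] := pu.
rewrite leNgt; apply/negP => lt0.
have n0 : norm1 S u = 0.
  have /andP[+ _] := Hca Hu; rewrite /anorm (ler0_sqrtr (ltW lt0)) => n0.
  rewrite (pmulr_rle0 _ ca_gt0) in n0.
  by apply/eqP; rewrite eq_le n0 norm1E snorm_ge0.
have bu : b1 u u = 0 by rewrite -(snorm_sqr b1_si pu) -norm1E n0 expr0n.
have B0 : ip Om u.1 u.1 = 0 /\ forall i, ip Om (fun x => u.2 x 0 i) (fun x => u.2 x 0 i) = 0.
  have s0 i : 0 <= ip Om (fun x => u.2 x 0 i) (fun x => u.2 x 0 i) by exact: (si_ge0 ip_si (u2 i)).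
  move/eqP: bu; rewrite /b1 paddr_eq0 ?sumr_ge0//; last exact: (si_ge0 ip_si u1).
  move=> /andP[/eqP -> ]; rewrite psumr_eq0// => /allP H; split=> // i.
  by apply/eqP; apply: H; rewrite mem_index_enum.
suff E : aform S u u = 0 by rewrite E ltxx in lt0.
have nul f : sqint mu Om f -> ip Om f f = 0 -> forall g, sqint mu Om g -> ip Om g f = 0.
  move=> sf f0 g sg; rewrite ipC; apply: (si_null ip_si) => //.
  by rewrite /snorm -ipE f0 sqrtr0.
rewrite aformE// big1 ?add0r; last first.
  move=> i _; apply: nul; [exact: u2|exact: B0.2|].
  by apply: sqint_sum; [exact: measurable_dom|move=> j; exact: sqint_coefA].
by apply: nul; [exact: u1|exact: B0.1|exact: sqint_pot].
Qed.

Lemma a_si : semi_inner (H01 S) (aform S).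
Proof.
split.
- exact: H01D.
- exact: H01Z.
- by move=> u v _ _; exact: aformC.
- by move=> u v w Hu Hv Hw; apply: aform_addl; exact: H01_L2pair.
- by move=> a u v Hu Hv; apply: aform_scalel; exact: H01_L2pair.
- exact: aform_ge0.
Qed.

Definition b0 u v : R := ip Om u.1 v.1.

Lemma b0_si : semi_inner (H01 S) b0.
Proof.
split.
- exact: H01D.
- exact: H01Z.
- by move=> u v _ _; exact: ipC.
- by move=> u v w /H01_L2pair[u1 _] /H01_L2pair[v1 _] /H01_L2pair[w1 _]; exact: ipD1.
- by move=> a u v /H01_L2pair[u1 _] /H01_L2pair[v1 _]; exact: ipZ1.
- by move=> u /H01_L2pair[u1 _]; exact: (si_ge0 ip_si u1).
Qed.

Lemma anormE u : anorm S u = snorm (aform S) u. Proof. by []. Qed.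
Lemma nrmE u : nrm Om u.1 = snorm b0 u. Proof. by []. Qed.

Lemma poincare w : H01 S w -> nrm Om w.1 <= anorm S w / ca.
Proof.
move=> Hw; rewrite ler_pdivlMr// mulrC.
have /andP[+ _] := Hca Hw; apply: le_trans; rewrite ler_pM2l//; exact: nrm_le_norm1.
Qed.

(** * Finite element functions *)

Lemma polyn_gradvD (p q : pt -> R) x : polyn p -> polyn q ->
  gradv (fun x => p x + q x) x = gradv p x + gradv q x.
Proof.
by move=> pp pq; apply/rowP => i; rewrite !mxE /pd deriveD//; exact: polyn_derivable.
Qed.

Lemma polyn_gradvZ a (p : pt -> R) x : polyn p ->
  gradv (fun x => a * p x) x = a *: gradv p x.
Proof.
by move=> pp; apply/rowP => i; rewrite !mxE /pd (@deriveZ _ _ _ p a)//; exact: polyn_derivable.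
Qed.

Lemma fespace_H01 M v : fespace S M v -> H01 S v. Proof. by case. Qed.

Lemma fespaceD M u v : packed M -> fespace S M u -> fespace S M v -> fespace S M (u + v).
Proof.
move=> pM [Hu cu bu eu] [Hv cv bv ev]; split.
- exact: H01D.
- by move=> x; apply: continuousD; [exact: cu|exact: cv].
- by move=> x bx; rewrite /= fctE bu// bv// addr0.
- move=> T TM; have U := pk_nd pM TM.
  have [[p pp up] gu] := eu _ TM; have [[q pq vq] gv] := ev _ TM; split.
    exists (fun x => p x + q x); first exact: polyfun_add.
    by move=> x Tx; rewrite /= fctE up// vq.
  move=> x Tx; rewrite /= fctE gu// gv//.
  have oT := open_osimplex U.
  rewrite (gradv_local oT (fun y Ty => up y (osimplex_hull Ty)) Tx).
  rewrite (gradv_local oT (fun y Ty => vq y (osimplex_hull Ty)) Tx).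
  rewrite (@gradv_local _ _ (osimplex T) (u.1 + v.1) (fun x => p x + q x) x oT)//.
    by rewrite polyn_gradvD//; [exact: (polyfun_polyn pp)|exact: (polyfun_polyn pq)].
  by move=> y /osimplex_hull Ty; rewrite fctE up// vq.
Qed.

Lemma fespaceZ M a u : packed M -> fespace S M u -> fespace S M (a *: u).
Proof.
move=> pM [Hu cu bu eu]; split.
- exact: H01Z.
- move=> x; apply: (@continuousM _ _ (fun=> a) (u.1 : subspace (closure Om) -> R));
    [exact: cst_continuous|exact: cu].
- by move=> x bx; rewrite /= fctE bu// scaler0.
- move=> T TM; have U := pk_nd pM TM.
  have [[p pp up] gu] := eu _ TM; split.
    exists (fun x => a * p x); first exact: polyfun_scale.
    by move=> x Tx; rewrite /= fctE up.
  move=> x Tx; rewrite /= fctE gu//.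
  have oT := open_osimplex U.
  rewrite (gradv_local oT (fun y Ty => up y (osimplex_hull Ty)) Tx).
  rewrite (@gradv_local _ _ (osimplex T) (a *: u.1) (fun x => a * p x) x oT)//.
    by rewrite polyn_gradvZ//; exact: (polyfun_polyn pp).
  by move=> y /osimplex_hull Ty; rewrite fctE up.
Qed.

Lemma fespace_sub M M' : packed M -> packed M' ->
  (forall T, T \in M' -> exists2 T', T' \in M & hull T `<=` hull T') ->
  fespace S M `<=` fespace S M'.
Proof.
move=> pM pM' sub v [Hv cv bv ev]; split=> // T TM'.
have [T' T'M TT] := sub _ TM'; have [[p pp vp] gv] := ev _ T'M; split.
  by exists p => // x Tx; apply: vp; exact: TT.
move=> x Tx; apply: gv.
exact: (hull_sub_osimplex (pk_nd pM' TM') (pk_nd pM T'M) TT Tx).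
Qed.

Lemma fespace_cont M v x : fespace S M v -> Om x -> {for x, continuous v.1}.
Proof.
move=> [_ cv _ _] Ox.
have : {within Om, continuous (v.1 : pt -> R)}.
  by apply: continuous_subspaceW cv; exact: subset_closure.
rewrite continuous_open_subspace; last exact: (dom_open HS).
by apply; rewrite inE.
Qed.

(** The energy controls the L2 norm, and a continuous function whose square integrates to
    zero vanishes. *)
Lemma fespace_eq M v w : fespace S M v -> fespace S M w -> anorm S (v - w) = 0 ->
  forall x, Om x -> v.1 x = w.1 x.
Proof.
move=> fv fw d0 x Ox; have Hv := fespace_H01 fv; have Hw := fespace_H01 fw.
have Hd : H01 S (v - w) by exact: (si_sub a_si).
have [sd _] := H01_L2pair Hd.
apply/eqP; rewrite -subr_eq0; apply/eqP.
apply: (prodint_eq0_continuous (dom_open HS) _ sd _ Ox) => [y Oy|].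
  by apply: continuousB; [exact: fespace_cont fv Oy|exact: fespace_cont fw Oy].
have := poincare Hd; rewrite d0 mul0r => n0.
have {}n0 : nrm Om (v - w).1 = 0 by apply/eqP; rewrite eq_le n0 sqrtr_ge0.
by have := snorm_sqr b0_si Hd; rewrite -nrmE n0 expr0n /= => /esym.
Qed.

End Energy.

(** * Piecewise polynomial functions on an element *)

Section Pieces.
Context (R : realType) (n : nat) (S : setting R n) (HS : standing S).
Local Notation pt := 'rV[R]_n.+1.
Local Notation Om := (dom S).
Local Notation mu := (lebesgue_row n.+1).
Implicit Types (f g : pt -> R) (T : simplex R n) (M : mesh R n).

Definition pwpoly T f := exists2 p, polyn p & forall x, hull T x -> f x = p x.

Lemma fespace_pwpoly M v T : fespace S M v -> T \in M -> pwpoly T v.1.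
Proof.
by move=> [_ _ _ ev] /ev[[p pp vp] _]; exists p => //; exact: polyfun_polyn pp.
Qed.

Lemma pwpolyD T f g : pwpoly T f -> pwpoly T g -> pwpoly T (fun x => f x + g x).
Proof.
move=> [p pp fp] [q pq gq]; exists (p + q); first exact: polyn_add.
by move=> x Tx; rewrite fctE fp// gq.
Qed.

Lemma pwpolyZ T a f : pwpoly T f -> pwpoly T (fun x => a * f x).
Proof.
move=> [p pp fp]; exists ((fun=> a) * p); first by apply: polyn_mul => //; exact: polyn_cst.
by move=> x Tx; rewrite fctE fp.
Qed.

Lemma divA_local T f g x : nondegenerate T -> (forall y, osimplex T y -> f y = g y) ->
  osimplex T x -> divA S f x = divA S g x.
Proof.
move=> U fg Tx; have oT := open_osimplex U.
apply: eq_bigr => i _; apply: eq_bigr => j _.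
by rewrite (pd_local j oT fg Tx) (pd_local i oT (fun y Ty => pd_local j oT fg Ty) Tx).
Qed.

Lemma divA_add T f g x : nondegenerate T -> pwpoly T f -> pwpoly T g -> osimplex T x ->
  divA S (fun x => f x + g x) x = divA S f x + divA S g x.
Proof.
move=> U [p pp fp] [q pq gq] Tx.
have fp' y : osimplex T y -> f y = p y by move=> /osimplex_hull/fp.
have gq' y : osimplex T y -> g y = q y by move=> /osimplex_hull/gq.
rewrite (divA_local U fp' Tx) (divA_local U gq' Tx).
rewrite (@divA_local T _ (p + q) x U)//; last by move=> y Ty; rewrite fctE fp'// gq'.
have dD i (a b : pt -> R) : polyn a -> polyn b -> pd i (a + b) = pd i a + pd i b.
  by move=> pa pb; apply/funext => y; rewrite /pd fctE deriveD//; exact: polyn_derivable.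
rewrite /divA -big_split; apply: eq_bigr => i _ /=; rewrite -big_split.
apply: eq_bigr => j _ /=; rewrite dD// dD; try exact: polyn_pd.
by rewrite !fctE !mulrDr addrACA.
Qed.

Lemma divA_scale T a f x : nondegenerate T -> pwpoly T f -> osimplex T x ->
  divA S (fun x => a * f x) x = a * divA S f x.
Proof.
move=> U [p pp fp] Tx.
have fp' y : osimplex T y -> f y = p y by move=> /osimplex_hull/fp.
rewrite (divA_local U fp' Tx).
rewrite (@divA_local T _ (a *: p) x U)//; last by move=> y Ty; rewrite fctE fp'.
have dZ i (b : pt -> R) : polyn b -> pd i (a *: b) = a *: pd i b.
  by move=> pb; apply/funext => y; rewrite /pd fctE deriveZ//; exact: polyn_derivable.
rewrite /divA mulr_sumr; apply: eq_bigr => i _ /=; rewrite mulr_sumr.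
apply: eq_bigr => j _ /=; rewrite dZ// dZ; last exact: polyn_pd.
have sE (g : pt -> R) : (a *: g) x = a * g x by [].
by rewrite !sE mulrDr (mulrCA a (dcoefA S i x i j)) (mulrCA a (coefA S x i j)).
Qed.

Context (M : mesh R n) (cM : conforming Om M).

Lemma mesh_nd T : T \in M -> nondegenerate T.
Proof. by case: cM => nd _ _ _ /nd. Qed.

Lemma mesh_sub T : T \in M -> osimplex T `<=` Om.
Proof. exact: (osimplex_sub_dom (dom_open HS) (dom_lipschitz HS) cM). Qed.

Lemma mesh_hull T : T \in M -> hull T `<=` closure Om.
Proof. by move=> TM x Tx; case: cM => _ <- _ _; exists T. Qed.

Lemma measurable_osimplex T : T \in M -> measurable (osimplex T).
Proof. by move=> TM; apply: measurable_open; apply: open_osimplex; exact: mesh_nd. Qed.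

Lemma osimplex_finite T : T \in M -> (mu (osimplex T) < +oo)%E.
Proof.
move=> TM; apply: le_lt_trans (dom_finite HS).
apply: le_measure; rewrite ?inE; [exact: measurable_osimplex|exact: (measurable_dom HS)|].
exact: mesh_sub.
Qed.

Lemma sqint_polyn T p : T \in M -> polyn p -> sqint mu (osimplex T) p.
Proof.
move=> TM pp; have [B HB] := dom_bound HS.
have [C HC] := polyn_bounded B pp.
apply: (sqint_bounded (measurable_osimplex TM) (osimplex_finite TM) (C := C)).
  apply: measurable_fun_open_continuous; first by apply: open_osimplex; exact: mesh_nd.
  by move=> x _; exact: polyn_continuous.
move=> x /(mesh_sub TM) Ox; apply: HC; apply: HB; exact: subset_closure.
Qed.

Lemma sqint_pwpoly T f : T \in M -> pwpoly T f -> sqint mu (osimplex T) f.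
Proof.
move=> TM [p pp fp]; apply: (sqint_eq (measurable_osimplex TM) _ (sqint_polyn TM pp)).
by move=> x /osimplex_hull/fp.
Qed.

Lemma sqint_LinftyM T f g : T \in M -> Linfty Om f -> sqint mu (osimplex T) g ->
  sqint mu (osimplex T) (fun x => f x * g x).
Proof.
move=> TM [mf [C HC]]; apply: (sqint_bndM (measurable_osimplex TM) (C := C)).
  by apply: measurable_funS mf; [exact: (measurable_dom HS)|exact: mesh_sub].
by apply: filterS HC => x H Tx; apply: H; exact: mesh_sub Tx.
Qed.

Lemma sqint_divA T f : T \in M -> pwpoly T f -> sqint mu (osimplex T) (divA S f).
Proof.
move=> TM [p pp fp]; have mT := measurable_osimplex TM.
apply: (@sqint_eq _ _ _ mu _ mT (divA S p)).
  by move=> x Tx; apply/esym; apply: (divA_local (mesh_nd TM) _ Tx) => y /osimplex_hull/fp.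
apply: sqint_sum => // i; apply: sqint_sum => // j; apply: sqintD => //.
  apply: (sqint_LinftyM TM); first exact: (dcoefA_bnd HS).
  by apply: sqint_polyn => //; exact: polyn_pd.
apply: (sqint_LinftyM TM); first exact: (coefA_bnd HS).
by apply: sqint_polyn => //; apply: polyn_pd; exact: polyn_pd.
Qed.

Lemma sqint_resid T f g : T \in M -> sqint mu (osimplex T) f -> pwpoly T g ->
  sqint mu (osimplex T) (resid S f g).
Proof.
move=> TM sf pg; have mT := measurable_osimplex TM.
apply: sqintB => //; last first.
  by apply: (sqint_LinftyM TM); [exact: (pot_bnd HS)|exact: sqint_pwpoly].
by apply: sqintD => //; exact: sqint_divA.
Qed.

Lemma resid_local T f g g' x : T \in M -> (forall y, osimplex T y -> g y = g' y) ->
  osimplex T x -> resid S f g x = resid S f g' x.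
Proof. by move=> TM gg Tx; rewrite /resid (divA_local (mesh_nd TM) gg Tx) gg. Qed.

Lemma resid_add T f f' g g' x : T \in M -> pwpoly T g -> pwpoly T g' -> osimplex T x ->
  resid S (fun x => f x + f' x) (fun x => g x + g' x) x = resid S f g x + resid S f' g' x.
Proof.
move=> TM pg pg' Tx; rewrite /resid (divA_add (mesh_nd TM) pg pg' Tx).
move: (divA S g x) (divA S g' x) (pot S x) (f x) (f' x) (g x) (g' x) => a b c d e h k.
ring.
Qed.

Lemma resid_scale T a f g x : T \in M -> pwpoly T g -> osimplex T x ->
  resid S (fun x => a * f x) (fun x => a * g x) x = a * resid S f g x.
Proof. move=> TM pg Tx; rewrite /resid (divA_scale a (mesh_nd TM) pg Tx).
by rewrite mulrBr mulrDr [in RHS]mulrCA. Qed.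

Lemma residE f g x : f x - Lop S g x = resid S f g x.
Proof. by rewrite /resid /Lop opprD opprK addrA. Qed.

End Pieces.

(** * Estimator and oscillation *)

Section Estimator.
Context (R : realType) (n : nat) (S : setting R n) (HS : standing S).
Local Notation pt := 'rV[R]_n.+1.
Local Notation V := (sobfun R n).
Local Notation Om := (dom S).
Local Notation mu := (lebesgue_row n.+1).
Implicit Types (f g : pt -> R) (T : simplex R n) (M : mesh R n).

Lemma ref_simplex_bound (t : 'rV[R]_n) : ref_simplex t -> forall i, `|t 0 i| <= 1.
Proof.
move=> [t0 t1] i; rewrite ger0_norm; last exact/ltW/t0.
apply: le_trans (ltW t1).
by rewrite (bigD1 i)//= lerDl sumr_ge0// => j _; exact: ltW.
Qed.

Lemma open_ref_simplex : open (@ref_simplex R n).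
Proof.
rewrite openE => t [t0 t1].
have h1 : \forall s \near t, forall i, 0 < (s : 'rV[R]_n) 0 i.
  apply: (@filter_forall _ _ (fun i (s : 'rV[R]_n) => 0 < s 0 i) (nbhs t)) => i.
  apply: (@coord_continuous _ _ _ 0 i t [set u | 0 < u]).
  exact: lt_nbhsr.
have h2 : \forall s \near t, \sum_j (s : 'rV[R]_n) 0 j < 1.
  have cs : continuous (fun s : 'rV[R]_n => \sum_j s 0 j).
    by move=> s; apply: continuous_bigsum => j; exact: coord_continuous.
  by apply: (cs t [set u | u < 1]); exact: lt_nbhsl.
by apply: filterS2 h1 h2 => s; split.
Qed.

Definition measurable_ref := measurable_open open_ref_simplex.

Lemma ref_simplex_finite : (lebesgue_row n (@ref_simplex R n) < +oo)%E.
Proof.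
apply: (lebesgue_bounded (C := 1)); first exact: measurable_ref.
exact: ref_simplex_bound.
Qed.

Lemma continuous_facet_pt T i : continuous (facet_pt T i).
Proof.
move=> t; apply: (@cvg_row _ _ _ (nbhs t) (facet_pt T i) (facet_pt T i t)) => k.
pose V : 'M[R]_n.+1 := row' i T.1.
pose B : 'M[R]_(n, n.+1) := \matrix_(j < n) (row (lift ord0 j) V - row ord0 V).
have E : (fun s : 'rV[R]_n => facet_pt T i s 0 k) = (fun s => row ord0 V 0 k + \sum_j s 0 j * B j k).
  by apply/funext => s; rewrite /facet_pt -/V -/B mxE [X in _ + X]mxE.
have c : continuous (fun s : 'rV[R]_n => row ord0 V 0 k + \sum_j s 0 j * B j k).
  move=> s; apply: (@continuousD _ _ _ (fun=> row ord0 V 0 k)); first exact: cst_continuous.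
  exact: continuous_linear_form.
have := c t; rewrite -E; exact.
Qed.

Context (M : mesh R n) (cM : conforming Om M).

Let nd := mesh_nd cM.

(** The facets that two elements share lie in the domain, where A is continuous. *)
Lemma shared_facet_dom T T' i i' t : T \in M -> T' \in M -> T' != T ->
  facet T i = facet T' i' -> ref_simplex t ->
  [/\ Om (facet_pt T i t), hull T (facet_pt T i t) & hull T' (facet_pt T i t)].
Proof.
move=> TM T'M ne FF rt; have U := nd TM; have [b0 b1] := bary_facet_pt i U rt.
have HT : hull T (facet_pt T i t).
  by apply/(hullP _ U) => j; have [->|/b1/ltW//] := eqVneq j i; rewrite b0.
split=> //.
  apply: (lipschitz_interior_closure (dom_open HS) (dom_lipschitz HS)).
  exact: (facet_interior cM TM T'M ne FF b0 b1).
have : facet T i (facet_pt T i t) by apply/(facetP _ _ U).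
by rewrite FF; exact: subface_hull.
Qed.

Lemma jump_add T i T' i' f g x : T \in M -> T' \in M -> hull T x -> hull T' x ->
  pwpoly T f -> pwpoly T g -> pwpoly T' f -> pwpoly T' g ->
  jump S T i T' i' (fun x => f x + g x) x = jump S T i T' i' f x + jump S T i T' i' g x.
Proof.
move=> TM T'M Tx T'x pf pg pf' pg'.
have tD T0 : T0 \in M -> hull T0 x -> pwpoly T0 f -> pwpoly T0 g ->
    tgrad T0 (fun x => f x + g x) x = tgrad T0 f x + tgrad T0 g x.
  move=> T0M T0x [p pp fp] [q pq gq]; have U := nd T0M.
  rewrite (@tgradE _ _ T0 f p x U pp (fun y Ty => fp y (osimplex_hull Ty)) T0x).
  rewrite (@tgradE _ _ T0 g q x U pq (fun y Ty => gq y (osimplex_hull Ty)) T0x).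
  rewrite (@tgradE _ _ T0 _ (p + q) x U (polyn_add pp pq) _ T0x); first exact: polyn_gradvD.
  by move=> y /osimplex_hull Ty; rewrite fctE fp// gq.
have dD (a b c : pt) : dotv (a + b) c = dotv a c + dotv b c.
  by rewrite /dotv -big_split; apply: eq_bigr => k _ /=; rewrite mxE mulrDl.
by rewrite /jump !tD// !mulmxDl !dD !opprD addrACA.
Qed.

Lemma jump_scale T i T' i' a f x : T \in M -> T' \in M -> hull T x -> hull T' x ->
  pwpoly T f -> pwpoly T' f ->
  jump S T i T' i' (fun x => a * f x) x = a * jump S T i T' i' f x.
Proof.
move=> TM T'M Tx T'x pf pf'.
have tZ T0 : T0 \in M -> hull T0 x -> pwpoly T0 f ->
    tgrad T0 (fun x => a * f x) x = a *: tgrad T0 f x.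
  move=> T0M T0x [p pp fp]; have U := nd T0M.
  rewrite (@tgradE _ _ T0 f p x U pp (fun y Ty => fp y (osimplex_hull Ty)) T0x).
  rewrite (@tgradE _ _ T0 _ ((fun=> a) * p) x U _ _ T0x); first exact: polyn_gradvZ.
    by apply: polyn_mul => //; exact: polyn_cst.
  by move=> y /osimplex_hull Ty; rewrite fctE fp.
have dZ (b c : pt) : dotv (a *: b) c = a * dotv b c.
  by rewrite /dotv mulr_sumr; apply: eq_bigr => k _ /=; rewrite mxE mulrA.
by rewrite /jump !tZ// -!scalemxAl !dZ mulrBr mulrN.
Qed.

Lemma jump_local T i T' i' f g x : T \in M -> T' \in M -> hull T x -> hull T' x ->
  pwpoly T f -> pwpoly T' f ->
  (forall y, osimplex T y -> f y = g y) -> (forall y, osimplex T' y -> f y = g y) ->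
  jump S T i T' i' f x = jump S T i T' i' g x.
Proof.
move=> TM T'M Tx T'x pf pf' e e'.
have tL T0 : T0 \in M -> hull T0 x -> pwpoly T0 f -> (forall y, osimplex T0 y -> f y = g y) ->
    tgrad T0 f x = tgrad T0 g x.
  move=> T0M T0x [p pp fp] e0; have U := nd T0M.
  rewrite (@tgradE _ _ T0 f p x U pp (fun y Ty => fp y (osimplex_hull Ty)) T0x).
  rewrite (@tgradE _ _ T0 g p x U pp _ T0x)// => y Ty.
  by rewrite -e0//; apply: fp; exact: osimplex_hull.
by rewrite /jump !tL.
Qed.

Lemma sqint_jump T i T' i' f : T \in M -> T' \in M -> T' != T ->
  facet T i = facet T' i' -> pwpoly T f -> pwpoly T' f ->
  sqint (lebesgue_row n) (@ref_simplex R n) (fun t => jump S T i T' i' f (facet_pt T i t)).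
Proof.
move=> TM T'M ne FF [p pp fp] [q pq fq].
have U := nd TM; have U' := nd T'M.
have rd t : ref_simplex t -> _ := @shared_facet_dom T T' i i' t TM T'M ne FF.
have piece (p0 : pt -> R) (nu : pt) : polyn p0 ->
  sqint (lebesgue_row n) (@ref_simplex R n)
   (fun t => dotv (gradv p0 (facet_pt T i t) *m (coefA S (facet_pt T i t))^T) nu).
  move=> pp0.
  apply: (@sqint_eq _ _ _ (lebesgue_row n) _ measurable_ref
    (fun t => \sum_j \sum_k (pd k p0 (facet_pt T i t) * coefA S (facet_pt T i t) j k) * nu 0 j)).
    move=> t _; apply: eq_bigr => j _; rewrite mxE mulr_suml; apply: eq_bigr => k _.
    by rewrite !mxE.
  apply: sqint_sum; [exact: measurable_ref|move=> j].
  apply: sqint_sum; [exact: measurable_ref|move=> k].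
  have := @sqintZ _ _ _ (lebesgue_row n) _ measurable_ref (nu 0 j)
     (fun t => pd k p0 (facet_pt T i t) * coefA S (facet_pt T i t) j k).
  move=> H; apply: (sqint_eq measurable_ref _ (H _)); first by move=> t _; rewrite mulrC.
  have [B HB] := dom_bound HS.
  have [C HC] := polyn_bounded B (polyn_pd k pp0).
  have [mA [CA HCA]] := coefA_bnd HS j k.
  have cA y : Om y -> {for y, continuous (fun x => coefA S x j k)}.
    move=> Oy; have := @coefA_cont _ _ _ HS j k.
    rewrite continuous_open_subspace; last exact: (dom_open HS).
    by apply; rewrite inE.
  have bA := ae_bound_continuous (dom_open HS) cA HCA.
  apply: (sqint_bounded measurable_ref ref_simplex_finite (C := C * CA)).
    apply: measurable_fun_open_continuous; first exact: open_ref_simplex.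
    move=> t /rd[Ox _ _]; apply: continuousM.
      apply: (@continuous_comp _ _ _ (facet_pt T i) (pd k p0)); first exact: continuous_facet_pt.
      by apply: polyn_continuous; exact: polyn_pd.
    apply: (@continuous_comp _ _ _ (facet_pt T i) (fun x => coefA S x j k)); first exact: continuous_facet_pt.
    exact: cA.
  move=> t /rd[Ox _ _]; rewrite normrM; apply: ler_pM => //; last exact: bA.
  by apply: HC; apply: HB; exact: subset_closure.
have := sqintB measurable_ref (sqintN measurable_ref (piece p (outer_normal T i) pp))
  (piece q (outer_normal T' i') pq).
apply: sqint_eq; first exact: measurable_ref.
move=> t /rd[_ Tx T'x]; rewrite /jump.
rewrite (@tgradE _ _ T f p _ U pp (fun y Ty => fp y (osimplex_hull Ty)) Tx).
by rewrite (@tgradE _ _ T' f q _ U' pq (fun y Ty => fq y (osimplex_hull Ty)) T'x).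
Qed.

Lemma diam_ge0 (D : set pt) : 0 <= diam D.
Proof.
rewrite /diam; have [hs|hs] := pselect (has_sup [set enorm (x - y) | x in D & y in D]); last first.
  by rewrite sup_out.
have [[z [x Dx [y Dy E]]] ub] := hs.
apply: le_trans (_ : enorm (x - y) <= _); first exact: sqrtr_ge0.
by apply: ub_le_sup => //; exists x => //; exists y.
Qed.

Definition fcoef T (i : 'I_n.+2) : R :=
  let V : 'M[R]_n.+1 := row' i T.1 in
  let B : 'M[R]_(n, n.+1) := \matrix_(j < n) (row (lift ord0 j) V - row ord0 V) in
  Num.sqrt (\det (B *m B^T)).

Definition fint T i g : R := prodint (lebesgue_row n) (@ref_simplex R n)
  (fun t => g (facet_pt T i t)) (fun t => g (facet_pt T i t)).

Definition pwp f := forall T, T \in M -> pwpoly T f.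
Definition pw2 f := forall T, T \in M -> sqint mu (osimplex T) f.

Definition jump2 T i T' i' f : R :=
  if `[< facet T i = facet T' i' >]
  then (diam (facet T i) * fcoef T i) * fint T i (jump S T i T' i' f) else 0.

Lemma eta2E f g T : eta2 S M f g T = diamT T ^+ 2 * nrm (osimplex T) (resid S f g) ^+ 2 +
  \sum_i \sum_(T' <- M | T' != T) \sum_i' jump2 T i T' i' g.
Proof.
rewrite /eta2; apply: f_equal2; first by [].
apply: eq_bigr => i _; apply: eq_bigr => T' _; apply: eq_bigr => i' _.
by rewrite /jump2; case: asboolP => // _; rewrite -mulrA.
Qed.

Lemma jcoef_ge0 T i : 0 <= diam (facet T i) * fcoef T i.
Proof. by apply: mulr_ge0; [exact: diam_ge0|exact: sqrtr_ge0]. Qed.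

Lemma nrm_sqr T f : T \in M -> sqint mu (osimplex T) f ->
  nrm (osimplex T) f ^+ 2 = prodint mu (osimplex T) f f.
Proof.
move=> TM sf; exact: (snorm_sqr (prodint_semi_inner mu (measurable_osimplex cM TM)) sf).
Qed.

Lemma jump2_ge0 T i T' i' g : 0 <= jump2 T i T' i' g.
Proof.
rewrite /jump2; case: asboolP => // _; apply: mulr_ge0; first exact: jcoef_ge0.
by apply: Rintegral_ge0 => t _; rewrite -expr2 sqr_ge0.
Qed.

Lemma eta2_ge0 f g T : 0 <= eta2 S M f g T.
Proof.
rewrite eta2E; apply: addr_ge0; first by apply: mulr_ge0; exact: sqr_ge0.
by apply: sumr_ge0 => i _; apply: sumr_ge0 => T' _; apply: sumr_ge0 => i' _; exact: jump2_ge0.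
Qed.

Lemma young_scale (c a b x y z : R) : 0 <= c -> x <= a * y + b * z ->
  c * x <= a * (c * y) + b * (c * z).
Proof. by move=> c0 h; rewrite mulrCA (mulrCA b) -mulrDr; exact: ler_wpM2l. Qed.

Lemma young_subst (a b x y z x' y' z' : R) : x = x' -> y = y' -> z = z' ->
  x' <= a * y' + b * z' -> x <= a * y + b * z.
Proof. by move=> -> -> ->. Qed.

Lemma scale_subst (a x y x' y' : R) : x = x' -> y = y' -> x' = a * y' -> x = a * y.
Proof. by move=> -> ->. Qed.

Lemma young_add (a b x y z w : R) :
  a * x + b * y + (a * z + b * w) = a * (x + z) + b * (y + w).
Proof. ring. Qed.

Lemma jump2_young (d : R) T i T' i' f g : 0 < d -> pwp f -> pwp g -> T \in M -> T' \in M ->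
  T' != T -> jump2 T i T' i' (fun x => f x + g x)
    <= (1 + d) * jump2 T i T' i' f + (1 + d^-1) * jump2 T i T' i' g.
Proof.
move=> d0 pf pg TM T'M ne; rewrite /jump2; case: asboolP => FF; last first.
  by rewrite !mulr0 addr0.
apply: young_scale; first exact: jcoef_ge0.
have := si_young (prodint_semi_inner (lebesgue_row n) measurable_ref)
  (sqint_jump TM T'M ne FF (pf _ TM) (pf _ T'M))
  (sqint_jump TM T'M ne FF (pg _ TM) (pg _ T'M)) d0.
apply: le_trans; rewrite le_eqVlt; apply/orP; left; apply/eqP.
have E t : ref_simplex t -> jump S T i T' i' (fun x => f x + g x) (facet_pt T i t) =
  jump S T i T' i' f (facet_pt T i t) + jump S T i T' i' g (facet_pt T i t).
  move=> rt; have [_ Tx T'x] := shared_facet_dom TM T'M ne FF rt.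
  exact: (jump_add i i' TM T'M Tx T'x (pf _ TM) (pg _ TM) (pf _ T'M) (pg _ T'M)).
exact: eq_prodint.
Qed.

Lemma eta2_young (d : R) f f' g g' T : 0 < d -> pw2 f -> pw2 f' -> pwp g -> pwp g' -> T \in M ->
  eta2 S M (fun x => f x + f' x) (fun x => g x + g' x) T
    <= (1 + d) * eta2 S M f g T + (1 + d^-1) * eta2 S M f' g' T.
Proof.
move=> d0 sf sf' pg pg' TM; rewrite !eta2E.
have H : \sum_i \sum_(T' <- M | T' != T) \sum_i' jump2 T i T' i' (fun x => g x + g' x) <=
  (1 + d) * \sum_i \sum_(T' <- M | T' != T) \sum_i' jump2 T i T' i' g +
  (1 + d^-1) * \sum_i \sum_(T' <- M | T' != T) \sum_i' jump2 T i T' i' g'.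
  apply: ler_sum_lin => i _ _; apply: ler_sum_lin => T' T'M ne.
  by apply: ler_sum_lin => i' _ _; exact: jump2_young.
have mT := measurable_osimplex cM TM.
have s1 := sqint_resid HS cM TM (sf _ TM) (pg _ TM).
have s2 := sqint_resid HS cM TM (sf' _ TM) (pg' _ TM).
have s3 := sqint_resid HS cM TM (sqintD mT (sf _ TM) (sf' _ TM)) (pwpolyD (pg _ TM) (pg' _ TM)).
have Y := si_young (prodint_semi_inner mu mT) s1 s2 d0.
have E : nrm (osimplex T) (resid S (fun x => f x + f' x) (fun x => g x + g' x)) ^+ 2 =
    prodint mu (osimplex T) (resid S f g + resid S f' g' : pt -> R^o)
      (resid S f g + resid S f' g' : pt -> R^o).
  rewrite (nrm_sqr TM s3); have e x : osimplex T x -> _ := resid_add cM f f' TM (pg _ TM) (pg' _ TM).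
  by apply: eq_prodint => x Tx; exact: e.
rewrite E (nrm_sqr TM s1) (nrm_sqr TM s2).
have := lerD (young_scale (sqr_ge0 (diamT T)) Y) H.
move/le_trans; apply; rewrite le_eqVlt; apply/orP; left; apply/eqP.
exact: young_add.
Qed.

Lemma jump2_scale a T i T' i' g : pwp g -> T \in M -> T' \in M -> T' != T ->
  jump2 T i T' i' (fun x => a * g x) = a ^+ 2 * jump2 T i T' i' g.
Proof.
move=> pg TM T'M ne; rewrite /jump2; case: asboolP => FF; last by rewrite mulr0.
rewrite [RHS]mulrCA; apply: f_equal2; first by [].
have sj := sqint_jump TM T'M ne FF (pg _ TM) (pg _ T'M).
have si := prodint_semi_inner (lebesgue_row n) measurable_ref.
have E t : ref_simplex t -> jump S T i T' i' (fun x => a * g x) (facet_pt T i t) =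
  a * jump S T i T' i' g (facet_pt T i t).
  move=> rt; have [_ Tx T'x] := shared_facet_dom TM T'M ne FF rt.
  exact: (jump_scale i i' a TM T'M Tx T'x (pg _ TM) (pg _ T'M)).
have := si_scaler si a sj sj => E1.
have := si_scalel si a sj (si_scale si a sj); rewrite E1 mulrA -expr2 => <-.
exact: eq_prodint.
Qed.

Lemma eta2_scale a f g T : pw2 f -> pwp g -> T \in M ->
  eta2 S M (fun x => a * f x) (fun x => a * g x) T = a ^+ 2 * eta2 S M f g T.
Proof.
move=> sf pg TM; rewrite !eta2E [RHS]mulrDr; apply: f_equal2; last first.
  apply: eq_sum_scale => i _ _; apply: eq_sum_scale => T' T'M ne.
  by apply: eq_sum_scale => i' _ _; exact: jump2_scale.
have mT := measurable_osimplex cM TM.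
have s1 := sqint_resid HS cM TM (sf _ TM) (pg _ TM).
have s3 := sqint_resid HS cM TM (sqintZ mT a (sf _ TM)) (pwpolyZ a (pg _ TM)).
have si := prodint_semi_inner mu mT.
rewrite (nrm_sqr TM s3) (nrm_sqr TM s1) [RHS]mulrCA; apply: f_equal2; first by [].
have E1 := si_scaler si a s1 s1.
have := si_scalel si a s1 (si_scale si a s1); rewrite E1 mulrA -expr2 => <-.
have e x : osimplex T x -> _ := resid_scale cM a f TM (pg _ TM).
by apply: eq_prodint => x Tx; exact: e.
Qed.

Lemma eta2_local f g g' T : pwp g -> (forall x, Om x -> g x = g' x) -> T \in M ->
  eta2 S M f g T = eta2 S M f g' T.
Proof.
move=> pg gg TM.
have e T0 : T0 \in M -> forall y, osimplex T0 y -> g y = g' y.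
  by move=> T0M y /(mesh_sub HS cM T0M); exact: gg.
have r x : osimplex T x -> resid S f g x = resid S f g' x.
  exact: (resid_local cM f TM (e _ TM)).
have rr : nrm (osimplex T) (resid S f g) = nrm (osimplex T) (resid S f g').
  by apply: (f_equal Num.sqrt); exact: eq_prodint.
rewrite !eta2E rr; apply: f_equal2; first by [].
apply: eq_bigr => i _; apply: eq_sum_seq => T' T'M ne; apply: eq_bigr => i' _.
rewrite /jump2; case: asboolP => FF; last by [].
apply: f_equal2; first by [].
have E t : ref_simplex t -> jump S T i T' i' g (facet_pt T i t) =
  jump S T i T' i' g' (facet_pt T i t).
  move=> rt; have [_ Tx T'x] := shared_facet_dom TM T'M ne FF rt.
  exact: (jump_local i i' TM T'M Tx T'x (pg _ TM) (pg _ T'M) (e _ TM) (e _ T'M)).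
exact: eq_prodint.
Qed.

Lemma eta_sqr f g : eta S M f g M ^+ 2 = \sum_(T <- M) eta2 S M f g T.
Proof. by apply: sqr_sqrtr; apply: sumr_ge0 => T _; exact: eta2_ge0. Qed.

Lemma eta_young (d : R) f f' g g' : 0 < d -> pw2 f -> pw2 f' -> pwp g -> pwp g' ->
  eta S M (fun x => f x + f' x) (fun x => g x + g' x) M ^+ 2
    <= (1 + d) * eta S M f g M ^+ 2 + (1 + d^-1) * eta S M f' g' M ^+ 2.
Proof.
move=> d0 sf sf' pg pg'.
apply: (young_subst (eta_sqr _ _) (eta_sqr f g) (eta_sqr f' g')).
by apply: ler_sum_lin => T TM _; exact: eta2_young.
Qed.

Lemma eta_scale a f g : pw2 f -> pwp g ->
  eta S M (fun x => a * f x) (fun x => a * g x) M ^+ 2 = a ^+ 2 * eta S M f g M ^+ 2.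
Proof.
move=> sf pg; apply: (scale_subst (eta_sqr _ _) (eta_sqr f g)).
by apply: eq_sum_scale => T TM _; exact: eta2_scale.
Qed.

Lemma eta_local f g g' M' : pwp g -> (forall x, Om x -> g x = g' x) -> (M' `<=` M)%fset ->
  eta S M f g M' = eta S M f g' M'.
Proof.
move=> pg gg /fsubsetP sM; apply: (f_equal Num.sqrt).
by apply: eq_sum_seq => T /sM TM _; exact: eta2_local.
Qed.

End Estimator.

(** * Oscillation *)

Section Oscillation.
Context (R : realType) (n : nat) (S : setting R n) (HS : standing S).
Local Notation pt := 'rV[R]_n.+1.
Local Notation Om := (dom S).
Local Notation mu := (lebesgue_row n.+1).
Implicit Types (f g : pt -> R) (T : simplex R n) (M : mesh R n).

Definition oscT T g : R := nrm (osimplex T) (fun x => diamT T * (g x - projP S T g x)).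

Lemma oscE M g : osc S g M ^+ 2 = \sum_(T <- M) oscT T g ^+ 2.
Proof. by apply: sqr_sqrtr; apply: sumr_ge0 => T _; exact: sqr_ge0. Qed.

Lemma osc_ge0 M g : 0 <= osc S g M. Proof. exact: sqrtr_ge0. Qed.

Section OnMesh.
Context (M : mesh R n) (cM : conforming Om M).

Lemma sqint_proj T g : T \in M -> sqint mu (osimplex T) g -> sqint mu (osimplex T) (projP S T g).
Proof.
move=> TM sg; have [/polyfun_polyn pp _] := projP_spec HS (mesh_nd cM TM) sg.
exact: (sqint_polyn HS cM TM pp).
Qed.

Lemma oscT_sqr T g : T \in M -> sqint mu (osimplex T) g ->
  oscT T g ^+ 2 = diamT T ^+ 2 *
    prodint mu (osimplex T) (fun x => g x - projP S T g x) (fun x => g x - projP S T g x).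
Proof.
move=> TM sg; have mT := measurable_osimplex cM TM.
have sd := sqintB mT sg (sqint_proj TM sg).
have si := prodint_semi_inner mu mT.
rewrite /oscT (nrm_sqr cM TM (sqintZ mT (diamT T) sd)).
have E1 := si_scaler si (diamT T) sd sd.
by have := si_scalel si (diamT T) sd (si_scale si (diamT T) sd); rewrite E1 mulrA -expr2.
Qed.

(** P_T g is the best approximation, whatever representative is used. *)
Lemma proj_best T g q : T \in M -> sqint mu (osimplex T) g -> polyfun (odeg S) q ->
  prodint mu (osimplex T) (fun x => g x - projP S T g x) (fun x => g x - projP S T g x)
  <= prodint mu (osimplex T) (fun x => g x - q x) (fun x => g x - q x).
Proof.
move=> TM sg pq; have mT := measurable_osimplex cM TM.
have [pP orth] := projP_spec HS (mesh_nd cM TM) sg.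
have sP := sqint_proj TM sg; have sq := sqint_polyn HS cM TM (polyfun_polyn pq).
have sd := sqintB mT sg sP; have se := sqintB mT sP sq.
have si := prodint_semi_inner mu mT.
have pd : polyfun (odeg S) (fun x => projP S T g x - q x).
  have := polyfun_add pP (polyfun_scale (-1) pq).
  by rewrite (_ : (fun x => projP S T g x + -1 * q x) = fun x => projP S T g x - q x)//;
    apply/funext => x; rewrite mulN1r.
have o := orth _ pd.
have E := si_sqrD si sd se.
have e0 := si_ge0 si se.
have -> : prodint mu (osimplex T) (fun x => g x - q x) (fun x => g x - q x) =
  prodint mu (osimplex T) ((fun x => g x - projP S T g x) + (fun x => projP S T g x - q x) : pt -> R^o)
   ((fun x => g x - projP S T g x) + (fun x => projP S T g x - q x) : pt -> R^o).
  by apply: eq_prodint => x _; rewrite fctE addrA subrK.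
have drop (a b c : R) : b = 0 -> 0 <= c -> a <= a + 2 * b + c.
  by move=> -> c0; rewrite mulr0 addr0 lerDl.
rewrite E; exact: drop o e0.
Qed.

Lemma oscT_local T g g' : T \in M -> sqint mu (osimplex T) g ->
  (forall x, osimplex T x -> g x = g' x) -> oscT T g ^+ 2 = oscT T g' ^+ 2.
Proof.
move=> TM sg gg; have mT := measurable_osimplex cM TM.
have sg' := sqint_eq mT gg sg.
rewrite !oscT_sqr//; congr (_ * _).
have [pP _] := projP_spec HS (mesh_nd cM TM) sg.
have [pP' _] := projP_spec HS (mesh_nd cM TM) sg'.
apply: le_anti; apply/andP; split.
  apply: le_trans (proj_best TM sg pP') _; rewrite le_eqVlt; apply/orP; left; apply/eqP.
  by apply: eq_prodint => x Tx; rewrite gg.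
apply: le_trans (proj_best TM sg' pP) _; rewrite le_eqVlt; apply/orP; left; apply/eqP.
by apply: eq_prodint => x Tx; rewrite gg.
Qed.

Lemma osc_local g g' : (forall T, T \in M -> sqint mu (osimplex T) g) ->
  (forall x, Om x -> g x = g' x) -> osc S g M = osc S g' M.
Proof.
move=> sg gg; apply: (f_equal Num.sqrt); apply: eq_sum_seq => T TM _.
apply: oscT_local => //; first exact: sg.
by move=> x /(mesh_sub HS cM TM); exact: gg.
Qed.

Lemma osc_scale_le a g : (forall T, T \in M -> sqint mu (osimplex T) g) ->
  osc S (fun x => a * g x) M ^+ 2 <= a ^+ 2 * osc S g M ^+ 2.
Proof.
move=> sg; rewrite (oscE M (fun x => a * g x)) (oscE M g) mulr_sumr.
apply: ler_sum_seq => T TM _; have mT := measurable_osimplex cM TM.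
have sT := sg _ TM; have sP := sqint_proj TM sT; have sd := sqintB mT sT sP.
rewrite (oscT_sqr TM (sqintZ mT a sT)) (oscT_sqr TM sT) mulrCA.
apply: ler_wpM2l; first exact: sqr_ge0.
have [pP _] := projP_spec HS (mesh_nd cM TM) sT.
apply: le_trans (proj_best TM (sqintZ mT a sT) (polyfun_scale a pP)) _.
have si := prodint_semi_inner mu mT.
have E1 := si_scaler si a sd sd.
have := si_scalel si a sd (si_scale si a sd); rewrite E1 mulrA -expr2 => <-.
rewrite le_eqVlt; apply/orP; left; apply/eqP.
by apply: eq_prodint => x _; rewrite -mulrBr.
Qed.

Lemma sqint_Lop T g : T \in M -> pwpoly T g -> sqint mu (osimplex T) (Lop S g).
Proof.
move=> TM pg; have mT := measurable_osimplex cM TM.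
apply: (sqintD mT); first exact: (sqintN mT (sqint_divA HS cM TM pg)).
by apply: (sqint_LinftyM HS cM TM (pot_bnd HS)); exact: (sqint_pwpoly HS cM TM pg).
Qed.

Lemma osc_Lop_scale a g : pwp M g -> osc S (Lop S (fun x => a * g x)) M ^+ 2
  <= a ^+ 2 * osc S (Lop S g) M ^+ 2.
Proof.
move=> pg; have sL T : T \in M -> sqint mu (osimplex T) (Lop S g).
  by move=> TM; apply: sqint_Lop => //; exact: pg.
apply: le_trans (osc_scale_le a sL); rewrite le_eqVlt; apply/orP; left; apply/eqP.
rewrite (oscE M (Lop S (fun x => a * g x))) (oscE M (fun x => a * Lop S g x)).
apply: eq_sum_seq => T TM _; apply: oscT_local => //.
  by apply: sqint_Lop => //; apply: pwpolyZ; exact: pg.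
move=> x Tx; rewrite /Lop (divA_scale S a (mesh_nd cM TM) (pg _ TM) Tx).
by rewrite mulrDr mulrN (mulrCA a).
Qed.

(** Dropping the projection and the jumps turns the oscillation of the residual into
    part of the estimator. *)
Lemma osc_le_eta f g : (forall T, T \in M -> sqint mu (osimplex T) f) -> pwp M g ->
  osc S (fun x => f x - Lop S g x) M <= eta S M f g M.
Proof.
move=> sf pg; rewrite -(ler_pXn2r (n := 2))// ?nnegrE ?sqrtr_ge0//.
rewrite (eta_sqr S M f g) (oscE M (fun x => f x - Lop S g x)).
apply: ler_sum_seq => T TM _; have mT := measurable_osimplex cM TM.
have sr := sqint_resid HS cM TM (sf _ TM) (pg _ TM).
have e x : osimplex T x -> f x - Lop S g x = resid S f g x by move=> _; exact: residE.
have sd : sqint mu (osimplex T) (fun x => f x - Lop S g x).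
  by apply: (sqint_eq mT _ sr) => x Tx; rewrite e.
rewrite (oscT_local TM sd e) (oscT_sqr TM sr) (eta2E S M f g T) (nrm_sqr cM TM sr).
apply: ler_wpDr.
  by apply: sumr_ge0 => i _; apply: sumr_ge0 => T' _; apply: sumr_ge0 => i' _; exact: jump2_ge0.
apply: ler_wpM2l; first exact: sqr_ge0.
have p0 : polyfun (odeg S) (fun _ : pt => 0 : R) by exact: polyfun0.
apply: le_trans (proj_best TM sr p0) _; rewrite le_eqVlt; apply/orP; left; apply/eqP.
by apply: eq_prodint => x _; rewrite subr0.
Qed.

Lemma osc_Lop0 : osc S (Lop S (fun=> 0)) M = 0.
Proof.
have E : Lop S (fun=> 0) = (fun=> 0 : R).
  apply/funext => x; rewrite /Lop mulr0 addr0 /divA.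
  have pd0 i : pd i (fun _ : pt => 0 : R) = fun=> 0.
    by apply/funext => y; rewrite /pd derive_cst.
  rewrite big1 ?oppr0// => i _; rewrite big1// => j _.
  by rewrite !pd0 !mulr0 addr0.
apply/eqP; rewrite -sqrf_eq0 (oscE M (Lop S (fun=> 0))) E; apply/eqP.
have s0 T : T \in M -> sqint mu (osimplex T) (fun _ : pt => 0 : R).
  by move=> TM; exact: (sqint0 mu (measurable_osimplex cM TM)).
rewrite (@eq_sum_seq _ _ _ _ _ (fun=> 0)) ?big1// => T TM _.
rewrite (oscT_sqr TM (s0 _ TM)).
have si := prodint_semi_inner mu (measurable_osimplex cM TM).
have sd := sqintB (measurable_osimplex cM TM) (s0 _ TM) (sqint_proj TM (s0 _ TM)).
have := proj_best TM (s0 _ TM) (polyfun0 R n (odeg S)).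
have -> : prodint mu (osimplex T) (fun _ : pt => 0 - 0 : R) (fun=> 0 - 0) = 0.
  rewrite /prodint (_ : (fun x => _) = fun=> 0).
    by rewrite Rintegral_cst ?mul0r//; exact: (measurable_osimplex cM TM).
  by apply/funext => x; rewrite subr0 mul0r.
move=> le0; have ge0 := si_ge0 si sd.
have /eqP -> : prodint mu (osimplex T) (fun x => 0 - projP S T (fun=> 0) x)
   (fun x => 0 - projP S T (fun=> 0) x) == 0 by rewrite eq_le le0 ge0.
by rewrite mulr0.
Qed.

End OnMesh.

Lemma enorm_bound (B : R) (x y : pt) : (forall i, `|x 0 i| <= B) -> (forall i, `|y 0 i| <= B) ->
  enorm (x - y) <= Num.sqrt (\sum_(i < n.+1) (2 * B) ^+ 2).
Proof.
move=> xB yB; apply: ler_wsqrtr; apply: ler_sum => i _; rewrite -expr2 !mxE.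
have H : `|x 0 i - y 0 i| <= 2 * B.
  by apply: le_trans (ler_normB _ _) _; have := xB i; have := yB i; lra.
by rewrite -[leLHS]real_normK ?num_real//; apply: lerXn2r => //; rewrite nnegrE//; apply: le_trans H.
Qed.

Lemma diam_mono (B : R) (D D' : set pt) : D' !=set0 -> D' `<=` D ->
  (forall x, D x -> forall i, `|x 0 i| <= B) -> diam D' <= diam D.
Proof.
move=> [z Dz] DD DB.
have ub : has_ubound [set enorm (x - y) | x in D & y in D].
  exists (Num.sqrt (\sum_(i < n.+1) (2 * B) ^+ 2)) => _ [x Dx [y Dy <-]].
  by apply: enorm_bound; exact: DB.
apply: sup_le_ub; first by exists (enorm (z - z)); exists z => //; exists z.
move=> _ [x Dx [y Dy <-]]; apply: ub_le_sup => //.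
by exists x; [exact: DD|exists y; [exact: DD|]].
Qed.

(** Refinement can only decrease the oscillation: elements shrink, and the coarse
    projection competes with the fine ones. *)
Lemma osc_mono M N g : conforming Om M -> conforming Om N ->
  (forall T, T \in N -> exists2 T', T' \in M & hull T `<=` hull T') ->
  (forall T, T \in M -> sqint mu (osimplex T) g) -> osc S g N <= osc S g M.
Proof.
move=> cM cN sub sg; rewrite -(ler_pXn2r (n := 2))// ?nnegrE ?osc_ge0//.
rewrite (oscE N g) (oscE M g).
pose c T T' := `[< hull T `<=` hull T' >].
pose J T T' := diamT T' ^+ 2 * prodint mu (osimplex T)
   (fun x => g x - projP S T' g x) (fun x => g x - projP S T' g x).
have osub T T' : T \in N -> T' \in M -> c T T' -> osimplex T `<=` osimplex T'.
  move=> TN T'M /asboolP; apply: hull_sub_osimplex; [exact: (mesh_nd cN)|exact: (mesh_nd cM)].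
have sd T' : T' \in M -> sqint mu (osimplex T') (fun x => g x - projP S T' g x).
  by move=> T'M; exact: (sqintB (measurable_osimplex cM T'M) (sg _ T'M) (sqint_proj cM T'M (sg _ T'M))).
have J0 T T' : T \in N -> 0 <= J T T'.
  move=> TN; apply: mulr_ge0; first exact: sqr_ge0.
  by apply: Rintegral_ge0 => x _; rewrite -expr2 sqr_ge0.
apply: (@le_trans _ _ (\sum_(T <- N) \sum_(T' <- M | c T T') J T T')).
  apply: ler_sum_seq => T TN _; have mT := measurable_osimplex cN TN.
  have [T' T'M TT] := sub _ TN; have cTT : c T T' by apply/asboolP.
  rewrite (big_rem T')//= cTT; apply: ler_wpDr.
    by apply: sumr_ge0 => T0 _; exact: J0.
  have oTT := osub _ _ TN T'M cTT.
  have sgT : sqint mu (osimplex T) g.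
    exact: (sqint_sub (measurable_osimplex cM T'M) mT oTT (sg _ T'M)).
  rewrite (oscT_sqr cN TN sgT).
  have [pP _] := projP_spec HS (mesh_nd cM T'M) (sg _ T'M).
  apply: ler_pM; [exact: sqr_ge0| | |exact: (proj_best cN TN sgT pP)].
    by apply: Rintegral_ge0 => x _; rewrite -expr2 sqr_ge0.
  apply: lerXn2r; rewrite ?nnegrE ?diam_ge0//.
  have [B HB] := dom_bound HS.
  apply: (@diam_mono B) => //; first by exists (vtx T ord0); exact: vtx_hull.
  by move=> x /(mesh_hull cM T'M); exact: HB.
rewrite (exchange_big_dep xpredT)//=.
apply: ler_sum_seq => T' T'M _; rewrite -mulr_sumr (oscT_sqr cM T'M (sg _ T'M)).
apply: ler_wpM2l; first exact: sqr_ge0.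
rewrite -big_filter.
apply: sum_prodint_le.
- exact: (measurable_osimplex cM T'M).
- by move=> T; rewrite mem_filter => /andP[_ /(measurable_osimplex cN)].
- by rewrite filter_uniq// fset_uniq.
- by move=> T; rewrite mem_filter => /andP[cT TN]; exact: osub.
- move=> T1 T2; rewrite !mem_filter => /andP[_ N1] /andP[_ N2].
  exact: (pk_dj (conforming_packed cN)).
- exact: sd.
Qed.

End Oscillation.

(** * The ground state *)

(** Energy form a and L2 form b on an abstract space; lam and uh are the first
    eigenpair. *)
Section GroundState.
Context (R : realType) (V : lmodType R) (H : set V) (a b : V -> V -> R).
Context (asi : semi_inner H a) (bsi : semi_inner H b).
Context (ca : R) (ca_gt0 : 0 < ca).
Local Notation N := (snorm a).
Local Notation l2 := (snorm b).
Hypothesis l2_N : forall u, H u -> l2 u <= N u / ca.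
Context (lam : R) (lam_gt0 : 0 < lam) (uh : V) (H_uh : H uh) (a_uhuh : a uh uh = 1).
Hypothesis a_uh : forall v, H v -> a uh v = lam * b uh v.
Implicit Types u v w z f g : V.

Lemma HZ c u : H u -> H (c *: u). Proof. exact: (si_scale asi). Qed.
Lemma HB u v : H u -> H v -> H (u - v). Proof. exact: (si_sub asi). Qed.

Lemma N_ge0 u : 0 <= N u. Proof. exact: sqrtr_ge0. Qed.
Lemma N_sqr u : H u -> N u ^+ 2 = a u u. Proof. exact: (snorm_sqr asi). Qed.
Lemma N_D u v : H u -> H v -> N (u + v) <= N u + N v. Proof. exact: (snormD asi). Qed.
Lemma N_B u v : H u -> H v -> N (u - v) <= N u + N v. Proof. exact: (snorm_subD asi). Qed.
Lemma N_Z c u : H u -> N (c *: u) = `|c| * N u. Proof. exact: (snormZ asi). Qed.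
Lemma N_sym u v : H u -> H v -> N (u - v) = N (v - u). Proof. exact: (snormB asi). Qed.
Lemma a_D u v w : H u -> H v -> H w -> a (u + v) w = a u w + a v w.
Proof. exact: (si_addl asi). Qed.
Lemma a_B u v w : H u -> H v -> H w -> a (u - v) w = a u w - a v w.
Proof. exact: (si_subl asi). Qed.
Lemma a_Br u v w : H u -> H v -> H w -> a w (u - v) = a w u - a w v.
Proof. exact: (si_subr asi). Qed.
Lemma a_Z c u v : H u -> H v -> a (c *: u) v = c * a u v.
Proof. exact: (si_scalel asi). Qed.
Lemma a_Zr c u v : H u -> H v -> a u (c *: v) = c * a u v.
Proof. exact: (si_scaler asi). Qed.
Lemma a_C u v : H u -> H v -> a u v = a v u. Proof. exact: (si_sym asi). Qed.

Lemma N_eq u v : H u -> H v -> N (u - v) = 0 -> N u = N v.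
Proof.
move=> Hu Hv d0; apply: le_anti; apply/andP; split.
  by have := snorm_lip asi Hu Hv; rewrite d0 addr0.
by have := snorm_lip asi Hv Hu; rewrite (N_sym Hv Hu) d0 addr0.
Qed.

Lemma l2_ge0 u : 0 <= l2 u. Proof. exact: sqrtr_ge0. Qed.
Lemma l2_sqr u : H u -> l2 u ^+ 2 = b u u. Proof. exact: (snorm_sqr bsi). Qed.
Lemma l2_D u v : H u -> H v -> l2 (u + v) <= l2 u + l2 v. Proof. exact: (snormD bsi). Qed.
Lemma l2_B u v : H u -> H v -> l2 (u - v) <= l2 u + l2 v. Proof. exact: (snorm_subD bsi). Qed.
Lemma l2_Z c u : H u -> l2 (c *: u) = `|c| * l2 u. Proof. exact: (snormZ bsi). Qed.
Lemma b_cs u v : H u -> H v -> `|b u v| <= l2 u * l2 v. Proof. exact: (si_cs bsi). Qed.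
Lemma b_B u v w : H u -> H v -> H w -> b (u - v) w = b u w - b v w.
Proof. exact: (si_subl bsi). Qed.
Lemma b_Z c u v : H u -> H v -> b (c *: u) v = c * b u v.
Proof. exact: (si_scalel bsi). Qed.
Lemma b_C u v : H u -> H v -> b u v = b v u. Proof. exact: (si_sym bsi). Qed.
Lemma l2_eq u v : H u -> H v -> N (u - v) = 0 -> l2 u = l2 v.
Proof.
move=> Hu Hv d0; have Hd := HB Hu Hv.
have l0 : l2 (u - v) = 0.
  by apply/eqP; rewrite eq_le l2_ge0 andbT (le_trans (l2_N Hd))// d0 mul0r.
apply: le_anti; apply/andP; split.
  by have := snorm_lip bsi Hu Hv; rewrite l0 addr0.
by have := snorm_lip bsi Hv Hu; rewrite -(snormB bsi Hu Hv) l0 addr0.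
Qed.

(** Test with z itself. *)
Lemma N_load z g : H z -> H g -> (forall v, H v -> a z v = b g v) -> N z <= l2 g / ca.
Proof.
move=> Hz Hg zg; have [->|z0] := eqVneq (N z) 0.
  by rewrite divr_ge0 ?l2_ge0// ltW.
have z1 : 0 < N z by rewrite lt_neqAle eq_sym z0 N_ge0.
rewrite -(ler_pM2r z1) -expr2 (N_sqr Hz) zg//.
apply: le_trans (ler_norm _) _; apply: le_trans (b_cs Hg Hz) _.
by rewrite mulrAC -mulrA; apply: ler_wpM2l; [exact: l2_ge0|exact: l2_N].
Qed.

Lemma N_eq0 z : H z -> (forall v, H v -> a z v = 0) -> N z = 0.
Proof.
by move=> Hz z0; apply/eqP; rewrite -sqrf_eq0 (N_sqr Hz) z0.
Qed.

(** The component along the first eigenfunction and the remainder. *)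
Definition cc v := a v uh.
Definition ww v := v - cc v *: uh.

Lemma H_ww v : H v -> H (ww v).
Proof. by move=> Hv; apply: HB => //; exact: HZ. Qed.

Lemma a_ww_uh v : H v -> a (ww v) uh = 0.
Proof.
move=> Hv; rewrite a_B//; last exact: HZ.
by rewrite a_Z// a_uhuh mulr1 subrr.
Qed.

Lemma b_ww_uh v : H v -> b (ww v) uh = 0.
Proof.
move=> Hv; have := a_ww_uh Hv; rewrite a_C ?a_uh//; try exact: H_ww.
move=> /eqP.
rewrite mulf_eq0 gt_eqF//= => /eqP E.
by rewrite b_C//; exact: H_ww.
Qed.

Lemma cc_b v : H v -> cc v = lam * b uh v.
Proof. by move=> Hv; rewrite /cc a_C// a_uh. Qed.

Lemma N_pyth v : H v -> N v ^+ 2 = cc v ^+ 2 + N (ww v) ^+ 2.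
Proof.
move=> Hv; have Hw := H_ww Hv.
rewrite (N_sqr Hw) {2}/ww a_Br//; last exact: HZ.
rewrite a_Zr// (a_ww_uh Hv) mulr0 subr0 a_B//; last exact: HZ.
rewrite a_Z// (a_C H_uh)// -/(cc v) (N_sqr Hv); ring.
Qed.

Lemma l2_ww_le v : H v -> l2 (ww v) <= l2 v.
Proof.
move=> Hv; have Hw := H_ww Hv.
rewrite -(ler_pXn2r (n := 2))// ?nnegrE ?l2_ge0// (l2_sqr Hv) (l2_sqr Hw).
have -> : b v v = b (ww v) (ww v) + cc v ^+ 2 * b uh uh.
  have Hc := HZ (cc v) H_uh.
  have {1 2}-> : v = ww v + cc v *: uh by rewrite subrK.
  rewrite (si_sqrD bsi Hw Hc) (si_scaler bsi _ Hw H_uh) (b_ww_uh Hv) !mulr0 addr0.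
  by rewrite (b_Z _ H_uh Hc) (si_scaler bsi _ H_uh H_uh) mulrA -expr2.
by rewrite lerDl mulr_ge0 ?sqr_ge0// (si_ge0 bsi H_uh).
Qed.

Lemma N_ww_le v : H v -> N (ww v) <= N v.
Proof.
move=> Hv; rewrite -(ler_pXn2r (n := 2))// ?nnegrE ?N_ge0// (N_pyth Hv).
by rewrite lerDr sqr_ge0.
Qed.

Lemma cc_le v : H v -> `|cc v| <= N v.
Proof.
move=> Hv; rewrite -(ler_pXn2r (n := 2))// ?nnegrE ?N_ge0// (N_pyth Hv).
by rewrite real_normK ?num_real// lerDl sqr_ge0.
Qed.

Lemma ww_Z c v : H v -> ww (c *: v) = c *: ww v.
Proof. by move=> Hv; rewrite /ww /cc a_Z// scalerBr scalerA. Qed.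

Lemma ww_B u v : H u -> H v -> ww (u - v) = ww u - ww v.
Proof.
move=> Hu Hv; rewrite /ww /cc a_B// scalerBl !opprD !opprK.
by rewrite addrACA.
Qed.

(** The first eigenspace is a line: every other eigenfunction belongs to a larger
    eigenvalue, and the eigenfunctions are complete. *)
Lemma eigenspace_line (e : nat -> V) (mu : nat -> R) v : e 0%N = uh ->
  (forall i, H (e i)) -> (forall i, lam < mu i.+1) ->
  (forall i w, H w -> a (e i) w = mu i * b (e i) w) ->
  (forall w, H w -> (forall i, a w (e i) = 0) -> N w = 0) ->
  H v -> (forall w, H w -> a v w = lam * b v w) -> N (ww v) = 0.
Proof.
move=> e0 He gap ee compl Hv ev; have Hw := H_ww Hv.
apply: compl => // -[|i]; first by rewrite e0 a_ww_uh.
have Hi := He i.+1.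
have ew : a (ww v) (e i.+1) = lam * b (ww v) (e i.+1).
  rewrite a_B//; last exact: HZ.
  rewrite a_Z// ev// a_uh// b_B//; last exact: HZ.
  by rewrite b_Z// mulrBr mulrCA.
have := ee i.+1 _ Hw; rewrite a_C// ew b_C// => /eqP.
rewrite -subr_eq0 -mulrBl mulf_eq0 subr_eq0 lt_eqF//= => /eqP bE.
by rewrite bE mulr0.
Qed.

Lemma proj_null v p : H v -> H p -> N (ww p) = 0 -> a (v - p) uh = 0 ->
  N (v - p) = N (ww v) /\ l2 (v - p) = l2 (ww v).
Proof.
move=> Hv Hp l0 o; have Hd := HB Hv Hp; have Hw := H_ww Hv.
have cE : cc p = cc v by move: o; rewrite a_B// => /eqP; rewrite subr_eq0 => /eqP.
have d0 : N (v - p - ww v) = 0.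
  have -> : v - p - ww v = (-1) *: ww p.
    by rewrite /ww cE scaleN1r !opprB addrC addrA subrK addrC.
  by rewrite N_Z ?l0 ?mulr0//; exact: H_ww.
by split; [exact: N_eq|exact: l2_eq].
Qed.

(** * The solution operator *)

Context (KK : V -> V).
Hypothesis KK_H : forall g, H g -> H (KK g).
Hypothesis KK_spec : forall g v, H g -> H v -> a (KK g) v = b g v.

Lemma N_KK g : H g -> N (KK g) <= l2 g / ca.
Proof. by move=> Hg; apply: N_load => //; [exact: KK_H|move=> v; exact: KK_spec]. Qed.

Lemma cc_KK g : H g -> cc (KK g) = cc g / lam.
Proof.
move=> Hg; rewrite {1}/cc KK_spec// (cc_b Hg) b_C//.
by rewrite mulrAC mulfV ?mul1r// gt_eqF.
Qed.

Lemma ww_KK_load g v : H g -> H v -> a (ww (KK g)) v = b (ww g) v.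
Proof.
move=> Hg Hv; rewrite a_B//; [|exact: KK_H|exact: HZ].
rewrite a_Z// (KK_spec Hg Hv) (cc_KK Hg) (a_uh Hv) b_B//; last exact: HZ.
by rewrite b_Z// mulrA divfK// gt_eqF.
Qed.

Lemma N_ww_KK g : H g -> N (ww (KK g)) <= l2 (ww g) / ca.
Proof.
move=> Hg; apply: N_load; [exact/H_ww/KK_H|exact: H_ww|].
by move=> v; exact: ww_KK_load.
Qed.

(** * One discrete solve *)

(** A Galerkin solution in a subspace X, together with the duality estimate for its
    error in terms of a small number e. *)
Section DiscreteSolve.
Context (X : set V) (XH : X `<=` H) (f ub : V) (e : R).
Hypothesis (e_ge0 : 0 <= e) (Hf : H f) (Xub : X ub).
Hypothesis ub_sol : forall v, X v -> a ub v = b f v.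
Let r := KK f - ub.
Hypothesis dual : l2 r <= e * N r.

Let Hub : H ub := XH Xub.
Let HKf : H (KK f) := KK_H Hf.

Lemma H_err : H r. Proof. exact: HB. Qed.

Lemma err_orth v : X v -> a r v = 0.
Proof. by move=> Xv; rewrite a_B//; [rewrite KK_spec ?ub_sol ?subrr//|]; exact: XH. Qed.

Lemma err_sqr : N r ^+ 2 = b f r.
Proof.
have Hr := H_err; have E : a r r = a r (KK f) - a r ub by rewrite -a_Br.
by rewrite (N_sqr Hr) E (err_orth Xub) subr0 a_C// KK_spec.
Qed.

Lemma err_small : N r <= e * l2 f.
Proof.
have Hr := H_err; have [->|r0] := eqVneq (N r) 0; first by rewrite mulr_ge0// l2_ge0.
have r1 : 0 < N r by rewrite lt_neqAle eq_sym r0 N_ge0.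
rewrite -(ler_pM2r r1) -expr2 err_sqr.
apply: le_trans (ler_norm _) _; apply: le_trans (b_cs Hf Hr) _.
by rewrite mulrAC mulrC; apply: ler_wpM2r => //; exact: l2_ge0.
Qed.

Lemma err_le : N r <= N (KK f).
Proof.
have Hr := H_err; rewrite -(ler_pXn2r (n := 2))// ?nnegrE ?N_ge0//.
rewrite (N_sqr Hr) (N_sqr HKf).
have {1 2}-> : KK f = r + ub by rewrite subrK.
by rewrite (si_sqrD asi Hr Hub) (err_orth Xub) mulr0 addr0 lerDl (si_ge0 asi Hub).
Qed.

Lemma N_sol_le : N ub <= N (KK f).
Proof.
have Hr := H_err; rewrite -(ler_pXn2r (n := 2))// ?nnegrE ?N_ge0//.
rewrite (N_sqr Hub) (N_sqr HKf).
have {1 2}-> : KK f = r + ub by rewrite subrK.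
by rewrite (si_sqrD asi Hr Hub) (err_orth Xub) mulr0 addr0 lerDr (si_ge0 asi Hr).
Qed.

Lemma ww_ub : ww ub = ww (KK f) - ww r.
Proof. by rewrite -ww_B//; [rewrite opprB addrC subrK|exact: H_err]. Qed.

Lemma N_ww_sol : N (ww ub) <= N r + l2 (ww f) / ca.
Proof.
rewrite ww_ub; apply: le_trans (N_B (H_ww HKf) (H_ww H_err)) _.
by rewrite addrC; apply: lerD; [exact: N_ww_le H_err|exact: N_ww_KK].
Qed.

Lemma l2_ww_sol : l2 (ww ub) <= l2 (ww f) / ca ^+ 2 + e * N r.
Proof.
rewrite ww_ub; apply: le_trans (l2_B (H_ww HKf) (H_ww H_err)) _.
apply: lerD; last exact: le_trans (l2_ww_le H_err) dual.
apply: le_trans (l2_N (H_ww HKf)) _.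
by rewrite expr2 invfM mulrA ler_pM2r ?invr_gt0// N_ww_KK.
Qed.

Lemma N_KK_upper : N f = 1 -> N (KK f) <= lam^-1 + l2 (ww f) / ca.
Proof.
move=> f1; have -> : KK f = cc (KK f) *: uh + ww (KK f) by rewrite addrC subrK.
apply: le_trans (N_D (HZ _ H_uh) (H_ww HKf)) _; apply: lerD; last exact: N_ww_KK.
rewrite N_Z// cc_KK// normrM (gtr0_norm (x := lam^-1)) ?invr_gt0//.
have -> : N uh = 1 by rewrite /snorm a_uhuh sqrtr1.
rewrite mulr1 ler_piMl//; first by rewrite invr_ge0 ltW.
by rewrite -f1; exact: cc_le.
Qed.

Lemma N_sol_upper : N f = 1 -> N ub <= lam^-1 + l2 (ww f) / ca.
Proof. by move=> f1; apply: le_trans N_sol_le _; exact: N_KK_upper. Qed.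

Lemma N_sol_lower : `|cc f| / lam <= N ub + lam * l2 uh * (e * N r).
Proof.
have -> : `|cc f| / lam = `|cc (KK f)|.
  by rewrite cc_KK// normrM (gtr0_norm (x := lam^-1)) ?invr_gt0.
have -> : cc (KK f) = cc ub + cc r.
  by rewrite /cc -a_D//; [rewrite addrC subrK|exact: H_err].
apply: le_trans (ler_normD _ _) _; apply: lerD; first exact: cc_le.
rewrite (cc_b H_err) normrM gtr0_norm// -mulrA; apply: ler_wpM2l; first exact: ltW.
apply: le_trans (b_cs H_uh H_err) _; apply: ler_wpM2l dual; exact: l2_ge0.
Qed.

(** The norm of the solution is close to the reciprocal of the eigenvalue, so that
    normalising it costs a bounded factor. *)
Lemma N_sol_near : N f = 1 -> N (ww f) <= 4^-1 -> lam * (l2 (ww f) / ca) <= 4^-1 ->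
  lam * (lam * (l2 uh * (e * (e / ca)))) <= 10^-1 -> 4 / 5 <= lam * N ub <= 5 / 4.
Proof.
move=> f1 wf tf ef; have W0 := N_ge0 (ww f).
have up := N_sol_upper f1; have lo := N_sol_lower.
have lf : l2 f <= ca^-1 by have := l2_N Hf; rewrite f1 div1r.
have rs : N r <= e / ca by apply: le_trans err_small _; apply: ler_wpM2l.
apply/andP; split; last first.
  apply: le_trans (ler_wpM2l (ltW lam_gt0) up) _.
  rewrite mulrDr divff ?gt_eqF//; apply: le_trans (lerD (lexx 1) tf) _; lra.
have cf : 15 / 16 <= `|cc f|.
  have p0 : (0 : R) <= 15 / 16 by lra.
  rewrite -(ler_pXn2r (n := 2))// real_normK ?num_real//; have := N_pyth Hf; rewrite f1 expr1n.
  by move: (N (ww f)) wf W0 => x x1 x0; move: (cc f ^+ 2) => y; nra.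
have lo' : `|cc f| <= lam * N ub + lam * (lam * (l2 uh * (e * (e / ca)))).
  have -> : `|cc f| = lam * (`|cc f| / lam) by rewrite mulrCA divff ?mulr1// gt_eqF.
  apply: le_trans (ler_wpM2l (ltW lam_gt0) lo) _; rewrite mulrDr lerD2l.
  apply: ler_wpM2l; first exact: ltW.
  rewrite -mulrA; apply: ler_wpM2l; first exact: ltW.
  apply: ler_wpM2l; first exact: l2_ge0.
  by apply: ler_wpM2l.
by move: (lam * N ub) lo' ef cf => x; move: (lam * (lam * _)) `|cc f| => y z; lra.
Qed.

Lemma normalized_sol : 4 / 5 <= lam * N ub -> let u := (N ub)^-1 *: ub in
  [/\ N u = 1, N (ww u) <= 5 / 4 * lam * (N r + l2 (ww f) / ca) &
      l2 (ww u) <= 5 / 4 * lam * (l2 (ww f) / ca ^+ 2 + e * N r)].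
Proof.
move=> lo u; have n0 : 0 < N ub by rewrite -(pmulr_rgt0 _ lam_gt0); lra.
have inv : (N ub)^-1 <= 5 / 4 * lam.
  by rewrite -[leLHS]mul1r ler_pdivrMr// -mulrA; lra.
have i0 : 0 <= (N ub)^-1 by rewrite invr_ge0 ltW.
have sc (m : V -> R) x y : 0 <= x -> m (ww u) = `|(N ub)^-1| * x -> x <= y ->
    m (ww u) <= 5 / 4 * lam * y.
  by move=> x0 -> xy; rewrite ger0_norm//; apply: ler_pM.
have Hw := H_ww Hub; split.
- by rewrite /u N_Z// ger0_norm// mulVf// gt_eqF.
- apply: sc (N_ge0 (ww ub)) _ N_ww_sol.
  by rewrite /u ww_Z// N_Z.
- apply: sc (l2_ge0 (ww ub)) _ l2_ww_sol.
  by rewrite /u ww_Z// l2_Z.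
Qed.

End DiscreteSolve.

(** The factor c matches the components along uh, so that only the two remainders are
    left. *)
Lemma KK_near_line f u c : H f -> H u -> cc u != 0 -> c = cc f / (lam * cc u) ->
  N (KK f - c *: u) ^+ 2 <= 2 * (l2 (ww f) / ca) ^+ 2 + 2 * (c ^+ 2 * N (ww u) ^+ 2).
Proof.
move=> Hf Hu u0 cd; have HKf := KK_H Hf; have Wu := H_ww Hu; have Wf := H_ww HKf.
have cE : cc (KK f) = c * cc u by rewrite cc_KK// cd invfM mulrA divfK.
have -> : KK f - c *: u = ww (KK f) - c *: ww u.
  by rewrite /ww scalerBr scalerA cE opprB addrA subrK.
have tri := N_B Wf (HZ c Wu); have Nf := N_ww_KK Hf.
have sq (x y z : R) : 0 <= x -> x <= y + z -> 0 <= y -> 0 <= z -> x ^+ 2 <= 2 * y ^+ 2 + 2 * z ^+ 2.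
  move=> x0 xyz y0 z0; apply: le_trans (_ : (y + z) ^+ 2 <= _).
    by rewrite lerXn2r// nnegrE ?addr_ge0.
  by have := sqr_ge0 (y - z); rewrite sqrrB sqrrD; lra.
apply: le_trans (sq _ _ _ (N_ge0 _) tri (N_ge0 _) (N_ge0 _)) _.
rewrite (N_Z c Wu) exprMn real_normK ?num_real// lerD2r ler_pM2l//.
by rewrite lerXn2r// nnegrE ?N_ge0// (le_trans (N_ge0 _) Nf).
Qed.

(** The unit vectors u and uh have the same distance from the line spanned by the
    other. *)
Lemma line_dist s u : H u -> N u = 1 -> s ^+ 2 = 1 -> N (s *: uh - (s * cc u) *: u) = N (ww u).
Proof.
move=> Hu u1 s2; have Hc := HZ (cc u) Hu.
have -> : s *: uh - (s * cc u) *: u = s *: (uh - cc u *: u) by rewrite scalerBr scalerA.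
rewrite N_Z; last exact: HB.
have s1 : `|s| = 1.
  by apply/eqP; rewrite -(eqrXn2 (n := 2))// ?ler01// expr1n real_normK ?num_real// s2.
rewrite s1 mul1r; apply/eqP; rewrite -(eqrXn2 (n := 2))// ?N_ge0//; apply/eqP.
have := N_pyth Hu; rewrite u1 expr1n => E.
rewrite (N_sqr (HB H_uh Hc)) (si_sqrD asi H_uh (si_opp asi Hc)) (si_oppr asi H_uh Hc).
rewrite (si_oppl asi Hc (si_opp asi Hc)) (si_oppr asi Hc Hc) opprK a_uhuh.
rewrite (a_Zr _ H_uh Hu) (a_Z _ Hu Hc) (a_Zr _ Hu Hu) (a_C H_uh Hu) -/(cc u).
by rewrite -(N_sqr Hu) u1; lra.
Qed.

Lemma circle_diff (p q x y : R) : 0 <= p * q -> 0 <= x <= 2^-1 -> 0 <= y <= 2^-1 ->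
  1 = p ^+ 2 + x ^+ 2 -> 1 = q ^+ 2 + y ^+ 2 -> `|q - p| <= x ^+ 2 + y ^+ 2.
Proof.
move=> pq /andP[x0 x1] /andP[y0 y1] Ep Eq.
have s1 : 1 <= `|q + p|.
  rewrite -(ler_pXn2r (n := 2))// ?nnegrE// expr1n real_normK ?num_real//; nra.
apply: le_trans (_ : `|q - p| * `|q + p| <= _); first by rewrite ler_peMr.
rewrite -normrM -subr_sqr (_ : q ^+ 2 - p ^+ 2 = x ^+ 2 - y ^+ 2); last lra.
have := sqr_ge0 x; have := sqr_ge0 y => *; rewrite ler_norml; apply/andP; split; lra.
Qed.

(** The components along uh are cosines, so up to sign they differ to second order in the
    energy remainders. *)
Lemma unit_diff f g : H f -> H g -> N f = 1 -> N g = 1 -> N (ww f) <= 2^-1 -> N (ww g) <= 2^-1 ->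
  exists2 s : R, s ^+ 2 = 1 &
  l2 (g - s *: f) <= l2 uh * (N (ww f) ^+ 2 + N (ww g) ^+ 2) + l2 (ww f) + l2 (ww g).
Proof.
move=> Hf Hg f1 g1 wf wg; have Wf := H_ww Hf; have Wg := H_ww Hg.
have := N_pyth Hf; have := N_pyth Hg; rewrite f1 g1 !expr1n.
set x := N (ww f) in wf *; set y := N (ww g) in wg *.
have x0 : 0 <= x := N_ge0 _; have y0 : 0 <= y := N_ge0 _.
set cf := cc f; set cg := cc g => Eg Ef.
have [s s2 sd] : exists2 s : R, s ^+ 2 = 1 & `|cg - s * cf| <= x ^+ 2 + y ^+ 2.
  have x01 : 0 <= x <= 2^-1 by rewrite x0.
  have y01 : 0 <= y <= 2^-1 by rewrite y0.
  have [sg|sg] := leP 0 (cf * cg).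
    by exists 1; rewrite ?expr1n// mul1r; exact: circle_diff.
  exists (-1); first by rewrite sqrrN expr1n.
  rewrite mulN1r; apply: circle_diff; rewrite ?sqrrN//.
  by rewrite mulNr oppr_ge0 ltW.
exists s => //.
have sn : `|s| = 1.
  by apply/eqP; rewrite -(eqrXn2 (n := 2))// ?ler01// expr1n real_normK ?num_real// s2.
have -> : g - s *: f = (cg - s * cf) *: uh + (ww g - s *: ww f).
  have Eg' : g = ww g + cg *: uh by rewrite subrK.
  have Ef' : s *: f = s *: ww f + (s * cf) *: uh by rewrite -scalerA -scalerDr subrK.
  by rewrite {1}Eg' Ef' opprD addrACA addrC -scalerBl.
have Hs := HZ s Wf.
apply: le_trans (l2_D (HZ _ H_uh) (HB Wg Hs)) _; rewrite -[leRHS]addrA; apply: lerD.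
  by rewrite l2_Z// mulrC; apply: ler_wpM2l => //; exact: l2_ge0.
by apply: le_trans (l2_B Wg Hs) _; rewrite l2_Z// sn mul1r addrC.
Qed.

End GroundState.

(** * The recursion of the adaptive loop *)

Lemma small_eps (R : realType) (s : seq (R * R)) : (forall p, p \in s -> 0 <= p.1 /\ 0 < p.2) ->
  exists2 e : R, 0 < e & forall p, p \in s -> e * p.1 <= p.2.
Proof.
elim: s => [|p s IH] s0; first by exists 1.
have [|e e0 es] := IH; first by move=> q qs; apply: s0; rewrite in_cons qs orbT.
have [p1 p2] := s0 p (mem_head _ _); have q1 : 0 < p.1 + 1 by rewrite ltr_wpDl.
exists (Num.min e (p.2 / (p.1 + 1))); first by rewrite lt_min e0 divr_gt0.
move=> q; rewrite in_cons => /orP[/eqP ->|qs].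
  have m : Num.min e (p.2 / (p.1 + 1)) <= p.2 / (p.1 + 1) by rewrite ge_min lexx orbT.
  apply: le_trans (ler_wpM2r p1 m) _.
  by rewrite mulrAC ler_pdivrMr// ler_pM2l// lerDl.
apply: le_trans (es q qs); apply: ler_wpM2r; last by rewrite ge_min lexx.
by apply: (s0 q _).1; rewrite in_cons qs orbT.
Qed.

Lemma power_below (R : realType) (alpha C x : R) : 0 < alpha < 1 -> 0 <= C -> 0 < x ->
  exists k, alpha ^+ k * C < x.
Proof.
move=> /andP[a0 a1] C0 x0; have a1' : `|alpha| < 1 by rewrite gtr0_norm.
have C1 : 0 < C + 1 by rewrite ltr_wpDl.
have /cvgrPdist_lt /(_ (x / (C + 1)) (divr_gt0 x0 C1)) [k _ kP] := cvg_expr a1'.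
exists k; have := kP k (leqnn k); rewrite /= sub0r normrN gtr0_norm ?exprn_gt0// => h.
have ak : 0 < alpha ^+ k by rewrite exprn_gt0.
rewrite ltr_pdivlMr// in h; apply: le_lt_trans h.
by rewrite ler_pM2l// lerDl.
Qed.

(** The numbers that govern a run. At level k the accepted load has remainder w k in
    energy and t k in L2, the normalised solution has remainders nu k and tau k, the
    estimator is eta k, and the quantity that contracts is E k; the functions with a
    second index are those of the inner loop. The coarse space enters only through the
    small number eps. *)
Section Recursion.
Context (R : realType) (t0 P Q Q2 B q D D0 Hm C1 C2 A k0 th alpha eps : R).
Context (N : nat) (J : nat -> nat) (w t nu tau eta E h : nat -> R).
Context (w_ t_ nu_ eta_ : nat -> nat -> R).
Hypotheses (P0 : 0 <= P) (Q0 : 0 <= Q) (Q20 : 0 <= Q2) (B0 : 0 <= B) (q0 : 0 <= q).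
Hypotheses (D_0 : 0 <= D) (D00 : 0 <= D0) (Hm0 : 0 <= Hm) (C10 : 0 < C1) (C20 : 0 < C2).
Hypotheses (A0 : 0 <= A) (th01 : 0 < th < 1) (al01 : 0 < alpha < 1) (eps0 : 0 < eps).
Hypotheses (w0 : forall k, 0 <= w k) (t_0 : forall k, 0 <= t k) (eta0 : forall k, 0 <= eta k).
Hypotheses (w0_ : forall k j, 0 <= w_ k j) (t0_ : forall k j, 0 <= t_ k j).
Hypothesis etaH : forall k, (1 <= k <= N)%N -> eta k <= Hm.
Hypothesis etaE : forall k, (1 <= k <= N)%N -> eta k <= C1 * E k.
Hypothesis Eeta : forall k, (1 <= k <= N)%N -> E k <= C2 * eta k.
Hypothesis solve : forall k, (1 <= k <= N)%N -> w k <= 4^-1 -> t k <= t0 ->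
  [/\ nu k <= Q * eta k + P * t k, nu k <= Q2 * eps + P * t k &
      tau k <= B * t k + eps * q * eta k].
Hypothesis solve_ : forall k j, (2 <= k <= N)%N -> (j <= J k)%N ->
  w_ k j <= 4^-1 -> t_ k j <= t0 -> nu_ k j <= Q * eta_ k j + P * t_ k j.
Hypothesis first : (1 <= N)%N ->
  [/\ w 1 <= D * eps, t 1 <= D0 * eps * w 1, w 1 = nu 1%N & h 1 = eta 1%N].
Hypothesis last_ : forall k, (2 <= k <= N)%N ->
  [/\ w k = w_ k (J k), t k = t_ k (J k), eta k = eta_ k (J k) &
      th ^+ (J k).+1 * h k.-1 <= eta k].
Hypothesis next0 : forall k, (1 <= k < N)%N -> J k = 0%N -> w_ k.+1 0 = nu k /\ t_ k.+1 0 = tau k.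
Hypothesis nextJ : forall k, (1 <= k < N)%N -> (0 < J k)%N ->
  [/\ w_ k.+1 0 <= D * nu k, w_ k.+1 0 <= D * eps & t_ k.+1 0 <= D0 * eps * w_ k.+1 0%N].
Hypothesis inner : forall k j, (2 <= k <= N)%N -> (j < J k)%N ->
  [/\ eta_ k j <= th ^+ j.+1 * h k.-1, w_ k j.+1 <= D * nu_ k j, w_ k j.+1 <= D * eps &
      t_ k j.+1 <= D0 * eps * w_ k j.+1].
Hypothesis hE : forall k, (2 <= k <= N)%N -> h k = if (0 < J k)%N then eta k else h k.-1.
Hypothesis contr : forall k, (1 <= k < N)%N -> w k <= 4^-1 -> w k.+1 <= 4^-1 ->
  A * (w k ^+ 2 + w k.+1 ^+ 2) + t k + t k.+1 <= k0 * (E k + E k.+1) -> E k.+1 <= alpha * E k.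

(** Along the levels that keep the same reference estimator the L2 remainder may grow by
    the factor B + 1, but E shrinks by alpha; as the estimator stays above a fraction of
    the reference, there are at most N0 such levels. *)
Context (N0 : nat) (N0P : alpha ^+ N0 * C1 * C2 < th).

(** The first three bound the L2 remainder of a load, in units of eps times the reference
    estimator: inside the inner loop, after a correction, and at any level. The last two
    bound its energy remainder, in units of the reference estimator and of eps. *)
Definition inner_cst := D0 * D * (Q + 1).
Definition base_cst := inner_cst / th + q * C1 * C2 + D0 * (D + 2) * (Q * C1 * C2 + 2 * Q + 1).
Definition drift_cst := base_cst * (B + 1) ^+ N0.
Definition energy_cst := (D + 1) * (Q * C1 * C2 + 2 * Q + 1) / th.
Definition small_cst := Q2 + P * drift_cst * Hm + D.

Let th0 : 0 < th. Proof. by case/andP: th01. Qed.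
Let th1 : th < 1. Proof. by case/andP: th01. Qed.
Let c50 : 0 <= inner_cst.
Proof. by rewrite /inner_cst; apply: mulr_ge0; rewrite ?mulr_ge0 ?addr_ge0. Qed.

Let QC0 : 0 <= Q * C1 * C2. Proof. by rewrite !mulr_ge0// ltW. Qed.
Let qC0 : 0 <= q * C1 * C2. Proof. by rewrite !mulr_ge0// ltW. Qed.
Let DD0 : 0 <= D0 * (D + 2) * (Q * C1 * C2 + 2 * Q + 1).
Proof. by apply: mulr_ge0; [apply: mulr_ge0|]; rewrite ?addr_ge0// mulr_ge0. Qed.
Let c1_ge0 : 0 <= base_cst. Proof. by rewrite /base_cst !addr_ge0// divr_ge0// ltW. Qed.
Let BX m : 1 <= (B + 1) ^+ m. Proof. by rewrite exprn_ege1// lerDr. Qed.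
Let c12 : base_cst <= drift_cst. Proof. by rewrite /drift_cst ler_peMr. Qed.
Lemma drift_ge0 : 0 <= drift_cst. Proof. exact: le_trans c12. Qed.
Let c20 := drift_ge0.
Let G0 : 0 <= energy_cst.
Proof.
rewrite /energy_cst; apply: divr_ge0; last exact: ltW.
by apply: mulr_ge0; rewrite !addr_ge0// mulr_ge0.
Qed.
Let be1 : 0 <= Q2 + P * drift_cst * Hm.
Proof. by apply: addr_ge0 => //; apply: mulr_ge0 => //; exact: mulr_ge0. Qed.
Let be0 : 0 <= small_cst. Proof. exact: addr_ge0. Qed.
Let Deb : D <= small_cst. Proof. by rewrite /small_cst lerDr. Qed.

Let Gge : Q * C1 * C2 + 2 * Q + 1 <= energy_cst.
Proof.
have key g : 0 <= g -> g * th <= (D + 1) * g.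
  move=> g0; have x1 : g * th <= g by rewrite ler_piMr// ltW.
  have x2 : 0 <= D * g by rewrite mulr_ge0.
  by rewrite mulrDl mul1r; apply: le_trans x1 _; rewrite lerDr.
by rewrite /energy_cst ler_pdivlMr//; apply: key; move: Q0 QC0; lra.
Qed.

Definition small_enough e :=
  [/\ e * (P * (drift_cst + inner_cst)) <= th / 2, e * small_cst <= 4^-1,
      e * ((drift_cst + inner_cst) * Hm) <= t0 &
  [/\ e * (P * D0) <= 2^-1, e * D0 <= t0 &
      e * ((A * small_cst * energy_cst + drift_cst) * C1 / th) <= k0]].

Lemma small_enough_exists (ext : seq (R * R)) : 0 < t0 -> 0 < k0 ->
  (forall p, p \in ext -> 0 <= p.1 /\ 0 < p.2) ->
  exists2 e, 0 < e & small_enough e /\ forall p, p \in ext -> e * p.1 <= p.2.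
Proof.
move=> t1 k1 ext0.
have di0 : 0 <= drift_cst + inner_cst by rewrite addr_ge0.
have last0 : 0 <= (A * small_cst * energy_cst + drift_cst) * C1 / th.
  apply: divr_ge0; last exact: ltW.
  by apply: mulr_ge0; [apply: addr_ge0 => //; apply: mulr_ge0 => //; exact: mulr_ge0|exact: ltW].
pose s := [:: (P * (drift_cst + inner_cst), th / 2), (small_cst, 4^-1),
  ((drift_cst + inner_cst) * Hm, t0), (P * D0, 2^-1), (D0, t0),
  ((A * small_cst * energy_cst + drift_cst) * C1 / th, k0) & ext].
have s0 p : p \in s -> 0 <= p.1 /\ 0 < p.2.
  rewrite !in_cons => /orP[/eqP ->|/orP[/eqP ->|/orP[/eqP ->|/orP[/eqP ->|/orP[/eqP ->|/orP[/eqP ->|]]]]]];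
    last exact: ext0; split => //=; rewrite ?divr_gt0 ?invr_gt0//; exact: mulr_ge0.
have [e e0 es] := small_eps s0; exists e => //; split.
  have m i : (i < 6)%N -> e * (nth (0, 0) s i).1 <= (nth (0, 0) s i).2.
    by move=> i6; apply: es; rewrite mem_nth//= (leq_trans i6).
  by split; [exact: (m 0)|exact: (m 1)|exact: (m 2)|split; [exact: (m 3)|exact: (m 4)|exact: (m 5)]].
by move=> p pe; apply: es; rewrite !in_cons pe !orbT.
Qed.

Hypothesis eps_small : small_enough eps.
Let small1 : eps * (P * (drift_cst + inner_cst)) <= th / 2. Proof. by case: eps_small. Qed.
Let small2 : eps * small_cst <= 4^-1. Proof. by case: eps_small. Qed.
Let small3 : eps * ((drift_cst + inner_cst) * Hm) <= t0. Proof. by case: eps_small. Qed.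
Let small4 : eps * (P * D0) <= 2^-1. Proof. by case: eps_small => _ _ _ []. Qed.
Let small6 : eps * D0 <= t0. Proof. by case: eps_small => _ _ _ []. Qed.
Let small5 : eps * ((A * small_cst * energy_cst + drift_cst) * C1 / th) <= k0.
Proof. by case: eps_small => _ _ _ []. Qed.

(* The contraction from one level to the next uses the first bound at both levels; the
   second one is what the induction carries, m being the number of levels since the last
   correction. *)
Definition level_pre k := [/\ 0 <= h k <= Hm, th * h k <= eta k, w k <= energy_cst * h k,
  w k <= eps * small_cst & t k <= eps * drift_cst * h k].
Definition level_bound k m := t k <= eps * base_cst * (B + 1) ^+ m * h k /\
  E k <= alpha ^+ m * (C2 * h k).

Lemma level_count m k : (1 <= k <= N)%N -> 0 <= h k -> th * h k <= eta k ->
  E k <= alpha ^+ m * (C2 * h k) -> (m < N0)%N \/ h k = 0.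
Proof.
move=> kN h0 the Ek; have [->|hk] := eqVneq (h k) 0; [by right|left].
have {}h0 : 0 < h k by rewrite lt_neqAle eq_sym hk.
rewrite ltnNge; apply/negP => N0m.
have a0 : 0 < alpha by case/andP: al01.
have a1 : alpha <= 1 by case/andP: al01 => _ /ltW.
have am : alpha ^+ m <= alpha ^+ N0 by rewrite ler_wiXn2l// ltW.
have : th * h k <= alpha ^+ N0 * C1 * C2 * h k.
  apply: le_trans the _; apply: le_trans (etaE kN) _.
  apply: le_trans (ler_wpM2l (ltW C10) Ek) _.
  rewrite [leRHS](_ : _ = C1 * (alpha ^+ N0 * (C2 * h k))); last ring.
  by rewrite ler_pM2l// ler_wpM2r// mulr_ge0// ltW.
by rewrite ler_pM2r// leNgt N0P.
Qed.

Lemma count_bound m x : 0 <= x -> (m <= N0)%N \/ x = 0 ->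
  eps * base_cst * (B + 1) ^+ m * x <= eps * drift_cst * x.
Proof.
move=> x0 [mN|->]; last by rewrite !mulr0.
rewrite ler_wpM2r// /drift_cst -!mulrA ler_pM2l// ler_wpM2l//.
by rewrite ler_weXn2l// lerDr.
Qed.

Lemma level_small k : level_pre k -> w k <= 4^-1 /\ t k <= t0.
Proof.
case=> /andP[h0 hH] _ _ wb tb; split; first exact: le_trans small2.
apply: le_trans tb _; apply: le_trans small3; rewrite -mulrA ler_pM2l//.
by apply: ler_pM => //; rewrite lerDl.
Qed.

Lemma level_E k : (1 <= k <= N)%N -> level_pre k -> A * w k ^+ 2 + t k <= k0 * E k.
Proof.
move=> kN [/andP[h0 hH] the wG wb tb]; have Ek := etaE kN.
have w2 : w k ^+ 2 <= eps * small_cst * (energy_cst * h k) by rewrite expr2; apply: ler_pM.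
have E0 : 0 <= E k by rewrite -(pmulr_rge0 _ C10); apply: le_trans Ek.
have hE' : h k <= C1 / th * E k.
  by rewrite mulrAC ler_pdivlMr// mulrC; apply: le_trans the Ek.
apply: le_trans (ler_wpM2r E0 small5).
apply: (@le_trans _ _ (eps * (A * small_cst * energy_cst + drift_cst) * h k)).
  apply: le_trans (lerD (ler_wpM2l A0 w2) tb) _.
  by rewrite le_eqVlt; apply/orP; left; apply/eqP; ring.
rewrite -!mulrA ler_pM2l//.
have := ler_wpM2l (_ : 0 <= A * small_cst * energy_cst + drift_cst) hE'.
rewrite addr_ge0//; last by apply: mulr_ge0 => //; exact: mulr_ge0.
by move=> /(_ isT); rewrite !mulrA.
Qed.

Lemma level_step k : (1 <= k < N)%N -> level_pre k -> level_pre k.+1 ->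
  E k.+1 <= alpha * E k.
Proof.
move=> kN b1 b2; have [k1 kN'] := andP kN.
have kN1 : (1 <= k <= N)%N by rewrite k1 ltnW.
have kN2 : (1 <= k.+1 <= N)%N by [].
apply: contr => //; [exact: (level_small b1).1|exact: (level_small b2).1|].
have := level_E kN1 b1; have := level_E kN2 b2; lra.
Qed.

Lemma first_level : (1 <= N)%N -> level_pre 1 /\ exists m, level_bound 1 m.
Proof.
move=> N1; have kN : (1 <= 1 <= N)%N by [].
have [w1 t1 wn h1] := first N1.
have wb : w 1%N <= eps * small_cst by apply: le_trans w1 _; rewrite mulrC ler_pM2l.
have w4 : w 1%N <= 4^-1 by apply: le_trans small2.
have e1 := eta0 1%N; have eH := etaH kN.
have tt : t 1 <= t0.
  apply: le_trans t1 _; apply: le_trans small6; rewrite (mulrC eps).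
  by apply: ler_piMr; [rewrite mulr_ge0// ltW|apply: le_trans w4 _; rewrite invf_le1// ler1n].
have [n1 _ _] := solve kN w4 tt.
have w2 : w 1%N <= 2 * Q * eta 1%N.
  have : P * t 1%N <= P * (D0 * eps * w 1%N) by apply: ler_wpM2l.
  have : eps * (P * D0) * w 1%N <= 2^-1 * w 1%N by apply: ler_wpM2r.
  rewrite -wn in n1; rewrite (_ : P * (D0 * eps * w 1%N) = eps * (P * D0) * w 1%N); last ring.
  by move: (eps * _ * _) (P * t _) n1 => x y; lra.
have tb : t 1%N <= eps * base_cst * (B + 1) ^+ 0 * h 1%N.
  apply: le_trans t1 _; rewrite h1 expr0 mulr1 (mulrC D0) -!mulrA ler_pM2l//.
  apply: le_trans (ler_wpM2l D00 w2) _; rewrite mulrA; apply: ler_wpM2r => //.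
  apply: le_trans (_ : D0 * (D + 2) * (Q * C1 * C2 + 2 * Q + 1) <= _).
    rewrite -mulrA ler_wpM2l//; have x2 : 0 <= D * (Q * C1 * C2 + 2 * Q + 1) by rewrite mulr_ge0// !addr_ge0// mulr_ge0.
    by rewrite [leRHS]mulrDl; move: Q0 QC0 x2; lra.
  by rewrite /base_cst lerDr addr_ge0// divr_ge0// ltW.
have h0 : 0 <= h 1%N by rewrite h1.
split.
  split; rewrite ?h1// ?e1//.
  - by rewrite ler_piMl// ltW.
  - by apply: le_trans w2 _; apply: ler_wpM2r => //; move: Gge Q0 QC0; lra.
  - by rewrite -h1; apply: le_trans tb _; apply: count_bound => //; left.
by exists 0%N; split; rewrite ?expr0 ?mul1r// h1; apply: Eeta.
Qed.

(** If the solution of level k is taken over, its drift costs one more factor B + 1; if it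
    is corrected, the old drift is forgotten. *)
Lemma start_bound k m : (1 <= k < N)%N -> level_pre k -> level_bound k m ->
  [/\ w_ k.+1 0%N <= (D + 1) * (Q * C1 * C2 + 2 * Q + 1) * h k, w_ k.+1 0%N <= eps * small_cst &
      t_ k.+1 0%N <= eps * base_cst * (B + 1) ^+ m.+1 * h k].
Proof.
move=> kN pre [tm Em]; have [w4 tt] := level_small pre.
have [/andP[h0 hH] the wG wb tb] := pre; have [k1 kN'] := andP kN.
have kN1 : (1 <= k <= N)%N by rewrite k1 ltnW.
have [n1 n2 ta] := solve kN1 w4 tt.
have a1 : alpha ^+ m <= 1 by case/andP: al01 => /ltW ? /ltW ?; rewrite exprn_ile1.
have Ch : 0 <= C2 * h k by rewrite mulr_ge0// ltW.
have eh : eta k <= C1 * C2 * h k.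
  apply: le_trans (etaE kN1) _; rewrite -mulrA ler_pM2l//; apply: le_trans Em _.
  by rewrite ler_piMl.
have Pt : P * t k <= h k.
  apply: le_trans (ler_wpM2l P0 tb) _; rewrite mulrA ler_piMl//.
  rewrite mulrCA; apply: le_trans (_ : eps * (P * (drift_cst + inner_cst)) <= _).
    by rewrite ler_pM2l// ler_wpM2l// lerDl.
  by apply: le_trans small1 _; move: th0 th1; lra.
have nh : nu k <= (Q * C1 * C2 + 2 * Q + 1) * h k.
  have := ler_wpM2l Q0 eh; have : 0 <= Q * h k by rewrite mulr_ge0.
  rewrite !mulrDl mulrA (mulrA Q) mul1r; lra.
have nb : nu k <= eps * (Q2 + P * drift_cst * Hm).
  apply: le_trans n2 _; rewrite mulrDr (mulrC Q2) lerD2l.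
  apply: le_trans (ler_wpM2l P0 tb) _.
  rewrite (_ : P * (eps * drift_cst * h k) = eps * (P * drift_cst * h k)); last ring.
  by rewrite ler_pM2l// ler_wpM2l// mulr_ge0.
have g0 : 0 <= Q * C1 * C2 + 2 * Q + 1 by move: Q0 QC0; lra.
have gh0 : 0 <= (Q * C1 * C2 + 2 * Q + 1) * h k by rewrite mulr_ge0.
have [J0|J0] := posnP (J k).
  have [-> ->] := next0 kN J0; split.
  - by rewrite -mulrA mulrDl mul1r; apply: le_trans nh _; rewrite lerDr mulr_ge0.
  - by apply: le_trans nb _; rewrite ler_pM2l// /small_cst lerDl.
  apply: le_trans ta _.
  rewrite exprSr mulrA mulrDr mulr1 mulrDl; apply: lerD.
    rewrite mulrC (mulrC (_ * B)) mulrA ler_wpM2r//.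
    by rewrite mulrC.
  apply: le_trans (_ : eps * (q * (C1 * C2 * h k)) <= _).
    by rewrite -mulrA ler_pM2l// ler_wpM2l.
  rewrite -!mulrA ler_pM2l//.
  have qc : q * C1 * C2 <= base_cst by rewrite /base_cst addrAC lerDr addr_ge0// divr_ge0// ltW.
  rewrite !mulrA; apply: ler_wpM2r => //; apply: le_trans qc _.
  by rewrite ler_peMr.
have [w1 w2 t1] := nextJ kN J0.
have w3 := le_trans w1 (ler_wpM2l D_0 nh); split.
- apply: le_trans w3 _; rewrite mulrA; apply: ler_wpM2r => //.
  by rewrite ler_wpM2r// lerDl.
- by apply: le_trans w2 _; rewrite mulrC ler_pM2l.
apply: le_trans t1 _; apply: le_trans (_ : eps * base_cst * h k <= _); last first.
  by apply: ler_wpM2r => //; rewrite ler_peMr// mulr_ge0// ltW.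
rewrite (mulrC D0) -!mulrA ler_pM2l//.
apply: le_trans (ler_wpM2l D00 w3) _; rewrite !mulrA; apply: ler_wpM2r => //.
apply: le_trans (_ : D0 * (D + 2) * (Q * C1 * C2 + 2 * Q + 1) <= _).
  rewrite -!mulrA ler_wpM2l//; rewrite !mulrA; apply: ler_wpM2r; last by rewrite lerDl.
  by move: Q0 QC0; lra.
by rewrite /base_cst lerDr addr_ge0// divr_ge0// ltW.
Qed.

Lemma inner_bound k m j : (1 <= k < N)%N -> level_pre k -> level_bound k m -> (j < J k.+1)%N ->
  [/\ w_ k.+1 j.+1 <= D * (Q + 1) * (th ^+ j.+1 * h k), w_ k.+1 j.+1 <= D * eps &
      t_ k.+1 j.+1 <= eps * inner_cst * (th ^+ j.+1 * h k)].
Proof.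
move=> kN pre lb; have [k1 kN'] := andP kN.
have kN1 : (1 <= k <= N)%N by rewrite k1 ltnW.
have kN2 : (2 <= k.+1 <= N)%N by rewrite ltnS k1.
have [/andP[h0 hH] the _ _ _] := pre.
have mN : (m.+1 <= N0)%N \/ h k = 0 by apply: level_count lb.2.
have [_ wb tb] := start_bound kN pre lb.
have {}tb : t_ k.+1 0%N <= eps * (drift_cst + inner_cst) * (th ^+ 0 * h k).
  apply: le_trans tb _; apply: le_trans (count_bound h0 mN) _.
  by rewrite expr0 mul1r ler_wpM2r// ler_pM2l// lerDl.
have thj i : 0 <= th ^+ i * h k by rewrite mulr_ge0// exprn_ge0// ltW.
have step i : (i < J k.+1)%N -> w_ k.+1 i <= eps * small_cst ->
    t_ k.+1 i <= eps * (drift_cst + inner_cst) * (th ^+ i * h k) ->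
  [/\ w_ k.+1 i.+1 <= D * (Q + 1) * (th ^+ i.+1 * h k), w_ k.+1 i.+1 <= D * eps &
      t_ k.+1 i.+1 <= eps * inner_cst * (th ^+ i.+1 * h k)].
  move=> iJ wi ti; have [ei w1 w2 ti1] := inner kN2 iJ.
  have ti0 : t_ k.+1 i <= t0.
    apply: le_trans ti _; apply: le_trans small3; rewrite -mulrA ler_pM2l//.
    apply: ler_wpM2l; first by rewrite addr_ge0.
    by apply: le_trans hH; rewrite ler_piMl// exprn_ile1// ltW.
  have n1 := solve_ kN2 (ltnW iJ) (le_trans wi small2) ti0.
  have w3 : w_ k.+1 i.+1 <= D * (Q + 1) * (th ^+ i.+1 * h k).
    apply: le_trans w1 _; rewrite -mulrA; apply: ler_wpM2l => //.
    apply: le_trans n1 _; rewrite mulrDl mul1r; apply: lerD; first exact: ler_wpM2l.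
    apply: le_trans (ler_wpM2l P0 ti) _; rewrite exprS -[leRHS]mulrA.
    rewrite (_ : P * _ = eps * (P * (drift_cst + inner_cst)) * (th ^+ i * h k)); last ring.
    apply: ler_wpM2r => //; apply: le_trans small1 _.
    by move: th0; lra.
  split=> //; apply: le_trans ti1 _; rewrite (mulrC D0) -!mulrA ler_pM2l//.
  apply: le_trans (ler_wpM2l D00 w3) _.
  by rewrite le_eqVlt; apply/orP; left; apply/eqP; rewrite /inner_cst; ring.
elim: j => [|j IH] jJ; first exact: step.
have [w1 w2 t1] := IH (ltnW jJ); apply: step => //.
  by apply: le_trans w2 _; rewrite mulrC ler_pM2l.
apply: le_trans t1 _; apply: ler_wpM2r => //.
by rewrite ler_pM2l// lerDr.
Qed.

Lemma next_level k m : (1 <= k < N)%N -> level_pre k -> level_bound k m ->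
  level_pre k.+1 /\ exists m', level_bound k.+1 m'.
Proof.
move=> kN pre lb; have [k1 kN'] := andP kN.
have kN1 : (1 <= k <= N)%N by rewrite k1 ltnW.
have kN2 : (2 <= k.+1 <= N)%N by rewrite ltnS k1.
have kN3 : (1 <= k.+1 <= N)%N by [].
have [/andP[h0 hH] the _ _ _] := pre.
have mN : (m.+1 <= N0)%N \/ h k = 0 by apply: level_count lb.2.
have [wE tE eE last] := last_ kN2; rewrite /= in last.
have hk := hE kN2; rewrite /= in hk.
have [J0|J0] := posnP (J k.+1).
  rewrite J0 in wE tE hk last; rewrite expr1 in last.
  have [w1 w2 t1] := start_bound kN pre lb.
  have pre' : level_pre k.+1.
    split; rewrite ?hk ?h0// ?wE ?tE//.
      apply: le_trans w1 _; apply: ler_wpM2r => //.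
      rewrite /energy_cst ler_pdivlMr// ler_piMr//; last exact: ltW.
      by apply: mulr_ge0; move: D_0 Q0 QC0; lra.
    by apply: le_trans t1 _; exact: count_bound.
  split=> //; exists m.+1; split; first by rewrite tE hk.
  have [a0 _] := andP al01; rewrite hk exprS -mulrA.
  apply: le_trans (level_step kN pre pre') _; rewrite ler_pM2l//.
  exact: lb.2.
rewrite J0 in hk; have e0 := eta0 k.+1.
case JE : (J k.+1) J0 => [//|j] _; rewrite JE in wE tE last.
have [w1 w2 t1] : [/\ w k.+1 <= D * (Q + 1) * (th ^+ j.+1 * h k), w k.+1 <= D * eps &
      t k.+1 <= eps * inner_cst * (th ^+ j.+1 * h k)].
  by rewrite wE tE; apply: inner_bound kN pre lb _; rewrite JE.
have lh : th ^+ j.+1 * h k <= eta k.+1 / th.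
  by rewrite ler_pdivlMr// mulrC mulrA -exprS.
have tb : t k.+1 <= eps * base_cst * eta k.+1.
  apply: le_trans t1 _; apply: le_trans (ler_wpM2l _ lh) _; first by rewrite mulr_ge0// ltW.
  rewrite (_ : eps * inner_cst * _ = eps * (inner_cst / th) * eta k.+1); last ring.
  by rewrite ler_wpM2r// ler_pM2l// /base_cst -addrA lerDl addr_ge0.
split.
  split; rewrite ?hk// ?e0 ?etaH//.
  - by rewrite ler_piMl// ltW.
  - apply: le_trans w1 _; apply: le_trans (ler_wpM2l _ lh) _.
      by rewrite mulr_ge0// addr_ge0.
    rewrite (_ : D * (Q + 1) * _ = D * (Q + 1) / th * eta k.+1); last ring.
    rewrite ler_wpM2r// /energy_cst ler_wpM2r ?invr_ge0 1?ltW//; have x2 : 0 <= D * (Q * C1 * C2) by rewrite mulr_ge0.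
    have x3 : 0 <= D * Q by rewrite mulr_ge0.
    by move: Q0 D_0 QC0 x2 x3; rewrite !mulrDl !mulrDr !mulrA; lra.
  - by apply: le_trans w2 _; rewrite mulrC ler_pM2l.
  - by apply: le_trans tb _; apply: ler_wpM2r => //; rewrite ler_pM2l.
exists 0%N; split; first by rewrite expr0 mulr1 hk.
by rewrite expr0 mul1r hk Eeta.
Qed.

(** A level without correction adds one to m and multiplies E by alpha; a correction makes
    the current estimator the new reference and restarts m at zero. *)
Theorem adaptive_recursion k : (1 <= k <= N)%N ->
  [/\ w k <= 4^-1, t k <= t0, t k <= eps * (drift_cst / th) * eta k &
      (k < N)%N -> E k.+1 <= alpha * E k].
Proof.
have main i : (1 <= i <= N)%N -> level_pre i /\ exists m, level_bound i m.
  elim: i => [//|[|i] IH] iN; first exact: first_level.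
  have [|pre [m lb]] := IH; first by case/andP: iN => _ /ltnW.
  by apply: next_level lb.
move=> kN; have [pre lb] := main _ kN; have [w4 tt] := level_small pre.
have [/andP[h0 hH] the _ _ tb] := pre; split=> //.
  apply: le_trans tb _; rewrite -[leLHS]mulrA -[leRHS]mulrA ler_pM2l// -mulrA ler_wpM2l//.
  by rewrite ler_pdivlMl.
move=> k1; apply: level_step => //; first by case/andP: kN => -> _.
by have [] := main k.+1; first by [].
Qed.

End Recursion.

(** * Galerkin solutions *)

Section Galerkin.
Context (R : realType) (n : nat) (S : setting R n) (HS : standing S).
Context (ca Ca : R) (ca_gt0 : 0 < ca) (Hca : norm_equiv S ca Ca).
Local Notation Om := (dom S).
Local Notation mu := (lebesgue_row n.+1).
Local Notation V := (sobfun R n).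
Local Notation pt := 'rV[R]_n.+1.
Local Notation a := (aform S).
Local Notation b := (b0 S).
Local Notation N := (snorm a).
Local Notation l2 := (snorm b).
Local Notation H := (H01 S).
Local Notation lam := (eigval S 0).
Local Notation uh := (eigfun S 0).
Local Notation KK := (fun g : V => solK S g.1).
Local Notation rem := (ww a uh).
Implicit Types (u v w f g : V) (M : mesh R n) (W : set V).

Let asi := a_si HS ca_gt0 Hca.
Let bsi := b0_si HS.

Lemma l2_N u : H u -> l2 u <= N u / ca. Proof. exact: (poincare HS ca_gt0 Hca). Qed.

Lemma H01_L2 f : H f -> L2 Om f.1. Proof. by case. Qed.

Lemma K_H f : H f -> H (KK f).
Proof. by move=> /H01_L2 /(solK_spec HS)[]. Qed.

Lemma K_spec f v : H f -> H v -> a (KK f) v = b f v.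
Proof. by move=> /H01_L2 /(solK_spec HS)[_]; exact. Qed.

Lemma lam_gt0 : 0 < lam. Proof. exact: eigval_gt0 HS. Qed.

Lemma H_uh : H uh. Proof. by have [] := eigfun_spec HS 0. Qed.

Lemma a_uhuh : a uh uh = 1.
Proof.
have [Hu u1 _] := eigfun_spec HS 0.
by rewrite -(snorm_sqr asi Hu) -anormE u1 expr1n.
Qed.

Lemma a_uh v : H v -> a uh v = lam * b uh v.
Proof. by have [_ _] := eigfun_spec HS 0; exact. Qed.

Lemma rem_H v : H v -> H (rem v).
Proof. exact: (H_ww asi H_uh). Qed.

Lemma lam_gap i : lam < eigval S i.+1.
Proof.
elim: i => [|i IH]; first exact: eigval_gap HS.
by apply: lt_le_trans IH _; exact: eigval_nd HS i.
Qed.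

Lemma eigspace1_rem v : eigspace1 S v -> N (rem v) = 0.
Proof.
case=> Hv ev; have He i : H (eigfun S i) by have [] := eigfun_spec HS i.
have ee i w : H w -> a (eigfun S i) w = eigval S i * b (eigfun S i) w.
  by have [_ _] := eigfun_spec HS i; exact.
exact: (eigenspace_line asi bsi H_uh a_uhuh a_uh erefl He lam_gap ee (eigfun_complete HS) Hv ev).
Qed.

Lemma uh_eigspace1 : eigspace1 S uh.
Proof. by split; [exact: H_uh|exact: a_uh]. Qed.

(** The eigenspace is a line, so the two projections differ by a vector of energy zero. *)
Lemma projE_rem v : H v ->
  anorm S (v - projE S v) = N (rem v) /\ nrm Om (v - projE S v).1 = l2 (rem v).
Proof.
move=> Hv; have [eE oE] := projE_spec HS Hv; have [HE _] := eE.
rewrite anormE nrmE.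
apply: (proj_null asi bsi l2_N H_uh) => //; first exact: eigspace1_rem.
exact: oE uh_eigspace1.
Qed.

Lemma Lop_local (p q : pt -> R) : (forall x, Om x -> p x = q x) ->
  forall x, Om x -> Lop S p x = Lop S q x.
Proof.
move=> pq x Ox; have OO := dom_open HS.
have E i y : Om y -> pd i p y = pd i q y by move=> Oy; exact: (pd_local i OO pq Oy).
have D : divA S p x = divA S q x.
  apply: eq_bigr => i _; apply: eq_bigr => j _.
  by rewrite (E j x Ox) (pd_local i OO (E j) Ox).
by rewrite /Lop D (pq _ Ox).
Qed.

(** A solution of the discrete problem and the Galerkin projection of the exact
    solution have the same values, so every quantity of the estimates can be computed
    from either. *)
Section Solution.
Context (M : mesh R n) (mM : is_mesh S M) (f ub : V) (Hf : H f).
Hypothesis sol : lsolve S f.1 (fespace S M) ub.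
Let cM : conforming Om M := mM.1.
Let pM : packed M := conforming_packed cM.
Let gal := galerkin S M (KK f).
Let Fub : fespace S M ub := sol.1.
Let Fgal : fespace S M gal := (galerkin_spec HS mM (K_H Hf)).1.
Let Hub : H ub := fespace_H01 Fub.
Let Hgal : H gal := fespace_H01 Fgal.

Lemma fespaceB u v : fespace S M u -> fespace S M v -> fespace S M (u - v).
Proof.
move=> Fu Fv; have -> : u - v = u + (-1) *: v by rewrite scaleN1r.
exact: (fespaceD HS pM Fu (fespaceZ HS (-1) pM Fv)).
Qed.

Lemma galerkin_null : N (ub - gal) = 0.
Proof.
have Fd := fespaceB Fub Fgal; have Hd := fespace_H01 Fd.
apply/eqP; rewrite -sqrf_eq0 (snorm_sqr asi Hd); apply/eqP.
have gE : a gal (ub - gal) = b f (ub - gal).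
  have := (galerkin_spec HS mM (K_H Hf)).2 _ Fd.
  rewrite (si_subl asi (K_H Hf) Hgal Hd) => /eqP; rewrite subr_eq0 => /eqP <-.
  exact: K_spec.
by rewrite (si_subl asi Hub Hgal Hd) gE (sol.2 _ Fd) subrr.
Qed.

Lemma galerkin_vals x : Om x -> ub.1 x = gal.1 x.
Proof. exact: (fespace_eq HS ca_gt0 Hca Fub Fgal galerkin_null). Qed.

Let H_KfB u : H u -> H (KK f - u). Proof. by move=> Hu; exact: (si_sub asi (K_H Hf) Hu). Qed.

Let err_null : N (KK f - gal - (KK f - ub)) = 0.
Proof. by rewrite -galerkin_null opprB addrC addrA subrK. Qed.

Lemma galerr_sol : galerr S f.1 M = N (KK f - ub).
Proof. exact: (N_eq asi (H_KfB Hgal) (H_KfB Hub) err_null). Qed.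

Lemma eta_sol_sol M' : (M' `<=` M)%fset -> eta_sol S f.1 M M' = eta S M f.1 ub.1 M'.
Proof.
move=> MM; apply: (eta_local HS cM) => //; first by move=> T TM; exact: fespace_pwpoly Fgal TM.
by move=> x Ox; rewrite -galerkin_vals.
Qed.

Lemma oscsol_sol : fespace S M f -> oscsol S f.1 M = osc S (Lop S ub.1) M.
Proof.
move=> Ff; rewrite /oscsol (osc_data HS mM Ff Fgal); apply/esym.
apply: (osc_local HS cM) => [T TM|x Ox]; last exact: (Lop_local galerkin_vals).
exact: (sqint_Lop HS cM TM (fespace_pwpoly Fub TM)).
Qed.

Lemma dual_sol Can e : 0 < Can -> duality_property S Can -> etaA S (fespace S M) <= e ->
  l2 (KK f - ub) <= Can * e * N (KK f - ub).
Proof.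
move=> Can0 dual ee; have := dual _ mM _ (K_H Hf); rewrite anormE nrmE -/gal.
rewrite (N_eq asi (H_KfB Hgal) (H_KfB Hub) err_null).
rewrite (l2_eq asi bsi l2_N (H_KfB Hgal) (H_KfB Hub) err_null) => le1.
apply: le_trans le1 _; apply: ler_wpM2r; first exact: sqrtr_ge0.
by rewrite ler_pM2l.
Qed.

End Solution.

(** * Approximation numbers of nested spaces *)

Lemma inf_dist_mono W W' v : W !=set0 -> W `<=` W' ->
  inf [set anorm S (v - w) | w in W'] <= inf [set anorm S (v - w) | w in W].
Proof.
move=> [w0 Ww0] WW; apply: lb_le_inf; first by exists (anorm S (v - w0)); exists w0.
move=> _ [w Ww <-]; apply: ge_inf; last by exists w => //; exact: WW.
by exists 0 => _ [w' _ <-]; exact: sqrtr_ge0.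
Qed.

Lemma inf_dist0 W v : W 0 -> inf [set anorm S (v - w) | w in W] <= anorm S v.
Proof.
move=> W0; rewrite -[leRHS]/(anorm S v) -{2}(subr0 v); apply: ge_inf; last by exists 0.
by exists 0 => _ [w' _ <-]; exact: sqrtr_ge0.
Qed.

Lemma sup_dist_mono (I : Type) (F : set I) (g : I -> V) (B : R) W W' : W 0 -> W `<=` W' ->
  (forall i, F i -> anorm S (g i) <= B) ->
  sup [set inf [set anorm S (g i - w) | w in W'] | i in F]
  <= sup [set inf [set anorm S (g i - w) | w in W] | i in F].
Proof.
move=> W0 WW FB; have [[i0 Fi0]|F0] := pselect (F !=set0); last first.
  have E : F = set0 by apply/seteqP; split => // i Fi; apply: F0; exists i.
  by rewrite E !image_set0.
apply: ge_sup; first by eexists; exists i0.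
move=> _ [i Fi <-]; apply: le_trans (inf_dist_mono (g i) (ex_intro _ 0 W0) WW) _.
apply: ub_le_sup; last by exists i.
by exists B => _ [j Fj <-]; apply: le_trans (inf_dist0 _ W0) (FB _ Fj).
Qed.

Lemma K_bound (f : pt -> R) : L2 Om f -> anorm S (solK S f) <= nrm Om f / ca.
Proof.
move=> Lf; have [HK KE] := solK_spec HS Lf; set z := solK S f in HK KE *.
have [->|z0] := eqVneq (anorm S z) 0.
  by rewrite divr_ge0 ?sqrtr_ge0// ltW.
have z1 : 0 < anorm S z by rewrite lt_neqAle eq_sym z0 sqrtr_ge0.
rewrite -(ler_pM2r z1) -expr2 anormE (snorm_sqr asi HK) KE//.
have mO := measurable_dom HS.
have Lz : L2 Om z.1 by exact: H01_L2.
apply: le_trans (ler_norm _) _.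
apply: le_trans (si_cs (prodint_semi_inner mu mO) Lf Lz) _.
rewrite [leRHS]mulrAC -mulrA; apply: ler_wpM2l; first exact: sqrtr_ge0.
exact: (l2_N HK).
Qed.

Lemma etaA_mono W W' : W 0 -> W `<=` W' -> etaA S W' <= etaA S W.
Proof.
move=> W0 WW; apply: (@sup_dist_mono _ _ _ ca^-1) => // f [Lf f1].
by apply: le_trans (K_bound Lf) _; rewrite f1 mul1r.
Qed.

Lemma delta_mono W W' : W 0 -> W `<=` W' -> delta S W' <= delta S W.
Proof.
move=> W0 WW; apply: (@sup_dist_mono _ _ id 1) => // v [_ v1].
by rewrite v1.
Qed.

Lemma span_add_sub W u : W `<=` span_add W u.
Proof. by move=> w Ww; exists w, 0; rewrite scale0r addr0. Qed.

(** The multiple of u next to an eigenfunction v of norm one is as far from v as u is from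
    the eigenspace. *)
Lemma delta_span W u : W 0 -> H u -> anorm S u = 1 -> delta S (span_add W u) <= N (rem u).
Proof.
move=> W0 Hu u1; apply: ge_sup.
  apply: image_nonempty; exists uh; apply: conj; first exact: uh_eigspace1.
  by rewrite anormE /snorm a_uhuh sqrtr1.
move=> _ [v [ev v1] <-]; have [Hv _] := ev; have l0 := eigspace1_rem ev.
set s := cc a uh v; have s2 : s ^+ 2 = 1.
  by have := N_pyth asi H_uh a_uhuh Hv; rewrite -anormE v1 l0 expr1n expr0n addr0.
have Hs := si_scale asi s H_uh; have Hc := si_scale asi (s * cc a uh u) Hu.
apply: (@le_trans _ _ (anorm S (v - (s * cc a uh u) *: u))).
  apply: ge_inf; first by exists 0 => _ [w' _ <-]; exact: sqrtr_ge0.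
  by exists ((s * cc a uh u) *: u) => //; exists 0, (s * cc a uh u); rewrite add0r.
rewrite anormE -(line_dist asi H_uh a_uhuh Hu u1 s2).
have -> : v - (s * cc a uh u) *: u = rem v + (s *: uh - (s * cc a uh u) *: u).
  by rewrite addrA subrK.
apply: le_trans (snormD asi (rem_H Hv) (si_sub asi Hs Hc)) _.
by rewrite l0 add0r.
Qed.

End Galerkin.

(** * Dependence on the load *)

(** Discrete solutions and their errors are linear in the load, up to vectors of energy
    zero. *)
Section LoadLinear.
Context (R : realType) (V : lmodType R) (H : set V) (a b : V -> V -> R).
Context (asi : semi_inner H a) (bsi : semi_inner H b).
Local Notation N := (snorm a).
Context (KK : V -> V).
Hypothesis KK_H : forall g, H g -> H (KK g).
Hypothesis KK_spec : forall g v, H g -> H v -> a (KK g) v = b g v.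
Context (X : set V) (XH : X `<=` H).
Hypothesis XD : forall u v, X u -> X v -> X (u + v).
Hypothesis XZ : forall c u, X u -> X (c *: u).
Context (s : R) (f g ub ug ub' : V) (Hf : H f) (Hg : H g) (Xub : X ub) (Xug : X ug) (Xub' : X ub').
Hypothesis sol : forall v, X v -> a ub v = b f v.
Hypothesis solg : forall v, X v -> a ug v = b g v.
Hypothesis sol' : forall v, X v -> a ub' v = b (s *: f + g) v.

Let Hub := XH Xub. Let Hug := XH Xug. Let Hub' := XH Xub'.
Let Hsf := si_scale asi s Hf.
Let Hsg := si_add asi Hsf Hg.

Lemma sol_lin : N (ub' - (s *: ub + ug)) = 0.
Proof.
have Xl : X (s *: ub + ug) by apply: XD => //; exact: XZ.
have Xd : X (ub' - (s *: ub + ug)) by rewrite -[- _]scaleN1r; apply: XD => //; exact: XZ.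
have Hd := XH Xd; have Hs := si_scale asi s Hub.
apply/eqP; rewrite -sqrf_eq0 (snorm_sqr asi Hd) (si_subl asi Hub' (XH Xl) Hd).
rewrite sol'// (si_addl bsi Hsf Hg Hd) (si_scalel bsi s Hf Hd).
by rewrite (si_addl asi Hs Hug Hd) (si_scalel asi s Hub Hd) sol// solg// subrr.
Qed.

Lemma KK_lin : N (KK (s *: f + g) - (s *: KK f + KK g)) = 0.
Proof.
have H1 := KK_H Hf; have H2 := KK_H Hg; have H3 := KK_H Hsg; have H4 := si_scale asi s H1.
have H5 := si_add asi H4 H2.
apply: (N_eq0 asi); first exact: (si_sub asi H3 H5).
move=> v Hv; rewrite (si_subl asi H3 H5 Hv) (si_addl asi H4 H2 Hv) (si_scalel asi s H1 Hv).
by rewrite !KK_spec// (si_addl bsi Hsf Hg Hv) (si_scalel bsi s Hf Hv) subrr.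
Qed.

Lemma err_lin : N (KK (s *: f + g) - ub') = N (s *: (KK f - ub) + (KK g - ug)).
Proof.
have H1 := KK_H Hf; have H2 := KK_H Hg; have H3 := KK_H Hsg.
have e1 := si_sub asi H1 Hub; have e2 := si_sub asi H2 Hug.
have H4 := si_add asi (si_scale asi s H1) H2.
have H5 := si_add asi (si_scale asi s Hub) Hug.
apply: (N_eq asi); [exact: (si_sub asi H3 Hub')|exact: (si_add asi (si_scale asi s e1) e2)|].
have -> : KK (s *: f + g) - ub' - (s *: (KK f - ub) + (KK g - ug))
    = (KK (s *: f + g) - (s *: KK f + KK g)) - (ub' - (s *: ub + ug)).
  have -> : s *: (KK f - ub) + (KK g - ug) = (s *: KK f + KK g) - (s *: ub + ug).
    by rewrite scalerBr opprD addrACA.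
  have sub4 (x y p q : V) : x - y - (p - q) = x - p - (y - q).
    by rewrite !opprB [LHS]addrACA [RHS]addrACA (addrC (- y)).
  exact: sub4.
apply/eqP; rewrite eq_le sqrtr_ge0 andbT.
apply: le_trans (snorm_subD asi (si_sub asi H3 H4) (si_sub asi Hub' H5)) _.
by rewrite KK_lin sol_lin addr0.
Qed.

Lemma err_young d : 0 < d -> N (KK (s *: f + g) - ub') ^+ 2
  <= (1 + d) * (s ^+ 2 * N (KK f - ub) ^+ 2) + (1 + d^-1) * N (KK g) ^+ 2.
Proof.
move=> d0; have H1 := KK_H Hf; have H2 := KK_H Hg.
have e1 := si_sub asi H1 Hub; have e2 := si_sub asi H2 Hug.
have se := si_scale asi s e1.
rewrite err_lin (snorm_sqr asi (si_add asi se e2)).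
apply: le_trans (si_young asi se e2 d0) _; rewrite -!(snorm_sqr asi)//.
rewrite (snormZ asi s e1) exprMn real_normK ?num_real// lerD2l.
apply: ler_wpM2l; first by rewrite addr_ge0// invr_ge0 ltW.
apply: lerXn2r; rewrite ?nnegrE ?sqrtr_ge0//.
exact: (err_le asi KK_H KK_spec XH Hg Xug solg).
Qed.

End LoadLinear.

Lemma pert_arith (R : realType) (d gam s ca c l x y z e e' e'' p : R) : 0 < d -> 0 < gam ->
  x <= (1 + d) * (s ^+ 2 * y) + (1 + d^-1) * z ^+ 2 ->
  e <= (1 + d) * e' + (1 + d^-1) * p ^+ 2 -> e' = s ^+ 2 * e'' ->
  0 <= p -> p <= c * l -> 0 <= z -> z <= l / ca ->
  x + gam * e <= (1 + d) * (s ^+ 2 * (y + gam * e''))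
    + (1 + d^-1) * ((ca^-1 ^+ 2 + gam * c ^+ 2) * l ^+ 2).
Proof.
move=> d0 g0 X E E' p0 pc z0 zl; have i0 : 0 <= 1 + d^-1 by rewrite addr_ge0// invr_ge0 ltW.
have Z : z ^+ 2 <= ca^-1 ^+ 2 * l ^+ 2.
  by rewrite -exprMn mulrC; apply: lerXn2r; rewrite ?nnegrE// (le_trans z0).
have P : p ^+ 2 <= c ^+ 2 * l ^+ 2.
  by rewrite -exprMn; apply: lerXn2r; rewrite ?nnegrE// (le_trans p0).
have := ler_wpM2l i0 Z; have := ler_wpM2l i0 P; rewrite E' in E.
move=> {}P {}Z; have := ler_wpM2l (ltW g0) (le_trans E (lerD (lexx _) P)).
move=> {}E; apply: le_trans (lerD (le_trans X (lerD (lexx _) Z)) E) _.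
by rewrite le_eqVlt; apply/orP; left; apply/eqP; ring.
Qed.

Section Perturbation.
Context (R : realType) (n : nat) (S : setting R n) (HS : standing S).
Context (ca Ca : R) (ca_gt0 : 0 < ca) (Hca : norm_equiv S ca Ca).
Local Notation Om := (dom S).
Local Notation V := (sobfun R n).
Local Notation a := (aform S).
Local Notation b := (b0 S).
Local Notation N := (snorm a).
Local Notation l2 := (snorm b).
Local Notation H := (H01 S).
Local Notation KK := (fun g : V => solK S g.1).
Implicit Types (u v w f g : V) (M : mesh R n).

Let asi := a_si HS ca_gt0 Hca.
Let bsi := b0_si HS.
Let K_H' := K_H HS.
Let K_spec' := K_spec HS.
Let l2_N' := l2_N HS ca_gt0 Hca.

Context (Clow Coa CD gam : R) (Clow_gt0 : 0 < Clow) (gam_gt0 : 0 < gam) (Coa_gt0 : 0 < Coa).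
Hypothesis (Hlow : lower_property S Clow) (Hosc : osc_property S Coa).

Definition total_err gam' M f := galerr S f.1 M ^+ 2 + gam' * eta_sol S f.1 M M ^+ 2.

Context (M : mesh R n) (mM : is_mesh S M).
Let cM : conforming Om M := mM.1.
Let pM : packed M := conforming_packed cM.

Lemma galerkin_lsolve f : H f -> lsolve S f.1 (fespace S M) (galerkin S M (KK f)).
Proof.
move=> Hf; have [Fg o] := galerkin_spec HS mM (K_H' Hf); split=> // v Fv.
have Hv := fespace_H01 Fv.
have := o v Fv; rewrite (si_subl asi (K_H' Hf) (fespace_H01 Fg) Hv) => /eqP.
by rewrite subr_eq0 => /eqP <-; exact: K_spec'.
Qed.

Lemma sqint_fespace f : fespace S M f -> pw2 M f.1.
Proof. by move=> Ff T TM; exact: (sqint_pwpoly HS cM TM (fespace_pwpoly Ff TM)). Qed.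

Lemma pwp_fespace f : fespace S M f -> pwp M f.1.
Proof. by move=> Ff T TM; exact: fespace_pwpoly Ff TM. Qed.

(** The estimator of a load is bounded by its L2 norm: the error is, and so is the
    oscillation of the Galerkin solution. *)
Lemma eta_load f : fespace S M f -> eta_sol S f.1 M M <= (1 + Coa) / (ca * Clow) * l2 f.
Proof.
move=> Ff; have Hf := fespace_H01 Ff; have sol := galerkin_lsolve Hf.
set ub := galerkin S M (KK f) in sol; have Fub := sol.1; have Hub := fespace_H01 Fub.
have XH : fespace S M `<=` H by move=> v; exact: fespace_H01.
have NK := N_KK asi bsi ca_gt0 l2_N' K_H' K_spec' Hf.
have ubK := N_sol_le asi K_H' K_spec' XH Hf Fub sol.2.
have err := err_le asi K_H' K_spec' XH Hf Fub sol.2.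
have lo := Hlow mM (H01_L2 Hf).
have oE := oscsol_sol HS ca_gt0 Hca mM Hf sol Ff.
have gE := galerr_sol HS ca_gt0 Hca mM Hf sol.
have oL := Hosc mM Fub; rewrite anormE in oL.
rewrite oE gE in lo.
move: NK ubK err lo oL; move: (N _) (N _) (N _) (osc _ _ _) (eta_sol _ _ _ _) (l2 f) => x y z o e l.
move=> xl yx zx le oy.
rewrite mulrAC ler_pdivlMr ?mulr_gt0//.
have {}xl : ca * z <= l by rewrite mulrC -ler_pdivlMr.
have {}le : Clow * e <= (1 + Coa) * z.
  apply: le_trans le _; rewrite mulrDl mul1r; apply: lerD => //.
  by apply: le_trans oy _; rewrite ler_pM2l.
rewrite mulrCA (mulrC e); apply: le_trans (ler_wpM2l (ltW ca_gt0) le) _.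
by rewrite mulrCA ler_pM2l// addr_gt0.
Qed.

Definition pert_const := (ca^-1) ^+ 2 + gam * ((1 + Coa) / (ca * Clow)) ^+ 2.

(** By linearity the new error is s times the old one plus that of the load g, and Young's
    inequality separates the two. *)
Lemma total_err_pert s d f g : 0 < d -> fespace S M f -> fespace S M g ->
  total_err gam M (s *: f + g) <=
  (1 + d) * (s ^+ 2 * total_err gam M f) + (1 + d^-1) * (pert_const * l2 g ^+ 2).
Proof.
move=> d0 Ff Fg; have Hf := fespace_H01 Ff; have Hg := fespace_H01 Fg.
have Fs := fespaceZ HS s pM Ff; have Fsg := fespaceD HS pM Fs Fg.
have Hsg := fespace_H01 Fsg.
have XH : fespace S M `<=` H by move=> v; exact: fespace_H01.
have XD u v : fespace S M u -> fespace S M v -> fespace S M (u + v) by move=> Xu Xv; exact: (fespaceD HS pM Xu Xv).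
have XZ c u : fespace S M u -> fespace S M (c *: u) by move=> Xu; exact: (fespaceZ HS c pM Xu).
have sol := galerkin_lsolve Hf; have solg := galerkin_lsolve Hg; have sol' := galerkin_lsolve Hsg.
have gE := galerr_sol HS ca_gt0 Hca mM Hf sol.
have gE' := galerr_sol HS ca_gt0 Hca mM Hsg sol'.
have eE := eta_sol_sol HS ca_gt0 Hca mM Hf sol (fsubset_refl M).
have eE' := eta_sol_sol HS ca_gt0 Hca mM Hsg sol' (fsubset_refl M).
have eEg := eta_sol_sol HS ca_gt0 Hca mM Hg solg (fsubset_refl M).
have eg := eta_load Fg.
set ub := galerkin S M (KK f) in sol gE eE; set ug := galerkin S M (KK g) in solg eEg.
set ub' := galerkin S M (KK (s *: f + g)) in sol' gE' eE'.
have NK := N_KK asi bsi ca_gt0 l2_N' K_H' K_spec' Hg.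
have Y1 := err_young asi bsi K_H' K_spec' XH XD XZ Hf Hg sol.1 solg.1 sol'.1 sol.2 solg.2 sol'.2 d0.
have lin := sol_lin asi bsi XH XD XZ Hf Hg sol.1 solg.1 sol'.1 sol.2 solg.2 sol'.2.
have Fl : fespace S M (s *: ub + ug) by apply: XD; [exact: XZ sol.1|exact: solg.1].
have vals := fespace_eq HS ca_gt0 Hca sol'.1 Fl lin.
have eL := eta_local HS cM (s *: f + g).1 (pwp_fespace sol'.1) vals (fsubset_refl M).
have Y2 := eta_young HS cM d0 (sqint_fespace Fs) (sqint_fespace Fg)
  (pwp_fespace (XZ s _ sol.1)) (pwp_fespace solg.1).
have Sc := eta_scale HS cM s (sqint_fespace Ff) (pwp_fespace sol.1).
have eg0 : 0 <= eta_sol S g.1 M M by exact: sqrtr_ge0.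
rewrite eEg in eg eg0; rewrite /total_err gE gE' eE eE' eL.
exact: (pert_arith d0 gam_gt0 Y1 Y2 Sc eg0 eg (snorm_ge0 _ _) NK).
Qed.

End Perturbation.

(** * Marked elements against optimal meshes *)

(** As xi^2 < 1/2 and lam times the norm of the exact solution is at most 5/4, the error of
    u is below 1/10; hence cu^2 >= 9/10 and lam^2 c^2 <= 10/9. The competitor then uses 5/18
    of xi^2 tot, and the remaining 13/18 is left for the remainder of the load. *)
Lemma overlay_arith (R : realType) (CD ca lam kap Clow xi t cf cu wu tot eta osc totN os' : R) :
  0 < CD -> 0 < ca -> 0 < lam -> 0 < Clow -> 0 <= t -> 0 <= tot ->
  0 < xi ^+ 2 < 2^-1 -> lam ^+ 2 * tot <= CD * (5 / 4) ^+ 2 -> cf ^+ 2 <= 1 ->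
  cu ^+ 2 + wu ^+ 2 = 1 -> Clow ^+ 2 * eta ^+ 2 <= 2 * tot -> t <= kap * eta ->
  4 * CD * kap ^+ 2 <= 13 / 18 * xi ^+ 2 * (ca ^+ 2 * Clow ^+ 2) ->
  let c := cf / (lam * cu) in
  wu ^+ 2 + osc ^+ 2 <= 2 * (xi ^+ 2 / (16 * CD) * (lam ^+ 2 * tot)) ->
  os' ^+ 2 <= c ^+ 2 * osc ^+ 2 ->
  (cu != 0 -> totN <= CD * (2 * (t / ca) ^+ 2 + 2 * (c ^+ 2 * wu ^+ 2) + os' ^+ 2)) ->
  totN <= xi ^+ 2 * tot.
Proof.
move=> CD0 ca0 l0 Cl0 t0 tot0 /andP[xi0 xi1] lt cf1 cuwu etat tk kk c wo oc tN.
have ok0 := sqr_ge0 osc; have wu0 := sqr_ge0 wu.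
have e2 : xi ^+ 2 / (16 * CD) * (lam ^+ 2 * tot) <= 20^-1.
  rewrite mulrAC ler_pdivrMr ?mulr_gt0//.
  apply: le_trans (ler_wpM2l (ltW xi0) lt) _.
  rewrite (_ : _ * (CD * _) = (xi ^+ 2 * (5 / 4) ^+ 2) * CD); last ring.
  rewrite (_ : 20^-1 * _ = (16 / 20) * CD); last by field.
  by rewrite ler_pM2r//; move: (xi ^+ 2) xi1 => x x1; lra.
have cu9 : 9 / 10 <= cu ^+ 2 by move: (xi ^+ 2 / _ * _) e2 wo => z; lra.
have cu0 : 0 < cu ^+ 2 by lra.
have cun : cu != 0 by rewrite -sqrf_eq0 gt_eqF.
have cl : c ^+ 2 * lam ^+ 2 <= 10 / 9.
  rewrite /c expr_div_n exprMn invfM (_ : _ * lam ^+ 2 = cf ^+ 2 / cu ^+ 2).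
    by rewrite ler_pdivrMr//; lra.
  by field; rewrite cun gt_eqF.
apply: le_trans (tN cun) _.
have c0 := sqr_ge0 c.
have p1 : 2 * (c ^+ 2 * wu ^+ 2) + os' ^+ 2 <= 2 * c ^+ 2 * (wu ^+ 2 + osc ^+ 2).
  rewrite -(mulrA 2) (mulrDr (c ^+ 2)); move: (mulr_ge0 c0 ok0) oc.
  by move: (c ^+ 2 * osc ^+ 2) (c ^+ 2 * wu ^+ 2) (os' ^+ 2) => x y z; lra.
have p2 : CD * (2 * c ^+ 2 * (wu ^+ 2 + osc ^+ 2)) <= 5 / 18 * (xi ^+ 2 * tot).
  apply: le_trans (ler_wpM2l (ltW CD0) (ler_wpM2l _ wo)) _; first by rewrite mulr_ge0.
  rewrite [leLHS](_ : _ = 4^-1 * (c ^+ 2 * lam ^+ 2) * (xi ^+ 2 * tot)); last first.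
    by field; rewrite gt_eqF.
  apply: ler_wpM2r; first by rewrite mulr_ge0// ltW.
  by lra.
have ca2 : 0 < ca ^+ 2 * Clow ^+ 2 by rewrite mulr_gt0// exprn_gt0.
have p3 : CD * (2 * (t / ca) ^+ 2) <= 13 / 18 * (xi ^+ 2 * tot).
  have t2 : t ^+ 2 <= kap ^+ 2 * eta ^+ 2.
    by rewrite -exprMn lerXn2r// nnegrE// (le_trans t0).
  rewrite -(ler_pM2r ca2) [leLHS](_ : _ = 2 * CD * Clow ^+ 2 * t ^+ 2); last first.
    by field; rewrite gt_eqF.
  have CC : 0 <= 2 * CD * Clow ^+ 2 by rewrite mulr_ge0 ?sqr_ge0// mulr_ge0// ltW.
  apply: le_trans (ler_wpM2l CC t2) _.
  rewrite [leLHS](_ : _ = 2 * CD * kap ^+ 2 * (Clow ^+ 2 * eta ^+ 2)); last ring.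
  apply: le_trans (ler_wpM2l _ etat) _; first by rewrite mulr_ge0 ?sqr_ge0// mulr_ge0// ltW.
  rewrite [leLHS](_ : _ = 4 * CD * kap ^+ 2 * tot); last ring.
  apply: le_trans (ler_wpM2r tot0 kk) _.
  by rewrite le_eqVlt; apply/orP; left; apply/eqP; ring.
move: (le_trans (ler_wpM2l (ltW CD0) p1) p2) => p4.
rewrite -addrA (mulrDr CD (2 * (t / ca) ^+ 2)); by apply: le_trans (lerD p3 p4) _; move: (xi ^+ 2 * tot) => z; lra.
Qed.

Lemma count_arith (R : realType) (s Mc e x CMa lam tot : R) : 0 < s -> 0 < Mc -> 0 < CMa -> 0 < lam ->
  0 < tot -> 0 <= x -> 0 < e -> e ^+ 2 = CMa * (lam ^+ 2 * tot) -> e * x `^ s <= Mc ->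
  x <= CMa `^ (- (2 * s)^-1) * Mc `^ s^-1 * (lam ^+ 2 * tot) `^ (- (2 * s)^-1).
Proof.
move=> s0 M0 C0 l0 t0 x0 e0 eE ex.
have lt0 : 0 < lam ^+ 2 * tot by rewrite mulr_gt0// exprn_gt0.
have s2 : 0 < 2 * s by rewrite mulr_gt0.
have xs : x `^ s <= Mc / e by rewrite ler_pdivlMr// mulrC.
have -> : x = (x `^ s) `^ s^-1 by rewrite -powRrM divff ?powRr1// gt_eqF.
apply: le_trans (_ : (Mc / e) `^ s^-1 <= _).
  by apply: ge0_ler_powR; rewrite ?nnegrE ?powR_ge0 ?invr_ge0 ?divr_ge0// ltW.
have ei : e^-1 = (CMa * (lam ^+ 2 * tot)) `^ (- 2^-1).
  rewrite -eE powRN -[e ^+ 2]powR_mulrn ?ltW// -powRrM mulfV// powRr1 ?ltW//.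
have E : (- 2^-1) * s^-1 = - (2 * s)^-1 by rewrite mulNr invfM.
have ei0 : 0 <= e^-1 by rewrite invr_ge0 ltW.
rewrite powRM//; last exact: ltW.
rewrite ei -powRrM E powRM; [|exact: ltW|exact: ltW].
by rewrite mulrA (mulrC (Mc `^ _)).
Qed.

Lemma total_arith (R : realType) (Clow gam x y z T : R) : 0 < Clow -> 0 < gam -> 0 <= z ->
  Clow ^+ 2 * y <= 2 * T -> T = x + z -> x + gam * y <= (1 + 2 * gam / Clow ^+ 2) * (x + z).
Proof.
move=> C0 g0 z0 yT TE; have C2 : 0 < Clow ^+ 2 by rewrite exprn_gt0.
rewrite -TE mulrDl mul1r; apply: lerD; first by rewrite TE lerDl.
rewrite mulrAC ler_pdivlMr// -!mulrA (mulrCA 2) ler_pM2l// mulrC.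
exact: yT.
Qed.

Lemma load_arith (R : realType) (CD lam x y tot : R) : 0 < CD -> 0 < lam -> 0 <= x ->
  x <= lam^-1 + y -> lam * y <= 4^-1 -> tot <= CD * x ^+ 2 ->
  lam ^+ 2 * tot <= CD * (5 / 4) ^+ 2.
Proof.
move=> C0 l0 x0 xy ly tx; have lx : lam * x <= 5 / 4.
  apply: le_trans (ler_wpM2l (ltW l0) xy) _; rewrite mulrDr divff ?gt_eqF//; lra.
apply: le_trans (ler_wpM2l (sqr_ge0 lam) tx) _; rewrite mulrCA ler_pM2l// -exprMn.
have p0 : 0 <= lam * x by rewrite mulr_ge0// ltW.
by rewrite lerXn2r// nnegrE// (le_trans p0).
Qed.

Lemma marking_arith (R : realType) (th1 ths xi x y : R) : 0 < th1 ->
  th1 <= ths * Num.sqrt (1 - 2 * xi ^+ 2) -> xi ^+ 2 < 2^-1 -> 0 <= x -> 0 <= y ->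
  ths ^+ 2 * (1 - 2 * xi ^+ 2) * x ^+ 2 <= y ^+ 2 -> th1 * x <= y.
Proof.
move=> t0 tt xi1 x0 y0 xy; have q0 : 0 <= 1 - 2 * xi ^+ 2 by lra.
have p0 : 0 <= th1 * x by rewrite mulr_ge0// ltW.
rewrite -(ler_pXn2r (n := 2))//; apply: le_trans xy; rewrite exprMn; apply: ler_wpM2r; first exact: sqr_ge0.
have tp := le_trans (ltW t0) tt; rewrite -(sqr_sqrtr q0) -exprMn.
by apply: lerXn2r => //; rewrite nnegrE ltW.
Qed.

Lemma ler_mono_sub (R : realType) (C x y z T : R) : 0 < C -> T <= C * (x + y) -> x <= z ->
  T <= C * (z + y).
Proof. by move=> C0 Tl xz; apply: le_trans Tl _; rewrite ler_pM2l// lerD2r. Qed.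

Section Marking.
Context (R : realType) (n : nat) (S : setting R n) (HS : standing S).
Context (ca Ca : R) (ca_gt0 : 0 < ca) (Hca : norm_equiv S ca Ca).
Local Notation Om := (dom S).
Local Notation V := (sobfun R n).
Local Notation a := (aform S).
Local Notation b := (b0 S).
Local Notation N := (snorm a).
Local Notation l2 := (snorm b).
Local Notation H := (H01 S).
Local Notation KK := (fun g : V => solK S g.1).
Local Notation lam := (eigval S 0).
Local Notation uh := (eigfun S 0).
Local Notation rem := (ww a uh).
Local Notation coef := (cc a uh).
Implicit Types (u v w f g : V) (M : mesh R n).

Let asi := a_si HS ca_gt0 Hca.
Let bsi := b0_si HS.
Let l2_N' := l2_N HS ca_gt0 Hca.

Context (Clow CD gam : R) (Clow_gt0 : 0 < Clow) (CD_gt0 : 0 < CD) (gam_gt0 : 0 < gam).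
Hypothesis (Hlow : lower_property S Clow) (Hopt : quasi_opt_property S CD).

Definition tot2 M f := galerr S f.1 M ^+ 2 + oscsol S f.1 M ^+ 2.

Lemma tot2_ge0 M f : 0 <= tot2 M f.
Proof. by apply: addr_ge0; exact: sqr_ge0. Qed.

Lemma eta_le_tot M f : is_mesh S M -> H f -> Clow ^+ 2 * eta_sol S f.1 M M ^+ 2 <= 2 * tot2 M f.
Proof.
move=> mM Hf; have := Hlow mM (H01_L2 Hf).
have : 0 <= Clow * eta_sol S f.1 M M by apply: mulr_ge0; [exact: ltW|exact: sqrtr_ge0].
rewrite /tot2 -exprMn; move: (Clow * _) (galerr _ _ _) (oscsol _ _ _) => x y z x0 xyz.
apply: le_trans (_ : (y + z) ^+ 2 <= _); first by rewrite lerXn2r// nnegrE// (le_trans x0).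
by have := sqr_ge0 (y - z); rewrite sqrrB sqrrD; lra.
Qed.

Lemma total_le_tot M f : is_mesh S M -> H f ->
  total_err S gam M f <= (1 + 2 * gam / Clow ^+ 2) * tot2 M f.
Proof.
move=> mM Hf; have := eta_le_tot mM Hf; have o0 := sqr_ge0 (oscsol S f.1 M).
rewrite /total_err {2}/tot2 => E.
exact: (total_arith Clow_gt0 gam_gt0 o0 E erefl).
Qed.

(** A load of the finite element space does not contribute to the oscillation, so that of
    the competitor alone remains. *)
Lemma tot2_opt M f v : is_mesh S M -> fespace S M f -> fespace S M v ->
  tot2 M f <= CD * (N (KK f - v) ^+ 2 + osc S (Lop S v.1) M ^+ 2).
Proof.
move=> mM Ff Fv; apply: le_trans (Hopt mM (H01_L2 (fespace_H01 Ff))) _.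
rewrite ler_pM2l// -(osc_data HS mM Ff Fv) -anormE; apply: ge_inf; last by exists v.
by exists 0 => _ [w _ <-]; apply: addr_ge0; exact: sqr_ge0.
Qed.

Lemma tot2_load M f : is_mesh S M -> fespace S M f -> tot2 M f <= CD * N (KK f) ^+ 2.
Proof.
move=> mM Ff; have cM := mM.1; have F0 := fespaceZ HS 0 (conforming_packed cM) Ff.
rewrite scale0r in F0.
by have := tot2_opt mM Ff F0; rewrite subr0 (osc_Lop0 HS cM) expr0n addr0.
Qed.

(** The infimum of the approximation class is attained, because mesh sizes are
    integers. *)
Lemma approx_mesh s Mc M1 e : 0 < s -> approx_const S s M1 = Mc%:E -> 0 < e ->
  packed M1 ->
  exists Me, [/\ refinement Om M1 Me, (best_err2 S Me <= (e ^+ 2)%:E)%E &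
    e * (#|` Me|%:R - #|` M1|%:R) `^ s <= Mc].
Proof.
move=> s0 AM e0 pM1.
pose P M := refinement Om M1 M /\ (best_err2 S M <= (e ^+ 2)%:E)%E.
pose I := ereal_inf [set (((#|` M|%:R - #|` M1|%:R) `^ s)%:E : \bar R) | M in P].
have eI : (e%:E * I <= Mc%:E)%E.
  by rewrite -AM; apply: ereal_sup_ubound; exists e.
have exP : exists k, `[< exists2 M, P M & #|` M| = k >].
  apply: contrapT => nP.
  have P0 : P = set0.
    apply/seteqP; split=> // M PM; apply: nP; exists #|` M|; apply/asboolP.
    by exists M.
  by move: eI; rewrite /I P0 image_set0 ereal_inf0 gt0_muley ?lte_fin.
have [k /asboolP[M PM Mk] kmin] := ex_minnP exP.
exists M; split; [exact: PM.1|exact: PM.2|].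
rewrite -lee_fin EFinM; apply: le_trans eI.
rewrite lee_pmul2l ?lte_fin//; apply: le_ereal_inf_tmp => _ [M' PM' <-].
have [c1 _] := card_refined pM1 PM.1.1; have [c2 _] := card_refined pM1 PM'.1.1.
rewrite lee_fin; apply: ge0_ler_powR; rewrite ?nnegrE ?subr_ge0 ?ler_nat ?(ltW s0)//.
by rewrite lerD2r ler_nat Mk; apply: kmin; apply/asboolP; exists M'.
Qed.

Lemma near_best M (e2 : R) : 0 < e2 -> (best_err2 S M <= e2%:E)%E ->
  exists u, [/\ fespace S M u, anorm S u = 1 & err2 S u M <= 2 * e2].
Proof.
move=> e0 be; have : (best_err2 S M < (2 * e2)%:E)%E.
  by apply: le_lt_trans be _; rewrite lte_fin; lra.
move=> /ereal_inf_lt[_ [u [Fu u1] <-]]; rewrite lte_fin => /ltW ue.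
by exists u.
Qed.

(** The competitor is the multiple of u that matches the component of the solution along
    the eigenfunction; it lives on the overlay, where the oscillation is no larger than on
    Me. *)
Lemma overlay_reduces M Me Nn f u xi kap :
  is_mesh S M -> is_mesh S Nn -> conforming Om Me ->
  (forall T, T \in Nn -> exists2 T', T' \in M & hull T `<=` hull T') ->
  (forall T, T \in Nn -> exists2 T', T' \in Me & hull T `<=` hull T') ->
  fespace S M f -> anorm S f = 1 -> fespace S Me u -> anorm S u = 1 ->
  0 < xi ^+ 2 < 2^-1 -> lam * (l2 (rem f) / ca) <= 4^-1 ->
  l2 (rem f) <= kap * eta_sol S f.1 M M ->
  4 * CD * kap ^+ 2 <= 13 / 18 * xi ^+ 2 * (ca ^+ 2 * Clow ^+ 2) ->
  err2 S u Me <= 2 * (xi ^+ 2 / (16 * CD) * (lam ^+ 2 * tot2 M f)) ->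
  tot2 Nn f <= xi ^+ 2 * tot2 M f.
Proof.
move=> mM mN cMe NM NMe Ff f1 Fu u1 xi01 tf tk kk eu.
have Hf := fespace_H01 Ff; have Hu := fespace_H01 Fu.
have pM := conforming_packed mM.1; have pN := conforming_packed mN.1.
have pMe := conforming_packed cMe.
have lam0 := lam_gt0 HS; have Huh := H_uh HS; have auh := a_uhuh HS ca_gt0 Hca.
have ea := @a_uh _ _ _ HS.
have KH := K_H HS; have Ksp := K_spec HS.
have FfN := fespace_sub pM pN NM Ff; have FuN := fespace_sub pMe pN NMe Fu.
rewrite anormE in f1; rewrite anormE in u1.
have py := N_pyth asi Huh auh Hu; rewrite u1 expr1n in py.
have cf := cc_le asi Huh auh Hf; rewrite f1 in cf.
have NKf := N_KK_upper asi bsi ca_gt0 l2_N' lam0 Huh auh ea KH Ksp Hf f1.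
set c := coef f / (lam * coef u).
have FcN := fespaceZ HS c pN FuN.
have ON := tot2_opt mN FfN FcN.
have oc := osc_Lop_scale HS mN.1 c (pwp_fespace FuN).
have om := osc_mono HS cMe mN.1 NMe (fun T TMe => sqint_Lop HS cMe TMe (fespace_pwpoly Fu TMe)).
have [pE _] := projE_rem HS ca_gt0 Hca Hu.
have tl := tot2_load mM Ff; have te := eta_le_tot mM Hf.
rewrite /err2 pE in eu.
have N0 := snorm_ge0 a (KK f).
have lt : lam ^+ 2 * tot2 M f <= CD * (5 / 4) ^+ 2.
  exact: (load_arith CD_gt0 lam0 N0 NKf tf tl).
have near (u0 : coef u != 0) : N (KK f - c *: u) ^+ 2 <= 2 * (l2 (rem f) / ca) ^+ 2 + 2 * (c ^+ 2 * N (rem u) ^+ 2).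
  exact: (KK_near_line asi bsi ca_gt0 l2_N' lam0 Huh ea KH Ksp Hf Hu u0 erefl).
have cf2 : coef f ^+ 2 <= 1 by rewrite -(real_normK (num_real _)) expr_le1.
apply: (overlay_arith CD_gt0 ca_gt0 lam0 Clow_gt0 (snorm_ge0 b (rem f)) (tot2_ge0 M f)
  xi01 lt cf2 (esym py) te tk kk eu) => [|cu0].
  apply: le_trans oc _; apply: ler_wpM2l; first exact: sqr_ge0.
  by apply: lerXn2r om; exact: osc_ge0.
exact: (ler_mono_sub CD_gt0 ON (near cu0)).
Qed.

(** The elements outside the overlay form a competitor for the marking, so minimality
    of the marked set bounds its size by the number of bisections of the optimal mesh. *)
Lemma marked_count M1 M Mk f ub (th1 ths s Mc xi kap : R) :
  is_mesh S M1 -> (forall M', refinement Om M1 M' -> shape_regular S M') ->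
  refinement Om M1 M -> fespace S M f -> anorm S f = 1 ->
  lsolve S f.1 (fespace S M) ub -> mark S th1 M f.1 ub.1 Mk -> marking_property S ths ->
  0 < th1 -> th1 <= ths * Num.sqrt (1 - 2 * xi ^+ 2) -> 0 < xi ^+ 2 < 2^-1 ->
  0 < s -> 0 < Mc -> approx_const S s M1 = Mc%:E -> 0 < tot2 M f ->
  lam * (l2 (rem f) / ca) <= 4^-1 -> l2 (rem f) <= kap * eta_sol S f.1 M M ->
  4 * CD * kap ^+ 2 <= 13 / 18 * xi ^+ 2 * (ca ^+ 2 * Clow ^+ 2) ->
  #|` Mk|%:R <= (xi ^+ 2 / (16 * CD)) `^ (- (2 * s)^-1) * Mc `^ s^-1
                * (lam ^+ 2 * tot2 M f) `^ (- (2 * s)^-1).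
Proof.
move=> mM1 reg rM Ff f1 sol mk Hths th0 thxi xi01 s0 Mc0 AM tot0 tf tk kk.
have [xi0 xi1] := andP xi01.
have mesh M' : refinement Om M1 M' -> is_mesh S M' by move=> r; split; [exact: r.2|exact: reg].
have mM := mesh _ rM; have pM := conforming_packed mM.1; have pM1 := conforming_packed mM1.1.
have lam0 := lam_gt0 HS; have Hf := fespace_H01 Ff.
have C0 : 0 < xi ^+ 2 / (16 * CD) by rewrite divr_gt0// mulr_gt0.
set CMa := xi ^+ 2 / (16 * CD) in C0 *.
have e20 : 0 < CMa * (lam ^+ 2 * tot2 M f) by rewrite mulr_gt0// mulr_gt0// exprn_gt0.
pose e := Num.sqrt (CMa * (lam ^+ 2 * tot2 M f)).
have e0 : 0 < e by rewrite sqrtr_gt0.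
have eE : e ^+ 2 = CMa * (lam ^+ 2 * tot2 M f) by rewrite sqr_sqrtr// ltW.
have [Me [rMe beMe cMe]] := approx_mesh s0 AM e0 pM1.
rewrite eE in beMe; have [u [Fu u1 eu]] := near_best e20 beMe.
have [Nn [rN NMe cN]] := overlay_refinement mM1.1 rM rMe.
have mN := mesh _ (refinement_trans rM rN).
have NM := bisections_hull pM rN.1.
have red := overlay_reduces mM mN rMe.2 NM NMe Ff f1 Fu u1 xi01 tf tk kk eu.
have hm := Hths _ _ mM mN rN _ (H01_L2 Hf) _ xi01 red.
have [MkM _ mkmin] := mk.
have sub : (M `\` (Nn `&` M) `<=` M)%fset by exact: fsubsetDl.
have eM := eta_sol_sol HS ca_gt0 Hca mM Hf sol (fsubset_refl M).
have eD := eta_sol_sol HS ca_gt0 Hca mM Hf sol sub.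
have le1 : th1 * eta S M f.1 ub.1 M <= eta S M f.1 ub.1 (M `\` (Nn `&` M))%fset.
  have p M' : 0 <= eta S M f.1 ub.1 M' by exact: sqrtr_ge0.
  rewrite eM eD in hm; exact: (marking_arith th0 thxi xi1 (p _) (p _) hm).
have c1 := mkmin _ sub le1.
have [_ c2] := card_refined pM rN.1.
have c3 : (#|` Mk| + #|` M1| <= #|` Me|)%N.
  by rewrite -(leq_add2l #|` M|) addnA; apply: leq_trans cN; rewrite leq_add2r addnC; apply: leq_trans c2; rewrite leq_add2r.
have c4 : #|` Mk|%:R <= #|` Me|%:R - #|` M1|%:R :> R by rewrite lerBrDr -natrD ler_nat.
apply: le_trans c4 _; apply: (count_arith s0 Mc0 C0 lam0 tot0 _ e0 eE cMe).
by rewrite subr_ge0 ler_nat; exact: (card_refined pM1 rMe.1).1.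
Qed.

End Marking.

(** * Runs of the algorithm *)

Section Loads.
Context (R : realType) (n : nat) (S : setting R n) (HS : standing S).
Context (ca Ca : R) (ca_gt0 : 0 < ca) (Hca : norm_equiv S ca Ca).
Local Notation Om := (dom S).
Local Notation V := (sobfun R n).
Local Notation a := (aform S).
Local Notation b := (b0 S).
Local Notation N := (snorm a).
Local Notation l2 := (snorm b).
Local Notation H := (H01 S).
Implicit Types (u v w f g : V) (M : mesh R n).

Let asi := a_si HS ca_gt0 Hca.
Let bsi := b0_si HS.

(** The last clause excludes a solve with zero solution. *)
Definition load M f := [/\ fespace S M f, anorm S f = 1 & 0 < l2 f].

Definition normalize u : V := (anorm S u)^-1 *: u.

Lemma fespace0 M : is_mesh S M -> fespace S M 0.
Proof.
move=> mM; have [F _] := galerkin_spec HS mM (H_uh HS).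
by have := fespaceZ HS 0 (conforming_packed mM.1) F; rewrite scale0r.
Qed.

Lemma load_sub M M' f : fespace S M `<=` fespace S M' -> load M f -> load M' f.
Proof. by move=> sub [F f1 l0]; split=> //; exact: sub. Qed.

Lemma sol_norm_gt0 M f ub : load M f -> lsolve S f.1 (fespace S M) ub -> 0 < N ub /\ 0 < l2 ub.
Proof.
move=> [F f1 l0] [Fub sol]; have Hf := fespace_H01 F; have Hub := fespace_H01 Fub.
have bff : 0 < b f f by rewrite -(snorm_sqr bsi Hf) exprn_gt0.
have N0 : N ub != 0.
  apply/eqP => N0; have := sol _ F; rewrite (si_null asi Hub Hf N0) => E.
  by move: bff; rewrite /b0 -E ltxx.
have N1 : 0 < N ub by rewrite lt_neqAle eq_sym N0 snorm_ge0.
split=> //; rewrite lt_neqAle eq_sym snorm_ge0 andbT; apply/eqP => l20.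
have := sol _ Fub; rewrite -(snorm_sqr asi Hub) -/(b0 S f ub) (si_sym bsi Hf Hub).
by rewrite (si_null bsi Hub Hf l20) => /eqP; rewrite sqrf_eq0 (negbTE N0).
Qed.

Lemma normalize_load M u : packed M -> fespace S M u -> 0 < N u -> 0 < l2 u -> load M (normalize u).
Proof.
move=> pM F N0 l0; have Hu := fespace_H01 F.
have i0 : 0 < (N u)^-1 by rewrite invr_gt0.
split; first exact: (fespaceZ HS _ pM F).
  rewrite anormE /normalize (snormZ asi _ Hu) anormE (gtr0_norm i0).
  by rewrite mulVf// gt_eqF.
by rewrite /normalize (snormZ bsi _ Hu) anormE (gtr0_norm i0) mulr_gt0.
Qed.

Lemma solve_load M f ub : packed M -> load M f -> lsolve S f.1 (fespace S M) ub ->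
  load M (normalize ub).
Proof.
move=> pM lf sol; have [N0 l0] := sol_norm_gt0 lf sol.
exact: normalize_load pM sol.1 N0 l0.
Qed.

Lemma disc_eig_gt0 (W : set V) mu w : W `<=` H -> disc_eigpair S W mu w -> 0 < mu /\ 0 < l2 w.
Proof.
move=> WH [Ww w1 e]; have Hw := WH _ Ww; have := e _ Ww.
rewrite -(snorm_sqr asi Hw) -anormE w1 expr1n => E.
have b0' := si_ge0 bsi Hw; have bE : 1 = mu * b w w := E.
have bw : 0 < b w w.
  rewrite lt_neqAle b0' andbT eq_sym; apply/eqP => z; move: bE; rewrite z mulr0 => /eqP.
  by rewrite oner_eq0.
split; first by rewrite -(pmulr_lgt0 _ bw) -bE ltr01.
by rewrite lt_neqAle eq_sym snorm_ge0 andbT -sqrf_eq0 (snorm_sqr bsi Hw) gt_eqF.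
Qed.

Lemma span_load M MH u mu w : packed M -> fespace S MH `<=` fespace S M -> fespace S M u ->
  esolve S (span_add (fespace S MH) u) mu w -> load M w.
Proof.
move=> pM sub Fu [[Ww w1 e] _].
have spF : span_add (fespace S MH) u `<=` fespace S M.
  by move=> _ [v [c [Fv ->]]]; exact: (fespaceD HS pM (sub _ Fv) (fespaceZ HS c pM Fu)).
split; [exact: spF|exact: w1|].
have WH : span_add (fespace S MH) u `<=` H by move=> z /spF; exact: fespace_H01.
have dw : disc_eigpair S (span_add (fespace S MH) u) mu w by split.
exact: (disc_eig_gt0 WH dw).2.
Qed.

Context (th1 th2 : R) (MH M1 : mesh R n) (adm : admissible S MH M1).
Context (r : run R n) (K : nat) (rr : is_run S th1 th2 MH M1 r K).

Let mMH : is_mesh S MH. Proof. by case: adm. Qed.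
Let mM1 : is_mesh S M1. Proof. by case: adm. Qed.
Let pMH := conforming_packed mMH.1.
Let pM1 := conforming_packed mM1.1.

Lemma refinement_mesh M : refinement Om M1 M -> is_mesh S M.
Proof. by move=> rM; split; [exact: rM.2|case: adm => _ _ _; exact]. Qed.

Lemma coarse_sub M : refinement Om M1 M -> fespace S MH `<=` fespace S M.
Proof.
move=> rM v Fv; apply: (fespace_sub pM1 (conforming_packed rM.2)).
  exact: (bisections_hull pM1 rM.1).
by apply: (fespace_sub pMH pM1) Fv => T TM; case: adm => _ _ sub _; exact: sub.
Qed.

Definition level_loads k := [/\ refinement Om M1 (r_mesh r k), load (r_mesh r k) (r_fbar r k),
  lsolve S (r_fbar r k).1 (fespace S (r_mesh r k)) (r_ubar r k) &
  r_u r k = normalize (r_ubar r k)].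

Lemma first_loads : (1 <= K)%N -> level_loads 1.
Proof.
move=> K1; have [[m1 [eig _] [f1 _ _ ub1] _] _] := rr.
have WH : fespace S M1 `<=` H by move=> v; exact: fespace_H01.
have [Fu u1 e] := eig; have [l0 l20] := disc_eig_gt0 WH eig.
have i0 : 0 < (r_lam r 1)^-1 by rewrite invr_gt0.
have Hu := fespace_H01 Fu.
have Nub : anorm S (r_ubar r 1) = (r_lam r 1)^-1.
  by rewrite ub1 anormE (snormZ asi _ Hu) -anormE u1 mulr1 gtr0_norm.
rewrite /level_loads m1 f1; split.
- exact: refinement_refl mM1.1.
- by split.
- split; first by rewrite ub1; exact: (fespaceZ HS _ pM1 Fu).
  move=> v Fv; rewrite ub1 (si_scalel asi _ Hu (fespace_H01 Fv)) e//.
  by rewrite mulrA mulVf ?mul1r// gt_eqF.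
- by rewrite /normalize Nub ub1 invrK scalerA mulfV ?scale1r// gt_eqF.
Qed.

Lemma next_mesh k : (1 <= k < K)%N -> refinement Om M1 (r_mesh r k) ->
  refinement Om M1 (r_mesh r k.+1) /\ fespace S (r_mesh r k) `<=` fespace S (r_mesh r k.+1).
Proof.
move=> kK rk; have [_ lv] := rr; have [|[_ [rk1 _ _]] _ _ _ _] := lv k.+1.
  by case/andP: kK => k1 kK; rewrite ltnS k1.
split; first exact: refinement_trans rk rk1.
apply: fespace_sub; [exact: conforming_packed rk.2|exact: conforming_packed rk1.2|].
exact: (bisections_hull (conforming_packed rk.2) rk1.1).
Qed.

Lemma inner_loads k j : (1 <= k < K)%N -> level_loads k -> (j <= r_jmax r k.+1)%N ->
  (k = 1%N -> r_fbarj r k.+1 0 = r_u r k) ->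
  (k != 1%N -> if (0 < r_jmax r k)%N then
     esolve S (span_add (fespace S MH) (r_u r k)) (r_tlam r k) (r_tu r k) /\
     r_fbarj r k.+1 0 = r_tu r k else r_fbarj r k.+1 0 = r_u r k) ->
  load (r_mesh r k.+1) (r_fbarj r k.+1 j).
Proof.
move=> kK [rk lf sol uE] jJ k1 kn1.
have [rk1 sub] := next_mesh kK rk; have pk1 := conforming_packed rk1.2.
have pk := conforming_packed rk.2.
have lu : load (r_mesh r k) (r_u r k) by rewrite uE; exact: solve_load pk lf sol.
have [Fu _ _] := load_sub sub lu.
have [_ lv] := rr; have [|_ sv inn _ _] := lv k.+1.
  by case/andP: kK => ? ?; rewrite ltnS; apply/andP.
elim: j jJ => [_|j IH jJ].
  have [k1'|kn] := eqVneq k 1%N; first by rewrite (k1 k1'); exact: load_sub sub lu.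
  have := kn1 kn; case: ifP => _; last by move=> ->; exact: load_sub sub lu.
  by case=> es ->; exact: (span_load pk1 (coarse_sub rk1) Fu es).
have [sj uj _] := sv j (ltnW jJ); have lj := IH (ltnW jJ).
have [_ es ->] := inn.1 j jJ.
have [Fj _ _] : load (r_mesh r k.+1) (r_uj r k.+1 j) by rewrite uj; exact: solve_load pk1 lj sj.
exact: (span_load pk1 (coarse_sub rk1) Fj es).
Qed.

Lemma opening_load k : (1 <= k < K)%N ->
  (k = 1%N -> r_fbarj r k.+1 0 = r_u r k) /\
  (k != 1%N -> if (0 < r_jmax r k)%N then
     esolve S (span_add (fespace S MH) (r_u r k)) (r_tlam r k) (r_tu r k) /\
     r_fbarj r k.+1 0 = r_tu r k else r_fbarj r k.+1 0 = r_u r k).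
Proof.
move=> /andP[k0 kK]; have [[_ _ [_ f2 _ _] _] lv] := rr; split; first by move=> ->.
move=> kn1; have k2 : (2 <= k <= K)%N by rewrite ltn_neqAle eq_sym kn1 k0 ltnW.
have [_ _ _ _] := lv k k2; case: ifP => _; first by case=> es fE _ _ _; split.
by case.
Qed.

Theorem run_loads k : (1 <= k <= K)%N -> level_loads k.
Proof.
elim: k => [//|[|k] IH] /andP[_ kK]; first exact: first_loads.
have kK' : (1 <= k.+1 < K)%N by [].
have lk : level_loads k.+1 by apply: IH; exact: ltnW.
have [op1 op2] := opening_load kK'.
have lJ := inner_loads kK' lk (leqnn _) op1 op2.
have [rk1 _] := next_mesh kK' (let: And4 x _ _ _ := lk in x).
have [_ lv] := rr; have [|_ sv _ [fE ubE uE _] _] := lv k.+2; first exact: kK.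
have [sj uj _] := sv _ (leqnn _).
by split; rewrite ?fE ?ubE ?uE.
Qed.

Lemma run_inner_loads k j : (2 <= k <= K)%N -> (j <= r_jmax r k)%N ->
  load (r_mesh r k) (r_fbarj r k j).
Proof.
case: k => [//|k] /andP[k1 kK] jJ; have kK' : (1 <= k < K)%N by rewrite -ltnS k1.
have [op1 op2] := opening_load kK'.
by apply: inner_loads => //; apply: run_loads; case/andP: kK' => -> /ltnW.
Qed.

End Loads.

(** The choice of d spends half of the gap between alh^2 and alpha^2, and k0 pays with a
    quarter for the change of load, which involves both x and y. *)
Lemma contr_arith (R : realType) (alh alpha CE d k0 x y z g : R) :
  0 < alh < alpha -> alpha < 1 -> 0 < CE ->
  d = (alpha ^+ 2 - alh ^+ 2) / (2 * alh ^+ 2) ->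
  k0 ^+ 2 = (alpha ^+ 2 - alh ^+ 2) / (8 * ((1 + d^-1) * CE)) ->
  0 <= x -> 0 <= y -> 0 <= g -> g <= k0 * (x + y) -> z <= alh ^+ 2 * x ^+ 2 ->
  y ^+ 2 <= (1 + d) * z + (1 + d^-1) * (CE * g ^+ 2) -> y <= alpha * x.
Proof.
move=> /andP[h0 ha] a1 C0 dE kE x0 y0 g0 gk zx yz.
have a0 : 0 < alpha by exact: lt_trans ha.
have h2 : 0 < alh ^+ 2 by rewrite exprn_gt0.
have ha2 : alh ^+ 2 < alpha ^+ 2 by rewrite ltrXn2r// ?nnegrE ltW.
have a2 : alpha ^+ 2 < 1 by rewrite expr_lt1// ltW.
have d0 : 0 < d by rewrite dE divr_gt0 ?mulr_gt0// subr_gt0.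
have dd : 0 < (1 + d^-1) * CE by rewrite mulr_gt0// addr_gt0// invr_gt0.
have e1 : (1 + d) * alh ^+ 2 = (alh ^+ 2 + alpha ^+ 2) / 2.
  by rewrite dE; field; rewrite gt_eqF.
have g2 : (1 + d^-1) * (CE * g ^+ 2) <= (alpha ^+ 2 - alh ^+ 2) / 8 * (x + y) ^+ 2.
  have gg : g ^+ 2 <= k0 ^+ 2 * (x + y) ^+ 2.
    by rewrite -exprMn lerXn2r// nnegrE// (le_trans g0).
  rewrite mulrA; apply: le_trans (ler_wpM2l (ltW dd) gg) _.
  rewrite kE le_eqVlt; apply/orP; left; apply/eqP.
  by move: ((1 + d^-1) * CE) dd => Z Z0; field; rewrite gt_eqF.
have {}zx : (1 + d) * z <= (alh ^+ 2 + alpha ^+ 2) / 2 * x ^+ 2.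
  by rewrite -e1 -mulrA ler_pM2l// addr_gt0.
have xy : (x + y) ^+ 2 <= 2 * x ^+ 2 + 2 * y ^+ 2.
  by have := sqr_ge0 (x - y); rewrite sqrrB sqrrD; lra.
have ax0 : 0 <= alpha * x by rewrite mulr_ge0// ltW.
rewrite -(ler_pXn2r (n := 2))// exprMn.
have := sqr_ge0 x; have := sqr_ge0 y; have := sqr_ge0 (x + y).
move: yz zx g2 xy a2 ha2 h2; move: (alh ^+ 2) (alpha ^+ 2) => A B.
move: (x ^+ 2) (y ^+ 2) ((x + y) ^+ 2) ((1 + d) * z) ((1 + d^-1) * _) => X Y W p r.
move=> yz zx g2 xy a2 ha2 h2 W0 Y0 X0.
have {}g2 : r <= (B - A) / 8 * (2 * X + 2 * Y).
  by apply: le_trans g2 _; apply: ler_wpM2l => //; rewrite divr_ge0// subr_ge0 ltW.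
have k : (1 - (B - A) / 4) * Y <= (1 - (B - A) / 4) * (B * X).
  have : 0 <= (B - A) / 4 * ((1 - B) * X) by rewrite !mulr_ge0 ?divr_ge0 ?subr_ge0// ltW.
  lra.
have pos : 0 < 1 - (B - A) / 4 by lra.
by rewrite -(ler_pM2l pos).
Qed.

Lemma solve_arith (R : realType) (lam ca Can Cup eps rho t eta nu tau : R) :
  0 < lam -> 0 < ca -> 0 < Can -> 0 < Cup -> 0 < eps ->
  nu <= 5 / 4 * lam * (rho + t / ca) -> tau <= 5 / 4 * lam * (t / ca ^+ 2 + Can * eps * rho) ->
  rho <= Can * eps / ca -> rho <= Cup * eta ->
  [/\ nu <= 5 / 4 * lam * Cup * eta + 5 / 4 * lam / ca * t,
      nu <= 5 / 4 * lam * (Can / ca) * eps + 5 / 4 * lam / ca * t &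
      tau <= 5 / 4 * lam / ca ^+ 2 * t + eps * (5 / 4 * lam * (Can * Cup)) * eta].
Proof.
move=> l0 c0 C0 U0 e0 n1 t1 r1 r2.
have L0 : 0 <= 5 / 4 * lam by rewrite mulr_ge0// ltW.
split.
- apply: le_trans n1 _; rewrite [leRHS](_ : _ = 5 / 4 * lam * (Cup * eta + t / ca)); last ring.
  by rewrite ler_wpM2l// lerD2r.
- apply: le_trans n1 _; rewrite [leRHS](_ : _ = 5 / 4 * lam * (Can * eps / ca + t / ca)); last ring.
  by rewrite ler_wpM2l// lerD2r.
- apply: le_trans t1 _.
  rewrite [leRHS](_ : _ = 5 / 4 * lam * (t / ca ^+ 2 + Can * eps * (Cup * eta))); last ring.
  by rewrite ler_wpM2l// lerD2l ler_wpM2l// mulr_ge0// ltW.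
Qed.

(** Normalising the solution costs the factor 25/16; the difference to 2 pays for the mixed
    term with the remainder x of the load. *)
Lemma err2_arith (R : realType) (lam gam nu os rho x eta n e2 E2 : R) :
  0 < lam -> 0 < gam -> 0 <= nu -> nu <= 5 / 4 * lam * (rho + x) -> 0 <= rho -> 0 <= x -> x <= eta / 3 ->
  0 < n -> 4 / 5 <= lam * n -> 0 <= os -> os <= eta -> e2 <= nu ^+ 2 + (n^-1) ^+ 2 * os ^+ 2 ->
  E2 = rho ^+ 2 + gam * eta ^+ 2 -> e2 <= (2 + 5 / gam) * (lam ^+ 2 * E2).
Proof.
move=> l0 g0 nu0 nuE r0 x0 xe n0 ln os0 oe ee ->.
have eta0 : 0 <= eta by apply: le_trans oe.
have n2 : nu ^+ 2 <= lam ^+ 2 * (2 * rho ^+ 2 + 15 / 2 * x ^+ 2).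
  apply: le_trans (_ : (5 / 4 * lam * (rho + x)) ^+ 2 <= _).
    by rewrite lerXn2r// nnegrE (le_trans nu0).
  rewrite [leLHS](_ : _ = lam ^+ 2 * (25 / 16 * (rho + x) ^+ 2)); last by field.
  rewrite ler_pM2l ?exprn_gt0//.
  (* The discriminant of 2 rho^2 + 15/2 x^2 - 25/16 (rho + x)^2 is negative. *)
  by have := sqr_ge0 (7 * rho - 25 * x); rewrite sqrrB sqrrD !exprMn; have := sqr_ge0 x; lra.
have i2 : (n^-1) ^+ 2 * os ^+ 2 <= lam ^+ 2 * (25 / 16 * eta ^+ 2).
  rewrite -exprMn (_ : lam ^+ 2 * _ = (5 / 4 * lam * eta) ^+ 2); last by field.
  have ni : n^-1 <= 5 / 4 * lam by rewrite -[leLHS]mul1r ler_pdivrMr// -mulrA; lra.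
  have ni0 : 0 <= n^-1 by rewrite invr_ge0 ltW.
  have p : n^-1 * os <= 5 / 4 * lam * eta by apply: ler_pM.
  by rewrite lerXn2r// nnegrE ?mulr_ge0// ltW.
apply: le_trans ee _; apply: le_trans (lerD n2 i2) _.
rewrite -mulrDr (mulrCA _ (lam ^+ 2)) ler_pM2l ?exprn_gt0//.
have x2 : x ^+ 2 <= eta ^+ 2 / 9.
  rewrite (_ : eta ^+ 2 / 9 = (eta / 3) ^+ 2); last by field.
  by rewrite lerXn2r// nnegrE// divr_ge0.
rewrite (_ : _ * (_ + _) = 2 * rho ^+ 2 + 5 / gam * rho ^+ 2 + (2 * gam + 5) * eta ^+ 2); last first.
  by field; rewrite gt_eqF.
have p1 : 0 <= 5 / gam * rho ^+ 2 by rewrite mulr_ge0 ?sqr_ge0// divr_ge0// ltW.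
have p2 : 0 <= gam * eta ^+ 2 by rewrite mulr_ge0 ?sqr_ge0// ltW.
have := sqr_ge0 eta; move: x2 p1 p2.
rewrite [(2 * gam + 5) * _]mulrDl -[2 * gam * _]mulrA.
by move: (x ^+ 2) (rho ^+ 2) (eta ^+ 2) (5 / gam * _) (gam * _) => X Y Z p q; lra.
Qed.

Lemma scaled_load (R : realType) (lam ca t : R) : 0 < lam -> 0 < ca -> t <= ca / (4 * lam) ->
  lam * (t / ca) <= 4^-1.
Proof.
move=> l0 c0; rewrite ler_pdivlMr ?mulr_gt0// mulrA ler_pdivrMr// => h.
by rewrite -(ler_pM2r (ltr0n R 4)) [leRHS](_ : _ = ca); [rewrite [leLHS](_ : _ = t * (4 * lam)); last ring|field].
Qed.

Lemma quarter_half (R : realType) (x : R) : x <= 4^-1 -> x <= 2^-1.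
Proof. by lra. Qed.

Lemma gap_pos (R : realType) (alh alpha d : R) : 0 < alh < alpha ->
  d = (alpha ^+ 2 - alh ^+ 2) / (2 * alh ^+ 2) -> 0 < d.
Proof.
move=> /andP[h0 ha] ->; rewrite divr_gt0 ?mulr_gt0 ?exprn_gt0// subr_gt0.
by rewrite ltrXn2r// ?nnegrE ltW// (lt_trans h0).
Qed.

Section RunNumbers.
Context (R : realType) (n : nat) (S : setting R n) (HS : standing S).
Context (ca Ca : R) (ca_gt0 : 0 < ca) (Hca : norm_equiv S ca Ca).
Local Notation Om := (dom S).
Local Notation V := (sobfun R n).
Local Notation a := (aform S).
Local Notation b := (b0 S).
Local Notation N := (snorm a).
Local Notation l2 := (snorm b).
Local Notation H := (H01 S).
Local Notation KK := (fun g : V => solK S g.1).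
Local Notation lam := (eigval S 0).
Local Notation uh := (eigfun S 0).
Local Notation rem := (ww a uh).
Implicit Types (u v w f g : V) (M : mesh R n).

Let asi := a_si HS ca_gt0 Hca.
Let bsi := b0_si HS.
Let l2_N' := l2_N HS ca_gt0 Hca.

Context (Cea Ce0 Can Cup Clow Coa gam : R).
Hypotheses (Cea_gt0 : 0 < Cea) (Ce0_gt0 : 0 < Ce0) (Can_gt0 : 0 < Can) (Cup_gt0 : 0 < Cup).
Hypotheses (Clow_gt0 : 0 < Clow) (Coa_gt0 : 0 < Coa) (gam_gt0 : 0 < gam).
Hypotheses (Hdual : duality_property S Can) (Hup : upper_property S Cup).
Hypotheses (Hlow : lower_property S Clow) (Hosc : osc_property S Coa).

Context (MH M1 : mesh R n) (adm : admissible S MH M1) (eps : R) (eps0 : 0 < eps).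
Hypotheses (etaH : etaA S (fespace S MH) <= eps) (deltaH : delta S (fespace S MH) <= eps).
Hypothesis eps_small : lam * (lam * (l2 uh * (Can * eps * (Can * eps / ca)))) <= 10^-1.

Let mMH : is_mesh S MH. Proof. by case: adm. Qed.
Let F0 : fespace S MH 0 := fespace0 HS mMH.

(** The spaces of all levels contain the coarse space, so eps bounds the duality constant
    on every level. *)
Lemma solve_numbers M f ub : refinement Om M1 M -> load S M f ->
  lsolve S f.1 (fespace S M) ub -> N (rem f) <= 4^-1 -> l2 (rem f) <= ca / (4 * lam) ->
  [/\ N (rem (normalize S ub)) <= 5 / 4 * lam * (galerr S f.1 M + l2 (rem f) / ca),
      l2 (rem (normalize S ub)) <= 5 / 4 * lam * (l2 (rem f) / ca ^+ 2 + Can * eps * galerr S f.1 M),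
      galerr S f.1 M <= Can * eps / ca & 4 / 5 <= lam * N ub].
Proof.
move=> rM [F f1 _] sol wf tf; have Hf := fespace_H01 F; have mM := refinement_mesh adm rM.
have lam0 := lam_gt0 HS; have Huh := H_uh HS; have auh := a_uhuh HS ca_gt0 Hca.
have ea := @a_uh _ _ _ HS; have KH := K_H HS; have Ksp := K_spec HS.
have XH : fespace S M `<=` H by move=> v; exact: fespace_H01.
have eM : etaA S (fespace S M) <= eps.
  exact: le_trans (etaA_mono HS ca_gt0 Hca F0 (coarse_sub adm rM)) etaH.
have dl := dual_sol HS ca_gt0 Hca mM Hf sol Can_gt0 Hdual eM.
have gE := galerr_sol HS ca_gt0 Hca mM Hf sol.
rewrite anormE in f1.
have e0 : 0 <= Can * eps by rewrite mulr_ge0// ltW.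
have tf' := scaled_load lam0 ca_gt0 tf.
have near := N_sol_near asi bsi ca_gt0 l2_N' lam0 Huh auh ea KH Ksp XH e0 Hf sol.1 sol.2 dl f1 wf tf' eps_small.
have [lo _] := andP near.
have [_ n1 n2] := normalized_sol asi bsi ca_gt0 l2_N' lam0 Huh auh ea KH Ksp XH Hf sol.1 dl lo.
have es := err_small asi bsi KH Ksp XH e0 Hf sol.1 sol.2 dl.
have lf := l2_N' Hf; rewrite f1 div1r in lf.
rewrite gE; split; [exact: n1|exact: n2| |exact: lo].
exact: le_trans es (ler_wpM2l e0 lf).
Qed.

Lemma galerr_eta M f ub : refinement Om M1 M -> load S M f -> lsolve S f.1 (fespace S M) ub ->
  galerr S f.1 M <= Cup * eta S M f.1 ub.1 M.
Proof.
move=> rM [F _ _] sol; have mM := refinement_mesh adm rM; have Hf := fespace_H01 F.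
rewrite -(eta_sol_sol HS ca_gt0 Hca mM Hf sol (fsubset_refl M)).
exact: Hup mM _ (H01_L2 Hf).
Qed.

Lemma eta_bound M f ub : refinement Om M1 M -> load S M f -> lsolve S f.1 (fespace S M) ub ->
  eta S M f.1 ub.1 M <= (1 + Coa) / (ca * Clow) / ca.
Proof.
move=> rM [F f1 _] sol; have mM := refinement_mesh adm rM; have Hf := fespace_H01 F.
rewrite -(eta_sol_sol HS ca_gt0 Hca mM Hf sol (fsubset_refl M)).
apply: le_trans (eta_load HS ca_gt0 Hca Clow_gt0 Coa_gt0 Hlow Hosc mM F) _.
have lf := l2_N' Hf; rewrite -anormE f1 div1r in lf.
by apply: ler_wpM2l lf; rewrite divr_ge0 ?mulr_ge0 ?addr_ge0 ?(ltW ca_gt0) ?(ltW Clow_gt0) ?(ltW Coa_gt0).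
Qed.

(** The trial space contains both the coarse space and u, so the correction inherits the
    better of the two approximations. *)
Lemma correction_numbers M u mu w : refinement Om M1 M -> load S M u ->
  esolve S (span_add (fespace S MH) u) mu w ->
  esolve_bounds S Cea Ce0 (span_add (fespace S MH) u) ->
  [/\ N (rem w) <= Cea * N (rem u), N (rem w) <= Cea * eps &
      l2 (rem w) <= Ce0 * eps * N (rem w)].
Proof.
move=> rM lu es bd; have [Fu u1 _] := lu; have Hu := fespace_H01 Fu.
have pM := conforming_packed rM.2.
have [Fw _ _] := span_load HS ca_gt0 Hca pM (coarse_sub adm rM) Fu es.
have [pN pl] := projE_rem HS ca_gt0 Hca (fespace_H01 Fw).
have [b1 b2] := bd _ _ es; rewrite pN in b1 b2; rewrite pl in b2.
have sub := @span_add_sub _ _ (fespace S MH) u.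
have d1 := delta_span HS ca_gt0 Hca F0 Hu u1.
have d2 := le_trans (delta_mono S F0 sub) deltaH.
have e1 := le_trans (etaA_mono HS ca_gt0 Hca F0 sub) etaH.
split.
- exact: le_trans b1 (ler_wpM2l (ltW Cea_gt0) d1).
- exact: le_trans b1 (ler_wpM2l (ltW Cea_gt0) d2).
- exact: le_trans b2 (ler_wpM2r (snorm_ge0 _ _) (ler_wpM2l (ltW Ce0_gt0) e1)).
Qed.

(** Both loads are unit vectors near the same line, so up to sign they agree to higher
    order; the gap between alh and alpha absorbs their difference. *)
Lemma contraction_step M M' f f' alh alpha d k0 : refinement Om M1 M' ->
  load S M' f -> load S M' f' ->
  0 < alh < alpha -> alpha < 1 ->
  d = (alpha ^+ 2 - alh ^+ 2) / (2 * alh ^+ 2) ->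
  k0 ^+ 2 = (alpha ^+ 2 - alh ^+ 2) / (8 * ((1 + d^-1) * pert_const ca Clow Coa gam)) ->
  total_err S gam M' f <= alh ^+ 2 * total_err S gam M f ->
  N (rem f) <= 4^-1 -> N (rem f') <= 4^-1 ->
  l2 uh * (N (rem f) ^+ 2 + N (rem f') ^+ 2) + l2 (rem f) + l2 (rem f')
    <= k0 * (Num.sqrt (total_err S gam M f) + Num.sqrt (total_err S gam M' f')) ->
  Num.sqrt (total_err S gam M' f') <= alpha * Num.sqrt (total_err S gam M f).
Proof.
move=> rM [F f1 _] [F' f1' _] ha a1 dE kE con w4 w4' small.
have mM := refinement_mesh adm rM; have pM := conforming_packed mM.1.
have Hf := fespace_H01 F; have Hf' := fespace_H01 F'.
rewrite anormE in f1; rewrite anormE in f1'.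
have [s s2 sd] := unit_diff asi bsi (H_uh HS) (a_uhuh HS ca_gt0 Hca) Hf Hf' f1 f1'
  (quarter_half w4) (quarter_half w4').
have Fg := fespaceB HS mM F' (fespaceZ HS s pM F).
have d0 : 0 < d by exact: gap_pos ha dE.
have pert := total_err_pert HS ca_gt0 Hca Clow_gt0 gam_gt0 Coa_gt0 Hlow Hosc mM s d0 F Fg.
have E : s *: f + (f' - s *: f) = f' by rewrite addrC subrK.
rewrite E s2 mul1r in pert.
have te0 Mx g : 0 <= total_err S gam Mx g.
  by apply: addr_ge0; [exact: sqr_ge0|apply: mulr_ge0; [exact: ltW|exact: sqr_ge0]].
have C0 : 0 < pert_const ca Clow Coa gam.
  apply: ltr_wpDr; first by apply: mulr_ge0; [exact: ltW|exact: sqr_ge0].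
  by rewrite exprn_gt0// invr_gt0.
have sq Mx g := sqr_sqrtr (te0 Mx g).
rewrite -(sq M' f') in pert; rewrite -(sq M f) in con.
exact: (contr_arith ha a1 C0 dE kE (sqrtr_ge0 _) (sqrtr_ge0 _) (snorm_ge0 _ _) (le_trans sd small) con pert).
Qed.

End RunNumbers.

Lemma energy_arith (R : realType) (gam rho eta Cup : R) : 0 < gam -> 0 <= rho -> 0 <= eta ->
  0 <= Cup -> rho <= Cup * eta ->
  eta <= (Num.sqrt gam)^-1 * Num.sqrt (rho ^+ 2 + gam * eta ^+ 2) /\
  Num.sqrt (rho ^+ 2 + gam * eta ^+ 2) <= Num.sqrt (Cup ^+ 2 + gam) * eta.
Proof.
move=> g0 r0 e0 C0 re; have sg : 0 < Num.sqrt gam by rewrite sqrtr_gt0.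
split.
  rewrite ler_pdivlMl// -[leLHS]ger0_norm ?mulr_ge0 ?sqrtr_ge0// -sqrtr_sqr.
  apply: ler_wsqrtr; rewrite exprMn sqr_sqrtr; last exact: ltW.
  by rewrite lerDr sqr_ge0.
have Cg : 0 <= Cup ^+ 2 + gam by rewrite addr_ge0 ?sqr_ge0// ltW.
rewrite -[leRHS]ger0_norm ?mulr_ge0 ?sqrtr_ge0// -sqrtr_sqr.
apply: ler_wsqrtr; rewrite exprMn sqr_sqrtr// mulrDl lerD2r -exprMn.
by rewrite lerXn2r// nnegrE ?mulr_ge0.
Qed.

Section RunControl.
Context (R : realType) (n : nat) (S : setting R n) (HS : standing S).
Context (ca Ca : R) (ca_gt0 : 0 < ca) (Hca : norm_equiv S ca Ca).
Local Notation Om := (dom S).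
Local Notation V := (sobfun R n).
Local Notation a := (aform S).
Local Notation b := (b0 S).
Local Notation N := (snorm a).
Local Notation l2 := (snorm b).
Local Notation lam := (eigval S 0).
Local Notation uh := (eigfun S 0).
Local Notation rem := (ww a uh).

Context (th1 th2 : R) (Hth2 : 0 < th2 < 1).
Context (Cea Ce0 Can Cup Clow Coa gam alh alpha : R).
Hypotheses (Cea_gt0 : 0 < Cea) (Ce0_gt0 : 0 < Ce0) (Can_gt0 : 0 < Can) (Cup_gt0 : 0 < Cup).
Hypotheses (Clow_gt0 : 0 < Clow) (Coa_gt0 : 0 < Coa) (gam_gt0 : 0 < gam).
Hypotheses (Hdual : duality_property S Can) (Hup : upper_property S Cup).
Hypotheses (Hlow : lower_property S Clow) (Hosc : osc_property S Coa).
Hypothesis Hesolve : esolve_property S th1 th2 Cea Ce0.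
Hypothesis Hcontr : contraction_property S th1 th2 gam alh.
Hypothesis (Halh : 0 < alh < 1) (Halpha : alh < alpha < 1).

Definition run_eta (r : run R n) k :=
  eta S (r_mesh r k) (r_fbar r k).1 (r_ubar r k).1 (r_mesh r k).
Definition run_energy (r : run R n) k := Num.sqrt (total_err S gam (r_mesh r k) (r_fbar r k)).

Let t0 := ca / (4 * lam).
Let P := 5 / 4 * lam / ca.
Let Q := 5 / 4 * lam * Cup.
Let Q2 := 5 / 4 * lam * (Can / ca).
Let B := 5 / 4 * lam / ca ^+ 2.
Let q := 5 / 4 * lam * (Can * Cup).
Let Hm := (1 + Coa) / (ca * Clow) / ca.
Let C1 := (Num.sqrt gam)^-1.
Let C2 := Num.sqrt (Cup ^+ 2 + gam).
Let d := (alpha ^+ 2 - alh ^+ 2) / (2 * alh ^+ 2).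
Let k0 := Num.sqrt ((alpha ^+ 2 - alh ^+ 2) / (8 * ((1 + d^-1) * pert_const ca Clow Coa gam))).

Let lam0 : 0 < lam := lam_gt0 HS.
Let L0 : 0 <= 5 / 4 * lam. Proof. by rewrite mulr_ge0// ltW. Qed.
Let P0 : 0 <= P. Proof. by apply: divr_ge0 => //; exact: ltW. Qed.
Let Q0 : 0 <= Q. Proof. by apply: mulr_ge0 => //; exact: ltW. Qed.
Let Q20 : 0 <= Q2. Proof. by apply: mulr_ge0 => //; apply: divr_ge0; exact: ltW. Qed.
Let B0 : 0 <= B. Proof. by apply: divr_ge0 => //; exact: sqr_ge0. Qed.
Let q0 : 0 <= q. Proof. by apply: mulr_ge0 => //; apply: mulr_ge0; exact: ltW. Qed.
Let Hm0 : 0 <= Hm.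
Proof.
apply: divr_ge0; last exact: ltW.
by apply: divr_ge0; [rewrite addr_ge0// ltW|apply: mulr_ge0; exact: ltW].
Qed.
Let C10 : 0 < C1. Proof. by rewrite invr_gt0 sqrtr_gt0. Qed.
Let C20 : 0 < C2. Proof. by rewrite sqrtr_gt0 ltr_wpDl ?sqr_ge0. Qed.
Let A0 : 0 <= l2 uh. Proof. exact: snorm_ge0. Qed.
Let d0 : 0 < d.
Proof. by apply: (@gap_pos _ alh alpha) => //; case/andP: Halh => -> _; case/andP: Halpha. Qed.
Let C0 : 0 < pert_const ca Clow Coa gam.
Proof.
apply: ltr_wpDr; first by apply: mulr_ge0; [exact: ltW|exact: sqr_ge0].
by rewrite exprn_gt0// invr_gt0.
Qed.
Let k0_pos : 0 < (alpha ^+ 2 - alh ^+ 2) / (8 * ((1 + d^-1) * pert_const ca Clow Coa gam)).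
Proof.
have [h0 _] := andP Halh; have [ha _] := andP Halpha.
apply: divr_gt0; first by rewrite subr_gt0 ltrXn2r// ?nnegrE ltW// (lt_trans h0).
by apply: mulr_gt0 => //; apply: mulr_gt0 => //; rewrite addr_gt0// invr_gt0.
Qed.
Let k00 : 0 < k0. Proof. by rewrite sqrtr_gt0. Qed.
Let al01 : 0 < alpha < 1.
Proof. by have [h0 _] := andP Halh; have [ha ->] := andP Halpha; rewrite (lt_trans h0). Qed.
Let t00 : 0 < t0. Proof. by apply: divr_gt0 => //; exact: mulr_gt0. Qed.

Section OneRun.
Context (N0 : nat) (N0P : alpha ^+ N0 * C1 * C2 < th2).
Context (eps : R) (eps0 : 0 < eps).
Hypothesis eps_small : small_enough t0 P Q Q2 B q Cea Ce0 Hm C1 C2 (l2 uh) k0 th2 N0 eps.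
Hypothesis eps_lam : lam * (lam * (l2 uh * (Can * eps * (Can * eps / ca)))) <= 10^-1.
Context (MH M1 : mesh R n) (adm : admissible S MH M1).
Hypotheses (etaH : etaA S (fespace S MH) <= eps) (deltaH : delta S (fespace S MH) <= eps).
Context (r : run R n) (K : nat) (rr : is_run S th1 th2 MH M1 r K).

Let loads k : (1 <= k <= K)%N -> level_loads S M1 r k := run_loads HS ca_gt0 Hca adm rr (k:=k).
Let iloads k j := run_inner_loads HS ca_gt0 Hca adm rr (k := k) (j := j).

Let J k := if (k <= 1)%N then 0%N else r_jmax r k.
Let w k := N (rem (r_fbar r k)).
Let t k := l2 (rem (r_fbar r k)).
Let nu k := N (rem (r_u r k)).
Let tau k := l2 (rem (r_u r k)).
Let h k := r_eta r (r_ell r k.+1).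
Let w_ k j := N (rem (r_fbarj r k j)).
Let t_ k j := l2 (rem (r_fbarj r k j)).
Let nu_ k j := N (rem (r_uj r k j)).

Let JE k : (2 <= k)%N -> J k = r_jmax r k.
Proof. by move=> k2; rewrite /J leqNgt k2. Qed.

Lemma level_solve k : (1 <= k <= K)%N -> w k <= 4^-1 -> t k <= t0 ->
  [/\ nu k <= Q * run_eta r k + P * t k, nu k <= Q2 * eps + P * t k &
      tau k <= B * t k + eps * q * run_eta r k].
Proof.
move=> kK wk tk; have [rM lf sol uE] := loads kK.
have [n1 n2 n3 _] := solve_numbers HS ca_gt0 Hca Can_gt0 Hdual adm eps0 etaH eps_lam rM lf sol wk tk.
have g := galerr_eta HS ca_gt0 Hca Hup adm rM lf sol.
rewrite /nu /tau uE.
exact: (solve_arith lam0 ca_gt0 Can_gt0 Cup_gt0 eps0 n1 n2 n3 g).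
Qed.

Lemma inner_solve k j : (2 <= k <= K)%N -> (j <= J k)%N -> w_ k j <= 4^-1 -> t_ k j <= t0 ->
  nu_ k j <= Q * est_j S r k j + P * t_ k j.
Proof.
move=> kK jJ wk tk; have k2 : (2 <= k)%N by case/andP: kK.
rewrite JE// in jJ; have lf := iloads kK jJ.
have [rM _ _ _] : level_loads S M1 r k by apply: loads; case/andP: kK => k2' ->; rewrite (ltnW k2').
have [_ lv] := rr; have [_ sv _ _ _] := lv k kK; have [sol uE _] := sv j jJ.
have [n1 n2 n3 _] := solve_numbers HS ca_gt0 Hca Can_gt0 Hdual adm eps0 etaH eps_lam rM lf sol wk tk.
have g := galerr_eta HS ca_gt0 Hca Hup adm rM lf sol.
rewrite /nu_ uE.
by have [] := solve_arith lam0 ca_gt0 Can_gt0 Cup_gt0 eps0 n1 n2 n3 g.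
Qed.

Lemma first_load : (1 <= K)%N ->
  [/\ w 1%N <= Cea * eps, t 1%N <= Ce0 * eps * w 1%N, w 1%N = nu 1%N & h 1%N = run_eta r 1].
Proof.
move=> K1; have [[m1 es [f1 _ _ ub1] [_ l2E e1]] _] := rr.
have [bd _] := Hesolve adm; have [b1 b2] := bd _ _ es.
have [Fu _ _] := es.1; have Hu := fespace_H01 Fu.
have [pN pl] := projE_rem HS ca_gt0 Hca Hu; rewrite pN in b1 b2; rewrite pl in b2.
have mM1 : is_mesh S M1 by case: adm.
have mMH : is_mesh S MH by case: adm.
have F0 := fespace0 HS mMH.
have sub := coarse_sub adm (refinement_refl mM1.1).
have dl := le_trans (delta_mono S F0 sub) deltaH.
have el := le_trans (etaA_mono HS ca_gt0 Hca F0 sub) etaH.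
rewrite /w /t /nu f1; split.
- exact: le_trans b1 (ler_wpM2l (ltW Cea_gt0) dl).
- exact: le_trans b2 (ler_wpM2r (snorm_ge0 _ _) (ler_wpM2l (ltW Ce0_gt0) el)).
- by [].
- by rewrite /h l2E e1 /run_eta m1.
Qed.

Lemma last_load k : (2 <= k <= K)%N ->
  [/\ w k = w_ k (J k), t k = t_ k (J k), run_eta r k = est_j S r k (J k) &
      th2 ^+ (J k).+1 * h k.-1 <= run_eta r k].
Proof.
move=> kK; have k2 : (2 <= k)%N by case/andP: kK.
have [_ lv] := rr; have [_ _ [_ nt] [fE ubE _ _] _] := lv k kK.
rewrite (JE k2) /w /t /w_ /t_ /run_eta fE ubE; split=> //.
rewrite /h (ltn_predK k2); apply: ltW; rewrite ltNge; apply/negP; exact: nt.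
Qed.

Lemma next_plain k : (1 <= k < K)%N -> J k = 0%N -> w_ k.+1 0 = nu k /\ t_ k.+1 0 = tau k.
Proof.
move=> kK Jk; have [op1 op2] := opening_load rr kK.
rewrite /w_ /t_ /nu /tau; suff -> : r_fbarj r k.+1 0 = r_u r k by split.
have [k1|k1] := eqVneq k 1%N; first exact: op1 k1.
have := op2 k1; have k2 : (2 <= k)%N by rewrite ltn_neqAle eq_sym k1; case/andP: kK.
by rewrite (JE k2) in Jk; rewrite Jk.
Qed.

Lemma next_corrected k : (1 <= k < K)%N -> (0 < J k)%N ->
  [/\ w_ k.+1 0%N <= Cea * nu k, w_ k.+1 0%N <= Cea * eps & t_ k.+1 0%N <= Ce0 * eps * w_ k.+1 0%N].
Proof.
move=> kK Jk; have k2 : (2 <= k)%N by rewrite ltnNge; apply/negP => k1; rewrite /J k1 in Jk.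
rewrite (JE k2) in Jk; have kK' : (2 <= k <= K)%N by rewrite k2; case/andP: kK => _ /ltnW.
have kK1 : (1 <= k <= K)%N by case/andP: kK => -> /ltnW.
have [rM lf sol uE] := loads kK1.
have [_ op2] := opening_load rr kK; have := op2 (negbT (gtn_eqF k2)); rewrite Jk => -[es fE].
have lu : load S (r_mesh r k) (r_u r k).
  by rewrite uE; exact: (solve_load HS ca_gt0 Hca (conforming_packed rM.2) lf sol).
have [_ bd] := Hesolve adm; have := bd r K k (r_jmax r k) rr kK' Jk (leqnn _).
have [_ lv] := rr; have [_ _ _ [_ _ <- _] _] := lv k kK'.
move=> bd'.
have := correction_numbers HS ca_gt0 Hca Cea_gt0 Ce0_gt0 adm etaH deltaH rM lu es bd'.
by rewrite /w_ /t_ fE.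
Qed.

Lemma inner_corrected k j : (2 <= k <= K)%N -> (j < J k)%N ->
  [/\ est_j S r k j <= th2 ^+ j.+1 * h k.-1, w_ k j.+1 <= Cea * nu_ k j, w_ k j.+1 <= Cea * eps &
      t_ k j.+1 <= Ce0 * eps * w_ k j.+1].
Proof.
move=> kK jJ; have k2 : (2 <= k)%N by case/andP: kK.
rewrite (JE k2) in jJ; have kK1 : (1 <= k <= K)%N by case/andP: kK => k2' ->; rewrite (ltnW k2').
have [rM _ _ _] := loads kK1; have lf := iloads kK (ltnW jJ).
have [_ lv] := rr; have [_ sv [inn _] _ _] := lv k kK.
have [tst es fE] := inn j jJ; have [sol uE _] := sv j (ltnW jJ).
have lu : load S (r_mesh r k) (r_uj r k j).
  by rewrite uE; exact: (solve_load HS ca_gt0 Hca (conforming_packed rM.2) lf sol).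
have [_ bd] := Hesolve adm.
have bd' := bd r K k j rr kK (leq_ltn_trans (leq0n j) jJ) (ltnW jJ).
have [c1 c2 c3] := correction_numbers HS ca_gt0 Hca Cea_gt0 Ce0_gt0 adm etaH deltaH rM lu es bd'.
by rewrite /h (ltn_predK k2) /w_ /t_ /nu_ fE.
Qed.

Lemma reference_step k : (2 <= k <= K)%N -> h k = if (0 < J k)%N then run_eta r k else h k.-1.
Proof.
move=> kK; have k2 : (2 <= k)%N by case/andP: kK.
have [_ lv] := rr; have [_ _ _ [fE ubE _ _]] := lv k kK.
rewrite (JE k2) /h (ltn_predK k2); case: ifP => _.
  by case=> _ _ eE _ ->; rewrite eE /run_eta fE ubE.
by case=> _ ->.
Qed.

Lemma run_eta_sol k : (1 <= k <= K)%N ->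
  eta_sol S (r_fbar r k).1 (r_mesh r k) (r_mesh r k) = run_eta r k.
Proof.
move=> kK; have [rM [F _ _] sol _] := loads kK.
exact: (eta_sol_sol HS ca_gt0 Hca (refinement_mesh adm rM) (fespace_H01 F) sol (fsubset_refl _)).
Qed.

Lemma level_energy k : (1 <= k <= K)%N ->
  run_eta r k <= C1 * run_energy r k /\ run_energy r k <= C2 * run_eta r k.
Proof.
move=> kK; have [rM lf sol _] := loads kK.
have g := galerr_eta HS ca_gt0 Hca Hup adm rM lf sol.
rewrite /run_energy /total_err (run_eta_sol kK).
exact: (energy_arith gam_gt0 (sqrtr_ge0 _) (sqrtr_ge0 _) (ltW Cup_gt0) g).
Qed.

Lemma level_contraction k : (1 <= k < K)%N -> w k <= 4^-1 -> w k.+1 <= 4^-1 ->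
  l2 uh * (w k ^+ 2 + w k.+1 ^+ 2) + t k + t k.+1 <= k0 * (run_energy r k + run_energy r k.+1) ->
  run_energy r k.+1 <= alpha * run_energy r k.
Proof.
move=> kK wk wk1 small; have [k1 kK2] := andP kK.
have [rM lf _ _] := loads (k := k) (introT andP (conj k1 (ltnW kK2))).
have [rM' lf' _ _] := loads (k := k.+1) kK2.
have [_ sub] := next_mesh rr kK rM.
have con := Hcontr adm rr kK.
have ha : 0 < alh < alpha by have [-> _] := andP Halh; have [-> _] := andP Halpha.
have [_ a1] := andP Halpha.
have kE := sqr_sqrtr (ltW k0_pos).
exact: (contraction_step HS ca_gt0 Hca Clow_gt0 Coa_gt0 gam_gt0 Hlow Hosc adm rM'
  (load_sub sub lf) lf' ha a1 erefl kE con wk wk1 small).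
Qed.

Theorem run_control k : (1 <= k <= K)%N ->
  [/\ w k <= 4^-1, t k <= t0,
      t k <= eps * (drift_cst Q B q Cea Ce0 C1 C2 th2 N0 / th2) * run_eta r k &
      (k < K)%N -> run_energy r k.+1 <= alpha * run_energy r k].
Proof.
move=> kK.
have w0 i : 0 <= w i by exact: snorm_ge0.
have e0 i : 0 <= run_eta r i by exact: sqrtr_ge0.
have eH i : (1 <= i <= K)%N -> run_eta r i <= Hm.
  move=> iK; have [rM lf sol _] := loads iK.
  exact: (eta_bound HS ca_gt0 Hca Clow_gt0 Coa_gt0 Hlow Hosc adm rM lf sol).
exact: (adaptive_recursion P0 Q0 Q20 B0 q0 (ltW Cea_gt0) (ltW Ce0_gt0) Hm0 C10 C20 A0 Hth2 al01
  eps0 w0 e0 eH (fun i iK => (level_energy iK).1) (fun i iK => (level_energy iK).2)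
  level_solve inner_solve first_load last_load next_plain next_corrected inner_corrected
  reference_step level_contraction N0P eps_small kK).
Qed.

Lemma solution_bounds k : (1 <= k <= K)%N ->
  N (rem (r_u r k)) <= 5 / 4 * lam * (galerr S (r_fbar r k).1 (r_mesh r k) + t k / ca) /\
  4 / 5 <= lam * N (r_ubar r k).
Proof.
move=> kK; have [rM lf sol uE] := loads kK; have [wk tk _ _] := run_control kK.
have [n1 _ _ n4] := solve_numbers HS ca_gt0 Hca Can_gt0 Hdual adm eps0 etaH eps_lam rM lf sol wk tk.
by split; rewrite ?uE.
Qed.

End OneRun.

(** All smallness conditions on the coarse space at once; c and y are arbitrary, so that
    the caller can ask for any bound on the constant kap. *)
Theorem uniform_control (c y : R) : 0 <= c -> 0 < y ->
  exists2 eps, 0 < eps & exists kap, [/\ kap / ca <= 3^-1, c * kap ^+ 2 <= y &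
  forall MH M1, admissible S MH M1 ->
    etaA S (fespace S MH) <= eps -> delta S (fespace S MH) <= eps ->
  forall r K, is_run S th1 th2 MH M1 r K -> forall k, (1 <= k <= K)%N ->
  [/\ l2 (rem (r_fbar r k)) <= t0,
      l2 (rem (r_fbar r k)) <= kap * run_eta r k,
      N (rem (r_u r k)) <= 5 / 4 * lam * (galerr S (r_fbar r k).1 (r_mesh r k)
                                          + l2 (rem (r_fbar r k)) / ca),
      4 / 5 <= lam * N (r_ubar r k) &
      (k < K)%N -> run_energy r k.+1 <= alpha * run_energy r k]].
Proof.
move=> c0 y0; have [th0 _] := andP Hth2.
have [N0 N0P] := power_below al01 (ltW (mulr_gt0 C10 C20)) th0; rewrite mulrA in N0P.
set D := drift_cst Q B q Cea Ce0 C1 C2 th2 N0 / th2.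
have D0 : 0 <= D.
  apply: divr_ge0; last exact: ltW.
  exact: (drift_ge0 Q0 B0 q0 (ltW Cea_gt0) (ltW Ce0_gt0) C10 C20 Hth2).
pose cl := lam * (lam * (l2 uh * (Can * (Can / ca)))).
have cl0 : 0 <= cl.
  apply: mulr_ge0; first exact: ltW.
  apply: mulr_ge0; first exact: ltW.
  apply: mulr_ge0 => //; apply: mulr_ge0; first exact: ltW.
  by apply: divr_ge0; exact: ltW.
pose ext := [:: (1, 1); (cl, 10^-1); (D / ca, 3^-1); (c * D ^+ 2, y)] : seq (R * R).
have ext0 p : p \in ext -> 0 <= p.1 /\ 0 < p.2.
  rewrite !in_cons in_nil orbF => /orP[/eqP ->|/orP[/eqP ->|/orP[/eqP ->|/eqP ->]]];
    apply: conj; rewrite /= ?ltr01 ?ler01 ?invr_gt0 ?ltr0n//.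
    by apply: divr_ge0 => //; exact: ltW.
  by apply: mulr_ge0 => //; exact: sqr_ge0.
have [eps eps0 [sm es]] := small_enough_exists P0 Q0 Q20 B0 q0 (ltW Cea_gt0) (ltW Ce0_gt0) Hm0
  C10 C20 A0 Hth2 N0 t00 k00 ext0.
have e1 : eps <= 1 by have := es _ (mem_nth (0, 0) (_ : (0 < size ext)%N)); rewrite /= mulr1; apply.
have e2 : eps * cl <= 10^-1 by have := es _ (mem_nth (0, 0) (_ : (1 < size ext)%N)); apply.
have e3 : eps * (D / ca) <= 3^-1 by have := es _ (mem_nth (0, 0) (_ : (2 < size ext)%N)); apply.
have e4 : eps * (c * D ^+ 2) <= y by have := es _ (mem_nth (0, 0) (_ : (3 < size ext)%N)); apply.
exists eps => //; exists (eps * D).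
have sq x : 0 <= x -> eps * (eps * x) <= eps * x.
  by move=> x0; rewrite ler_pM2l//; apply: ler_piMl.
split.
- by rewrite -mulrA.
- apply: le_trans e4; rewrite exprMn mulrCA expr2 -mulrA; apply: sq.
  by apply: mulr_ge0 => //; exact: sqr_ge0.
move=> MH M1 adm eH dH r K rr k kK.
have el : lam * (lam * (l2 uh * (Can * eps * (Can * eps / ca)))) <= 10^-1.
  apply: le_trans e2; apply: le_trans (sq _ cl0).
  by rewrite /cl le_eqVlt; apply/orP; left; apply/eqP; ring.
have [wk tk tk' step] := run_control N0P eps0 sm el adm eH dH rr kK.
have [nb lo] := solution_bounds N0P eps0 sm el adm eH dH rr kK.
by split.
Qed.

End RunControl.

(** * Counting *)

Section Counting.
Context (R : realType).
Implicit Types (x y p s alpha beta : R).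

Lemma powRN_anti p x y : 0 <= p -> 0 < x -> x <= y -> y `^ (- p) <= x `^ (- p).
Proof.
move=> p0 x0 xy; have y0 := lt_le_trans x0 xy; rewrite !powRN.
by rewrite lef_pV2 ?posrE ?powR_gt0//; apply: ge0_ler_powR; rewrite ?nnegrE// ltW.
Qed.

Lemma root_lt1 s alpha : 0 < s -> 0 < alpha < 1 -> 0 < alpha `^ s^-1 < 1.
Proof.
move=> s0 /andP[a0 a1]; rewrite powR_gt0//=.
have : alpha `^ s^-1 < 1 `^ s^-1.
  by apply: gt0_ltr_powR; rewrite ?invr_gt0// nnegrE ?ler01// ltW.
by rewrite powR1.
Qed.

Lemma root_pow s alpha k : 0 < s -> 0 < alpha ->
  (alpha `^ s^-1) ^+ k = ((alpha ^+ k) ^+ 2) `^ (2 * s)^-1.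
Proof.
move=> s0 a0; have e1 : (alpha `^ s^-1) ^+ k = alpha `^ (s^-1 * k%:R).
  by rewrite -powR_mulrn ?powR_ge0// -powRrM.
have e2 : (alpha ^+ k) ^+ 2 = alpha `^ (k%:R * 2).
  by rewrite -exprM -powR_mulrn ?(ltW a0)// natrM.
rewrite e1 e2 -powRrM invfM mulrA mulfK; last by rewrite pnatr_eq0.
by rewrite mulrC.
Qed.

Lemma geometric_le beta k : 0 < beta < 1 -> \sum_(1 <= i < k) beta ^+ (k - i) <= beta / (1 - beta).
Proof.
move=> /andP[b0 b1]; have d0 : 0 < 1 - beta by rewrite subr_gt0.
elim: k => [|k IH]; first by rewrite big_geq// divr_ge0// ltW.
case: k IH => [|k] IH; first by rewrite big_geq// divr_ge0// ltW.
rewrite big_nat_recr//= subSnn expr1.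
have -> : \sum_(1 <= i < k.+1) beta ^+ (k.+2 - i) = beta * \sum_(1 <= i < k.+1) beta ^+ (k.+1 - i).
  rewrite mulr_sumr; apply: eq_big_nat => i /andP[_ ik].
  by rewrite subSn ?exprS// ltnW.
apply: le_trans (lerD (ler_wpM2l (ltW b0) IH) (lexx _)) _.
by rewrite le_eqVlt; apply/orP; left; apply/eqP; field; rewrite gt_eqF.
Qed.

(** Each level marks at most a power of its own error; as the errors decay
    geometrically, the last level dominates the sum. *)
Lemma marked_sum (s alpha CM lam C3 Ek : R) k (m : nat -> nat) (tot E : nat -> R) :
  0 < s -> 0 < alpha < 1 -> 0 <= CM -> 0 < lam -> 0 < C3 -> 0 < Ek ->
  (forall i, (1 <= i < k)%N -> [/\ (m i)%:R <= CM * (lam ^+ 2 * tot i) `^ (- (2 * s)^-1),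
     E i ^+ 2 <= C3 * tot i & Ek <= alpha ^+ (k - i) * E i]) ->
  (\sum_(1 <= i < k) m i)%:R <=
    CM * (lam ^+ 2 * Ek ^+ 2 / C3) `^ (- (2 * s)^-1) * (alpha `^ s^-1 / (1 - alpha `^ s^-1)).
Proof.
move=> s0 /andP[a0 a1] CM0 l0 C0 E0 H; set Y := lam ^+ 2 * Ek ^+ 2 / C3.
have Y0 : 0 < Y by rewrite divr_gt0// mulr_gt0// exprn_gt0.
have p0 : 0 <= (2 * s)^-1 by rewrite invr_ge0 mulr_ge0// ltW.
set beta := alpha `^ s^-1.
have b01 : 0 < beta < 1.
  by apply: root_lt1; rewrite ?a0.
have term i : (1 <= i < k)%N -> (m i)%:R <= CM * Y `^ (- (2 * s)^-1) * beta ^+ (k - i).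
  move=> ik; have [mi Ei Eki] := H i ik; apply: le_trans mi _; rewrite -mulrA ler_wpM2l//.
  have am : 0 < alpha ^+ (k - i) by rewrite exprn_gt0.
  have -> : Y `^ (- (2 * s)^-1) * beta ^+ (k - i) = (Y / (alpha ^+ (k - i)) ^+ 2) `^ (- (2 * s)^-1).
    rewrite powRM ?invr_ge0 ?sqr_ge0 ?(ltW Y0)//; congr (_ * _).
    by rewrite -powR_inv1 ?sqr_ge0// -powRrM mulN1r opprK /beta root_pow.
  apply: powRN_anti => //; first by rewrite divr_gt0// exprn_gt0.
  have E2 : Ek ^+ 2 <= (alpha ^+ (k - i)) ^+ 2 * (C3 * tot i).
    apply: le_trans (ler_wpM2l (sqr_ge0 _) Ei); rewrite -exprMn.
    by rewrite lerXn2r// nnegrE ?(ltW E0)// (le_trans (ltW E0)).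
  rewrite ler_pdivrMr ?exprn_gt0// /Y ler_pdivrMr//.
  apply: le_trans (ler_wpM2l (sqr_ge0 lam) E2) _.
  by rewrite le_eqVlt; apply/orP; left; apply/eqP; ring.
rewrite natr_sum; apply: le_trans (ler_sum_nat term) _.
rewrite -mulr_sumr; apply: ler_wpM2l; last exact: geometric_le.
by rewrite mulr_ge0// powR_ge0.
Qed.

Lemma count_to_rate s alpha (CM Cs Y X : R) : 0 < s -> 0 < alpha < 1 -> 0 <= CM -> 0 <= Cs -> 0 < Y -> 0 < X ->
  X <= Cs * (CM * Y `^ (- (2 * s)^-1) * (alpha `^ s^-1 / (1 - alpha `^ s^-1))) ->
  Y <= Cs `^ (2 * s) * CM `^ (2 * s) * alpha ^+ 2 * (1 - alpha `^ s^-1) `^ (- (2 * s)) * X `^ (- (2 * s)).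
Proof.
move=> s0 /andP[a0 a1] CM0 Cs0 Y0 X0 XY; set beta := alpha `^ s^-1 in XY *.
have s2 : 0 <= 2 * s by rewrite mulr_ge0// ltW.
have s2n : 2 * s != 0 by rewrite mulf_neq0// gt_eqF.
have b0 : 0 < beta by rewrite powR_gt0.
have b1 : 0 < 1 - beta.
  by rewrite subr_gt0; have /andP[] := root_lt1 s0 (introT andP (conj a0 a1)).
have XP : 0 < X `^ (2 * s) by rewrite powR_gt0.
have key : X `^ (2 * s) <= Cs `^ (2 * s) * CM `^ (2 * s) * alpha ^+ 2 * (1 - beta) `^ (- (2 * s)) * Y^-1.
  apply: le_trans (ge0_ler_powR s2 _ _ XY) _; rewrite ?nnegrE ?(ltW X0)//.
    exact: le_trans (ltW X0) XY.
  have yi : (Y `^ (- (2 * s)^-1)) `^ (2 * s) = Y^-1.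
    by rewrite -powRrM mulNr mulVf// powR_inv1// ltW.
  have bi : beta `^ (2 * s) = alpha ^+ 2.
    rewrite /beta -powRrM mulrCA mulVf ?mulr1 ?gt_eqF// powR_mulrn ?ltW//.
  have i0 : 0 <= (1 - beta)^-1 by rewrite invr_ge0 ltW.
  rewrite powRM//; last first.
    by apply: mulr_ge0; [apply: mulr_ge0 => //; exact: powR_ge0|apply: mulr_ge0 => //; exact: ltW].
  rewrite powRM; [|by apply: mulr_ge0 => //; exact: powR_ge0|by apply: mulr_ge0 => //; exact: ltW].
  rewrite powRM//; last exact: powR_ge0.
  rewrite powRM//; last exact: ltW.
  rewrite yi bi -[(1 - beta)^-1]powR_inv1 ?(ltW b1)// -powRrM mulN1r.
  by rewrite le_eqVlt; apply/orP; left; apply/eqP; ring.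
rewrite [X `^ _]powRN ler_pdivlMr//.
rewrite ler_pdivlMr// in key.
by rewrite mulrC.
Qed.

End Counting.

Lemma load_third (R : realType) (ca kap t e : R) : 0 < ca -> 0 <= e -> t <= kap * e ->
  kap / ca <= 3^-1 -> t / ca <= e / 3.
Proof.
move=> c0 e0 te kc; apply: le_trans (_ : kap * e / ca <= _); first by rewrite ler_pM2r ?invr_gt0.
by rewrite mulrAC mulrC; apply: ler_wpM2l.
Qed.

Lemma pos_of_decay (R : realType) (x y z : R) : 0 < x -> 0 <= y -> x <= z * y -> 0 < y.
Proof.
move=> x0 y0 xzy; rewrite lt_neqAle y0 andbT eq_sym; apply/eqP => yE.
by move: xzy; rewrite yE mulr0 leNgt x0.
Qed.

Lemma rate_arith (R : realType) (a b C3 d e C5 x Y L : R) : 0 < C3 -> 0 < C5 ->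
  L / C3 = Y -> Y <= a * b * d * e * x -> C5 * L <= a * b * C3 * d * e * C5 * x.
Proof.
move=> C30 C50 <-; rewrite ler_pdivrMr// => h.
rewrite [leRHS](_ : _ = C5 * (a * b * d * e * x * C3)); last ring.
by rewrite ler_pM2l.
Qed.

Lemma geometric_decay (R : realType) (alpha : R) (E : nat -> R) k : 0 <= alpha ->
  (forall i, (1 <= i < k)%N -> E i.+1 <= alpha * E i) ->
  forall i, (1 <= i <= k)%N -> E k <= alpha ^+ (k - i) * E i.
Proof.
move=> a0 step i; elim: (k - i)%N {-2}i (erefl (k - i)%N) => [|m IH] {}i km /andP[i1 ik].
  have -> : k = i by apply/eqP; rewrite eqn_leq ik -subn_eq0 km.
  by rewrite subnn expr0 mul1r.
have ik' : (i < k)%N by rewrite -subn_gt0 km.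
have km' : (k - i.+1)%N = m by rewrite subnS km.
apply: le_trans (IH i.+1 km' _) _; first by rewrite ik'.
rewrite km' km exprSr -mulrA; apply: ler_wpM2l; first exact: exprn_ge0.
by apply: step; rewrite i1.
Qed.

Lemma pos_of_sqr (R : realType) (c x y : R) : 0 < c -> 0 < x -> x ^+ 2 <= c * y -> 0 < y.
Proof.
by move=> c0 x0 h; rewrite -(pmulr_rgt0 _ c0); apply: lt_le_trans h; exact: exprn_gt0.
Qed.

(** The oscillation of a discrete solution is that of its residual, a part of the
    estimator. *)
Lemma err2_solution (R : realType) (n : nat) (S : setting R n) (HS : standing S)
  (ca Ca : R) (ca_gt0 : 0 < ca) (Hca : norm_equiv S ca Ca) (gam : R) (gam_gt0 : 0 < gam)
  (M : mesh R n) (f ub : sobfun R n) (x : R) :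
  is_mesh S M -> load S M f -> lsolve S f.1 (fespace S M) ub ->
  snorm (aform S) (ww (aform S) (eigfun S 0) (normalize S ub))
    <= 5 / 4 * eigval S 0 * (galerr S f.1 M + x) ->
  0 <= x -> x <= eta S M f.1 ub.1 M / 3 -> 4 / 5 <= eigval S 0 * anorm S ub ->
  err2 S (normalize S ub) M <= (2 + 5 / gam) * (eigval S 0 ^+ 2 * total_err S gam M f).
Proof.
move=> mM lf sol nb x0 xe lo; have [F _ _] := lf; have Fub := sol.1.
have [n0 _] := sol_norm_gt0 HS ca_gt0 Hca lf sol; rewrite -anormE in n0.
have Fu := fespaceZ HS (anorm S ub)^-1 (conforming_packed mM.1) Fub.
have [pN _] := projE_rem HS ca_gt0 Hca (fespace_H01 Fu).
have oE := osc_le_eta HS mM.1 (sqint_fespace HS mM F) (pwp_fespace Fub).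
have os := osc_Lop_scale HS mM.1 (anorm S ub)^-1 (pwp_fespace Fub).
have oD := osc_data HS mM F Fub; rewrite oD in oE.
have eE := eta_sol_sol HS ca_gt0 Hca mM (fespace_H01 F) sol (fsubset_refl M).
have lam0 := lam_gt0 HS.
apply: (err2_arith (E2 := total_err S gam M f) lam0 gam_gt0 (snorm_ge0 _ _) nb (sqrtr_ge0 _) x0 xe n0 lo
  (osc_ge0 S M _) oE); last by rewrite /total_err eE.
by rewrite /err2 pN lerD2l.
Qed.

Theorem theorem4p1 (R : realType) (n : nat) (S : setting R n) (HS : standing S)
  (ca Ca : R) (ca_gt0 : 0 < ca) (Ca_gt0 : 0 < Ca) (Hca : norm_equiv S ca Ca)
  (Hlim : coarse_limits S)
  (ths th1 th2 : R) (Hths : marking_property S ths)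
  (Hth1 : 0 < th1 < 1) (Hth1s : th1 < ths) (Hth2 : 0 < th2 < 1)
  (Cea Ce0 : R) (Cea_gt0 : 0 < Cea) (Ce0_gt0 : 0 < Ce0)
  (Hesolve : esolve_property S th1 th2 Cea Ce0)
  (Can : R) (Can_gt0 : 0 < Can) (Hdual : duality_property S Can)
  (Cup Clow : R) (Cup_gt0 : 0 < Cup) (Clow_gt0 : 0 < Clow)
  (Hup : upper_property S Cup) (Hlow : lower_property S Clow)
  (Coa : R) (Coa_gt0 : 0 < Coa) (Hosc : osc_property S Coa)
  (CD : R) (CD_gt0 : 0 < CD) (Hopt : quasi_opt_property S CD)
  (gam alh : R) (gam_gt0 : 0 < gam) (Halh : 0 < alh < 1)
  (Hcontr : contraction_property S th1 th2 gam alh)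
  (alpha : R) (Halpha : alh < alpha < 1)
  (xi : R) (Hxi : 0 < xi ^+ 2 < 2^-1)
  (Hxith : th1 <= ths * Num.sqrt (1 - 2 * xi ^+ 2)) :
  exists2 H0 : R, 0 < H0 &
  forall MH M1 : mesh R n, admissible S MH M1 -> 0 < mesh_size MH <= H0 ->
  forall s Mc : R, 0 < s -> 0 < Mc -> approx_const S s M1 = Mc%:E ->
  forall Csharp : R, 0 < Csharp -> complexity_property S th1 th2 MH M1 Csharp ->
  forall (r : run R n) (k : nat), (1 <= k)%N -> is_run S th1 th2 MH M1 r k ->
  let CM := (xi ^+ 2 / (16 * CD)) `^ (- (2 * s)^-1) * Mc `^ s^-1 in
  let Cc := Csharp `^ (2 * s) * CM `^ (2 * s) * (1 + 2 * gam / Clow ^+ 2)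
            * alpha ^+ 2 * (1 - alpha `^ s^-1) `^ (- (2 * s)) * (2 + 5 / gam) in
  ((err2 S (r_u r k) (r_mesh r k))%:E <=
    if #|` r_mesh r k| == #|` M1| then +oo
    else (Cc * (#|` r_mesh r k|%:R - #|` M1|%:R) `^ (- (2 * s)))%:E)%E.
Proof.
have [th10 _] := andP Hth1; have [xi0 _] := andP Hxi.
have y0 : 0 < 13 / 18 * xi ^+ 2 * (ca ^+ 2 * Clow ^+ 2).
  apply: mulr_gt0; first by apply: mulr_gt0 => //; exact: divr_gt0.
  by apply: mulr_gt0; exact: exprn_gt0.
have c0 : 0 <= 4 * CD by rewrite mulr_ge0// ltW.
have [eps eps0 [kap [kap3 kapD ctl]]] := uniform_control HS ca_gt0 Hca (th1 := th1) Hth2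
  Cea_gt0 Ce0_gt0 Can_gt0 Cup_gt0 Clow_gt0 Coa_gt0 gam_gt0 Hdual Hup Hlow Hosc Hesolve Hcontr
  Halh Halpha c0 y0.
have [H0 H00 coarse] := Hlim _ eps0; exists H0 => // MH M1 adm /andP[_ sizeH].
move=> s Mc s0 Mc0 AM Cs Cs0 cplx r k k1 rr; cbv zeta.
set CM := (xi ^+ 2 / (16 * CD)) `^ (- (2 * s)^-1) * Mc `^ s^-1.
set Cc := Cs `^ (2 * s) * CM `^ (2 * s) * (1 + 2 * gam / Clow ^+ 2)
            * alpha ^+ 2 * (1 - alpha `^ s^-1) `^ (- (2 * s)) * (2 + 5 / gam).
have [mMH mM1 _ reg] := adm; have [eH dH] := coarse MH mMH sizeH.
have ctl' := ctl MH M1 adm (ltW eH) (ltW dH) r k rr.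
have lam0 := lam_gt0 HS; set lam := eigval S 0 in lam0.
have loads i (ik : (1 <= i <= k)%N) := run_loads HS ca_gt0 Hca adm rr ik.
pose C3 := 1 + 2 * gam / Clow ^+ 2.
have C30 : 0 < C3.
  by apply: addr_gt0 => //; apply: divr_gt0; [exact: mulr_gt0|exact: exprn_gt0].
have C50 : 0 < 2 + 5 / gam by apply: addr_gt0 => //; exact: divr_gt0.
have al01 : 0 < alpha < 1.
  by have [h0 _] := andP Halh; have [ha ->] := andP Halpha; rewrite (lt_trans h0).
have CM0 : 0 <= CM by apply: mulr_ge0; exact: powR_ge0.
have kk : (1 <= k <= k)%N by rewrite k1 leqnn.
pose E i := run_energy S gam r i.
have te i : E i ^+ 2 = total_err S gam (r_mesh r i) (r_fbar r i).
  rewrite /E /run_energy sqr_sqrtr//; apply: addr_ge0; first exact: sqr_ge0.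
  by apply: mulr_ge0; [exact: ltW|exact: sqr_ge0].
have E0 i : 0 <= E i by exact: sqrtr_ge0.
have errk : err2 S (r_u r k) (r_mesh r k) <= (2 + 5 / gam) * (lam ^+ 2 * E k ^+ 2).
  have [_ tk nk lo _] := ctl' k kk; have [rM lf sol uE] := loads k kk.
  rewrite uE te in nk *.
  apply: (err2_solution HS ca_gt0 Hca gam_gt0 (refinement_mesh adm rM) lf sol nk) lo.
    by apply: divr_ge0; [exact: snorm_ge0|exact: ltW].
  exact: (load_third ca_gt0 (sqrtr_ge0 _) tk kap3).
case: eqP => [_|neq]; first exact: leey.
rewrite lee_fin; apply: le_trans errk _.
have Cc0 : 0 <= Cc.
  apply: mulr_ge0 (ltW C50); apply: mulr_ge0 (powR_ge0 _ _); apply: mulr_ge0 (sqr_ge0 _).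
  by apply: mulr_ge0 (ltW C30); apply: mulr_ge0; exact: powR_ge0.
have [Ek0|Ek0] := eqVneq (E k) 0.
  by rewrite Ek0 expr0n !mulr0 mulr_ge0// powR_ge0.
have Ek : 0 < E k by rewrite lt_neqAle eq_sym Ek0 E0.
have decay i : (1 <= i <= k)%N -> E k <= alpha ^+ (k - i) * E i.
  apply: geometric_decay => [|{}i /andP[i1 ik]]; first by case/andP: al01 => /ltW.
  by have [_ _ _ _ step] := ctl' i (introT andP (conj i1 (ltnW ik))); exact: step.
have marked i : (1 <= i < k)%N -> [/\ #|` r_marked r i|%:R <= CM * (lam ^+ 2 * tot2 S (r_mesh r i) (r_fbar r i)) `^ (- (2 * s)^-1),
     E i ^+ 2 <= C3 * tot2 S (r_mesh r i) (r_fbar r i) & E k <= alpha ^+ (k - i) * E i].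
  move=> ik; have [i1 ik'] := andP ik; have ikk : (1 <= i <= k)%N by rewrite i1 ltnW.
  have [rM lf sol uE] := loads i ikk; have [F f1 _] := lf.
  have [ti tki _ _ _] := ctl' i ikk.
  have tot := total_le_tot Clow_gt0 gam_gt0 Hlow (refinement_mesh adm rM) (fespace_H01 F).
  rewrite -te in tot; have dk := decay i ikk; split=> //.
  have [_ lv] := rr; have [[mk _] _ _ _ _] := lv i.+1 (introT andP (conj i1 ik')).
  have tot0 : 0 < tot2 S (r_mesh r i) (r_fbar r i).
    exact: (pos_of_sqr C30 (pos_of_decay Ek (E0 i) dk) tot).
  rewrite -(run_eta_sol HS ca_gt0 Hca adm rr ikk) in tki.
  exact: (marked_count HS ca_gt0 Hca Clow_gt0 CD_gt0 Hlow Hopt mM1 reg rM F f1 sol mk Hths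
    th10 Hxith Hxi s0 Mc0 AM tot0 (scaled_load lam0 ca_gt0 ti) tki kapD).
have sum := marked_sum s0 al01 CM0 lam0 C30 Ek marked.
have [rMk _ _ _] := loads k kk.
have cardk := (card_refined (conforming_packed mM1.1) rMk.1).1.
have X0 : 0 < #|` r_mesh r k|%:R - #|` M1|%:R :> R.
  by rewrite subr_gt0 ltr_nat ltn_neqAle eq_sym; apply/andP; split=> //; apply/eqP.
have k2 : (2 <= k)%N.
  rewrite ltn_neqAle k1 andbT; apply/eqP => k1'; apply: neq.
  by have [[m1 _ _ _] _] := rr; rewrite -k1' m1.
have := cplx r k k.-1 rr; rewrite prednK// -ltnS prednK// k2 leqnn => /(_ isT) count.
have Y0 : 0 < lam ^+ 2 * E k ^+ 2 / C3 by rewrite divr_gt0// mulr_gt0// exprn_gt0.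
have rate := count_to_rate s0 al01 CM0 (ltW Cs0) Y0 X0 (le_trans count (ler_wpM2l (ltW Cs0) sum)).
exact: (rate_arith C30 C50 erefl rate).
Qed.
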